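(* The following problem is 2ExpTime-complete: given $\mathcal{ALC}$ KBs $\mathcal{K}_1,\mathcal{K}_2$ and a signature $\Sigma$, decide whether $\mathcal{K}_1$ $\Sigma$-rUCQ entails $\mathcal{K}_2$.
   Context: A KB is $\mathcal{K}=(\mathcal{T},\mathcal{A})$ with $\mathcal{T}$ an $\mathcal{ALC}$ TBox and $\mathcal{A}$ an ABox of assertions $A(a)$, $R(a,b)$; $\mathsf{ind}(\mathcal{K})$ its individuals; interpretations satisfy $a^{\mathcal{I}}=a$. A CQ $\exists\vec y\,\varphi(\vec x,\vec y)$ is a conjunction of atoms $A(z)$, $R(z,z')$; it is rooted if every quantified variable is connected, in the undirected graph with edges $\{u,v\}$ for atoms $R(u,v)$, to an answer variable; an rUCQ is a disjunction of rooted CQs with the same answer variables. $\mathcal{K}\models q(\vec a)$ means all models satisfy $q(\vec a)$. For consistent KBs, $\mathcal{K}_1$ $\Sigma$-rUCQ entails $\mathcal{K}_2$ if for every rUCQ $q(\vec x)$ over names in $\Sigma$ and tuple $\vec a$ from $\mathsf{ind}(\mathcal{K}_2)$, $\mathcal{K}_2\models q(\vec a)$ implies $\vec a\subseteq\mathsf{ind}(\mathcal{K}_1)$ and $\mathcal{K}_1\models q(\vec a)$. *)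

(* Defs.v *)
From Stdlib Require List.
From Stdlib Require Import Relation_Operators.
From mathcomp Require Import all_boot.

Set Implicit Arguments.
Unset Strict Implicit.
Unset Printing Implicit Defensive.

Notation cname := nat (only parsing).
Notation rname := nat (only parsing).
Notation iname := nat (only parsing).
Notation var := nat (only parsing).

(** * ALC knowledge bases *)

Inductive concept : Type :=
| Top
| Bot
| Atomic of cname
| Neg of concept
| And of concept & concept
| Or of concept & concept
| Ex of rname & concept
| All of rname & concept.

Inductive assertion : Type :=
| CAssert of cname & iname
| RAssert of rname & iname & iname.

(* A pair (C, D) of the TBox is the concept inclusion C [= D. *)
Record kb := KB { tbox : seq (concept * concept); abox : seq assertion }.

Definition assertion_inds (s : assertion) : seq iname :=
  match s with CAssert _ a => [:: a] | RAssert _ a b => [:: a; b] end.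

Definition ind (K : kb) : seq iname := flatten (map assertion_inds (abox K)).

(* The standard name assumption a^I = a is built in: the domain consists of the
   individual names themselves and of an arbitrary type of further elements. *)
Record interp := Interp {
  anon : Type;
  cint : cname -> iname + anon -> Prop;
  rint : rname -> iname + anon -> iname + anon -> Prop }.

Definition dom (I : interp) : Type := (iname + anon I)%type.

Definition iint (I : interp) (a : iname) : dom I := inl a.

Fixpoint ext (I : interp) (C : concept) (d : dom I) : Prop :=
  match C with
  | Top => True
  | Bot => False
  | Atomic A => cint A d
  | Neg C1 => ~ ext C1 d
  | And C1 C2 => ext C1 d /\ ext C2 d
  | Or C1 C2 => ext C1 d \/ ext C2 d
  | Ex R C1 => exists e : dom I, rint R d e /\ ext C1 e
  | All R C1 => forall e : dom I, rint R d e -> ext C1 e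
  end.

Definition sat_assertion (I : interp) (s : assertion) : Prop :=
  match s with
  | CAssert A a => cint A (iint I a)
  | RAssert R a b => rint R (iint I a) (iint I b)
  end.

Definition model (I : interp) (K : kb) : Prop :=
  (forall C D, List.In (C, D) (tbox K) -> forall d : dom I, ext C d -> ext D d) /\
  (forall s, List.In s (abox K) -> sat_assertion I s).

Definition consistent (K : kb) : Prop := exists I : interp, model I K.

(** * Rooted unions of conjunctive queries *)

Inductive atom : Type :=
| CAtom of cname & var
| RAtom of rname & var & var.

Definition atom_vars (t : atom) : seq var :=
  match t with CAtom _ z => [:: z] | RAtom _ z z' => [:: z; z'] end.

(* A CQ is given by its atoms.  Its answer variables are those of the UCQ it is
   a disjunct of, and all its other variables are existentially quantified.
   Answer variables need not occur in every disjunct. *)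
Definition cq := seq atom.

Definition cq_vars (q : cq) : seq var := flatten (map atom_vars q).

Record ucq := UCQ { answer : seq var; disjuncts : seq cq }.

Definition cq_edge (q : cq) (u v : var) : Prop :=
  exists R : rname, List.In (RAtom R u v) q \/ List.In (RAtom R v u) q.

Definition rooted_cq (xs : seq var) (q : cq) : Prop :=
  forall y, y \in cq_vars q -> y \notin xs ->
    exists2 x, x \in xs & clos_refl_trans var (cq_edge q) y x.

Definition is_rucq (q : ucq) : Prop :=
  uniq (answer q) /\
  (forall p, List.In p (disjuncts q) -> rooted_cq (answer q) p).

Record signature := Signature { sig_c : seq cname; sig_r : seq rname }.

Definition atom_over (S : signature) (t : atom) : bool :=
  match t with CAtom A _ => A \in sig_c S | RAtom R _ _ => R \in sig_r S end.

Definition ucq_over (S : signature) (q : ucq) : bool :=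
  all (all (atom_over S)) (disjuncts q).

Definition sat_atom (I : interp) (pi : var -> dom I) (t : atom) : Prop :=
  match t with
  | CAtom A z => cint A (pi z)
  | RAtom R z z' => rint R (pi z) (pi z')
  end.

Definition sat_ucq (I : interp) (q : ucq) (a : seq iname) : Prop :=
  exists2 p : cq, List.In p (disjuncts q) &
  exists pi : var -> dom I,
    map pi (answer q) = map (iint I) a /\
    (forall t, List.In t p -> sat_atom pi t).

Definition kb_entails (K : kb) (q : ucq) (a : seq iname) : Prop :=
  forall I : interp, model I K -> sat_ucq I q a.

Definition rucq_entails (S : signature) (K1 K2 : kb) : Prop :=
  forall (q : ucq) (a : seq iname),
    is_rucq q -> ucq_over S q ->
    size a = size (answer q) -> {subset a <= ind K2} ->
    kb_entails K2 q a ->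
    {subset a <= ind K1} /\ kb_entails K1 q a.

(** * Turing machines *)

(* Deterministic machines with one two-way infinite tape.  Tape symbols are
   None (blank), Some (inl b) (input and output symbols) and Some (inr g)
   (auxiliary symbols). *)
Inductive move := MoveL | MoveR | Stay.

Record tm := TM {
  state : finType;
  aux : finType;
  start : state;
  accepting : pred state;
  trans : state -> option (bool + aux) ->
          option (state * option (bool + aux) * move) }.

Definition tsym (M : tm) : Type := option (bool + aux M).

(* The cells left of the head are listed from the head outwards; cells not
   listed are blank. *)
Record config (M : tm) := Config {
  cstate : state M;
  cleft : seq (tsym M);
  chead : tsym M;
  cright : seq (tsym M) }.

Definition insym (M : tm) (b : bool) : tsym M := Some (inl b).

Definition shift (M : tm) (q : state M) (l : seq (tsym M)) (x : tsym M)
    (r : seq (tsym M)) (m : move) : config M :=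
  match m with
  | Stay => Config q l x r
  | MoveL => Config q (behead l) (head None l) (x :: r)
  | MoveR => Config q (x :: l) (head None r) (behead r)
  end.

(* The machine halts when no transition is defined. *)
Definition step (M : tm) (c : config M) : option (config M) :=
  if trans (cstate c) (chead c) is Some (q, x, m)
  then Some (shift q (cleft c) x (cright c) m) else None.

Definition init (M : tm) (w : seq bool) : config M :=
  Config (start M) [::] (head None (map (insym M) w)) (behead (map (insym M) w)).

Definition halts_in (M : tm) (w : seq bool) (t : nat) (c : config M) : Prop :=
  iter t (obind (@step M)) (Some (init M w)) = Some c /\ step c = None.

Definition decides_in (M : tm) (L : seq bool -> Prop) (T : nat -> nat) : Prop :=
  forall w, exists t (c : config M),
    [/\ t <= T (size w), halts_in w t c & (accepting (cstate c) <-> L w)].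

(* The output is read from the head position to the right, up to blanks. *)
Definition computes_in (M : tm) (f : seq bool -> seq bool) (T : nat -> nat) :
    Prop :=
  forall w, exists t (c : config M) n,
    [/\ t <= T (size w), halts_in w t c &
        chead c :: cright c = map (insym M) (f w) ++ nseq n None].

Definition in_2exptime (L : seq bool -> Prop) : Prop :=
  exists (M : tm) (k : nat), decides_in M L (fun n => 2 ^ (2 ^ (n ^ k + k))).

Definition polytime (f : seq bool -> seq bool) : Prop :=
  exists (M : tm) (k : nat), computes_in M f (fun n => n ^ k + k).

(** * Decision problems *)

(* [inst] singles out the admissible inputs among the elements of [input].
   As usual for problems on encoded objects, words that do not encode an
   admissible input are rejected, and reductions produce admissible inputs. *)
Record problem := Problem {
  input : Type;
  encode : input -> seq bool;
  inst : input -> Prop;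
  yes : input -> Prop }.

Definition language (P : problem) (w : seq bool) : Prop :=
  exists x : input P, [/\ w = encode x, inst x & yes x].

Definition reduces_to (L : seq bool -> Prop) (P : problem) : Prop :=
  exists f, polytime f /\
    forall w, exists x : input P, [/\ f w = encode x, inst x & (L w <-> yes x)].

Definition complete_2exptime (P : problem) : Prop :=
  in_2exptime (language P) /\
  (forall L : seq bool -> Prop, in_2exptime L -> reduces_to L P).

(** * Binary encoding of inputs *)

(* All the encodings are prefix-free; names are written in binary. *)
Fixpoint enc_pos (p : BinNums.positive) : seq bool :=
  match p with
  | BinNums.xH => [:: false]
  | BinNums.xO p1 => [:: true, false & enc_pos p1]
  | BinNums.xI p1 => [:: true, true & enc_pos p1]
  end.

Definition enc_nat (n : nat) : seq bool :=
  if bin_of_nat n is BinNums.Npos p then true :: enc_pos p else [:: false].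

Fixpoint enc_seq (T : Type) (e : T -> seq bool) (s : seq T) : seq bool :=
  if s is x :: s1 then true :: e x ++ enc_seq e s1 else [:: false].

Fixpoint enc_concept (C : concept) : seq bool :=
  match C with
  | Top => [:: false; false; false]
  | Bot => [:: false; false; true]
  | Atomic A => [:: false; true; false] ++ enc_nat A
  | Neg C1 => [:: false; true; true] ++ enc_concept C1
  | And C1 C2 => [:: true; false; false] ++ enc_concept C1 ++ enc_concept C2
  | Or C1 C2 => [:: true; false; true] ++ enc_concept C1 ++ enc_concept C2
  | Ex R C1 => [:: true; true; false] ++ enc_nat R ++ enc_concept C1
  | All R C1 => [:: true; true; true] ++ enc_nat R ++ enc_concept C1
  end.

Definition enc_ci (ci : concept * concept) : seq bool :=
  enc_concept ci.1 ++ enc_concept ci.2.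

Definition enc_assertion (s : assertion) : seq bool :=
  match s with
  | CAssert A a => false :: enc_nat A ++ enc_nat a
  | RAssert R a b => true :: enc_nat R ++ enc_nat a ++ enc_nat b
  end.

Definition enc_kb (K : kb) : seq bool :=
  enc_seq enc_ci (tbox K) ++ enc_seq enc_assertion (abox K).

Definition enc_signature (S : signature) : seq bool :=
  enc_seq enc_nat (sig_c S) ++ enc_seq enc_nat (sig_r S).

Definition enc_input (x : kb * kb * signature) : seq bool :=
  enc_kb x.1.1 ++ enc_kb x.1.2 ++ enc_signature x.2.

Definition prefix_inj (T : Type) (e : T -> seq bool) : Prop :=
  forall x y u v, e x ++ u = e y ++ v -> x = y /\ u = v.

Lemma enc_nat_inj : prefix_inj enc_nat.
Proof.
have Hp : prefix_inj enc_pos.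
  elim=> [p IH|p IH|] [q|q|] u v //=; try by case=> /IH [-> ->].
  by case.
move=> x y u v; rewrite /enc_nat => E.
suff [H ->] : bin_of_nat x = bin_of_nat y /\ u = v.
  by split=> //; rewrite -(bin_of_natK x) H bin_of_natK.
case: (bin_of_nat x) (bin_of_nat y) E => [|p] [|q] //=; first by case.
by case=> /Hp [-> ->].
Qed.

Lemma enc_seq_inj (T : Type) (e : T -> seq bool) :
  prefix_inj e -> prefix_inj (enc_seq e).
Proof.
move=> He; elim=> [|x s IH] [|y t] u v //=; first by case.
by case; rewrite -!catA => /He [-> /IH [-> ->]].
Qed.

Lemma enc_concept_inj : prefix_inj enc_concept.
Proof.
elim=> [||A|C IH|C IHC D IHD|C IHC D IHD|R C IH|R C IH]
       [||A'|C'|C' D'|C' D'|R' C'|R' C'] u v //=;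
  case; rewrite -?catA //.
- by move/enc_nat_inj=> [-> ->].
- by move/IH=> [-> ->].
- by move/IHC=> [-> /IHD [-> ->]].
- by move/IHC=> [-> /IHD [-> ->]].
- by move/enc_nat_inj=> [-> /IH [-> ->]].
- by move/enc_nat_inj=> [-> /IH [-> ->]].
Qed.

Lemma enc_ci_inj : prefix_inj enc_ci.
Proof.
move=> [C D] [C' D'] u v; rewrite /enc_ci /= -!catA.
by move/enc_concept_inj=> [-> /enc_concept_inj [-> ->]].
Qed.

Lemma enc_assertion_inj : prefix_inj enc_assertion.
Proof.
move=> [A a|R a b] [A' a'|R' a' b'] u v //=; case; rewrite -!catA.
  by move/enc_nat_inj=> [-> /enc_nat_inj [-> ->]].
by move/enc_nat_inj=> [-> /enc_nat_inj [-> /enc_nat_inj [-> ->]]].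
Qed.

Lemma enc_kb_inj : prefix_inj enc_kb.
Proof.
move=> [T A] [T' A'] u v; rewrite /enc_kb /= -!catA.
by move/(enc_seq_inj enc_ci_inj)=> [-> /(enc_seq_inj enc_assertion_inj) [-> ->]].
Qed.

Lemma enc_input_inj : injective enc_input.
Proof.
move=> [[K L] [c r]] [[K' L'] [c' r']]; rewrite /enc_input /enc_signature /=.
move/enc_kb_inj=> [-> /enc_kb_inj [-> /(enc_seq_inj enc_nat_inj) [->]]].
rewrite -[X in X = _]cats0 -[X in _ = X]cats0.
by move/(enc_seq_inj enc_nat_inj)=> [->].
Qed.

(** * Sigma-rUCQ entailment as a decision problem *)

Definition rucq_entailment : problem :=
  {| input := kb * kb * signature;
     encode := enc_input;
     inst := fun x => consistent x.1.1 /\ consistent x.1.2;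
     yes := fun x => rucq_entails x.2 x.1.1 x.1.2 |}.

(* Main.v *)
(* Upper bound.  A type is a set of subconcepts and concept names of the input, coded by a number below
   2 ^ (2 n), and a set of types is a number below 2 ^ (2 ^ (2 n)).  K1 entails K2 iff every model of K1
   admits a model of K2 whose part around the named individuals maps into it by a Sigma-homomorphism;
   a failure shows at a finite depth, and bounded simulations are expressed by rooted UCQs.  That a
   tree-shaped model of K1 with a root of type s can defeat all the K2-types in a set V is a least
   fixed point over pairs (s, V), and its steps are definable in first-order arithmetic over
   {0, .., N - 1} for N = 2 ^ (2 ^ (8 n + 8)); brute-force evaluation takes doubly exponential time.

   Hardness.  A rejecting run is certified by a proof tree of claims that after t steps the state is q and
   the cell at distance p from the head holds a; each claim follows from one or two claims for t - 1.
   In models of K1 a claim is a block of 2 ^ m nodes that spells the binary digits of t and p along a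
   counter.  K2 asks for two nodes of successive blocks with the same counter value and
   incompatible digits.  Since the disjunctions of K2 let this pair be anywhere, K1 entails K2 iff every
   proof tree contains an error, that is, iff the machine does not reject.  An escape disjunct at the
   root makes both knowledge bases consistent. *)

Require Import Defs.
From Stdlib Require Import Classical ClassicalEpsilon FunctionalExtensionality Relation_Operators.
From mathcomp Require Import all_boot zify.

Set Implicit Arguments.
Unset Strict Implicit.
Unset Printing Implicit Defensive.

(** * While programs on Turing machines *)

(** Two obstacles shape the upper bound. [K2] can resolve its disjunctions in many ways, so one
    successor in a model of [K1] must defeat all the types that [K2] could still place there; hence
    the fixed point runs over sets. And a query has finitely many disjuncts, so one depth must serve
    for all models of [K2]. Below anonymous elements this depth is a stage of the fixed point; at
    the individuals, where the ABox may have cycles, it comes from the finiteness of the set of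
    pairs of an individual and a type. The query is not designed: it is the disjunction of all
    rooted conjunctions of the relevant atoms that are false in the given model of [K1]. Parse
    relations, sets of types and assignments are numbers read by their bits, so their fixed points
    become bounded quantifiers; only the one over pairs [(s, V)] is iterated by the program.

    In the reduction the tape is circular with [S = 2 ^ (2 ^ m)] cells, so that positions are
    exactly the words of [2 ^ m] bits and no claim meets an end of the tape. Errors come in eight
    kinds: two polarities of four comparisons, with time minus one and with position minus one,
    unchanged or plus one. *)

Definition store := nat -> seq bool.

Definition upd (s : store) i v : store := fun j => if j == i then v else s j.

(** Registers are stacks of bits. [Case] and [Loop] pop the bit that they test, so the only
    primitives are a push and a pop with a three-way jump, and each costs a machine one sweep over
    the tape. *)
Inductive cmd :=
| Skip
| Push of nat & bool
| Seq of cmd & cmd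
| Case of nat & cmd & cmd & cmd
| Loop of nat & cmd & cmd.

(** The last index is the exact number of instructions that the compiled flowchart executes; this
    allows [code_sound] to be an equation about [iter t]. *)
Inductive run : cmd -> store -> store -> nat -> Prop :=
| run_skip s : run Skip s s 0
| run_push i b s : run (Push i b) s (upd s i (b :: s i)) 1
| run_seq c d s s' s'' t t' :
    run c s s' t -> run d s' s'' t' -> run (Seq c d) s s'' (t + t')
| run_case_nil i cn cf ct s s' t :
    s i = [::] -> run cn s s' t -> run (Case i cn cf ct) s s' t.+1
| run_case_cons i cn cf ct s s' t b v :
    s i = b :: v -> run (if b then ct else cf) (upd s i v) s' t ->
    run (Case i cn cf ct) s s' t.+1
| run_loop_nil i cf ct s : s i = [::] -> run (Loop i cf ct) s s 1
| run_loop_cons i cf ct s s' s'' t t' b v :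
    s i = b :: v -> run (if b then ct else cf) (upd s i v) s' t ->
    run (Loop i cf ct) s' s'' t' -> run (Loop i cf ct) s s'' (t + t').+1.

Fixpoint max_reg (c : cmd) : nat :=
  match c with
  | Skip => 0
  | Push i _ => i
  | Seq c d => maxn (max_reg c) (max_reg d)
  | Case i cn cf ct => maxn i (maxn (max_reg cn) (maxn (max_reg cf) (max_reg ct)))
  | Loop i cf ct => maxn i (maxn (max_reg cf) (max_reg ct))
  end.

Inductive instr (Q : Type) :=
| IPush of nat & bool & option Q
| IPop of nat & option Q & option Q & option Q.

Definition ireg Q (I : instr Q) := match I with IPush i _ _ => i | IPop i _ _ _ => i end.

Definition imap Q Q' (f : option Q -> option Q') (I : instr Q) : instr Q' :=
  match I with
  | IPush i b o => IPush i b (f o)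
  | IPop i on of_ ot => IPop i (f on) (f of_) (f ot)
  end.

Definition istep Q (I : instr Q) (s : store) : option Q * store :=
  match I with
  | IPush i b o => (o, upd s i (b :: s i))
  | IPop i on of_ ot =>
      if s i is b :: v then ((if b then ot else of_), upd s i v) else (on, s)
  end.

Definition astep Q (ins : Q -> instr Q) (x : option Q * store) :=
  if x.1 is Some q then istep (ins q) x.2 else x.

(* Control points of a program; the exit point is [None]. *)
Fixpoint ctl (c : cmd) : finType :=
  match c with
  | Skip => void
  | Push _ _ => unit
  | Seq c d => (ctl c + ctl d)%type
  | Case _ cn cf ct => option (ctl cn + (ctl cf + ctl ct))%type
  | Loop _ cf ct => option (ctl cf + ctl ct)%type
  end.

Definition link Q Q' (f : Q -> Q') (k : option Q') (o : option Q) : option Q' :=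
  if o is Some q then Some (f q) else k.

Fixpoint entry (c : cmd) : option (ctl c) :=
  match c return option (ctl c) with
  | Skip => None
  | Push _ _ => Some tt
  | Seq c d => link inl (link inr None (entry d)) (entry c)
  | Case _ _ _ _ => Some None
  | Loop _ _ _ => Some None
  end.

Fixpoint code (c : cmd) : ctl c -> instr (ctl c) :=
  match c return ctl c -> instr (ctl c) with
  | Skip => fun q => match q with end
  | Push i b => fun _ => IPush i b None
  | Seq c d => fun q => match q with
      | inl q => imap (link inl (link inr None (entry d))) (code q)
      | inr q => imap (link inr None) (code q)
      end
  | Case i cn cf ct => fun q => match q with
      | None => IPop i (link (fun x => Some (inl x)) None (entry cn))
                       (link (fun x => Some (inr (inl x))) None (entry cf))
                       (link (fun x => Some (inr (inr x))) None (entry ct))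
      | Some (inl q) => imap (link (fun x => Some (inl x)) None) (code q)
      | Some (inr (inl q)) => imap (link (fun x => Some (inr (inl x))) None) (code q)
      | Some (inr (inr q)) => imap (link (fun x => Some (inr (inr x))) None) (code q)
      end
  | Loop i cf ct => fun q => match q with
      | None => IPop i None (link (fun x => Some (inl x)) (Some None) (entry cf))
                            (link (fun x => Some (inr x)) (Some None) (entry ct))
      | Some (inl q) => imap (link (fun x => Some (inl x)) (Some None)) (code q)
      | Some (inr q) => imap (link (fun x => Some (inr x)) (Some None)) (code q)
      end
  end.

Lemma imap_comp Q Q' Q'' (f : option Q -> option Q') (g : option Q' -> option Q'') I :
  imap g (imap f I) = imap (g \o f) I.
Proof. by case: I. Qed.

Lemma imap_ext Q Q' (f g : option Q -> option Q') I : f =1 g -> imap f I = imap g I.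
Proof. by move=> E; case: I => * /=; rewrite !E. Qed.

Lemma link_link Q Q' Q'' (f : Q -> Q') (g : Q' -> Q'') k k' o :
  link g k' (link f k o) = link (g \o f) (link g k' k) o.
Proof. by case: o. Qed.

Lemma iter_astep Q (ins : Q -> instr Q) t q s :
  iter t.+1 (astep ins) (Some q, s) = iter t (astep ins) (istep (ins q) s).
Proof. by rewrite iterSr. Qed.

(** Commands occur inside larger ones. The embedding [f] of the control points into an arbitrary
    flowchart and the exit [k] are the two parameters that vary in the induction on the run. *)
Lemma code_sound c s s' t : run c s s' t ->
  forall Q' (ins : Q' -> instr Q') (f : ctl c -> Q') k,
  (forall q, ins (f q) = imap (link f k) (code q)) ->
  iter t (astep ins) (link f k (entry c), s) = (k, s').
Proof.
elim=> {c s s' t}.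
- by [].
- by move=> i b s Q' ins f k H; rewrite /= /astep /= H.
- move=> c d s s' s'' t t' _ IH1 _ IH2 Q' ins f k H.
  rewrite addnC iterD /= link_link (IH1 _ ins (f \o inl) (link f k (link inr None (entry d)))).
    rewrite link_link; apply: (IH2 _ ins (f \o inr)) => q /=.
    by rewrite H /= imap_comp; apply: imap_ext => o; case: o.
  by move=> q /=; rewrite H /= imap_comp; apply: imap_ext => o; case: o.
- move=> i cn cf ct s s' t E _ IH Q' ins f k H.
  rewrite iter_astep H /= E link_link.
  apply: (IH _ ins (f \o (fun x => Some (inl x)))) => q /=.
  by rewrite H /= imap_comp; apply: imap_ext => o; case: o.
- move=> i cn cf ct s s' t b v E _ IH Q' ins f k H.
  rewrite iter_astep H /= E.
  case: b E IH => E IH; rewrite link_link.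
    apply: (IH _ ins (f \o (fun x => Some (inr (inr x))))) => q /=.
    by rewrite H /= imap_comp; apply: imap_ext => o; case: o.
  apply: (IH _ ins (f \o (fun x => Some (inr (inl x))))) => q /=.
  by rewrite H /= imap_comp; apply: imap_ext => o; case: o.
- by move=> i cf ct s E Q' ins f k H; rewrite /= /astep /= H /= E.
- move=> i cf ct s s' s'' t t' b v E _ IH _ IHl Q' ins f k H.
  rewrite iter_astep H /= E addnC iterD.
  case: b E IH => E IH; rewrite link_link.
    rewrite (IH _ ins (f \o (fun x => Some (inr x)))); first exact: IHl.
    by move=> q /=; rewrite H /= imap_comp; apply: imap_ext => o; case: o.
  rewrite (IH _ ins (f \o (fun x => Some (inl x)))); first exact: IHl.
  by move=> q /=; rewrite H /= imap_comp; apply: imap_ext => o; case: o.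
Qed.

Lemma ireg_imap Q Q' (f : option Q -> option Q') I : ireg (imap f I) = ireg I.
Proof. by case: I. Qed.

Lemma code_reg c (q : ctl c) : ireg (code q) <= max_reg c.
Proof.
elim: c q => [|i b|c IHc d IHd|i cn IHn cf IHf ct IHt|i cf IHf ct IHt] //=.
- by case=> q; rewrite ireg_imap leq_max ?IHc ?IHd ?orbT.
- by case=> [[q|[q|q]]|] /=; rewrite ?ireg_imap ?leq_max ?IHn ?IHf ?IHt ?leqnn ?orbT.
- by case=> [[q|q]|] /=; rewrite ?ireg_imap ?leq_max ?IHf ?IHt ?leqnn ?orbT.
Qed.

(** * Simulation of finitely many stacks on one tape *)

Section Compile.

Variables (K : nat) (Q : finType) (ins : Q -> instr Q) (ent : option Q).
Hypothesis insK : forall q, ireg (ins q) <= K.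

Definition vect := {ffun 'I_K.+1 -> option bool}.
(* The auxiliary symbol [None] marks the cell in front of the stacks; the
   others hold one entry of each stack.  Cells occupied by stack 0 only are
   written as input symbols, so that the input word is a stack. *)
Definition sym := option (bool + option vect).

Definition marker : sym := Some (inr None).

Definition v0 : vect := [ffun=> None].
Definition vin b : vect := [ffun i => if i == ord0 then Some b else None].

Definition enc (v : vect) : sym :=
  if v == v0 then None else if v == vin true then Some (inl true)
  else if v == vin false then Some (inl false) else Some (inr (Some v)).

Definition dec (x : sym) : vect :=
  match x with
  | None => v0
  | Some (inl b) => vin b
  | Some (inr None) => v0
  | Some (inr (Some v)) => v
  end.

Lemma encK v : dec (enc v) = v.
Proof. by rewrite /enc; do !case: eqP => [->|_] //. Qed.

Lemma enc_marker v : (enc v == marker) = false.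
Proof. by rewrite /enc; do !case: eqP => [//|_]. Qed.

Lemma enc_v0 : enc v0 = None. Proof. by rewrite /enc eqxx. Qed.

Lemma enc_vin b : enc (vin b) = Some (inl b).
Proof.
have H0 : (vin b == v0) = false by apply/eqP => /ffunP/(_ ord0); rewrite !ffunE.
rewrite /enc H0; case: b H0 => _; first by rewrite eqxx.
by case: eqP => [/ffunP/(_ ord0)|_]; rewrite ?ffunE //= eqxx.
Qed.

Definition put (i : nat) (o : option bool) (v : vect) : vect :=
  [ffun j => if j == inord i then o else v j].

(* [inr (inr (inr _))] are the initial, second, final and accepting states. *)
Definition tst : finType := (option Q + (Q + (Q + 'I_4)))%type.

Definition Ret o : tst := inl o.
Definition Go q : tst := inr (inl q).
Definition Back q : tst := inr (inr (inl q)).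
Definition Aux (i : 'I_4) : tst := inr (inr (inr i)).

(** In state [Go q] the head runs right to the first cell not occupied by the stack of [q]. A push
    writes there; a pop steps back ([Back q]), where the marker means that the stack is empty. [Ret]
    runs left to the marker and starts the next instruction. [Aux] 0 and 1 put the marker in front
    of the input; [Aux] 2 stands on the first output cell and goes to the accepting [Aux] 3 if this
    cell holds [true]. *)
Definition ttrans (q : tst) (x : sym) : option (tst * sym * move) :=
  match q with
  | inl o =>
      if x == marker then
        if o is Some q then Some (Go q, x, MoveR) else Some (Aux (inord 2), x, MoveR)
      else Some (Ret o, x, MoveL)
  | inr (inl q) =>
      if dec x (inord (ireg (ins q))) is Some _ then Some (Go q, x, MoveR)
      else match ins q with
           | IPush i b o => Some (Ret o, enc (put i (Some b) (dec x)), MoveL)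
           | IPop _ _ _ _ => Some (Back q, x, MoveL)
           end
  | inr (inr (inl q)) =>
      if ins q is IPop i on of_ ot then
        if x == marker then Some (Ret on, x, Stay)
        else if dec x (inord i) is Some b
             then Some (Ret (if b then ot else of_), enc (put i None (dec x)), MoveL)
             else None
      else None
  | inr (inr (inr i)) =>
      if i == inord 0 then Some (Aux (inord 1), x, MoveL)
      else if i == inord 1 then Some (Ret ent, marker, Stay)
      else if i == inord 2 then
        if x == Some (inl true) then Some (Aux (inord 3), x, Stay) else None
      else None
  end.

Definition tmc : tm :=
  @TM tst (option vect) (Aux (inord 0)) (pred1 (Aux (inord 3))) ttrans.

Notation cfg := (config tmc).

Definition mk (q : tst) (l : seq sym) (x : sym) (r : seq sym) : cfg := @Config tmc q l x r.

Definition W q (cs : seq sym) j : cfg :=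
  mk q (rev (marker :: take j cs)) (nth None cs j) (drop j.+1 cs).

(** The bottoms of the stacks are next to the marker, hence [rev]: a push or a pop changes a single
    cell, and the input word is stack 0 with its last letter on top. *)
Definition vec (s : store) j : vect := [ffun i : 'I_K.+1 => onth (rev (s i)) j].
Definition cells s L : seq sym := mkseq (fun j => enc (vec s j)) L.
Definition home o s L : cfg := mk (Ret o) [::] marker (cells s L).

Definition tstep := obind (@step tmc).

Arguments tstep : simpl never.
Arguments W : simpl never.

Lemma step1 q l x r q' x' m : ttrans q x = Some (q', x', m) ->
  tstep (Some (mk q l x r)) = Some (@shift tmc q' l x' r m).
Proof. by move=> E; rewrite /tstep /= /step /= E. Qed.

Arguments step1 {q l x r q' x' m}.

Lemma move_right q q' cs j : j < size cs ->
  ttrans q (nth None cs j) = Some (q', nth None cs j, MoveR) ->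
  tstep (Some (W q cs j)) = Some (W q' cs j.+1).
Proof.
move=> lt E; rewrite /W (step1 E) /= /mk; congr (Some (Config _ _ _ _)).
- by rewrite (take_nth None lt) -rcons_cons rev_rcons.
- by rewrite -nth0 nth_drop addn0.
- by rewrite -drop1 drop_drop add1n.
Qed.

Lemma move_left q q' cs j x : j < size cs ->
  ttrans q (nth None cs j.+1) = Some (q', x, MoveL) ->
  tstep (Some (W q cs j.+1)) = Some (W q' (set_nth None cs j.+1 x) j).
Proof.
move=> lt E; rewrite /W (step1 E) /= /mk.
have E1 : take j.+1 (set_nth None cs j.+1 x) = take j.+1 cs.
  rewrite set_nthE; case: ltnP => h; first by rewrite take_size_cat ?size_takel // ltnW.
  have -> : j.+1 = size cs by lia.
  by rewrite take_size_cat // take_size.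
congr (Some (Config _ _ _ _)).
- by rewrite (take_nth None lt) -rcons_cons rev_rcons /= -[in RHS](take_takel _ (leqnSn j)) E1 take_takel.
- by rewrite (take_nth None lt) -rcons_cons rev_rcons /= nth_set_nth /= ltn_eqF.
- rewrite set_nthE; case: ltnP => h.
    by rewrite drop_cat size_takel // ltnn subnn drop0.
  have -> : j.+1 = size cs by lia.
  by rewrite drop_oversize // subnn drop_size_cat.
Qed.

Lemma move_home q q' cs x :
  ttrans q (nth None cs 0) = Some (q', x, MoveL) ->
  tstep (Some (W q cs 0)) = Some (mk q' [::] marker (set_nth None cs 0 x)).
Proof.
move=> E; rewrite /W (step1 E) /= take0 /mk; congr (Some (Config _ _ _ _)).
by case: cs {E} => //= a l; rewrite drop0.
Qed.

Lemma return_home o cs j : j < size cs -> marker \notin cs ->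
  iter j.+1 tstep (Some (W (Ret o) cs j)) = Some (mk (Ret o) [::] marker cs).
Proof.
move=> + H; elim: j => [|j IH] lt.
  have N : nth None cs 0 != marker by apply: contraNneq H => <-; apply: mem_nth.
  rewrite /= (move_home (q' := Ret o) (x := nth None cs 0)) ?set_nth_id //.
    by case: cs lt {H N}.
  by rewrite /= (negbTE N).
have N : nth None cs j.+1 != marker by apply: contraNneq H => <-; apply: mem_nth.
rewrite iterSr (move_left (q' := Ret o) (x := nth None cs j.+1)) /=; last by rewrite (negbTE N).
  rewrite -iterS.
  suff -> : set_nth None cs j.+1 (nth None cs j.+1) = cs by apply: IH; apply: ltnW.
  apply: (@eq_from_nth _ None) => [|i _]; first by rewrite size_set_nth; apply/maxn_idPr.
  by rewrite nth_set_nth /=; case: eqP => // ->.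
exact: ltnW.
Qed.

Definition fits (s : store) L := forall i, i <= K -> size (s i) <= L.

Lemma vec_default s L j : fits s L -> L <= j -> vec s j = v0.
Proof.
move=> H lt; apply/ffunP => i; rewrite !ffunE onth_default // size_rev.
by apply: leq_trans lt; apply: H; rewrite -ltnS.
Qed.

Lemma nth_cells s L j : fits s L -> nth None (cells s L) j = enc (vec s j).
Proof.
move=> H; case: (ltnP j L) => h; first by rewrite nth_mkseq.
by rewrite nth_default ?size_mkseq // (vec_default H h) enc_v0.
Qed.

Lemma marker_cells s L : marker \notin cells s L.
Proof. by apply/mapP => -[j _ /eqP]; rewrite eq_sym enc_marker. Qed.

Lemma set_nth_cells s s' L k : fits s L -> (forall j, j != k -> vec s' j = vec s j) ->
  set_nth None (cells s L) k (enc (vec s' k)) = cells s' (maxn k.+1 L).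
Proof.
move=> H E; apply: (@eq_from_nth _ None) => [|j]; first by rewrite size_set_nth !size_mkseq.
rewrite size_set_nth size_mkseq => lt; rewrite nth_set_nth nth_mkseq //=.
by case: eqP => [-> //|/eqP ne]; rewrite (nth_cells _ H) E.
Qed.

Lemma vec_push s i b j : i <= K -> vec (upd s i (b :: s i)) j =
  if j == size (s i) then put i (Some b) (vec s j) else vec s j.
Proof.
move=> iK; have E : forall x : 'I_K.+1, (x == inord i) = (x == i :> nat).
  by move=> x; rewrite -val_eqE /= inordK.
case: eqP => [->|ne]; apply/ffunP => x; rewrite !ffunE ?E /upd; case: eqP => // Ex; rewrite ?Ex.
  by rewrite rev_cons -cats1 onth_cat size_rev ltnn subnn.
rewrite rev_cons -cats1 onth_cat size_rev; case: ltnP => // h.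
by rewrite !onth_default ?size_rev //=; lia.
Qed.

Lemma vec_pop s i b v j : i <= K -> s i = b :: v -> vec (upd s i v) j =
  if j == size v then put i None (vec s j) else vec s j.
Proof.
move=> iK Es; have E : forall x : 'I_K.+1, (x == inord i) = (x == i :> nat).
  by move=> x; rewrite -val_eqE /= inordK.
case: eqP => [->|ne]; apply/ffunP => x; rewrite !ffunE ?E /upd; case: eqP => // Ex; rewrite ?Ex.
  by rewrite onth_default // size_rev.
rewrite Es rev_cons -cats1 onth_cat size_rev; case: ltnP => // h.
by rewrite !onth_default ?size_rev //=; lia.
Qed.

Lemma vec_reg s i j : i <= K -> vec s j (inord i) = onth (rev (s i)) j.
Proof. by move=> iK; rewrite ffunE inordK. Qed.

Lemma walk q s L k : fits s L -> k <= size (s (ireg (ins q))) ->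
  iter k tstep (Some (W (Go q) (cells s L) 0)) = Some (W (Go q) (cells s L) k).
Proof.
move=> H; elim: k => // k IH lt; rewrite iterS IH; last exact: ltnW.
have lt2 := leq_trans lt (H _ (insK q)).
apply: move_right; rewrite ?size_mkseq // nth_cells // /= encK vec_reg //.
by have := onthTE (rev (s (ireg (ins q)))) k; rewrite size_rev lt; case: onth.
Qed.

Lemma fits_upd s L i v k : fits s L -> size v <= k -> fits (upd s i v) (maxn k L).
Proof.
by move=> H lt j jK; rewrite leq_max /upd; case: eqP => _; rewrite ?lt // H ?orbT.
Qed.

(** The cost is one sweep to the free end of a stack and back. [L] is only a bound on the heights:
    cells beyond it are blank, and the blank is the code of the empty column. *)
Lemma instr_sim q s L o s' : fits s L -> istep (ins q) s = (o, s') ->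
  exists n L', [/\ n <= 2 * L + 4, L' <= L.+1, fits s' L' &
    iter n tstep (Some (home (Some q) s L)) = Some (home o s' L')].
Proof.
move=> H E; set i := ireg (ins q); have iK := insK q; set k := size (s i).
have kL : k <= L by apply: H.
have S1 : tstep (Some (home (Some q) s L)) = Some (W (Go q) (cells s L) 0).
  rewrite /home (step1 (q' := Go q) (x' := marker) (m := MoveR)) /= ?eqxx //.
  by rewrite /W /mk take0 -drop1; case: (cells s L).
have S2 : iter k.+1 tstep (Some (home (Some q) s L)) = Some (W (Go q) (cells s L) k).
  by rewrite iterSr S1; apply: walk.
have DN : dec (nth None (cells s L) k) (inord i) = None.
  by rewrite nth_cells // encK vec_reg // onth_default // size_rev.
have L1 : maxn k.+1 L <= L.+1 by rewrite geq_max !ltnS kL leqnSn.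
case Ei : (ins q) E => [i' b o'|i' on of_ ot] /=; have Ei2 : i' = i by rewrite /i Ei.
  case=> <- <-; rewrite Ei2; set s1 := upd s i _.
  have F1 : fits s1 (maxn k.+1 L) by apply: fits_upd.
  have SN : set_nth None (cells s L) k (enc (vec s1 k)) = cells s1 (maxn k.+1 L).
    by apply: set_nth_cells => // j ne; rewrite vec_push // (negbTE ne).
  have T : ttrans (Go q) (nth None (cells s L) k) = Some (Ret o', enc (vec s1 k), MoveL).
    by rewrite /= DN Ei /= Ei2 nth_cells // encK vec_push // eqxx.
  exists (k + k.+2), (maxn k.+1 L); split=> //; first by lia.
  case Ek : k T SN S2 => [|j] T SN S2.
    by rewrite iterS S2 (move_home T) SN.
  rewrite iterD [iter j.+3 _ _]iterS S2 (move_left _ T) ?SN; last by rewrite size_mkseq; lia.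
  by rewrite return_home ?marker_cells // size_mkseq; lia.
have SN : set_nth None (cells s L) k (nth None (cells s L) k) = cells s (maxn k.+1 L).
  by rewrite nth_cells //; apply: set_nth_cells.
have T : ttrans (Go q) (nth None (cells s L) k) = Some (Back q, nth None (cells s L) k, MoveL).
  by rewrite /= DN Ei.
have F0 : fits s (maxn k.+1 L) by move=> x xK; rewrite leq_max H ?orbT.
case Es : (s i') => [|b v] [<- <-].
  have k0 : k = 0 by rewrite /k -Ei2 Es.
  exists 3, (maxn k.+1 L); split=> //; first by lia.
  rewrite k0 in S2 T SN *.
  rewrite (iterD 2 1) S2 iterS /= (move_home T) SN (step1 (q' := Ret on) (x' := marker) (m := Stay)) //.
  by rewrite /= Ei ?eqxx.
rewrite Ei2 in Es *; have kv : k = (size v).+1 by rewrite /k Es.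
rewrite kv in S2 T SN F0 L1 *; set j := size v in S2 T SN F0 L1 kv *.
set L' := maxn j.+2 L in SN F0 L1 *; set s1 := upd s i v.
have F1 : fits s1 L'.
  by have := @fits_upd s L' i v j F0 (leqnn _); rewrite (maxn_idPr _) // leq_max; lia.
have T2 : ttrans (Back q) (nth None (cells s L') j) = Some (Ret (if b then ot else of_), enc (vec s1 j), MoveL).
  rewrite /= Ei nth_cells // enc_marker Ei2 encK vec_reg // Es rev_cons -cats1 onth_cat size_rev ltnn subnn /=.
  by rewrite (vec_pop _ _ Es) // eqxx.
have SN2 : set_nth None (cells s L') j (enc (vec s1 j)) = cells s1 L'.
  rewrite set_nth_cells // => [|x ne]; first by congr cells; apply/maxn_idPr; rewrite leq_max; lia.
  by rewrite (vec_pop _ _ Es) // (negbTE ne).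
exists (j + j.+4), L'; split=> //; first by lia.
case Ej : j T2 SN2 S2 SN T => [|h] T2 SN2 S2 SN T.
  rewrite (iterD 2 2) S2 iterS /= (move_left _ T) ?SN; last by rewrite size_mkseq; lia.
  by rewrite (move_home T2) SN2.
rewrite iterD (iterD 2 h.+3) S2 iterS /= (move_left _ T) ?SN; last by rewrite size_mkseq; lia.
rewrite (move_left _ T2) ?SN2 ?size_mkseq; last by rewrite leq_max; lia.
by rewrite -iterS return_home ?marker_cells // size_mkseq leq_max; lia.
Qed.

Lemma exec_sim t o s s' L : fits s L -> iter t (astep ins) (o, s) = (None, s') ->
  exists n L', [/\ n <= t * (2 * (L + t) + 4), fits s' L' &
    iter n tstep (Some (home o s L)) = Some (home None s' L')].
Proof.
elim: t o s L => [|t IH] o s L F; first by case=> -> <-; exists 0, L.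
case: o => [q|]; last first.
  rewrite iterSr {2}/astep /= => /(IH _ _ _ F) [n [L' [h1 h2 h3]]].
  by exists n, L'; split=> //; apply: leq_trans h1 _; apply: leq_mul; lia.
rewrite iter_astep; case E: (istep (ins q) s) => [o1 s1] E2.
have [n1 [L1 [h1 h2 F1 h3]]] := instr_sim F E.
have [n2 [L2 [g1 F2 g3]]] := IH _ _ _ F1 E2.
exists (n2 + n1), L2; split=> //; last by rewrite iterD h3.
apply: (@leq_trans (t * (2 * (L + t.+1) + 4) + (2 * L + 4))); last by rewrite mulSn; lia.
by apply: leq_add => //; apply: leq_trans g1 _; apply: leq_mul => //; lia.
Qed.

End Compile.

Definition reg0 (v : seq bool) : store := fun i => if i == 0 then v else [::].

Lemma cells_reg0 K y L : size y <= L ->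
  cells K (reg0 (rev y)) L = map (fun b => Some (inl b)) y ++ nseq (L - size y) None.
Proof.
move=> H; apply: (@eq_from_nth _ None) => [|j].
  by rewrite size_mkseq size_cat size_map size_nseq; lia.
rewrite size_mkseq => jL; rewrite nth_mkseq // nth_cat size_map nth_nseq if_same.
case: ltnP => h.
  rewrite (nth_map false) // -enc_vin; congr enc; apply/ffunP => i; rewrite !ffunE /reg0.
  by rewrite -val_eqE /=; case: eqP => _; rewrite ?revK ?onth0n // onthE (nth_map false).
transitivity (enc (v0 K)); last exact: enc_v0.
congr enc; apply/ffunP => i; rewrite !ffunE /reg0.
by case: eqP => _; rewrite onth_default ?revK.
Qed.

Lemma fits_reg0 K y L : size y <= L -> fits K (reg0 y) L.
Proof. by move=> H i _; rewrite /reg0; case: eqP. Qed.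

Lemma inord4 i j : i < 4 -> j < 4 -> (inord i == inord j :> 'I_4) = (i == j).
Proof. by move=> h1 h2; rewrite -val_eqE /= !inordK. Qed.

Arguments step1 {K Q ins ent q l x r q' x' m}.

Definition tm_of (c : cmd) : tm := tmc (max_reg c) (@code c) (entry c).

(** The final configuration serves both uses of machines: the word under and to the right of the
    head is the value of a function, and its first bit is the verdict of a decision procedure. *)
Lemma tm_of_sound c w y t : run c (reg0 (rev w)) (reg0 (rev y)) t ->
  exists n (C : config (tm_of c)) r,
    [/\ n <= (t + 1) * (2 * (size w + 1 + t) + 8), halts_in w n C,
        chead C :: cright C = map (insym (tm_of c)) y ++ nseq r None &
        accepting (cstate C) <-> head false y].
Proof.
(* At least one cell, because on the empty input the head already stands on a listed blank. *)
move=> H; set K := max_reg c; set L := maxn 1 (size w).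
have /(exec_sim (entry c) (@code_reg c)) : iter t (astep (@code c)) (entry c, reg0 (rev w)) = (None, reg0 (rev y)).
  have := @code_sound _ _ _ _ H _ (@code c) id None; rewrite /link.
  have -> : (if entry c is Some q then Some q else None) = entry c by case: (entry c).
  by apply => q; case: (code q) => [i b [x|]|i [x|] [x1|] [x2|]].
move=> /(_ L) [|n [L' [h1 F2 h2]]]; first by apply: fits_reg0; rewrite size_rev /L; lia.
have yL : size y <= L' by have := F2 0 isT; rewrite /reg0 /= size_rev.
pose ts := @tstep K _ (@code c) (entry c); pose mk' := @mk K _ (@code c) (entry c).
pose ax i := @Aux (ctl c) (inord i).
pose st1 := @step1 K _ (@code c) (entry c); set ws := map (insym (tm_of c)) w.
have I2 : iter 2 ts (Some (init (tm_of c) w)) =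
    Some (@home K _ (@code c) (entry c) (entry c) (reg0 (rev w)) L).
  have -> : iter 2 ts (Some (init (tm_of c) w)) =
      ts (Some (mk' (ax 1) [::] None (head None ws :: behead ws))).
    by congr (ts _); apply: (st1 (ax 0) [::] _ (behead ws) (ax 1) _ MoveL); rewrite /= inord4.
  rewrite /ts (st1 (ax 1) [::] _ _ (Ret (entry c)) (marker _) Stay); last by rewrite /= !inord4.
  rewrite /= /home /mk cells_reg0 ?/L; last by lia.
  rewrite /ws; case: w {H h1 h2 L ws} => [|a w] //=.
  by rewrite (_ : maxn 1 (size w).+1 - (size w).+1 = 0) ?cats0 //; lia.
set cs := cells K (reg0 (rev y)) L' in h2 *.
have Ecs : cs = map (insym (tm_of c)) y ++ nseq (L' - size y) None by apply: cells_reg0.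
have I3 : ts (Some (@home K _ (@code c) (entry c) None (reg0 (rev y)) L')) =
    Some (mk' (ax 2) [:: marker _] (head None cs) (behead cs)).
  by apply: (st1 (Ret None) [::] (marker _) cs (ax 2) (marker _) MoveR); rewrite /= ?eqxx.
have HC : exists r, head None cs :: behead cs = [seq insym (tm_of c) i | i <- y] ++ nseq r None.
  exists (maxn 1 L' - size y); rewrite Ecs.
  case: (y) yL => [|a y'] /= yL; last by congr (_ :: (_ ++ _)); congr nseq; lia.
  by case: (L') => [|L2] //=; rewrite subn0 (maxn_idPr _).
have {HC} [r HC] := HC.
have HD : (head None cs == Some (inl true)) = head false y.
  rewrite Ecs; case: (y) => [|a y'] /=; first by case: (L' - 0).
  by case: a.
case hy : (head false y).
  exists (1 + (1 + (n + 2))), (mk' (ax 3) [:: marker _] (head None cs) (behead cs)), r.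
  split=> //; first by rewrite mulnDl mul1n; nia.
    split; last by rewrite /step /= !inord4.
    rewrite [iter _ _ _](iterD 1) (iterD 1) iterD.
    change (ts (ts (iter n ts (iter 2 ts (Some (init (tm_of c) w))))) = Some (mk' (ax 3) [:: marker _] (head None cs) (behead cs))).
    rewrite I2 h2 I3; apply: (st1 (ax 2) [:: marker _] _ (behead cs) (ax 3) _ Stay).
    by rewrite /= !inord4 //= HD hy.
  by split=> // _; rewrite /= eqxx.
exists (1 + (n + 2)), (mk' (ax 2) [:: marker _] (head None cs) (behead cs)), r.
split=> //; first by rewrite mulnDl mul1n; nia.
  split; last by rewrite /step /= !inord4 //= HD hy.
  rewrite [iter _ _ _](iterD 1) iterD.
  change (ts (iter n ts (iter 2 ts (Some (init (tm_of c) w)))) = Some (mk' (ax 2) [:: marker _] (head None cs) (behead cs))).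
  by rewrite I2 h2 I3.
split=> //; rewrite /= /Aux => /eqP E.
have : inord 2 == inord 3 :> 'I_4 by case: E => ->.
by rewrite inord4.
Qed.

(** * Evaluation of arithmetic formulas *)

Definition exec c s s' B := exists2 t, t <= B & run c s s' t.

Lemma exec_le c s s' B B' : exec c s s' B -> B <= B' -> exec c s s' B'.
Proof. by move=> [t h r] h'; exists t => //; apply: leq_trans h'. Qed.

Lemma exec_skip s : exec Skip s s 0.
Proof. by exists 0 => //; constructor. Qed.

Lemma exec_push i b s : exec (Push i b) s (upd s i (b :: s i)) 1.
Proof. by exists 1 => //; constructor. Qed.

Lemma exec_seq s' c d s s'' B B' :
  exec c s s' B -> exec d s' s'' B' -> exec (Seq c d) s s'' (B + B').
Proof.
by move=> [t h r] [t' h' r']; exists (t + t'); [apply: leq_add|econstructor; eauto].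
Qed.

Lemma exec_nil i cn cf ct s s' B : s i = [::] -> exec cn s s' B ->
  exec (Case i cn cf ct) s s' B.+1.
Proof. by move=> E [t h r]; exists t.+1 => //; apply: run_case_nil. Qed.

Lemma exec_cons i cn cf ct s s' B b v : s i = b :: v ->
  exec (if b then ct else cf) (upd s i v) s' B -> exec (Case i cn cf ct) s s' B.+1.
Proof. by move=> E [t h r]; exists t.+1 => //; apply: run_case_cons E r. Qed.

Lemma exec_loop_nil i cf ct s : s i = [::] -> exec (Loop i cf ct) s s 1.
Proof. by exists 1 => //; constructor. Qed.

Lemma exec_loop_cons i cf ct s s' s'' b v B B' : s i = b :: v ->
  exec (if b then ct else cf) (upd s i v) s' B -> exec (Loop i cf ct) s' s'' B' ->
  exec (Loop i cf ct) s s'' (B + B').+1.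
Proof.
move=> E [t h r] [t' h' r']; exists (t + t').+1; first by rewrite ltnS leq_add.
exact: run_loop_cons E r r'.
Qed.

Arguments exec_nil {i cn cf ct s s' B}.
Arguments exec_cons {i cn cf ct s s' B b v}.
Arguments exec_loop_nil {i cf ct s}.
Arguments exec_loop_cons {i cf ct s s' s'' b v B B'}.

Lemma upd_id s i v : s i = v -> upd s i v = s.
Proof. by move=> <-; apply: functional_extensionality => j; rewrite /upd; case: eqP => // ->. Qed.

Lemma upd_upd s i v v' : upd (upd s i v) i v' = upd s i v'.
Proof. by apply: functional_extensionality => j; rewrite /upd; case: eqP. Qed.

Lemma upd_same s i v : upd s i v i = v.
Proof. by rewrite /upd eqxx. Qed.

Lemma upd_neq s i j v : j != i -> upd s i v j = s j.
Proof. by rewrite /upd => /negbTE ->. Qed.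

Lemma updC s i j v v' : i != j -> upd (upd s i v) j v' = upd (upd s j v') i v.
Proof.
move=> ne; apply: functional_extensionality => k; rewrite /upd.
by do 2 case: eqP => // ?; subst; rewrite eqxx in ne.
Qed.

Ltac seq_store :=
  apply: functional_extensionality => ?; rewrite /upd;
  repeat (case: eqP => ?); subst; rewrite ?eqxx //=; try lia; try congruence; auto.

Ltac reg := rewrite /upd; repeat (case: eqP => ?); try lia; auto.

Definition For i c := Loop i Skip c.

(** [S k] describes the store after [k] rounds apart from the counter. The counter is popped before
    the body runs, hence [x - k.+1] marks during round [k]. *)
Lemma exec_for i c (S : nat -> store) x B :
  (forall k, k < x -> exec c (upd (S k) i (nseq (x - k.+1) true))
                            (upd (S k.+1) i (nseq (x - k.+1) true)) B) ->
  exec (For i c) (upd (S 0) i (nseq x true)) (upd (S x) i [::]) (x * B.+1).+1.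
Proof.
elim: x S => [|x IH] S H.
  by rewrite mul0n /For /=; apply: exec_loop_nil; rewrite upd_same.
have E : upd (S 0) i (nseq x.+1 true) i = true :: nseq x true by rewrite upd_same.
have H0 := H 0 isT; rewrite subn1 /= in H0.
apply: (exec_le (exec_loop_cons E _ _)).
- by rewrite upd_upd; apply: H0.
- rewrite -/(For i c); apply: (IH (fun k => S k.+1)) => k kx.
  have := H k.+1 kx; rewrite subSS => H1; exact: H1.
- by rewrite mulSn addnS.
Qed.

Lemma exec_for_eq i c (S : nat -> store) x B s s' :
  s = upd (S 0) i (nseq x true) -> s' = upd (S x) i [::] ->
  (forall k, k < x -> exec c (upd (S k) i (nseq (x - k.+1) true))
                            (upd (S k.+1) i (nseq (x - k.+1) true)) B) ->
  exec (For i c) s s' (x * B.+1).+1.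
Proof. by move=> -> ->; apply: exec_for. Qed.

Lemma exec_eq c s s1 s2 B : exec c s s1 B -> s1 = s2 -> exec c s s2 B.
Proof. by move=> H <-. Qed.

(* [Move i j] reverses register [i] onto register [j]. *)
Definition Move i j := Loop i (Push j false) (Push j true).

Lemma exec_move i j s v : i != j -> s i = v ->
  exec (Move i j) s (upd (upd s i [::]) j (rev v ++ s j)) (2 * size v).+1.
Proof.
move=> ne; elim: v s => [|b v IH] s E.
  by rewrite /= (upd_id E) upd_id //; apply: exec_loop_nil.
have E2 : upd (upd s i v) j (b :: s j) i = v by reg.
have H := IH _ E2; rewrite /Move in H *.
apply: (exec_le (exec_loop_cons (B := 1) (s' := upd (upd s i v) j (b :: s j)) E _ _)).
- have -> : b :: s j = b :: upd s i v j by rewrite upd_neq // eq_sym.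
  by case: (b); apply: exec_push.
- have {1}-> : upd (upd s i [::]) j (rev (b :: v) ++ s j) =
    upd (upd (upd (upd s i v) j (b :: s j)) i [::]) j (rev v ++ upd (upd s i v) j (b :: s j) j).
    by rewrite upd_same rev_cons cat_rcons; seq_store.
  exact: H.
- by rewrite /=; lia.
Qed.

Lemma rev_nseq T k (x : T) : rev (nseq k x) = nseq k x.
Proof.
elim: k => // k IH; rewrite /= rev_cons IH; elim: k {IH} => //= k IH.
by rewrite IH.
Qed.

Lemma nseq_cons T k (x : T) l : nseq k x ++ x :: l = nseq k.+1 x ++ l.
Proof. by elim: k => //= k ->. Qed.

(* Register 3 is the scratch register of [Copy]. *)
Definition Copy i j := Seq (For i (Seq (Push 3 true) (Push j true))) (Move 3 i).

Lemma exec_copy i j s x : i != j -> i != 3 -> j != 3 -> s i = nseq x true -> s 3 = [::] ->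
  exec (Copy i j) s (upd s j (nseq x true ++ s j)) (5 * x + 2).
Proof.
move=> n1 n2 n3 E E3.
pose s1 := upd (upd (upd s 3 (nseq x true)) j (nseq x true ++ s j)) i [::].
apply: (exec_le (exec_seq (s' := s1) (B := (x * 3).+1) (B' := (2 * x).+1) _ _)); last by lia.
  apply: (@exec_for_eq i _ (fun k => upd (upd s 3 (nseq k true)) j (nseq k true ++ s j)) x 2) => //.
    by seq_store.
  move=> k kx; apply: (exec_seq (B := 1) (B' := 1) (exec_push _ _ _)).
  apply: (exec_eq (exec_push _ _ _)).
  by seq_store; rewrite /upd; do ?case: eqP; try lia.
have E3' : s1 3 = nseq x true by rewrite /s1; reg.
have := @exec_move 3 i s1 _ _ E3'; rewrite size_nseq eq_sym => /(_ n2) H.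
by apply: (exec_eq H); rewrite /s1 upd_same cats0 rev_nseq; seq_store.
Qed.

(* Registers of the evaluator: 0 collects truth values, 1 holds the bound [N] of
   the quantifiers, 2 the table of the set [X], 3 to 9 are scratch registers,
   [10 + 2 i] holds the variable [i] and [11 + 2 i] counts the iterations of its
   quantifier.  Numbers are in unary. *)
Inductive fm :=
| FAdd of nat & nat & nat
| FMul of nat & nat & nat
| FBit of nat & nat
| FIn of nat
| FNot of fm
| FAnd of fm & fm
| FEx of fm.

Definition bit (i x : nat) : bool := odd (x %/ 2 ^ i).

(** Variables are numbered from the outermost quantifier inwards, so [FEx] extends [e] at its end
    and the register of a variable stays the same under further quantifiers. Only quantifiers are
    bounded by [N]; sums and products are not truncated. *)
Fixpoint sem (N : nat) (X : seq bool) (e : seq nat) (f : fm) : bool :=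
  match f with
  | FAdd x y z => nth 0 e x + nth 0 e y == nth 0 e z
  | FMul x y z => nth 0 e x * nth 0 e y == nth 0 e z
  | FBit x y => bit (nth 0 e x) (nth 0 e y)
  | FIn x => nth false X (nth 0 e x)
  | FNot f => ~~ sem N X e f
  | FAnd f g => sem N X e f && sem N X e g
  | FEx f => has (fun x => sem N X (rcons e x) f) (iota 0 N)
  end.

Definition SetF := Case 0 Skip (Push 0 false) (Push 0 false).
(** Marks of registers 4 and 5 are cancelled in pairs, and the verdict is overwritten as soon as one
    side runs out before the other. *)
Definition EqTest :=
  Seq (Push 0 true) (Seq (For 4 (Case 5 SetF Skip Skip)) (For 5 SetF)).
Definition Half := Seq (Loop 4 Skip (Case 4 Skip Skip (Push 6 true))) (Move 6 4).
Definition vr i := 10 + 2 * i.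

Definition Merge :=
  Case 0 Skip Skip (Case 0 Skip (Push 0 true) (Push 0 true)).

Fixpoint compile (b : nat) (f : fm) : cmd :=
  match f with
  | FAdd x y z =>
      Seq (Copy (vr x) 4) (Seq (Copy (vr y) 4) (Seq (Copy (vr z) 5) EqTest))
  | FMul x y z =>
      Seq (Copy (vr x) 5) (Seq (For 5 (Copy (vr y) 4)) (Seq (Copy (vr z) 5) EqTest))
  | FBit x y =>
      Seq (Copy (vr y) 4) (Seq (Copy (vr x) 5) (Seq (For 5 Half)
        (Seq (Push 0 false) (For 4 (Case 0 Skip (Push 0 true) (Push 0 false))))))
  | FIn x =>
      Seq (Copy (vr x) 4) (Seq (For 4 (Case 2 Skip (Push 5 false) (Push 5 true)))
        (Seq (Case 2 (Push 0 false) (Seq (Push 0 false) (Push 2 false))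
                                    (Seq (Push 0 true) (Push 2 true)))
             (Move 5 2)))
  | FNot f => Seq (compile b f) (Case 0 Skip (Push 0 true) (Push 0 false))
  | FAnd f g => Seq (compile b f) (Seq (compile b g)
      (Case 0 Skip SetF Skip))
  | FEx f =>
      Seq (Copy 1 (vr b).+1) (Seq (Push 0 false)
        (Seq (For (vr b).+1 (Seq (compile b.+1 f) (Seq Merge (Push (vr b) true))))
             (For (vr b) Skip)))
  end.

Lemma exec_setF s b v : s 0 = b :: v -> exec SetF s (upd s 0 (false :: v)) 2.
Proof.
move=> E; rewrite /SetF; apply: (exec_cons (B := 1) E).
have -> : (if b then Push 0 false else Push 0 false) = Push 0 false by case: b {E}.
by apply: (exec_eq (exec_push _ _ _)); rewrite upd_same upd_upd.
Qed.

Lemma exec_eqtest s x y : s 4 = nseq x true -> s 5 = nseq y true ->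
  exec EqTest s (upd (upd (upd s 4 [::]) 5 [::]) 0 ((x == y) :: s 0)) (5 * x + 5 * y + 5).
Proof.
move=> E4 E5.
pose s1 := upd (upd (upd s 4 [::]) 5 (nseq (y - x) true)) 0 ((x <= y) :: s 0).
apply: (exec_le (exec_seq (exec_push _ _ _) (exec_seq (s' := s1) (B := (x * 4).+1) (B' := (y * 3).+1) _ _))); last by lia.
  apply: (@exec_for_eq 4 _ (fun k => upd (upd s 0 ((k <= y) :: s 0)) 5 (nseq (y - k) true)) x 3) => //.
  - by rewrite subn0; seq_store.
  - by rewrite /s1; seq_store.
  move=> k kx; case: (ltnP k y) => h.
    apply: (exec_cons (b := true) (v := nseq (y - k.+1) true)); first by rewrite (_ : y - k = (y - k.+1).+1); [reg|lia].
    by apply: exec_le (exec_eq (exec_skip _) _) _ => //; seq_store; congr (_ :: _); lia.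
  apply: exec_nil; first by rewrite (_ : y - k = 0); [reg|lia].
  apply: (exec_eq (@exec_setF _ (k <= y) (s 0) _)); first by reg.
  by seq_store; first [congr (_ :: _); lia|congr nseq; lia].
apply: (exec_le (B := ((y - x) * 3).+1)); last by lia.
apply: (@exec_for_eq 5 _ (fun k => upd (upd s 4 [::]) 0 (((x <= y) && (k == 0)) :: s 0)) (y - x) 2) => //.
- by rewrite andbT /s1; seq_store.
- rewrite (_ : (x <= y) && (y - x == 0) = (x == y)); last by lia.
  by seq_store.
move=> k kx; apply: (exec_eq (@exec_setF _ ((x <= y) && (k == 0)) (s 0) _)); first by reg.
by seq_store; rewrite andbF.
Qed.

Lemma exec_half s x : s 4 = nseq x true -> s 6 = [::] ->
  exec Half s (upd s 4 (nseq x./2 true)) (4 * x + 5).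
Proof.
move=> E4 E6.
have H : forall k h x s, x <= k -> s 4 = nseq x true -> s 6 = nseq h true ->
    exec (Loop 4 Skip (Case 4 Skip Skip (Push 6 true))) s
      (upd (upd s 4 [::]) 6 (nseq (x./2 + h) true)) (2 * x + 3).
  elim=> [|k IH] h [|[|y]] {}s // lt {}E4 {}E6; rewrite /=.
  - by apply: (exec_le (exec_eq (exec_loop_nil E4) _)); [seq_store|lia].
  - by apply: (exec_le (exec_eq (exec_loop_nil E4) _)); [seq_store|lia].
  - apply: (exec_eq (s1 := upd s 4 [::])); last by seq_store.
    have C : exec (Case 4 Skip Skip (Push 6 true)) (upd s 4 [::]) (upd s 4 [::]) 1.
      by apply: exec_nil (exec_skip _); rewrite upd_same.
    exact: (exec_le (exec_loop_cons E4 C (exec_loop_nil (upd_same _ _ _)))).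
  have E4' : upd s 4 (nseq y.+1 true) 4 = true :: nseq y true by rewrite upd_same.
  pose s1 := upd (upd s 4 (nseq y true)) 6 (true :: s 6).
  have H2 : exec (Case 4 Skip Skip (Push 6 true)) (upd s 4 (nseq y.+1 true)) s1 2.
    by apply: (exec_cons E4'); apply: (exec_eq (exec_push _ _ _)); rewrite /s1; seq_store.
  have H3 : y <= k by lia.
  have F4 : s1 4 = nseq y true by rewrite /s1; reg.
  have F6 : s1 6 = nseq h.+1 true by rewrite /s1 E6; reg.
  have H4 := IH h.+1 y s1 H3 F4 F6.
  apply: (exec_le (exec_eq (exec_loop_cons E4 H2 H4) _)); last by lia.
  by seq_store; rewrite ?addnS // /s1; reg.
have H1 := H x 0 x s (leqnn _) E4 E6; rewrite addn0 in H1.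
have H2 := @exec_move 6 4 (upd (upd s 4 [::]) 6 (nseq x./2 true)) (nseq x./2 true) isT (upd_same _ _ _).
apply: (exec_le (exec_seq H1 (exec_eq H2 _))); last by rewrite size_nseq; lia.
by rewrite rev_nseq; seq_store; rewrite cats0.
Qed.

(** A constant factor is paid for by a larger exponent. This needs a base above 1, hence the powers
    of [N + 2] in the time bounds. *)
Lemma pow_absorb c a m k : 1 < m -> c <= 2 ^ a -> c * m ^ k <= m ^ (k + a).
Proof.
move=> m1 h; rewrite expnD mulnC leq_mul // (leq_trans h) //.
by elim: a {h} => // a IH; rewrite !expnS leq_mul.
Qed.

Record good N X (e : seq nat) (s : store) : Prop := Good {
  good1 : s 1 = nseq N true;
  good2 : s 2 = X;
  good_tmp : forall j, 2 < j < 10 -> s j = [::];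
  good_var : forall i, s (vr i) = nseq (nth 0 e i) true;
  good_cnt : forall i, size e <= i -> s (vr i).+1 = [::] }.

Lemma nth_le N e : all (fun x => x < N) e -> forall i, nth 0 e i <= N.
Proof.
move=> /allP H i; case: (ltnP i (size e)) => h; last by rewrite nth_default.
by apply/ltnW/H/mem_nth.
Qed.

Lemma exec_copyE i j s s' x : i != j -> i != 3 -> j != 3 -> s i = nseq x true -> s 3 = [::] ->
  s' = upd s j (nseq x true ++ s j) -> exec (Copy i j) s s' (5 * x + 2).
Proof. by move=> *; subst s'; apply: exec_copy. Qed.

Lemma exec_merge s r a v : s 0 = r :: a :: v -> exec Merge s (upd s 0 ((r || a) :: v)) 3.
Proof.
move=> E; rewrite /Merge; apply: (exec_cons (B := 2) E); case: r E => E.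
  have E2 : upd s 0 (a :: v) 0 = a :: v by rewrite upd_same.
  apply: (exec_cons (B := 1) E2); have -> : (if a then Push 0 true else Push 0 true) = Push 0 true by case: (a).
  by apply: (exec_eq (exec_push _ _ _)); rewrite !upd_upd upd_same.
by apply: exec_le (exec_skip _) _.
Qed.

(** Atoms take time at most cubic in [N], and a quantifier multiplies the time by about [N]; so the
    exponent depends on the formula alone. *)
Lemma compile_sound f : exists k, forall N X e s, good N X e s -> all (fun x => x < N) e ->
  exec (compile (size e) f) s (upd s 0 (sem N X e f :: s 0)) ((N + 2) ^ k).
Proof.
have vn i j : j < 10 -> vr i != j by rewrite /vr; lia.
have v5 i : vr i != 5 by apply: vn.
have v4 i : vr i != 4 by apply: vn.
have v3 i : vr i != 3 by apply: vn.
elim: f => [x y z|x y z|x y|x|f [k IH]|f [k IH] g [k' IH']|f [k IH]].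
- exists 7 => N X e s [g1 g2 gt gv gc] /nth_le L /=.
  have [[Lx Ly] Lz] := (L x, L y, L z); move: (nth 0 e x) (nth 0 e y) (nth 0 e z) (gv x) (gv y) (gv z) Lx Ly Lz => vx vy vz Ex Ey Ez Lx Ly Lz.
  pose s1 := upd s 4 (nseq (vx + vy) true).
  pose s2 := upd s1 5 (nseq vz true).
  apply: (@exec_le _ _ _ ((5 * vx + 2) + ((5 * vy + 2) + ((5 * vz + 2) + (5 * (vx + vy) + 5 * vz + 5))))); last first.
    by have := @pow_absorb 30 5 (N + 2) 2; have : (N + 2) ^ 2 = (N + 2) * (N + 2) by []; nia.
  apply: (exec_seq (s' := upd s 4 (nseq vx true))).
    by apply: exec_copyE => //; rewrite gt // cats0.
  apply: (exec_seq (s' := s1)); first apply: exec_copyE => //; try by rewrite /s1; reg.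
    by rewrite /s1 upd_same upd_upd addnC nseqD.
  apply: (exec_seq (s' := s2)); first apply: exec_copyE => //; try by rewrite /s2 /s1; reg.
    by rewrite /s2 /s1 [X in _ ++ X](_ : _ = [::]) ?cats0 //; reg.
  apply: (exec_eq (exec_eqtest (x := vx + vy) (y := vz) _ _)); try by rewrite /s2 /s1; reg.
  by rewrite /s2 /s1; seq_store; rewrite gt.
- exists 9 => N X e s [g1 g2 gt gv gc] /nth_le L /=.
  have [[Lx Ly] Lz] := (L x, L y, L z); move: (nth 0 e x) (nth 0 e y) (nth 0 e z) (gv x) (gv y) (gv z) Lx Ly Lz => vx vy vz Ex Ey Ez Lx Ly Lz.
  pose s1 := upd s 4 (nseq (vx * vy) true).
  pose s2 := upd s1 5 (nseq vz true).
  apply: (@exec_le _ _ _ ((5 * vx + 2) + ((vx * (5 * vy + 2).+1).+1 + ((5 * vz + 2) + (5 * (vx * vy) + 5 * vz + 5))))); last first.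
    have := @pow_absorb 50 6 (N + 2) 3; rewrite (_ : (N + 2) ^ 3 = (N + 2) * ((N + 2) * (N + 2))) //.
    by have := leq_mul Lx Ly; nia.
  apply: (exec_seq (s' := upd s 5 (nseq vx true))).
    by apply: exec_copyE => //; rewrite gt // cats0.
  apply: (exec_seq (s' := s1)).
    apply: (@exec_for_eq 5 _ (fun k => upd s 4 (nseq (k * vy) true)) vx (5 * vy + 2)).
    - by seq_store; rewrite gt.
    - by rewrite /s1; seq_store; rewrite gt.
    move=> k kx; apply: exec_copyE => //; try by reg.
    by rewrite mulSn nseqD; seq_store.
  apply: (exec_seq (s' := s2)); first apply: exec_copyE => //; try by rewrite /s2 /s1; reg.
    by rewrite /s2 /s1 [X in _ ++ X](_ : _ = [::]) ?cats0 //; reg.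
  apply: (exec_eq (exec_eqtest (x := vx * vy) (y := vz) _ _)); try by rewrite /s2 /s1; reg.
  by rewrite /s2 /s1; seq_store; rewrite gt.
- exists 9 => N X e s [g1 g2 gt gv gc] /nth_le L /=.
  have [Lx Ly] := (L x, L y); move: (nth 0 e x) (nth 0 e y) (gv x) (gv y) Lx Ly => vx vy Ex Ey Lx Ly.
  have Ld k : vy %/ 2 ^ k <= vy by apply: leq_div.
  pose s1 := upd s 4 (nseq (vy %/ 2 ^ vx) true).
  apply: (@exec_le _ _ _ ((5 * vy + 2) + ((5 * vx + 2) + ((vx * (4 * vy + 5).+1).+1 + (1 + ((vy %/ 2 ^ vx) * 3).+1))))); last first.
    have := @pow_absorb 50 6 (N + 2) 3; rewrite (_ : (N + 2) ^ 3 = (N + 2) * ((N + 2) * (N + 2))) //.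
    by have := leq_mul Lx Ly; have := Ld vx; nia.
  apply: (exec_seq (s' := upd s 4 (nseq vy true))).
    by apply: exec_copyE => //; rewrite gt // cats0.
  apply: (exec_seq (s' := upd (upd s 4 (nseq vy true)) 5 (nseq vx true))).
    apply: exec_copyE => //; try by reg.
    by rewrite [X in _ ++ X](_ : _ = [::]) ?cats0 //; reg.
  apply: (exec_seq (s' := s1)).
    apply: (@exec_for_eq 5 _ (fun k => upd s 4 (nseq (vy %/ 2 ^ k) true)) vx (4 * vy + 5)).
    - by rewrite divn1.
    - by rewrite /s1; seq_store; rewrite gt.
    move=> k kx; apply: (exec_le (exec_eq (exec_half (x := vy %/ 2 ^ k) _ _) _)); try by reg.
      by rewrite -divn2 -divnMA -expnSr; seq_store.
    by have := Ld k; lia.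
  apply: (exec_seq (exec_push _ _ _)).
  apply: (@exec_for_eq 4 _ (fun k => upd s 0 (odd k :: s 0)) (vy %/ 2 ^ vx) 2).
  - by rewrite /s1; seq_store.
  - by rewrite /s1 -/(bit vx vy); seq_store; rewrite gt.
  move=> k kx; apply: (exec_cons (B := 1) (b := odd k) (v := s 0)); first by reg.
  rewrite (_ : (if odd k then _ else _) = Push 0 (~~ odd k)); last by case: odd.
  by apply: (exec_eq (exec_push _ _ _)); seq_store.
- exists 7 => N X e s [g1 g2 gt gv gc] /nth_le L /=.
  have Lx := L x; move: (nth 0 e x) (gv x) Lx => vx Ex Lx.
  pose s1 := upd (upd s 2 (drop vx X)) 5 (rev (take vx X)).
  pose s2 := upd s1 0 (nth false X vx :: s 0).
  apply: (@exec_le _ _ _ ((5 * vx + 2) + ((vx * 3).+1 + (4 + (2 * vx).+1)))); last first.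
    by have := @pow_absorb 30 5 (N + 2) 2; have : (N + 2) ^ 2 = (N + 2) * (N + 2) by []; nia.
  apply: (exec_seq (s' := upd s 4 (nseq vx true))).
    by apply: exec_copyE => //; rewrite gt // cats0.
  apply: (exec_seq (s' := s1)).
    apply: (@exec_for_eq 4 _ (fun k => upd (upd s 2 (drop k X)) 5 (rev (take k X))) vx 2).
    - by rewrite drop0 take0 -[X in upd s 2 X]g2 (upd_id (erefl _)) (upd_id (v := [::])) // gt.
    - by rewrite /s1; seq_store; rewrite gt.
    move=> k kx; case E : (drop k X) => [|b l].
      have h : size X <= k by move/(congr1 size): E; rewrite size_drop /=; lia.
      apply: exec_nil; first by reg.
      apply: exec_le (exec_eq (exec_skip _) _) _ => //.
      by rewrite !take_oversize ?drop_oversize //; lia.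
    apply: (exec_cons (B := 1) (b := b) (v := l)); first by reg.
    rewrite (_ : (if b then _ else _) = Push 5 b); last by case: (b).
    have h : k < size X by move/(congr1 size): E; rewrite size_drop /=; lia.
    have [Eb El] : nth false X k = b /\ drop k.+1 X = l by move: E; rewrite (drop_nth false h) => -[].
    apply: (exec_eq (exec_push _ _ _)); rewrite (take_nth false h) rev_rcons Eb El.
    by seq_store.
  have C : exec (Case 2 (Push 0 false) (Seq (Push 0 false) (Push 2 false)) (Seq (Push 0 true) (Push 2 true))) s1 s2 4.
    case E : (drop vx X) => [|b l].
      have h : size X <= vx by move/(congr1 size): E; rewrite size_drop /=; lia.
      have E1 : s1 2 = [::] by rewrite /s1; reg.
      apply: (exec_le (exec_eq (exec_nil E1 (exec_push _ _ _)) _)) => //.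
      by rewrite /s2 nth_default // /s1; seq_store.
    have h : vx < size X by move/(congr1 size): E; rewrite size_drop /=; lia.
    have [Eb El] : nth false X vx = b /\ drop vx.+1 X = l by move: E; rewrite (drop_nth false h) => -[].
    apply: (exec_cons (B := 3) (b := b) (v := l)); first by rewrite /s1; reg.
    rewrite (_ : (if b then _ else _) = Seq (Push 0 b) (Push 2 b)); last by case: (b).
    apply: (exec_le (exec_eq (exec_seq (exec_push _ _ _) (exec_push _ _ _)) _)) => //.
    by rewrite /s2 /s1 Eb E; seq_store.
  apply: (exec_seq C).
  have := @exec_move 5 2 s2 (rev (take vx X)) isT; rewrite size_rev => H.
  apply: (exec_le (exec_eq (H _) _)); first by rewrite /s2 /s1; reg.
    by rewrite revK /s2 /s1; seq_store; rewrite ?cat_take_drop ?g2 // gt.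
  by rewrite ltnS leq_mul2l size_take_min geq_minl.
- exists (k + 2) => N X e s G A /=; have := IH _ _ _ _ G A.
  have P : 0 < (N + 2) ^ k by rewrite expn_gt0 addn2.
  move=> H; apply: (exec_le (exec_seq H (exec_cons (B := 1) (upd_same _ _ _) _))); last first.
    by have := @pow_absorb 4 2 (N + 2) k; rewrite addn2 => /(_ isT isT); lia.
  rewrite (_ : (if _ then _ else _) = Push 0 (~~ sem N X e f)); last by case: sem.
  by apply: (exec_eq (exec_push _ _ _)); rewrite upd_same !upd_upd.
- exists (maxn k k' + 3) => N X e s G A /=; have := IH _ _ _ _ G A; set s1 := upd s 0 _ => H.
  have G1 : good N X e s1.
    case: G => g1 g2 gt gv gc; rewrite /s1; split=> //.
    by move=> j hj; rewrite upd_neq ?gt //; lia.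
  have H2 := IH' _ _ _ _ G1 A.
  apply: (exec_le (exec_seq H (exec_seq H2 (exec_cons (B := 2) (upd_same _ _ _) _)))).
    have E : s1 0 = sem N X e f :: s 0 by rewrite /s1 upd_same.
    rewrite !upd_upd E; case: (sem N X e g); rewrite ?andbT ?andbF.
      by apply: exec_le (exec_eq (exec_skip _) _) _ => //; rewrite /s1 upd_upd.
    apply: (exec_eq (exec_setF (upd_same _ _ _))); rewrite /s1 !upd_upd //.
  have P1 : (N + 2) ^ k <= (N + 2) ^ maxn k k' by rewrite leq_pexp2l ?addn2 // leq_maxl.
  have P2 : (N + 2) ^ k' <= (N + 2) ^ maxn k k' by rewrite leq_pexp2l ?addn2 // leq_maxr.
  have P : 0 < (N + 2) ^ k by rewrite expn_gt0 addn2.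
  apply: leq_trans (pow_absorb (c := 5) _ _ _) => //; last by rewrite addn2.
  by lia.
- exists (k + 6) => N X e s G A; rewrite [compile _ _]/= -/compile; set b := size e.
  have [g1 g2 gt gv gc] := G.
  pose acc j := has (fun x => sem N X (rcons e x) f) (iota 0 j).
  pose S j := upd (upd s 0 (acc j :: s 0)) (vr b) (nseq j true).
  have cv : (vr b).+1 != vr b by lia.
  apply: (@exec_le _ _ _ ((5 * N + 2) + (1 + ((N * ((N + 2) ^ k + (3 + 1)).+1).+1 + (N * 1).+1)))); last first.
    have P : 0 < (N + 2) ^ k by rewrite expn_gt0 addn2.
    have m1 : 1 < N + 2 by rewrite addn2.
    have := @pow_absorb 32 5 (N + 2) k.+1 m1 isT; rewrite addSnnS; apply: leq_trans.
    by rewrite expnS; move: ((N + 2) ^ k) P => p P; nia.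
  apply: (exec_seq (s' := upd s (vr b).+1 (nseq N true))).
    by apply: exec_copyE => //; rewrite ?gc ?cats0 ?gt // /vr; lia.
  apply: (exec_seq (exec_push _ _ _)).
  apply: (exec_seq (s' := upd (S N) (vr b).+1 [::])).
    apply: (@exec_for_eq _ _ S N) => //.
      rewrite /S /acc /= (upd_id (s := upd s 0 _)); first by rewrite updC // upd_neq //.
      by rewrite upd_neq ?gv ?nth_default // /vr; lia.
    move=> j jN; set s1 := upd _ _ _.
    have G1 : good N X (rcons e j) s1.
      split.
      - by rewrite /s1 /S /vr; reg.
      - by rewrite /s1 /S /vr; reg.
      - by move=> i hi; rewrite /s1 /S /vr; reg.
      - move=> i; rewrite /s1 /S /vr nth_rcons -/b.
        case: (ltngtP i b) => h; rewrite /upd; repeat (case: eqP => ?); try lia; rewrite -?/(vr i) ?gv //.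
        by rewrite nth_default // ltnW.
      - move=> i; rewrite size_rcons -/b => hi; rewrite /s1 /S /upd; repeat (case: eqP; rewrite /vr => ?); try lia.
        by apply: gc; apply: ltnW.
    have H := IH _ _ _ _ G1; rewrite size_rcons -/b all_rcons jN A in H.
    apply: (exec_seq (H isT)); apply: (exec_seq (s' := upd s1 0 (acc j.+1 :: s 0))).
      have E : upd s1 0 (sem N X (rcons e j) f :: s1 0) 0 = sem N X (rcons e j) f :: acc j :: s 0.
        by rewrite upd_same /s1 /S /vr; congr (_ :: _); reg.
      apply: (exec_eq (exec_merge E)); rewrite upd_upd /acc -[j.+1]addn1 iotaD has_cat /= orbF.
      by rewrite orbC.
    apply: (exec_eq (exec_push _ _ _)); rewrite /s1 /S; seq_store; rewrite /upd /vr in cv *; repeat case: eqP; lia.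
  apply: (@exec_for_eq _ _ (fun _ => upd s 0 (acc N :: s 0)) N 0).
  - rewrite /S (upd_id (v := [::])) // /vr; reg; apply: gc; rewrite /b //.
  - rewrite (upd_id (v := [::])) // upd_neq ?gv ?nth_default // /vr; lia.
  by move=> j _; apply: exec_skip.
Qed.

(** * Reading the input and computing the range of the quantifiers *)

Definition num (w : seq bool) : nat := foldr (fun (b : bool) x => b + 2 * x) 0 w.

Lemma num_lt w : num w < 2 ^ size w.
Proof. by elim: w => //= b w IH; rewrite expnS; case: b; lia. Qed.

Definition Dbl i := Seq (For i (Seq (Push 3 true) (Push 3 true))) (Move 3 i).

Lemma exec_dbl i s x : i != 3 -> s i = nseq x true -> s 3 = [::] ->
  exec (Dbl i) s (upd s i (nseq (2 * x) true)) (7 * x + 2).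
Proof.
move=> ne E E3; have ne' : 3 != i by rewrite eq_sym.
pose s1 := upd (upd s 3 (nseq (2 * x) true)) i [::].
apply: (exec_le (exec_seq (s' := s1) (B := (x * 3).+1) (B' := (2 * (2 * x)).+1) _ _)); last by lia.
  apply: (@exec_for_eq i _ (fun k => upd s 3 (nseq (2 * k) true)) x 2) => //.
    by rewrite muln0 (upd_id E3) upd_id.
  move=> k kx; apply: (exec_seq (B := 1) (B' := 1) (exec_push _ _ _)).
  apply: (exec_eq (exec_push _ _ _)); rewrite mulnS.
  by seq_store; rewrite /upd; do ?case: eqP => //=; try lia.
have E3' : s1 3 = nseq (2 * x) true by rewrite /s1; reg.
have := @exec_move 3 i s1 _ ne' E3'; rewrite size_nseq => H.
by apply: (exec_eq H); rewrite /s1 upd_same cats0 rev_nseq; seq_store.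
Qed.

Lemma exec_clear i s v : s i = v -> exec (Loop i Skip Skip) s (upd s i [::]) (size v).+1.
Proof.
elim: v s => [|b v IH] s E; first by rewrite (upd_id E); apply: exec_loop_nil.
have H : exec (if b then Skip else Skip) (upd s i v) (upd s i v) 0 by case: (b); apply: exec_skip.
apply: (exec_le (exec_eq (exec_loop_cons E H (IH _ (upd_same _ _ _))) _)) => //.
by rewrite upd_upd.
Qed.

Lemma exec_pow i j s d : i != j -> i != 3 -> j != 3 -> s i = nseq d true -> s j = [::] ->
  s 3 = [::] ->
  exec (Seq (Push j true) (For i (Dbl j))) s (upd (upd s i [::]) j (nseq (2 ^ d) true))
    (1 + (d * (7 * 2 ^ d + 3)).+1).
Proof.
move=> n1 n2 n3 Ei Ej E3; apply: (exec_seq (exec_push _ _ _)).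
apply: (exec_le (@exec_for_eq i _ (fun k => upd s j (nseq (2 ^ k) true)) d (7 * 2 ^ d + 2) _ _ _ _ _)).
- by seq_store; rewrite Ej.
- by seq_store.
- move=> k kd.
  have L : 2 ^ k <= 2 ^ d by rewrite leq_exp2l // ltnW.
  apply: (exec_le (exec_eq (exec_dbl (x := 2 ^ k) n3 _ _) _)).
  + by rewrite upd_neq ?upd_same // eq_sym.
  + by rewrite !upd_neq // eq_sym.
  + by rewrite -expnS; seq_store.
  + by lia.
by lia.
Qed.

(** The last letter of the input is on top of stack 0 and is the most significant digit of [num], so
    doubling [vr 1] before each letter is Horner's rule. [vr 0] counts the letters. *)
Definition Input :=
  Loop 0 (Seq (Dbl (vr 1)) (Push (vr 0) true))
         (Seq (Dbl (vr 1)) (Seq (Push (vr 1) true) (Push (vr 0) true))).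

Lemma exec_input u v s : s 0 = rev u -> s 3 = [::] -> s (vr 0) = nseq (size v) true ->
  s (vr 1) = nseq (num v) true ->
  exec Input s (upd (upd (upd s 0 [::]) (vr 0) (nseq (size (u ++ v)) true))
                    (vr 1) (nseq (num (u ++ v)) true))
    (size u * (7 * 2 ^ size (u ++ v) + 5)).+1.
Proof.
elim/last_ind: u v s => [|u b IH] v s E0 E3 En EW.
  by rewrite mul0n /= (@upd_id s 0 [::]) // (upd_id En) (upd_id EW); apply: exec_loop_nil.
rewrite rev_rcons in E0; rewrite cat_rcons size_rcons.
pose s1 := upd (upd (upd s 0 (rev u)) (vr 1) (nseq (num (b :: v)) true)) (vr 0) (nseq (size (b :: v)) true).
have L : 2 ^ size v <= 2 ^ size (u ++ b :: v) by rewrite leq_exp2l // size_cat /=; lia.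
have H : exec (if b then Seq (Dbl (vr 1)) (Seq (Push (vr 1) true) (Push (vr 0) true))
               else Seq (Dbl (vr 1)) (Push (vr 0) true)) (upd s 0 (rev u)) s1
              (7 * 2 ^ size v + 4).
  have F3 : upd s 0 (rev u) 3 = [::] by reg.
  have FW : upd s 0 (rev u) (vr 1) = nseq (num v) true by reg.
  have := @exec_dbl (vr 1) _ _ isT FW F3; have := num_lt v.
  rewrite {}/s1; case: (b) => lt H /=.
    apply: (exec_le (exec_seq H (exec_seq (exec_push _ _ _) (exec_eq (exec_push _ _ _) _)))).
      by seq_store; rewrite /upd /= En.
    by lia.
  apply: (exec_le (exec_seq H (exec_eq (exec_push _ _ _) _))).
    by seq_store; rewrite /upd /= En.
  by lia.
have H2 := IH (b :: v) s1 _ _ _ _; rewrite /Input in H2 *.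
apply: (exec_le (exec_loop_cons E0 H (exec_eq (H2 _ _ _ _) _))); try by rewrite /s1; reg.
  by rewrite /s1; seq_store.
Qed.

Fixpoint Pushes k i := if k is k.+1 then Seq (Push i true) (Pushes k i) else Skip.

Lemma exec_pushes k i s : exec (Pushes k i) s (upd s i (nseq k true ++ s i)) k.
Proof.
elim: k s => [|k IH] s; first by rewrite upd_id //; apply: exec_skip.
by apply: (exec_eq (exec_seq (exec_push _ _ _) (IH _))); rewrite upd_same upd_upd nseq_cons.
Qed.

Definition Universe :=
  Seq (Copy (vr 0) 5) (Seq (For 5 (Pushes 8 4)) (Seq (Pushes 8 4)
    (Seq (Seq (Push 6 true) (For 4 (Dbl 6))) (Seq (Push 1 true) (For 6 (Dbl 1)))))).

(** With [M = 2 ^ (2 * n)] types, the largest codes used are those of ternary relations below [M],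
    less than [2 ^ (M ^ 3) = 2 ^ (2 ^ (6 * n))], and those of pairs [V * M + s], less than
    [2 ^ M * M]. Both fit with room to spare. *)
Definition usize n := 2 ^ (2 ^ (8 * n + 8)).

Lemma exec_universe s n : s (vr 0) = nseq n true -> (forall j, j < 10 -> s j = [::]) ->
  exec Universe s (upd s 1 (nseq (usize n) true)) (30 * usize n * usize n).
Proof.
move=> En E0; rewrite /usize; set d := 8 * n + 8; set D := 2 ^ d; set N := 2 ^ D.
have dD : d < D by apply: ltn_expl.
have DN : D < N by apply: ltn_expl.
apply: (@exec_le _ _ _ ((5 * n + 2) + ((n * 9).+1 + (8 + ((1 + (d * (7 * D + 3)).+1) + (1 + (D * (7 * N + 3)).+1)))))).
  apply: (exec_seq (s' := upd s 5 (nseq n true))).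
    by apply: exec_copyE => //; rewrite !E0 // cats0.
  apply: (exec_seq (s' := upd s 4 (nseq (8 * n) true))).
    apply: (@exec_for_eq 5 _ (fun k => upd s 4 (nseq (8 * k) true)) n 8).
    - by seq_store; rewrite E0.
    - by seq_store; rewrite E0.
    move=> k kn; apply: (exec_eq (exec_pushes _ _ _)); rewrite mulnS nseqD; seq_store.
  apply: (exec_seq (s' := upd s 4 (nseq d true))).
    by apply: (exec_eq (exec_pushes _ _ _)); rewrite /d addnC nseqD; seq_store.
  apply: (exec_seq (s' := upd s 6 (nseq D true))).
    apply: (exec_eq (@exec_pow 4 6 _ d isT isT isT _ _ _)); try by rewrite /upd /= ?E0.
    by seq_store; rewrite E0.
  apply: (exec_eq (@exec_pow 6 1 _ D isT isT isT _ _ _)); try by rewrite /upd /= ?E0.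
  by seq_store; rewrite E0.
have nd : 8 * n + 8 = d by [].
have M1 : d * D <= N * N by apply: leq_mul; lia.
have M2 : D * N <= N * N by rewrite leq_mul // ltnW.
have M3 : N <= N * N by rewrite leq_pmulr; lia.
by nia.
Qed.

(** * Iteration of a definable operator *)

Definition tstage phi N n W X := [seq sem N X [:: n; W; v] phi | v <- iota 0 N].

(* Registers 11 and 13 are free: they hold the number of remaining stages and
   the table under construction. *)
Definition Stage phi :=
  Seq (Copy 1 15) (Seq (For 15 (Seq (compile 3 phi)
        (Seq (Case 0 Skip (Push 13 false) (Push 13 true)) (Push 14 true))))
    (Seq (For 14 Skip) (Seq (Loop 2 Skip Skip) (Move 13 2)))).

(** The bound [N] is copied to the stage counter, since a growing sequence of subsets of an
    [N]-element set needs at most [N] stages. The final loops clear every register but 0, so that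
    the output is the verdict alone. *)
Definition Main phi psi :=
  Seq Input (Seq Universe (Seq (Copy 1 11) (Seq (For 11 (Stage phi)) (Seq (compile 2 psi)
    (Seq (Loop 1 Skip Skip) (Seq (Loop 2 Skip Skip)
      (Seq (Loop 10 Skip Skip) (Loop 12 Skip Skip)))))))).

Definition wstate N n W X c : store :=
  fun i => if i == 1 then nseq N true else if i == 2 then X
    else if i == vr 0 then nseq n true else if i == vr 1 then nseq W true
    else if i == 11 then nseq c true else [::].

Lemma good_wstate N n W X c : good N X [:: n; W] (wstate N n W X c).
Proof.
split=> //.
- by move=> j hj; rewrite /wstate /vr; repeat (case: eqP => ?); try lia.
- by move=> [|[|i]] //; rewrite /wstate /vr /= nth_nil; repeat (case: eqP => ?); try lia.
- by move=> i /=; rewrite /wstate /vr; repeat (case: eqP => ?); try lia.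
Qed.

Lemma stage_sound phi : exists k, forall N n W X c, n < N -> W < N -> size X <= N ->
  exec (Stage phi) (wstate N n W X c) (wstate N n W (tstage phi N n W X) c) ((N + 2) ^ k).
Proof.
have [k H] := compile_sound phi; exists (k + 6) => N n W X c nN WN XN.
pose s := wstate N n W X c; pose T j := [seq sem N X [:: n; W; v] phi | v <- iota 0 j].
pose S j := upd (upd s 13 (rev (T j))) 14 (nseq j true).
apply: (@exec_le _ _ _ ((5 * N + 2) + ((N * ((N + 2) ^ k + (2 + 1)).+1).+1 + ((N * 1).+1 + ((size X).+1 + (2 * N).+1))))); last first.
  have P : 0 < (N + 2) ^ k by rewrite expn_gt0 addn2.
  have m1 : 1 < N + 2 by rewrite addn2.
  have := @pow_absorb 32 5 (N + 2) k.+1 m1 isT; rewrite addSnnS; apply: leq_trans.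
  by rewrite expnS; move: ((N + 2) ^ k) P => p P; nia.
apply: (exec_seq (s' := upd s 15 (nseq N true))).
  by apply: exec_copyE => //; rewrite cats0.
apply: (exec_seq (s' := upd (S N) 15 [::])).
  apply: (@exec_for_eq 15 _ S) => //; first by rewrite /S /s; seq_store.
  move=> j jN; set s1 := upd _ _ _.
  have G1 : good N X [:: n; W; j] s1.
    split=> //.
    - by move=> i hi; rewrite /s1 /S /s /wstate /vr; reg.
    - by move=> [|[|[|i]]] //; rewrite /s1 /S /s /wstate /vr /= nth_nil; reg.
    - by move=> i hi; rewrite /s1 /S /s /wstate /vr /= in hi *; reg.
  have := H _ _ _ _ G1; rewrite /= nN WN jN => /(_ isT) {}H.
  apply: (exec_seq H); set r := sem _ _ _ _.
  apply: (exec_seq (s' := upd s1 13 (r :: rev (T j)))).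
    apply: (exec_cons (B := 1) (upd_same _ _ _)).
    rewrite (_ : (if r then _ else _) = Push 13 r); last by case: r.
    by apply: (exec_eq (exec_push _ _ _)); rewrite /s1 /S /s /wstate; seq_store.
  apply: (exec_eq (exec_push _ _ _)).
  have TS : rev (T j.+1) = r :: rev (T j).
    by rewrite /T -[j.+1]addn1 iotaD map_cat cats1 rev_rcons.
  by rewrite /s1 /S TS; seq_store.
apply: (exec_seq (s' := upd s 13 (rev (T N)))).
  apply: (@exec_for_eq 14 _ (fun _ => upd s 13 (rev (T N))) N 0).
  - by rewrite /S /s /wstate; seq_store.
  - by rewrite /S /s /wstate; seq_store.
  by move=> *; apply: exec_skip.
apply: (exec_seq (s' := upd (upd s 13 (rev (T N))) 2 [::])).
  exact: exec_clear.
have := @exec_move 13 2 (upd (upd s 13 (rev (T N))) 2 [::]) _ isT (erefl _).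
rewrite [size _](_ : _ = N); last by rewrite /upd /= size_rev size_map size_iota.
move=> M; apply: (exec_eq M); rewrite upd_same cats0 revK /s /wstate /vr; seq_store.
Qed.

Lemma main_sound phi psi : exists k, forall w, let n := size w in let N := usize n in
  exec (Main phi psi) (reg0 (rev w))
    (reg0 [:: sem N (iter N (tstage phi N n (num w)) [::]) [:: n; num w] psi]) ((N + 2) ^ k).
Proof.
have [k1 H1] := stage_sound phi; have [k2 H2] := compile_sound psi.
exists (maxn k1 k2 + 12) => w n N.
set W := num w; pose X j := iter j (tstage phi N n W) [::].
have dN : 8 * n + 8 < N.
  by apply: leq_trans (ltn_expl _ _) (leq_trans (ltnW (ltn_expl _ _)) (leqnn _)).
have W2 : 2 ^ n < N by rewrite /N /usize ltn_exp2l // (leq_trans _ (ltnW (ltn_expl _ _))) //; lia.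
have WN : W < N by apply: ltn_trans W2; apply: num_lt.
have nN : n < N by lia.
have XN j : size (X j) <= N by case: j => //= j; rewrite /tstage size_map size_iota.
apply: (@exec_le _ _ _ ((n * (7 * 2 ^ n + 5)).+1 + (30 * N * N + ((5 * N + 2) + ((N * ((N + 2) ^ k1).+1).+1 +
  ((N + 2) ^ k2 + (N.+1 + ((size (X N)).+1 + (n.+1 + W.+1))))))))).
- apply: (exec_seq (s' := upd (upd (reg0 [::]) (vr 0) (nseq n true)) (vr 1) (nseq W true))).
    have := @exec_input w [::] (reg0 (rev w)) (erefl _) (erefl _) (erefl _) (erefl _).
    rewrite cats0 => H; apply: (exec_eq H); rewrite /reg0; seq_store.
  apply: (exec_seq (s' := wstate N n W [::] 0)).
    apply: (exec_eq (@exec_universe _ n _ _)) => //.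
      by move=> j hj; rewrite /reg0 /vr; reg; case: eqP.
    by rewrite /wstate /vr /reg0; seq_store; case: eqP.
  apply: (exec_seq (s' := wstate N n W [::] N)).
    by apply: exec_copyE => //; rewrite /wstate /vr; seq_store; rewrite /= cats0.
  apply: (exec_seq (s' := wstate N n W (X N) 0)).
    apply: (@exec_for_eq 11 _ (fun j => wstate N n W (X j) 0)).
    - by rewrite /wstate /vr; seq_store.
    - by rewrite /wstate /vr; seq_store.
    move=> j jN.
    have E Y c : upd (wstate N n W Y 0) 11 (nseq c true) = wstate N n W Y c.
      by rewrite /wstate /vr; seq_store.
    by rewrite !E; apply: H1.
  have := H2 _ _ _ _ (good_wstate N n W (X N) 0); rewrite /= nN WN => /(_ isT) H.
  apply: (exec_seq H); set r := sem _ _ _ _; set s1 := upd _ _ _.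
  have E1 : s1 1 = nseq N true by [].
  apply: (exec_seq (s' := upd s1 1 [::])); first by apply: (exec_le (exec_clear E1)); rewrite size_nseq.
  apply: (exec_seq (s' := upd (upd s1 1 [::]) 2 [::])); first exact: exec_clear.
  apply: (exec_seq (s' := upd (upd (upd s1 1 [::]) 2 [::]) 10 [::])).
    by apply: (exec_le (exec_clear (erefl _))); rewrite /upd /s1 /= size_nseq.
  apply: (exec_le (exec_eq (exec_clear (erefl _)) _)); last by rewrite /upd /s1 /= size_nseq.
  by rewrite /s1 /wstate /reg0 /vr; seq_store.
- have m1 : 1 < N + 2 by rewrite addn2.
  set p := (N + 2) ^ maxn k1 k2.
  have P1 : (N + 2) ^ k1 <= p by rewrite leq_pexp2l ?addn2 // leq_maxl.
  have P2 : (N + 2) ^ k2 <= p by rewrite leq_pexp2l ?addn2 // leq_maxr.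
  have P : 0 < p by rewrite expn_gt0 addn2.
  have := @pow_absorb 1000 10 (N + 2) ((maxn k1 k2).+2) m1 isT.
  rewrite (_ : (maxn k1 k2).+2 + 10 = maxn k1 k2 + 12); last by lia.
  apply: leq_trans; rewrite !expnS -/p.
  have M1 : n * 2 ^ n <= N * N by apply: leq_mul; apply: ltnW.
  have M2 : N * (N + 2) ^ k1 <= N * p by rewrite leq_mul2l P1 orbT.
  have M3 : (N + 2) * (N + 2) <= (N + 2) * ((N + 2) * p) by rewrite leq_mul2l leq_pmulr ?orbT.
  have M4 : N * p <= (N + 2) * ((N + 2) * p) by rewrite leq_mul ?leq_pmull; lia.
  have M5 : p <= (N + 2) * ((N + 2) * p) by rewrite mulnA leq_pmull //; lia.
  have := XN N; move: ((N + 2) ^ k1) ((N + 2) ^ k2) P1 P2 M2 M3 M4 M5 => a b.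
  by move: ((N + 2) * ((N + 2) * p)) => q; nia.
Qed.

(** The additive constant covers [n <= 1], where powers do not grow; the power covers all other
    [n]. *)
Lemma poly_bound n C : 8 * n + 8 + C <= n ^ (C + 100) + (C + 100).
Proof.
case: n => [|[|n]]; rewrite ?exp0n ?exp1n //; try lia.
have : 2 ^ 5 * n.+2 <= n.+2 ^ (C + 100).
  have -> : C + 100 = (C + 94 + 5).+1 by lia.
  rewrite [n.+2 ^ _]expnSr leq_mul2r expnD; apply/orP; right.
  apply: leq_trans (leq_pmull _ _); last by rewrite expn_gt0.
  by rewrite leq_exp2r.
by rewrite -[2 ^ 5]/32; lia.
Qed.

(** The running time is polynomial in [N], and [N ^ C] equals [2 ^ (C * 2 ^ (8 * n + 8))], which is
    at most [2 ^ (2 ^ (8 * n + 8 + C))]: a constant exponent of [N] only shifts the upper exponent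
    by a constant. *)
Lemma fo_2exptime (L : seq bool -> Prop) phi psi :
  (forall w, let n := size w in let N := usize n in
     L w <-> sem N (iter N (tstage phi N n (num w)) [::]) [:: n; num w] psi) ->
  in_2exptime L.
Proof.
move=> HL; have [k H] := main_sound phi psi.
pose C := 2 * (2 * k + 10); exists (tm_of (Main phi psi)), (C + 100) => w.
have [t ht r] := H w; set n := size w in ht r; set N := usize n in ht r.
have [T [cf [rr [h1 h2 h3 h4]]]] := @tm_of_sound _ _ [:: _] _ r.
exists T, cf; split=> //; last by rewrite h4 HL.
apply: leq_trans h1 _; rewrite -/n.
have N4 : 2 + 2 <= N.
  by rewrite /N /usize (@leq_pexp2l 2 2) // (leq_trans _ (ltnW (ltn_expl _ _))) //; lia.
have nN : n < N.
  by apply: leq_trans (ltn_expl n (isT : 1 < 2)) _; rewrite leq_exp2l // (leq_trans _ (ltnW (ltn_expl _ _))) //; lia.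
have B1 : (t + 1) * (2 * (n + 1 + t) + 8) <= (N + 2) ^ (2 * k + 10).
  have m1 : 1 < N + 2 by rewrite addn2.
  have P : 0 < (N + 2) ^ k by rewrite expn_gt0 addn2.
  have := @pow_absorb 100 7 (N + 2) (2 * k).+1 m1 isT => h.
  apply: leq_trans (leq_trans h _); last by rewrite leq_pexp2l ?addn2 //; lia.
  have E2 : (N + 2) ^ (2 * k).+1 = (N + 2) * ((N + 2) ^ k * (N + 2) ^ k).
    by rewrite expnS mul2n -addnn expnD.
  rewrite E2; move: ((N + 2) ^ k) ht P => p ht P.
  apply: (@leq_trans ((p + 1) * (2 * (n + 1 + p) + 8))); first by apply: leq_mul; lia.
  apply: (@leq_trans ((2 * p) * (12 * ((N + 2) * p)))); last first.
    have -> : (2 * p) * (12 * ((N + 2) * p)) = 24 * ((N + 2) * (p * p)).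
      by rewrite mulnACA [p * (_ * p)]mulnCA.
    by rewrite leq_mul2r orbT.
  have Q1 : N + 2 <= (N + 2) * p by rewrite leq_pmulr.
  have Q2 : p <= (N + 2) * p by rewrite leq_pmull // addn2.
  by apply: leq_mul; lia.
apply: leq_trans B1 _.
have NN : N + 2 <= N ^ 2 by rewrite -mulnn; nia.
apply: (@leq_trans ((N ^ 2) ^ (2 * k + 10))); first by rewrite leq_exp2r //; lia.
rewrite -expnM -/C /N /usize -expnM leq_exp2l //.
apply: (@leq_trans (2 ^ (8 * n + 8) * 2 ^ C)); first by rewrite leq_mul2l ltnW ?orbT // ltn_expl.
by rewrite -expnD leq_exp2l //; apply: poly_bound.
Qed.

(** * Definability of the syntax and of types *)

(** Contexts as nested pairs allow a property to be written as an ordinary proposition about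
    projections of [g], from which unification reads off the formula. *)
Fixpoint ctx (b : nat) : Type := if b is b.+1 then (ctx b * nat)%type else unit.

Fixpoint env (b : nat) : ctx b -> seq nat :=
  match b with
  | 0 => fun _ => [::]
  | b.+1 => fun g => rcons (env g.1) g.2
  end.

(** One formula serves for all [N] and [X]. The side conditions keep all values within the range of
    the quantifiers; the lemmas on terms rely on them. *)
Definition Dfn b (P : nat -> seq bool -> ctx b -> Prop) :=
  exists f, forall N X g, size X <= N -> all (fun x => x < N) (env g) ->
    (sem N X (env g) f <-> P N X g).

Definition isvar b (v : ctx b -> nat) :=
  exists2 i, i < b & forall g, nth 0 (env g) i = v g.

Inductive proj b : forall c, (ctx c -> ctx b) -> Prop :=
| proj_id : proj (fun g : ctx b => g)
| proj_lift c (r : ctx c -> ctx b) : proj r -> @proj b c.+1 (fun g => r g.1).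

(** Formulas have no terms, so a term is represented by its graph. Quantifying over all extensions
    [r] of the context makes the graph usable under further quantifiers. *)
Definition tdef b (t : ctx b -> nat) := forall c (r : ctx c -> ctx b) x,
  proj r -> isvar x -> Dfn (fun N X g => x g = t (r g)).

Lemma size_env b (g : ctx b) : size (env g) = b.
Proof. by elim: b g => //= b IH g; rewrite size_rcons IH. Qed.

Lemma isvar_last b : @isvar b.+1 (fun g => g.2).
Proof. by exists b => // g; rewrite /= nth_rcons size_env ltnn eqxx. Qed.

Lemma isvar_lift b (v : ctx b -> nat) : isvar v -> @isvar b.+1 (fun g => v g.1).
Proof.
by move=> [i ib E]; exists i => [|g]; [apply: ltnW|rewrite /= nth_rcons size_env ib E].
Qed.

Lemma isvar_lt b (v : ctx b -> nat) N g : isvar v -> all (fun x => x < N) (env g) -> v g < N.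
Proof. by move=> [i ib <-] /allP; apply; apply: mem_nth; rewrite size_env. Qed.

Lemma D_and b (P Q : nat -> seq bool -> ctx b -> Prop) :
  Dfn P -> Dfn Q -> Dfn (fun N X g => P N X g /\ Q N X g).
Proof.
move=> [f Hf] [h Hh]; exists (FAnd f h) => N X g hX hg /=.
by rewrite -Hf // -Hh //; split=> [/andP|[-> ->]].
Qed.

Lemma D_not b (P : nat -> seq bool -> ctx b -> Prop) :
  Dfn P -> Dfn (fun N X g => ~ P N X g).
Proof.
by move=> [f Hf]; exists (FNot f) => N X g hX hg /=; rewrite -Hf //; split=> /negP.
Qed.

Lemma D_ext b (P Q : nat -> seq bool -> ctx b -> Prop) :
  (forall N X g, size X <= N -> all (fun x => x < N) (env g) -> P N X g <-> Q N X g) ->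
  Dfn P -> Dfn Q.
Proof. by move=> E [f Hf]; exists f => N X g hX hg; rewrite Hf // E. Qed.

Lemma D_or b (P Q : nat -> seq bool -> ctx b -> Prop) :
  Dfn P -> Dfn Q -> Dfn (fun N X g => P N X g \/ Q N X g).
Proof.
move=> /D_not HP /D_not HQ; apply: D_ext (D_not (D_and HP HQ)) => N X g _ _; tauto.
Qed.

Lemma D_imp b (P Q : nat -> seq bool -> ctx b -> Prop) :
  Dfn P -> Dfn Q -> Dfn (fun N X g => P N X g -> Q N X g).
Proof.
move=> HP /D_not HQ; apply: D_ext (D_not (D_and HP HQ)) => N X g _ _; tauto.
Qed.

Lemma D_iff b (P Q : nat -> seq bool -> ctx b -> Prop) :
  Dfn P -> Dfn Q -> Dfn (fun N X g => P N X g <-> Q N X g).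
Proof. by move=> HP HQ; apply: D_and; apply: D_imp. Qed.

Lemma D_ex b (P : nat -> seq bool -> ctx b -> nat -> Prop) :
  @Dfn b.+1 (fun N X g => P N X g.1 g.2) -> Dfn (fun N X g => exists x, x < N /\ P N X g x).
Proof.
move=> [f Hf]; exists (FEx f) => N X g hX hg /=; split.
  move=> /hasP [x]; rewrite mem_iota add0n /= => xN Hx; exists x; split=> //.
  by apply/(Hf N X (g, x)) => //=; rewrite all_rcons xN.
move=> [x [xN Hx]]; apply/hasP; exists x; first by rewrite mem_iota.
by apply/(Hf N X (g, x)) => //=; rewrite all_rcons xN.
Qed.

Lemma D_all b (P : nat -> seq bool -> ctx b -> nat -> Prop) :
  @Dfn b.+1 (fun N X g => P N X g.1 g.2) -> Dfn (fun N X g => forall x, x < N -> P N X g x).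
Proof.
move=> /D_not HP; apply: D_ext (D_not (D_ex (P := fun N X g x => ~ P N X g x) HP)) => N X g _ _.
split=> [H x xN|H [x [xN]]]; last by apply; apply: H.
by apply: NNPP => Hx; apply: H; exists x.
Qed.

Lemma D_add b (x y z : ctx b -> nat) : isvar x -> isvar y -> isvar z ->
  Dfn (fun N X g => x g + y g = z g).
Proof.
move=> [i _ Ei] [j _ Ej] [k _ Ek]; exists (FAdd i j k) => N X g _ _ /=.
by rewrite Ei Ej Ek; split=> /eqP.
Qed.

Lemma D_mul b (x y z : ctx b -> nat) : isvar x -> isvar y -> isvar z ->
  Dfn (fun N X g => x g * y g = z g).
Proof.
move=> [i _ Ei] [j _ Ej] [k _ Ek]; exists (FMul i j k) => N X g _ _ /=.
by rewrite Ei Ej Ek; split=> /eqP.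
Qed.

Lemma D_bitv b (x y : ctx b -> nat) : isvar x -> isvar y ->
  Dfn (fun N X g => bit (x g) (y g)).
Proof.
by move=> [i _ Ei] [j _ Ej]; exists (FBit i j) => N X g _ _ /=; rewrite Ei Ej.
Qed.

Lemma D_inv b (x : ctx b -> nat) : isvar x -> Dfn (fun N X g => nth false X (x g)).
Proof. by move=> [i _ Ei]; exists (FIn i) => N X g _ _ /=; rewrite Ei. Qed.

Ltac isv := first [ assumption | exact: isvar_last |
  lazymatch goal with
  | |- @isvar (S ?b) ?v =>
      let v' := eval cbn beta iota delta [fst snd] in (fun g0 : ctx b => v (g0, 0)) in
      apply (@isvar_lift b v'); isv
  end ].

Lemma isvar_proj b c (r : ctx c -> ctx b) v : proj r -> isvar v -> isvar (fun g => v (r g)).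
Proof. by elim=> // {}c {}r _ IH Hv; apply: (@isvar_lift _ (fun g => v (r g))); apply: IH. Qed.

Lemma D_sub b (t : ctx b -> nat) (P : nat -> seq bool -> ctx b -> nat -> Prop) :
  tdef t -> @Dfn b.+1 (fun N X g => P N X g.1 g.2) ->
  Dfn (fun N X g => t g < N /\ P N X g (t g)).
Proof.
move=> Ht HP.
apply: D_ext (D_ex (P := fun N X g x => x = t g /\ P N X g x) (D_and _ HP)); last first.
  by apply: (Ht b.+1 (fun g => g.1)); [exact: (proj_lift (proj_id _))|apply: isvar_last].
by move=> N X g _ _; split=> [[x [xN [<- H]]] //|[xN H]]; exists (t g).
Qed.

Lemma T_var b (v : ctx b -> nat) : isvar v -> tdef v.
Proof.
move=> Hv c r x Hr Hx; have Hv' := isvar_proj Hr Hv.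
apply: D_ext (D_ex (P := fun N X (g : ctx c) z => z + z = z /\ x g + z = v (r g)) _).
  move=> N X g hX hg /=; split=> [[z [_ [E1 E2]]]|->]; first by lia.
  by exists 0; have lt := isvar_lt Hv' hg; do !split; lia.
apply: D_and; first by apply: D_add; apply: isvar_last.
by apply: D_add; isv.
Qed.

Lemma T_one b : tdef (fun _ : ctx b => 1).
Proof.
move=> c r x Hr Hx; apply: D_ext (D_and (D_mul Hx Hx Hx) (D_not (D_add Hx Hx Hx))) => N X g _ _.
by split=> [[]|-> //]; case: (x g) => [|[|y]] //; nia.
Qed.

Lemma T_add b (f h : ctx b -> nat) : tdef f -> tdef h -> tdef (fun g => f g + h g).
Proof.
move=> Hf Hh c r x Hr Hx.
apply: D_ext (D_ex (P := fun N X (g : ctx c) y => y = f (r g) /\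
  (exists z, z < N /\ (z = h (r g) /\ y + z = x g))) _).
  move=> N X g hX hg /=; split=> [[y [_ [-> [z [_ [-> <-]]]]]] //|E].
  by have lt := isvar_lt Hx hg; exists (f (r g)); do !split; [lia|]; exists (h (r g)); do !split; lia.
have L := @isvar_last; have S := @isvar_lift.
apply: D_and.
  by apply: (Hf c.+1 (fun g => r g.1) (fun g => g.2)); [exact: (proj_lift Hr)|apply: L].
apply: (D_ex (P := fun N X (g : ctx c.+1) z => z = h (r g.1) /\ g.2 + z = x g.1)); apply: D_and.
  by apply: (Hh c.+2 (fun g => r g.1.1) (fun g => g.2)); [exact: (proj_lift (proj_lift Hr))|apply: L].
by apply: D_add; isv.
Qed.

Lemma T_zero b : tdef (fun _ : ctx b => 0).
Proof.
move=> c r x Hr Hx; apply: D_ext (D_add Hx Hx Hx) => N X g _ _.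
by split=> [|->]; lia.
Qed.

Lemma T_succ b (f : ctx b -> nat) : tdef f -> tdef (fun g => (f g).+1).
Proof.
move=> /T_add /(_ (@T_one b)) H c r x Hr Hx; apply: D_ext (H c r x Hr Hx) => N X g _ _.
by rewrite addn1.
Qed.

Lemma T_mul b (f v : ctx b -> nat) : tdef f -> isvar v -> tdef (fun g => f g * v g).
Proof.
move=> Hf Hv c r x Hr Hx; have Hv' := isvar_proj Hr Hv.
have L := @isvar_last; have S := @isvar_lift.
(* [x + x = x] says that [x] is 0. The case of a zero factor is separate because then [f] may lie
   outside the range of the quantifiers; otherwise [f] is at most the product. *)
apply: D_ext (D_or (D_and (D_add Hx Hx Hx) (D_add Hv' Hv' Hv'))
  (D_ex (P := fun N X (g : ctx c) y => y = f (r g) /\ y * v (r g) = x g) (D_and _ _))).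
- move=> N X g hX hg /=; split=> [[[]|[y [_ [-> <-]]]] //|E]; first by nia.
  have lt := isvar_lt Hx hg.
  case: (posnP (v (r g))) => [Z|P]; first by left; rewrite E Z muln0.
  by right; exists (f (r g)); split=> //; apply: leq_ltn_trans lt; rewrite E leq_pmulr.
- by apply: (Hf c.+1 (fun g => r g.1) (fun g => g.2)); [exact: (proj_lift Hr)|apply: L].
- by apply: D_mul; isv.
Qed.

Lemma bit_small i x : x < 2 ^ i -> bit i x = false.
Proof. by move=> lt; rewrite /bit divn_small. Qed.

Lemma bit_big i x N : x < N -> N <= i -> bit i x = false.
Proof.
move=> h1 h2; apply: bit_small; apply: leq_trans (ltn_expl x (isT : 1 < 2)) _.
by rewrite leq_exp2l // (leq_trans _ h2) // ltnW.
Qed.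

(** The index [f g] may be out of reach of the quantifiers; but then it is at least [N], and a
    number below [N] has no such bit, so both sides are false. *)
Lemma D_bit b (f v : ctx b -> nat) : tdef f -> isvar v -> Dfn (fun N X g => bit (f g) (v g)).
Proof.
move=> Hf Hv; apply: D_ext (D_sub (P := fun N X g x => bit x (v g)) Hf _).
  move=> N X g _ hg; split=> [[]|H] //; split=> //; rewrite ltnNge; apply/negP => h.
  by rewrite (bit_big (isvar_lt Hv hg) h) in H.
by apply: D_bitv; [apply: isvar_last|apply: isvar_lift].
Qed.

Lemma D_in b (f : ctx b -> nat) : tdef f -> Dfn (fun N X g => nth false X (f g)).
Proof.
move=> Hf; apply: D_ext (D_sub (P := fun N X g x => nth false X x) Hf _).
  move=> N X g hX hg; split=> [[]|H] //; split=> //; rewrite ltnNge; apply/negP => h.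
  by rewrite nth_default in H => //; apply: leq_trans h.
by apply: D_inv; apply: isvar_last.
Qed.

Lemma D_le b (f v : ctx b -> nat) : tdef f -> isvar v -> Dfn (fun N X g => f g <= v g).
Proof.
move=> Hf Hv.
apply: D_ext (D_sub (P := fun N X g x => exists y, y < N /\ x + y = v g) Hf (D_ex (P := fun N X (g : ctx b.+1) y => g.2 + y = v g.1) _)).
  move=> N X g hX hg; split=> [[_ [y [_ <-]]]|H]; first exact: leq_addr.
  by have lt := isvar_lt Hv hg; split; [lia|exists (v g - f g); lia].
by apply: D_add; isv.
Qed.

Lemma D_ge b (f v : ctx b -> nat) : tdef f -> isvar v -> Dfn (fun N X g => v g <= f g).
Proof.
move=> /T_succ Hf Hv; apply: D_ext (D_not (D_le Hf Hv)) => N X g _ _.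
by split=> [/negP|]; [rewrite -leqNgt|rewrite leqNgt => /negP].
Qed.

Lemma D_eq b (f x : ctx b -> nat) : tdef f -> isvar x -> Dfn (fun N X g => x g = f g).
Proof. by move=> Ht Hx; apply: Ht => //; constructor. Qed.

Ltac tdf := first
  [ apply: T_var; isv | apply: T_one | apply: T_zero
  | apply: T_add; [tdf|tdf] | apply: T_succ; tdf | apply: T_mul; [tdf|isv] ].

(** A hook, redefined whenever predicates have been shown definable, so that [dfn] treats them as
    atoms. *)
Ltac dfn_user := fail.

Ltac dfn := first
  [ dfn_user
  | apply: D_ex; dfn | apply: D_all; dfn | apply: D_bit; [tdf|isv] | apply: D_in; tdf
  | apply: D_le; [tdf|isv] | apply: D_ge; [tdf|isv] | apply: D_eq; [tdf|isv]
  | apply: D_iff; dfn | apply: D_and; dfn | apply: D_or; dfn | apply: D_not; dfn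
  | apply: D_imp; dfn ].

(* The data read off an input word of length [pn] with code [pW]: the bound [pM]
   = 2 ^ (2 pn) of the numbers coding types, and the positions at which the two
   TBoxes, the two ABoxes and the two parts of the signature start. *)
Record par := Par { pn : nat; pW : nat; pM : nat;
  pt1 : nat; pa1 : nat; pt2 : nat; pa2 : nat; psc : nat; psr : nat }.

Record ispar b (p : ctx b -> par) : Prop := IsPar {
  isvar_n : isvar (fun g => pn (p g)); isvar_W : isvar (fun g => pW (p g));
  isvar_M : isvar (fun g => pM (p g)); isvar_t1 : isvar (fun g => pt1 (p g));
  isvar_a1 : isvar (fun g => pa1 (p g)); isvar_t2 : isvar (fun g => pt2 (p g));
  isvar_a2 : isvar (fun g => pa2 (p g)); isvar_sc : isvar (fun g => psc (p g));
  isvar_sr : isvar (fun g => psr (p g)) }.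

Lemma ispar_lift b (p : ctx b -> par) : ispar p -> @ispar b.+1 (fun g => p g.1).
Proof. by case=> *; split; apply: (@isvar_lift b (fun g => _ (p g))). Qed.

(** * Parsing the input by formulas *)

Definition bw p i := bit i (pW p).

(** The code of a number is [false], or [true] followed by [l] pairs of [true] and a digit and by a
    final [false]; the second form has length [l + l + 2]. *)
Definition inat N p i j :=
  (i < pn p /\ ~ bw p i /\ j = i.+1) \/
  (bw p i /\ exists l, l < N /\ (j = (i + l + l).+2 /\ j <= pn p /\
     (forall x, x < N -> x < l -> bw p (i + x + x).+1) /\ ~ bw p (i + l + l).+1)).

Ltac isp := first [ assumption |
  lazymatch goal with
  | |- @ispar (S ?b) ?v =>
      let v' := eval cbn beta iota delta [fst snd] in (fun g0 : ctx b => v (g0, 0)) in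
      apply (@ispar_lift b v'); isp
  end ].

Lemma D_inat b (p : ctx b -> par) i j : ispar p -> isvar i -> isvar j ->
  Dfn (fun N X g => inat N (p g) (i g) (j g)).
Proof. by case=> *; rewrite /inat /bw; dfn. Qed.

Ltac dfn_user ::= apply: D_inat; [isp|isv|isv].

Definition eqname N p i i' := exists j, j < N /\ exists j', j' < N /\ exists l, l < N /\
  (inat N p i j /\ inat N p i' j' /\ j = i + l /\ j' = i' + l /\
   (forall x, x < N -> x < l -> (bw p (i + x) <-> bw p (i' + x)))).

Lemma D_eqname b (p : ctx b -> par) i j : ispar p -> isvar i -> isvar j ->
  Dfn (fun N X g => eqname N (p g) (i g) (j g)).
Proof. by move=> Hp; case: (Hp) => *; rewrite /eqname /bw; dfn. Qed.

Definition cstep N p Y i j := i.+3 <= pn p /\ j <= pn p /\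
  ((~ bw p i /\ ~ bw p i.+1 /\ j = i.+3) \/
   (~ bw p i /\ bw p i.+1 /\ exists k, k < N /\ (k = i.+3 /\
      ((~ bw p i.+2 /\ inat N p k j) \/ (bw p i.+2 /\ bit (k * pM p + j) Y)))) \/
   (bw p i /\ exists k, k < N /\ exists l, l < N /\ (k = i.+3 /\ l <= pn p /\
      ((~ bw p i.+1 /\ bit (k * pM p + l) Y) \/ (bw p i.+1 /\ inat N p k l)) /\
      bit (l * pM p + j) Y))).

(** The parse relation is the least relation on positions closed under [cstep]. A relation is a
    number [Y] whose bit [i * pM + j] stands for the pair, so the second-order quantifier over
    closed relations is a bounded quantifier over numbers. *)
Definition iconc N p i j := i <= pn p /\ j <= pn p /\ forall Y, Y < N ->
  (forall i', i' < N -> forall j', j' < N -> cstep N p Y i' j' -> bit (i' * pM p + j') Y) ->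
  bit (i * pM p + j) Y.

Lemma D_iconc b (p : ctx b -> par) i j : ispar p -> isvar i -> isvar j ->
  Dfn (fun N X g => iconc N (p g) (i g) (j g)).
Proof. by move=> Hp; case: (Hp) => *; rewrite /iconc /cstep /bw; dfn. Qed.

Ltac dfn_user ::= first [apply: D_inat; [isp|isv|isv] | apply: D_eqname; [isp|isv|isv] |
  apply: D_iconc; [isp|isv|isv] ].

Definition elCI N p i j := exists i1, i1 < N /\ exists k, k < N /\
  (i1 = i.+1 /\ iconc N p i1 k /\ iconc N p k j).

Definition elAs N p i j := exists i2, i2 < N /\ exists k, k < N /\ exists l, l < N /\
  (i2 = i.+2 /\ inat N p i2 k /\ inat N p k l /\
   ((~ bw p i.+1 /\ j = l) \/ (bw p i.+1 /\ inat N p l j))).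

Definition elN N p i j := exists i1, i1 < N /\ (i1 = i.+1 /\ inat N p i1 j).

(** The least-fixed-point device again, with sets of positions: [q] is the start of a cell of the
    list that begins at [s]. *)
Definition reach (el : nat -> par -> nat -> nat -> Prop) N p s q := forall Y, Y < N ->
  bit s Y -> (forall i, i < N -> forall j, j < N -> bit i Y -> bw p i -> el N p i j -> bit j Y) ->
  bit q Y.

Lemma D_rCI b (p : ctx b -> par) s q : ispar p -> isvar s -> isvar q ->
  Dfn (fun N X g => reach elCI N (p g) (s g) (q g)).
Proof. by move=> Hp; case: (Hp) => *; rewrite /reach /elCI /bw; dfn. Qed.

Lemma D_rAs b (p : ctx b -> par) s q : ispar p -> isvar s -> isvar q ->
  Dfn (fun N X g => reach elAs N (p g) (s g) (q g)).
Proof. by move=> Hp; case: (Hp) => *; rewrite /reach /elAs /bw; dfn. Qed.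

Lemma D_rN b (p : ctx b -> par) s q : ispar p -> isvar s -> isvar q ->
  Dfn (fun N X g => reach elN N (p g) (s g) (q g)).
Proof. by move=> Hp; case: (Hp) => *; rewrite /reach /elN /bw; dfn. Qed.

(* At position [i] there is a concept [Ex R C] or [All R C]: the body is at [c]. *)
Definition modal N p i c := bw p i /\ bw p i.+1 /\
  (exists k, k < N /\ (k = i.+3 /\ inat N p k c)) /\ exists j, j < N /\ iconc N p i j.

(* [okc]: an element of type [t] is a witness for the modal concept at [i], or
   its negation for [All]; [dem]: an element of type [t] demands a witness. *)
Definition okc p i c t := bit c t <-> ~ bw p i.+2.
Definition dem p i t := bit i t <-> ~ bw p i.+2.

(** * Types as numbers *)

Definition samer N p i i' := exists k, k < N /\ exists k', k' < N /\
  (k = i.+3 /\ k' = i'.+3 /\ eqname N p k k').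

Lemma D_modal b (p : ctx b -> par) i c : ispar p -> isvar i -> isvar c ->
  Dfn (fun N X g => modal N (p g) (i g) (c g)).
Proof. by move=> Hp; case: (Hp) => *; rewrite /modal /bw; dfn. Qed.

Lemma D_samer b (p : ctx b -> par) i c : ispar p -> isvar i -> isvar c ->
  Dfn (fun N X g => samer N (p g) (i g) (c g)).
Proof. by move=> Hp; case: (Hp) => *; rewrite /samer; dfn. Qed.

Ltac dfn_user ::= first [apply: D_inat; [isp|isv|isv] | apply: D_eqname; [isp|isv|isv] |
  apply: D_iconc; [isp|isv|isv] | apply: D_rCI; [isp|isv|isv] | apply: D_rAs; [isp|isv|isv] |
  apply: D_rN; [isp|isv|isv] | apply: D_modal; [isp|isv|isv] | apply: D_samer; [isp|isv|isv] ].

(** An edge is harmless iff everything it witnesses is demanded at its source. For [Ex R C] this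
    says that a successor in [C] puts the source into [Ex R C]; for [All R C], that a successor
    outside [C] keeps the source out of [All R C]. *)
Definition compat N p r t t' := forall i, i < N -> forall c, c < N -> modal N p i c ->
  (exists k, k < N /\ (k = i.+3 /\ eqname N p r k)) -> okc p i c t' -> dem p i t.

Lemma D_compat b (p : ctx b -> par) r t t' : ispar p -> isvar r -> isvar t -> isvar t' ->
  Dfn (fun N X g => compat N (p g) (r g) (t g) (t' g)).
Proof. by move=> Hp; case: (Hp) => *; rewrite /compat /okc /dem /bw; dfn. Qed.

Definition compatm N p i t t' := exists k, k < N /\ (k = i.+3 /\ compat N p k t t').

Definition lcond N p i t :=
  (~ bw p i -> ~ bw p i.+1 -> (bit i t <-> ~ bw p i.+2)) /\
  (~ bw p i -> bw p i.+1 -> ~ bw p i.+2 -> (bit i t <-> bit (pn p + i.+3) t)) /\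
  (~ bw p i -> bw p i.+1 -> bw p i.+2 -> (bit i t <-> ~ bit i.+3 t)) /\
  (bw p i -> ~ bw p i.+1 -> exists k, k < N /\ exists l, l < N /\ (k = i.+3 /\ iconc N p k l /\
     (bit i t <-> ((bit k t /\ bit l t) \/ (bw p i.+2 /\ (bit k t \/ bit l t)))))).

(* [t] codes a set of concepts that is closed under the Boolean connectives and
   under the inclusions of the TBox at position [s]; bit [i] is the concept at
   position [i] and bit [pn + i] is the concept name at position [i]. *)
Definition ltype N p s t := t < pM p /\
  (forall i, i < N -> forall j, j < N -> iconc N p i j -> lcond N p i t) /\
  (forall i, i < N -> forall i', i' < N -> eqname N p i i' ->
     (bit (pn p + i) t <-> bit (pn p + i') t)) /\
  (forall q, q < N -> forall k, k < N -> reach elCI N p s q -> bw p q ->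
     (exists q1, q1 < N /\ (q1 = q.+1 /\ iconc N p q1 k)) -> bit q.+1 t -> bit k t).

Lemma D_compatm b (p : ctx b -> par) i t t' : ispar p -> isvar i -> isvar t -> isvar t' ->
  Dfn (fun N X g => compatm N (p g) (i g) (t g) (t' g)).
Proof.
move=> Hp; case: (Hp) => *; rewrite /compatm; apply: D_ex; apply: D_and; first dfn.
by apply: D_compat; [isp|isv..].
Qed.

Lemma D_ltype b (p : ctx b -> par) s t : ispar p -> isvar s -> isvar t ->
  Dfn (fun N X g => ltype N (p g) (s g) (t g)).
Proof. by move=> Hp; case: (Hp) => *; rewrite /ltype /lcond /bw; dfn. Qed.

Ltac dfn_user ::= first [apply: D_inat; [isp|isv|isv] | apply: D_eqname; [isp|isv|isv] |
  apply: D_iconc; [isp|isv|isv] | apply: D_rCI; [isp|isv|isv] | apply: D_rAs; [isp|isv|isv] |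
  apply: D_rN; [isp|isv|isv] | apply: D_modal; [isp|isv|isv] | apply: D_samer; [isp|isv|isv] |
  apply: D_compat; [isp|isv|isv|isv] | apply: D_compatm; [isp|isv|isv|isv] |
  apply: D_ltype; [isp|isv|isv] ].

(** Type elimination in one formula: [Y] is a set of local types in which every demand of a member
    has a compatible witness. Such a set becomes a model of the TBox by taking its members as
    elements. *)
Definition real N p s t := exists Y, Y < N /\ (bit t Y /\
  forall t', t' < N -> bit t' Y -> ltype N p s t' /\
    forall i, i < N -> forall c, c < N -> modal N p i c -> dem p i t' ->
      exists t'', t'' < N /\ (bit t'' Y /\ compatm N p i t' t'' /\ okc p i c t'')).

Lemma D_real b (p : ctx b -> par) s t : ispar p -> isvar s -> isvar t ->
  Dfn (fun N X g => real N (p g) (s g) (t g)).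
Proof. by move=> Hp; case: (Hp) => *; rewrite /real /okc /dem /bw; dfn. Qed.

Definition sigC N p i := exists q, q < N /\ (i = q.+1 /\ reach elN N p (psc p) q /\ bw p q).
Definition sigR N p r := exists q, q < N /\ (reach elN N p (psr p) q /\ bw p q /\
  exists k, k < N /\ (k = q.+1 /\ eqname N p r k)).
Definition sigRm N p i := exists r, r < N /\ (r = i.+3 /\ sigR N p r).

Definition mism N p s t := exists i, i < N /\
  (sigC N p i /\ bit (pn p + i) t /\ ~ bit (pn p + i) s).

Lemma D_sigR b (p : ctx b -> par) i : ispar p -> isvar i -> Dfn (fun N X g => sigR N (p g) (i g)).
Proof. by move=> Hp; case: (Hp) => *; rewrite /sigR /bw; dfn. Qed.

Lemma D_sigRm b (p : ctx b -> par) i : ispar p -> isvar i -> Dfn (fun N X g => sigRm N (p g) (i g)).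
Proof. by move=> Hp; case: (Hp) => *; rewrite /sigRm /sigR /bw; dfn. Qed.

Lemma D_mism b (p : ctx b -> par) s t : ispar p -> isvar s -> isvar t ->
  Dfn (fun N X g => mism N (p g) (s g) (t g)).
Proof. by move=> Hp; case: (Hp) => *; rewrite /mism /sigC /bw; dfn. Qed.

(* The types of the second knowledge base that are possible for a witness of the
   demand [i] of an element of type [t]. *)
Definition wit N p t i c t' := real N p (pt2 p) t' /\ compatm N p i t t' /\ okc p i c t'.

Ltac dfn_user ::= first [apply: D_inat; [isp|isv|isv] | apply: D_eqname; [isp|isv|isv] |
  apply: D_iconc; [isp|isv|isv] | apply: D_rCI; [isp|isv|isv] | apply: D_rAs; [isp|isv|isv] |
  apply: D_rN; [isp|isv|isv] | apply: D_modal; [isp|isv|isv] | apply: D_samer; [isp|isv|isv] |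
  apply: D_compat; [isp|isv|isv|isv] | apply: D_compatm; [isp|isv|isv|isv] |
  apply: D_ltype; [isp|isv|isv] | apply: D_real; [isp|isv|isv] | apply: D_sigR; [isp|isv] |
  apply: D_sigRm; [isp|isv] | apply: D_mism; [isp|isv|isv] ].

Lemma D_wit b (p : ctx b -> par) t i c t' : ispar p -> isvar t -> isvar i -> isvar c -> isvar t' ->
  Dfn (fun N X g => wit N (p g) (t g) (i g) (c g) (t' g)).
Proof. by move=> Hp; case: (Hp) => *; rewrite /wit /okc /bw; dfn. Qed.

(** [s] is the type of a root and [V] the set of [K2]-types to be defeated there. For each [t] in
    [V] without a mismatch, one demand of [t] over a role of the signature is chosen, and [Q]
    collects, for every demand [i'] of [s] with this role, all its possible witness types: the
    witness of [i'] must defeat them together, whichever [t] they come from. The second part finds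
    such witnesses in the table [X], where [(s', V')] is the number [V' * pM + s']. *)
Definition gstep N p (X : seq bool) s V := real N p (pt1 p) s /\
  ((forall t, t < N -> ~ bit t V) \/
   exists Q, Q < N /\
    ((forall t, t < N -> bit t V -> mism N p s t \/
       exists i, i < N /\ exists c, c < N /\ (modal N p i c /\ dem p i t /\ sigRm N p i /\
         forall i', i' < N -> forall c', c' < N -> modal N p i' c' -> dem p i' s ->
           samer N p i i' -> forall t', t' < N -> wit N p t i c t' -> bit (i' * pM p + t') Q)) /\
     (forall i, i < N -> forall c, c < N -> modal N p i c -> dem p i s ->
       exists s', s' < N /\ exists V', V' < N /\
         (nth false X (V' * pM p + s') /\ s' < pM p /\ compatm N p i s s' /\ okc p i c s' /\
          forall t', t' < N -> t' < pM p -> bit (i * pM p + t') Q -> bit t' V')))).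

Ltac dfn_user ::= first [apply: D_inat; [isp|isv|isv] | apply: D_eqname; [isp|isv|isv] |
  apply: D_iconc; [isp|isv|isv] | apply: D_rCI; [isp|isv|isv] | apply: D_rAs; [isp|isv|isv] |
  apply: D_rN; [isp|isv|isv] | apply: D_modal; [isp|isv|isv] | apply: D_samer; [isp|isv|isv] |
  apply: D_compat; [isp|isv|isv|isv] | apply: D_compatm; [isp|isv|isv|isv] |
  apply: D_ltype; [isp|isv|isv] | apply: D_real; [isp|isv|isv] | apply: D_sigR; [isp|isv] |
  apply: D_sigRm; [isp|isv] | apply: D_mism; [isp|isv|isv] | apply: D_wit; [isp|isv|isv|isv|isv] ].

Lemma D_gstep b (p : ctx b -> par) s V : ispar p -> isvar s -> isvar V ->
  Dfn (fun N X g => gstep N (p g) X (s g) (V g)).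
Proof.
move=> Hp; case: (Hp) => *; rewrite /gstep /okc /dem /bw; dfn.
Qed.

(** * ABoxes, and the entailment condition as a formula *)

Definition cass N p ab A a := exists q, q < N /\
  (reach elAs N p ab q /\ bw p q /\ ~ bw p q.+1 /\ A = q.+2 /\ inat N p A a).
Definition rass N p ab R a a' := exists q, q < N /\
  (reach elAs N p ab q /\ bw p q /\ bw p q.+1 /\ R = q.+2 /\ inat N p R a /\ inat N p a a').

Definition indp N p ab a := (exists A, A < N /\ cass N p ab A a) \/
  exists R, R < N /\ exists a', a' < N /\ (rass N p ab R a a' \/ rass N p ab R a' a).

(* [a] is the first position in the ABox of the name of an individual. *)
Definition ind0 N p ab a := indp N p ab a /\
  forall a', a' < N -> a' < a -> indp N p ab a' -> ~ eqname N p a' a.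

Definition cass0 N p ab A a := ind0 N p ab a /\
  exists a', a' < N /\ (eqname N p a' a /\ cass N p ab A a').
Definition rass0 N p ab R a b := ind0 N p ab a /\ ind0 N p ab b /\
  exists a', a' < N /\ exists b', b' < N /\ (eqname N p a' a /\ eqname N p b' b /\ rass N p ab R a' b').

(* [T] codes an assignment of types to the individuals. *)
Definition asg N p tb ab T :=
  (forall a, a < N -> ind0 N p ab a -> exists t, t < N /\ (real N p tb t /\ bit (a * pM p + t) T)) /\
  (forall a, a < N -> forall t, t < N -> forall t', t' < N -> ind0 N p ab a ->
     t < pM p -> t' < pM p -> bit (a * pM p + t) T -> bit (a * pM p + t') T -> t = t') /\
  (forall A, A < N -> forall a, a < N -> forall t, t < N -> cass0 N p ab A a -> t < pM p ->
     bit (a * pM p + t) T -> bit (pn p + A) t) /\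
  (forall R, R < N -> forall a, a < N -> forall b, b < N -> forall t, t < N -> forall t', t' < N ->
     rass0 N p ab R a b -> t < pM p -> t' < pM p -> bit (a * pM p + t) T -> bit (b * pM p + t') T ->
     compat N p R t t').

(** [Q] codes triples of an individual, a demand and a [K2]-type said to be defeated at the
    anonymous witness of that demand. For each individual and demand, a single entry of the table
    must defeat all of these types. *)
Definition childok N p (X : seq bool) T Q :=
  forall a, a < N -> forall s, s < N -> ind0 N p (pa1 p) a -> s < pM p -> bit (a * pM p + s) T ->
  forall i, i < N -> forall c, c < N -> modal N p i c -> dem p i s ->
  exists s', s' < N /\ exists V, V < N /\
    (nth false X (V * pM p + s') /\ s' < pM p /\ compatm N p i s s' /\ okc p i c s' /\
     forall t', t' < N -> t' < pM p -> bit ((a * pM p + i) * pM p + t') Q -> bit t' V).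

(* [Z] codes pairs of an individual [a] and a type of the second knowledge base
   that can be simulated at [a]. *)
Definition safe N p T Q Z :=
  forall a, a < N -> forall t, t < N -> forall s, s < N -> ind0 N p (pa1 p) a ->
  t < pM p -> s < pM p -> bit (a * pM p + t) Z -> bit (a * pM p + s) T ->
  ~ mism N p s t /\
  forall i, i < N -> forall c, c < N -> modal N p i c -> dem p i t -> sigRm N p i ->
  exists t', t' < N /\ (wit N p t i c t' /\
    ((exists i', i' < N /\ exists c', c' < N /\ (modal N p i' c' /\ dem p i' s /\
        samer N p i i' /\ ~ bit ((a * pM p + i') * pM p + t') Q)) \/
     (exists R, R < N /\ exists b, b < N /\ exists k, k < N /\ (rass0 N p (pa1 p) R a b /\
        k = i.+3 /\ eqname N p R k /\ bit (b * pM p + t') Z)))).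

(** [T] and [Q] are chosen by an adversary: types of the individuals in a model of [K1], and the
    [K2]-types defeated at their witnesses. [K2] answers with types [T'] of its individuals and a
    set [Z] of pairs that it can go on simulating. Only role assertions of [K1] count as edges
    between individuals, because the worst model of [K1] has no others. *)
Definition entl N p (X : seq bool) :=
  (forall a, a < N -> indp N p (pa2 p) a -> exists a', a' < N /\ (indp N p (pa1 p) a' /\ eqname N p a a')) /\
  forall T, T < N -> forall Q, Q < N -> asg N p (pt1 p) (pa1 p) T -> childok N p X T Q ->
  exists T', T' < N /\ exists Z, Z < N /\
    (asg N p (pt2 p) (pa2 p) T' /\
     (forall R, R < N -> forall a, a < N -> forall b, b < N -> rass N p (pa2 p) R a b -> sigR N p R ->
        exists R', R' < N /\ exists a', a' < N /\ exists b', b' < N /\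
          (rass N p (pa1 p) R' a' b' /\ eqname N p R R' /\ eqname N p a a' /\ eqname N p b b')) /\
     (forall a, a < N -> forall a', a' < N -> forall t, t < N -> ind0 N p (pa2 p) a ->
        ind0 N p (pa1 p) a' -> eqname N p a a' -> t < pM p -> bit (a * pM p + t) T' ->
        bit (a' * pM p + t) Z) /\
     safe N p T Q Z).

Definition cons N p tb ab :=
  (exists t, t < N /\ real N p tb t) /\ exists T, T < N /\ asg N p tb ab T.

Lemma D_cass b (p : ctx b -> par) ab A a : ispar p -> isvar ab -> isvar A -> isvar a ->
  Dfn (fun N X g => cass N (p g) (ab g) (A g) (a g)).
Proof. by move=> Hp; case: (Hp) => *; rewrite /cass /bw; dfn. Qed.

Lemma D_rass b (p : ctx b -> par) ab R a a' : ispar p -> isvar ab -> isvar R -> isvar a -> isvar a' ->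
  Dfn (fun N X g => rass N (p g) (ab g) (R g) (a g) (a' g)).
Proof. by move=> Hp; case: (Hp) => *; rewrite /rass /bw; dfn. Qed.

Ltac dfn_user ::= first [apply: D_inat; [isp|isv|isv] | apply: D_eqname; [isp|isv|isv] |
  apply: D_iconc; [isp|isv|isv] | apply: D_rCI; [isp|isv|isv] | apply: D_rAs; [isp|isv|isv] |
  apply: D_rN; [isp|isv|isv] | apply: D_modal; [isp|isv|isv] | apply: D_samer; [isp|isv|isv] |
  apply: D_compat; [isp|isv|isv|isv] | apply: D_compatm; [isp|isv|isv|isv] |
  apply: D_ltype; [isp|isv|isv] | apply: D_real; [isp|isv|isv] | apply: D_sigR; [isp|isv] |
  apply: D_sigRm; [isp|isv] | apply: D_mism; [isp|isv|isv] | apply: D_wit; [isp|isv|isv|isv|isv] |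
  apply: D_cass; [isp|isv|isv|isv] | apply: D_rass; [isp|isv|isv|isv|isv] ].

Lemma D_ind0 b (p : ctx b -> par) ab a : ispar p -> isvar ab -> isvar a ->
  Dfn (fun N X g => ind0 N (p g) (ab g) (a g)).
Proof. by move=> Hp; case: (Hp) => *; rewrite /ind0 /indp; dfn. Qed.

Lemma D_rass0 b (p : ctx b -> par) ab R a a' : ispar p -> isvar ab -> isvar R -> isvar a -> isvar a' ->
  Dfn (fun N X g => rass0 N (p g) (ab g) (R g) (a g) (a' g)).
Proof. by move=> Hp; case: (Hp) => *; rewrite /rass0 /ind0 /indp; dfn. Qed.

Ltac dfn_user ::= first [apply: D_inat; [isp|isv|isv] | apply: D_eqname; [isp|isv|isv] |
  apply: D_iconc; [isp|isv|isv] | apply: D_rCI; [isp|isv|isv] | apply: D_rAs; [isp|isv|isv] |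
  apply: D_rN; [isp|isv|isv] | apply: D_modal; [isp|isv|isv] | apply: D_samer; [isp|isv|isv] |
  apply: D_compat; [isp|isv|isv|isv] | apply: D_compatm; [isp|isv|isv|isv] |
  apply: D_ltype; [isp|isv|isv] | apply: D_real; [isp|isv|isv] | apply: D_sigR; [isp|isv] |
  apply: D_sigRm; [isp|isv] | apply: D_mism; [isp|isv|isv] | apply: D_wit; [isp|isv|isv|isv|isv] |
  apply: D_cass; [isp|isv|isv|isv] | apply: D_rass; [isp|isv|isv|isv|isv] |
  apply: D_ind0; [isp|isv|isv] | apply: D_rass0; [isp|isv|isv|isv|isv] ].

Lemma D_asg b (p : ctx b -> par) tb ab T : ispar p -> isvar tb -> isvar ab -> isvar T ->
  Dfn (fun N X g => asg N (p g) (tb g) (ab g) (T g)).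
Proof. by move=> Hp; case: (Hp) => *; rewrite /asg /cass0; dfn. Qed.

Lemma D_childok b (p : ctx b -> par) T Q : ispar p -> isvar T -> isvar Q ->
  Dfn (fun N X g => childok N (p g) X (T g) (Q g)).
Proof. by move=> Hp; case: (Hp) => *; rewrite /childok /okc /dem /bw; dfn. Qed.

Lemma D_safe b (p : ctx b -> par) T Q Z : ispar p -> isvar T -> isvar Q -> isvar Z ->
  Dfn (fun N X g => safe N (p g) (T g) (Q g) (Z g)).
Proof. by move=> Hp; case: (Hp) => *; rewrite /safe /dem /bw; dfn. Qed.

Ltac dfn_user ::= first [ apply: D_eqname; [isp|isv|isv] | apply: D_rass; [isp|isv|isv|isv|isv] |
  apply: D_cass; [isp|isv|isv|isv] | apply: D_real; [isp|isv|isv] | apply: D_sigR; [isp|isv] |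
  apply: D_ind0; [isp|isv|isv] | apply: D_asg; [isp|isv|isv|isv] |
  apply: D_childok; [isp|isv|isv] | apply: D_safe; [isp|isv|isv|isv] ].

Lemma D_entl b (p : ctx b -> par) : ispar p -> Dfn (fun N X g => entl N (p g) X).
Proof. by move=> Hp; case: (Hp) => *; rewrite /entl /indp; dfn. Qed.

Lemma D_cons b (p : ctx b -> par) tb ab : ispar p -> isvar tb -> isvar ab ->
  Dfn (fun N X g => cons N (p g) (tb g) (ab g)).
Proof. by move=> Hp; case: (Hp) => *; rewrite /cons; dfn. Qed.

Definition ends el N p s s' := exists q, q < N /\ (reach el N p s q /\ q < pn p /\ ~ bw p q /\ s' = q.+1).

(* The word is the code of an input, split at the positions in [p]. *)
Definition wf N p := (forall x, x < N -> (bit x (pM p) <-> x = pn p + pn p)) /\ pt1 p = 0 /\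
  ends elCI N p (pt1 p) (pa1 p) /\ ends elAs N p (pa1 p) (pt2 p) /\
  ends elCI N p (pt2 p) (pa2 p) /\ ends elAs N p (pa2 p) (psc p) /\
  ends elN N p (psc p) (psr p) /\ exists k, k < N /\ (ends elN N p (psr p) k /\ k = pn p).

Ltac dfn_user ::= first [ apply: D_rCI; [isp|isv|isv] | apply: D_rAs; [isp|isv|isv] |
  apply: D_rN; [isp|isv|isv] | apply: D_entl; isp | apply: D_cons; [isp|isv|isv] |
  apply: D_gstep; [isp|isv|isv] ].

Lemma D_wf b (p : ctx b -> par) : ispar p -> Dfn (fun N X g => wf N (p g)).
Proof. by move=> Hp; case: (Hp) => *; rewrite /wf /ends /bw; dfn. Qed.

(** The splitting positions are guessed; as the codes are prefix-free, there is at most one guess.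
    On words that code no input the formula is false. *)
Definition parsed N n W (P : par -> Prop) :=
  exists M, M < N /\ exists t1, t1 < N /\ exists a1, a1 < N /\ exists t2, t2 < N /\
  exists a2, a2 < N /\ exists sc, sc < N /\ exists sr, sr < N /\
  (wf N (Par n W M t1 a1 t2 a2 sc sr) /\ P (Par n W M t1 a1 t2 a2 sc sr)).

Definition phiP N X n W x := parsed N n W (fun p => exists s, s < N /\ exists V, V < N /\
  (s < pM p /\ x = V * pM p + s /\ gstep N p X s V)).

Definition psiP N X n W := parsed N n W (fun p =>
  cons N p (pt1 p) (pa1 p) /\ cons N p (pt2 p) (pa2 p) /\ entl N p X).

Lemma D_parsed b (P : nat -> seq bool -> ctx b -> par -> Prop) n W : isvar n -> isvar W ->
  (forall p, ispar p -> @Dfn b.+4.+3 (fun N X g => P N X g.1.1.1.1.1.1.1 (p g))) ->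
  Dfn (fun N X g => parsed N (n g) (W g) (P N X g)).
Proof.
move=> Hn HW HP; rewrite /parsed; do 7 apply: D_ex.
have H : ispar (fun g : ctx b.+4.+3 => Par (n g.1.1.1.1.1.1.1) (W g.1.1.1.1.1.1.1)
  g.1.1.1.1.1.1.2 g.1.1.1.1.1.2 g.1.1.1.1.2 g.1.1.1.2 g.1.1.2 g.1.2 g.2) by split=> /=; isv.
by apply: D_and; [apply: D_wf; exact: H|apply: (HP _ H)].
Qed.

Lemma D_phi : @Dfn 3 (fun N X g => phiP N X g.1.1.2 g.1.2 g.2).
Proof.
apply: (@D_parsed 3 (fun N X g p => exists s, s < N /\ exists V, V < N /\
  (s < pM p /\ g.2 = V * pM p + s /\ gstep N p X s V))); [isv|isv|] => p Hp.
by case: (Hp) => *; dfn.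
Qed.

Lemma D_psi : @Dfn 2 (fun N X g => psiP N X g.1.2 g.2).
Proof.
apply: (@D_parsed 2 (fun N X g p => cons N p (pt1 p) (pa1 p) /\ cons N p (pt2 p) (pa2 p) /\
  entl N p X)); [isv|isv|] => p Hp.
by case: (Hp) => *; dfn.
Qed.

(** * Entailment and bounded simulations *)

Definition pb (P : Prop) : bool := if excluded_middle_informative P then true else false.

Lemma pbP P : reflect P (pb P).
Proof. by rewrite /pb; case: excluded_middle_informative => h; constructor. Qed.

Lemma InP (T : eqType) (x : T) s : reflect (List.In x s) (x \in s).
Proof.
elim: s => [|y s IH]; first by constructor.
rewrite in_cons; apply: (iffP orP) => [[/eqP ->|/IH]|[->|/IH]] /=; auto.
Qed.

Lemma In_map T U (f : T -> U) s y : List.In y (map f s) <-> exists2 x, List.In x s & f x = y.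
Proof.
elim: s => [|x s IH] /=; first by split=> // -[].
rewrite IH; split=> [[<-|[z h <-]]|[z [->|h] <-]]; [exists x|exists z|left|right; exists z]; auto.
Qed.

Lemma In_cat T (s t : seq T) x : List.In x (s ++ t) <-> List.In x s \/ List.In x t.
Proof. by elim: s => /= [|y s ->]; tauto. Qed.

Lemma In_filter T (a : pred T) s x : List.In x (filter a s) <-> List.In x s /\ a x.
Proof.
elim: s => [|y s IH] /=; first by tauto.
case h : (a y) => /=; rewrite IH; split; try tauto.
- by move=> [E|[]]; [subst y; split; [left|]|tauto].
- by move=> [[E|//] a1]; rewrite -E h in a1.
Qed.

Lemma In_flatten T (ss : seq (seq T)) x :
  List.In x (flatten ss) <-> exists2 s, List.In s ss & List.In x s.
Proof.
elim: ss => [|s ss IH] /=; first by split=> // -[].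
rewrite In_cat IH; split=> [[h|[t h1 h2]]|[t [->|h1] h2]]; auto; try by exists s; auto.
  by exists t; auto.
by right; exists t.
Qed.

Lemma In_allpairs T U Z (f : T -> U -> Z) s t z :
  List.In z [seq f x y | x <- s, y <- t] <-> exists x y, [/\ List.In x s, List.In y t & z = f x y].
Proof.
rewrite In_flatten; split=> [[r /In_map [x xs <-] /In_map [y yt <-]]|[x [y [xs yt ->]]]].
  by exists x, y.
by exists (map (f x) t); apply/In_map; [exists x|exists y].
Qed.

Lemma all_In T (a : pred T) s : all a s <-> forall x, List.In x s -> a x.
Proof.
elim: s => //= x s IH; split=> [/andP [ax /IH H] y [<-|/H]|H] //.
by apply/andP; split; [apply: H; left|apply/IH => y Hy; apply: H; right].
Qed.

Section Transfer.

Variables (S : signature) (I1 I2 : interp).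

(** In a rooted query every quantified variable is linked to an answer variable by role atoms of the
    signature. [V] contains the answers and is closed under such edges in both directions, so the
    whole match lies in [V], where [h] preserves it. *)
Lemma hom_transfer (V : dom I2 -> Prop) (h : dom I2 -> dom I1) (as_ : seq iname) q :
  (forall a, a \in as_ -> V (iint I2 a) /\ h (iint I2 a) = iint I1 a) ->
  (forall A d, A \in sig_c S -> V d -> cint A d -> cint A (h d)) ->
  (forall R d e, R \in sig_r S -> rint R d e -> (V d <-> V e) /\ (V d -> rint R (h d) (h e))) ->
  is_rucq q -> ucq_over S q -> sat_ucq I2 q as_ -> sat_ucq I1 q as_.
Proof.
move=> Ha Hc Hr [_ Hroot] Hov [p Hp [pi [Epi Hsat]]]; exists p => //.
exists (h \o pi); split.
  rewrite map_comp Epi -map_comp; apply/eq_in_map => a /Ha [_ /= ->] //.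
have Hov' t : List.In t p -> atom_over S t.
  by move: t; apply/all_In; move/all_In: Hov; apply.
have Vedge u v : cq_edge p u v -> V (pi v) -> V (pi u).
  move=> [R [] /[dup] /Hov' /= RS /Hsat /= /(Hr _ _ _ RS) [E _] Hv]; apply/E => //.
have Vans x : x \in answer q -> V (pi x).
  move=> /InP xq; have /In_map : exists2 y, List.In y (answer q) & pi y = pi x by exists x.
  by rewrite Epi => /In_map [a /InP aS <-]; have [] := Ha _ aS.
have Vvar y : y \in cq_vars p -> V (pi y).
  move=> yp; case: (boolP (y \in answer q)) => [|yn]; first exact: Vans.
  have [x xq C] := Hroot _ Hp _ yp yn; have {xq} := Vans _ xq.
  by elim: C => {y x yp yn} [u v /Vedge H|u|u v x _ IH1 _ IH2 /IH2/IH1] //.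
move=> t Ht; have Vt z : z \in atom_vars t -> V (pi z).
  move=> zt; apply: Vvar; apply/InP/In_flatten; exists (atom_vars t); last exact/InP.
  by apply/In_map; exists t.
have := Hov' _ Ht; have := Hsat _ Ht; case: t Ht Vt => [A z|R z z'] Ht Vt /= H HS.
  by apply: Hc => //; apply: Vt; rewrite /= inE.
have [_] := Hr _ _ _ HS H; apply; apply: Vt; rewrite /= !inE eqxx //.
Qed.

End Transfer.

Section Psim.

Variables (S : signature) (exs : seq (rname * concept)) (I2 I1 : interp).

(* [d2] can be simulated by [d1] up to depth [n], as far as witnesses of the
   existential restrictions listed in [exs] are concerned. *)
Fixpoint psim (n : nat) (d2 : dom I2) (d1 : dom I1) : Prop :=
  (forall A, A \in sig_c S -> cint A d2 -> cint A d1) /\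
  if n is n.+1 then
    forall R C, List.In (R, C) exs -> R \in sig_r S -> ext (Ex R C) d2 ->
    exists e2 e1, [/\ rint R d2 e2, ext C e2, rint R d1 e1 & psim n e2 e1]
  else True.

End Psim.

Section Query.

Variables (S : signature) (K1 K2 : kb) (I1 : interp) (exs : seq (rname * concept)) (n : nat).

(* Query variables are words: the word [:: i_k; ..; i_1; a] stands for the element
   reached from the individual [a] by following witnesses of i_1, .., i_k. *)
Definition wcode (u : seq nat) : nat := pickle u.

Fixpoint words k : seq (seq nat) :=
  if k is k.+1 then words k ++ [seq i :: u | i <- iota 0 (size exs), u <- words k]
  else [seq [:: a] | a <- ind K2].

Definition qatoms : seq atom :=
  [seq CAtom A (wcode u) | A <- sig_c S, u <- words n] ++
  flatten [seq [seq RAtom R (wcode u) (wcode v) | u <- words n, v <- words n] | R <- sig_r S].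

Definition qinds := undup (ind K2).
Definition qans := [seq wcode [:: a] | a <- qinds].

Definition qfalse (p : cq) := pb (rooted_cq qans p /\
  ~ exists pi : var -> dom I1, map pi qans = map (iint I1) qinds /\
      (forall t, List.In t p -> sat_atom pi t)).

(** By construction no disjunct holds in [I1], yet every rooted conjunction of atoms from the finite
    list that could show a difference to [I1] is present. One query thus deals with all models of
    [K2] at once. *)
Definition query := UCQ qans
  (filter qfalse [seq mask m qatoms | m : (size qatoms).-tuple bool]).

Lemma wcode_inj : injective wcode.
Proof. exact: (pcan_inj pickleK). Qed.

Lemma in_qatoms t : List.In t qatoms <->
  match t with
  | CAtom A z => A \in sig_c S /\ exists2 u, u \in words n & z = wcode u
  | RAtom R z z' => R \in sig_r S /\
      exists u v, [/\ u \in words n, v \in words n, z = wcode u & z' = wcode v]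
  end.
Proof.
rewrite /qatoms In_cat; split.
  case=> [/In_allpairs [A [u [/InP AS /InP uW ->]]]|]; first by split=> //; exists u.
  move=> /In_flatten [s /In_map [R /InP RS <-] /In_allpairs [u [v [/InP uW /InP vW ->]]]].
  by split=> //; exists u, v.
case: t => [A z [/InP AS [u /InP uW ->]]|R z z' [/InP RS [u [v [/InP uW /InP vW -> ->]]]]].
  by left; apply/In_allpairs; exists A, u.
right; apply/In_flatten; exists [seq RAtom R (wcode u) (wcode v) | u <- words n, v <- words n].
  by apply/In_map; exists R.
by apply/In_allpairs; exists u, v.
Qed.

Variable I2 : interp.

Definition wgood (i : nat) (d : dom I2) : option (dom I2) :=
  match excluded_middle_informative (exists e, exists R C,
      [/\ onth exs i = Some (R, C), R \in sig_r S, rint R d e & ext C e]) with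
  | left h => Some (proj1_sig (constructive_indefinite_description _ h))
  | right _ => None
  end.

Fixpoint walk_to (u : seq nat) : option (dom I2) :=
  match u with
  | [::] => None
  | [:: a] => if a \in ind K2 then Some (iint I2 a) else None
  | i :: u => if walk_to u is Some d then wgood i d else None
  end.

Lemma walk_cons i a u :
  walk_to (i :: a :: u) = if walk_to (a :: u) is Some d then wgood i d else None.
Proof. by []. Qed.

Lemma wgoodP i d e : wgood i d = Some e ->
  exists R C, [/\ onth exs i = Some (R, C), R \in sig_r S, rint R d e & ext C e].
Proof.
rewrite /wgood; case: excluded_middle_informative => // h [<-].
exact: (proj2_sig (constructive_indefinite_description _ h)).
Qed.

Lemma wgood_ex i d R C : onth exs i = Some (R, C) -> R \in sig_r S -> ext (Ex R C) d ->
  exists e, wgood i d = Some e.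
Proof.
move=> h1 h2 [e [h3 h4]]; rewrite /wgood; case: excluded_middle_informative => [h|[]].
  by eexists.
by exists e, R, C.
Qed.

Lemma words_sub k k' u : k <= k' -> u \in words k -> u \in words k'.
Proof.
by move=> /subnK <-; elim: (k' - k) => //= m IH /IH h; rewrite mem_cat h.
Qed.

Lemma walk_words u d : walk_to u = Some d -> u \in words (size u).-1.
Proof.
elim: u d => // i [|a u] IH d; first by rewrite /=; case: ifP => // h _; rewrite map_f.
rewrite walk_cons.
case E : (walk_to (a :: u)) => [d'|] // W; have [R [C [h _ _ _]]] := wgoodP W.
rewrite /= mem_cat; apply/orP; right; apply/allpairsP; exists (i, a :: u); split=> //.
  rewrite mem_iota add0n /=; case: ltnP => // lt.
  by rewrite onth_default in h.
exact: IH E.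
Qed.

(** Of the roles in [I2], only the edges along the chosen walks and the assertions of [K2] are kept:
    the former make the conjunction rooted, and together they suffice to recover a bounded
    simulation from a match. *)
Definition qtrue (t : atom) := pb
  match t with
  | CAtom A z => exists u d, [/\ z = wcode u, walk_to u = Some d & cint A d]
  | RAtom R z z' =>
      (exists u i d e C, [/\ z = wcode u, z' = wcode (i :: u), walk_to u = Some d,
         wgood i d = Some e & onth exs i = Some (R, C)]) \/
      (exists a b, [/\ z = wcode [:: a], z' = wcode [:: b] & List.In (RAssert R a b) (abox K2)])
  end.

Definition qmap (z : var) : dom I2 :=
  if unpickle z is Some u then odflt (iint I2 0) (walk_to u) else iint I2 0.

Lemma qmapE u d : walk_to u = Some d -> qmap (wcode u) = d.
Proof. by rewrite /qmap /wcode pickleK => ->. Qed.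

Hypothesis M2 : model I2 K2.

Lemma ind_R R a b : List.In (RAssert R a b) (abox K2) -> a \in ind K2 /\ b \in ind K2.
Proof.
move=> H; suff : List.In a (ind K2) /\ List.In b (ind K2) by case=> /InP -> /InP ->.
by split; apply/In_flatten; exists [:: a; b]; rewrite /=; auto; apply/In_map; exists (RAssert R a b).
Qed.

Let qp := filter qtrue qatoms.

Lemma qp_sat t : List.In t qp -> sat_atom qmap t.
Proof.
move=> /In_filter [_ /pbP]; case: t => [A z|R z z'] /=; first by move=> [u [d [-> /qmapE ->]]].
case=> [[u [i [d [e [C [-> -> E W O]]]]]]|[a [b [-> -> H]]]].
  have [R' [C' []]] := wgoodP W; rewrite O => -[<- _] RS HR _.
  rewrite (qmapE E) (@qmapE (i :: u) e) //.
  by case: u E => [//|a u] E; rewrite walk_cons E.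
have [aK bK] := ind_R H.
by rewrite (@qmapE _ (iint I2 a)) ?(@qmapE _ (iint I2 b)) /= ?aK ?bK //; apply: M2.2 H.
Qed.

Lemma walk_rcons i u d e : walk_to u = Some d -> wgood i d = Some e -> walk_to (i :: u) = Some e.
Proof. by case: u => [//|a u] E W; rewrite walk_cons E. Qed.

Lemma qp_edge i u d : u != [::] -> walk_to (i :: u) = Some d -> size u <= n ->
  exists R, List.In (RAtom R (wcode u) (wcode (i :: u))) qp.
Proof.
case: u => [//|a u] _ E lt; have := E; rewrite walk_cons.
case E' : (walk_to (a :: u)) => [d'|] // W.
have [R [C [O RS _ _]]] := wgoodP W; exists R; apply/In_filter; split.
  apply/in_qatoms; split=> //; exists (a :: u), (i :: a :: u); split=> //.
    by apply: words_sub (walk_words E'); rewrite /= ltnW.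
  exact: words_sub (walk_words E).
by apply/pbP; left; exists (a :: u), i, d', d, C.
Qed.

Lemma qp_live y : y \in cq_vars qp -> exists u d, [/\ y = wcode u, walk_to u = Some d & size u <= n.+1].
Proof.
have W u d : u \in words n -> walk_to u = Some d -> size u <= n.+1.
  move=> uW _; elim: n u uW => [|k IH] u /=; first by case/mapP => a _ ->.
  rewrite mem_cat => /orP [/IH/leqW //|/allpairsP [[i v] [_ /= /IH h ->]]] //.
move=> /InP /In_flatten [s /In_map [t /In_filter [/in_qatoms Ht /pbP H] <-] /InP].
case: t Ht H => [A z|R z z'] /=.
  move=> [_ [u uW ->]] [u' [d [/wcode_inj <- E _]]]; rewrite inE => /eqP ->.
  by exists u, d; split=> //; apply: W E.
move=> [_ [u [v [uW vW -> ->]]]] [|].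
  move=> [u' [i [d [e [C [/wcode_inj <- /wcode_inj Ev E G _]]]]]].
  have E2 := walk_rcons E G; rewrite -Ev in E2.
  by rewrite !inE => /orP [] /eqP ->; [exists u, d|exists v, e]; split=> //; apply: W; eauto.
move=> [a [b [/wcode_inj Eu /wcode_inj Ev /ind_R [aK bK]]]]; rewrite !inE.
by move=> /orP [] /eqP ->; [exists u, (iint I2 a)|exists v, (iint I2 b)];
   rewrite ?Eu ?Ev /= ?aK ?bK.
Qed.

Lemma qp_rooted : rooted_cq qans qp.
Proof.
move=> y /qp_live [u [d [-> E lt]]] _; elim: u d E lt => // i [|a u] IH d E lt.
  exists (wcode [:: i]); last exact: rt_refl.
  by apply: map_f; rewrite mem_undup; move: E => /=; case: ifP.
have := E; rewrite walk_cons; case E' : (walk_to (a :: u)) => [d'|] // _.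
have [x xq C] := IH _ E' (ltnW lt); exists x => //; apply: rt_trans C; apply: rt_step.
by have [R HR] := @qp_edge i (a :: u) d isT E lt; exists R; right.
Qed.

Lemma qp_psim (pi : var -> dom I1) k u d : (forall t, List.In t qp -> sat_atom pi t) ->
  walk_to u = Some d -> size u + k <= n.+1 -> psim S exs k d (pi (wcode u)).
Proof.
move=> Hpi; elim: k u d => [|k IH] u d E lt.
  split=> // A AS Hd; apply: (Hpi (CAtom A (wcode u))); apply/In_filter; split.
    apply/in_qatoms; split=> //; exists u => //; apply: words_sub (walk_words E); lia.
  by apply/pbP; exists u, d.
split.
  move=> A AS Hd; apply: (Hpi (CAtom A (wcode u))); apply/In_filter; split.
    apply/in_qatoms; split=> //; exists u => //; apply: words_sub (walk_words E); lia.
  by apply/pbP; exists u, d.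
move=> R C HC RS Hex.
have [i Oi] : exists i, onth exs i = Some (R, C).
  elim: (exs) HC => //= x l IHl [->|/IHl [i Oi]]; first by exists 0.
  by exists i.+1.
have [e W] := wgood_ex Oi RS Hex; have E2 := walk_rcons E W.
have [R' [C' []]] := wgoodP W; rewrite Oi => -[<- <-] _ HR HC'.
exists e, (pi (wcode (i :: u))); split=> //; last by apply: IH => //=; lia.
apply: (Hpi (RAtom R _ _)); apply/In_filter; split.
  apply/in_qatoms; split=> //; exists u, (i :: u); split=> //.
    by apply: words_sub (walk_words E); lia.
  by apply: words_sub (walk_words E2) => /=; lia.
by apply/pbP; left; exists u, i, d, e, C.
Qed.

Hypothesis bad : ~ ((forall R a b, List.In (RAssert R a b) (abox K2) -> R \in sig_r S ->
    rint R (iint I1 a) (iint I1 b)) /\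
  (forall a, a \in ind K2 -> psim S exs n (iint I2 a) (iint I1 a))).

Lemma qp_in : List.In qp (disjuncts query).
Proof.
apply/In_filter; split.
  have Hs : size (map qtrue qatoms) == size qatoms by rewrite size_map.
  apply/In_map; exists (Tuple Hs); last by rewrite /= -filter_mask.
  by apply/InP; rewrite mem_enum.
apply/pbP; split; first exact: qp_rooted.
move=> [pi [Epi Hpi]]; apply: bad.
have Hind a : a \in ind K2 -> pi (wcode [:: a]) = iint I1 a.
  move: Epi; rewrite -map_comp => /eq_in_map E aK.
  by apply: E; rewrite mem_undup.
split=> [R a b H RS|a aK].
  have [aK bK] := ind_R H; rewrite -!Hind //; apply: (Hpi (RAtom R _ _)); apply/In_filter; split.
    apply/in_qatoms; split=> //; exists [:: a], [:: b]; split=> //;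
      by apply: (@words_sub 0) => //=; rewrite map_f.
  by apply/pbP; right; exists a, b.
by rewrite -Hind //; apply: qp_psim => //=; rewrite aK.
Qed.

Lemma query_sat : sat_ucq I2 query qinds.
Proof.
exists qp; first exact: qp_in.
exists qmap; split; last exact: qp_sat.
rewrite /= -map_comp; apply/eq_in_map => a; rewrite mem_undup => aK /=.
by apply: qmapE; rewrite /= aK.
Qed.

End Query.

(** If no model of [K2] were simulated in [I1] to depth [n], each would satisfy the conjunction read
    off its own walks, which is false in [I1] and hence a disjunct of [query]. Then [K2] entails
    [query], and so does [K1], although [query] fails in [I1]. *)
Lemma entails_psim S K1 K2 I1 exs n : rucq_entails S K1 K2 -> model I1 K1 ->
  exists I2, [/\ model I2 K2,
    (forall R a b, List.In (RAssert R a b) (abox K2) -> R \in sig_r S ->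
       rint R (iint I1 a) (iint I1 b)) &
    (forall a, a \in ind K2 -> psim S exs n (iint I2 a) (iint I1 a))].
Proof.
move=> ent M1; apply: NNPP => none.
have [|||||_ /(_ _ M1) [p Hp HI1]] := ent (query S K2 I1 exs n) (qinds K2).
- split=> [|p /In_filter [_ /pbP [] //]].
  by rewrite map_inj_uniq ?undup_uniq // => a b /wcode_inj [].
- apply/all_In => p /In_filter [/In_map [m _ <-] _]; apply/all_In => t Ht.
  have {Ht} : List.In t (qatoms S K2 exs n).
    elim: (qatoms S K2 exs n) (val m) Ht => [|x l IH] [|b m'] //=.
    by case: b => /= [[->|/IH]|/IH]; auto.
  by move=> /in_qatoms; case: t => [A z|R z z'] /= [].
- by rewrite size_map.
- by move=> a; rewrite mem_undup.
- move=> I2 M2; apply: query_sat => // -[h1 h2]; apply: none; exists I2; split=> //.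
by move: Hp => /In_filter [_ /pbP [_]]; apply.
Qed.

(** * Decoding words *)

Lemma bit_num i w : bit i (num w) = nth false w i.
Proof.
elim: w i => [|b w IH] [|i]; rewrite /bit ?nth_nil ?div0n //=.
  by rewrite divn1 oddD oddM /=; case: b.
have E : (b + 2 * num w) %/ 2 = num w by case: b; lia.
by rewrite expnS divnMA E -IH.
Qed.

Lemma set_ex B (P : nat -> Prop) : exists Y, Y < 2 ^ B /\ forall x, bit x Y <-> x < B /\ P x.
Proof.
exists (num (mkseq (fun x => pb (P x)) B)); split.
  by have := num_lt (mkseq (fun x => pb (P x)) B); rewrite size_mkseq.
move=> x; rewrite bit_num; case: (ltnP x B) => h; last first.
  by rewrite nth_default ?size_mkseq //; split=> // -[].
by rewrite nth_mkseq //; split=> [/pbP|[_ /pbP]].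
Qed.

(** * Correctness of the parsing of names and concepts *)

Section Word.

Variable w : seq bool.
Local Notation n := (size w).
Local Notation N := (usize n).
Local Notation M := (2 ^ (n + n)).

Lemma n_lt_M : n < M.
Proof. by apply: leq_ltn_trans (ltn_expl _ _); rewrite ?leq_addl. Qed.

Lemma M_gt0 : 0 < M. Proof. by rewrite expn_gt0. Qed.

Lemma M3_lt_N : 2 ^ (M * M * M) <= N.
Proof. by rewrite /usize leq_exp2l // -!expnD leq_exp2l //; lia. Qed.

Lemma M3_ltN : M * M * M < N.
Proof. by apply: leq_trans M3_lt_N; apply: ltn_expl. Qed.

Lemma M_le_M3 : M <= M * M * M.
Proof. by have := M_gt0; rewrite -mulnA => h; rewrite leq_pmulr // muln_gt0 h. Qed.

Lemma M_lt_N : M < N.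
Proof. exact: leq_ltn_trans M_le_M3 M3_ltN. Qed.

Lemma n_lt_N : n + n < N.
Proof. by apply: ltn_trans M_lt_N; apply: ltn_expl. Qed.

Lemma set2_lt_N : 2 ^ M <= N.
Proof. by apply: leq_trans M3_lt_N; rewrite leq_exp2l // M_le_M3. Qed.

Lemma pair_lt V s : V < 2 ^ M -> s < M -> V * M + s < N.
Proof.
move=> hV hs; apply: (@leq_trans (V.+1 * M)); first by rewrite mulSnr ltn_add2l.
apply: (@leq_trans (2 ^ M * M)); first by rewrite leq_mul2r hV orbT.
apply: (@leq_trans (2 ^ M * 2 ^ M)); first by apply: leq_mul => //; apply: ltnW; apply: ltn_expl.
rewrite -expnD /usize leq_exp2l // addnn -mul2n -expnS leq_exp2l //; lia.
Qed.

(** [i] runs up to [M * M] so that it may itself be a pair, as in the triples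
    [(a * M + i) * M + t']. *)
Lemma rel_ex (P : nat -> nat -> Prop) : exists Y, Y < N /\
  forall i j, i < M * M -> j < M -> (bit (i * M + j) Y <-> P i j).
Proof.
have [Y [lt HY]] := set_ex (M * M * M) (fun x => P (x %/ M) (x %% M)).
exists Y; split; first exact: leq_trans lt M3_lt_N.
move=> i j hi hj; rewrite HY divnMDl ?M_gt0 // modnMDl divn_small // modn_small // addn0.
split=> [[]|] // H; split=> //.
apply: (@leq_trans (i.+1 * M)); first by rewrite mulSnr ltn_add2l.
by rewrite leq_mul2r hi orbT.
Qed.

Lemma sub_ex (P : nat -> Prop) : exists Y, Y < N /\ forall x, bit x Y <-> x < M /\ P x.
Proof.
have [Y [lt HY]] := set_ex M P; exists Y; split=> //; exact: leq_trans lt set2_lt_N.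
Qed.

Definition at_ T (e : T -> seq bool) i x j :=
  [/\ i <= n, j <= n & drop i w = e x ++ drop j w].

Lemma drop_split i a b : i <= n -> drop i w = a ++ b ->
  [/\ i + size a <= n, drop (i + size a) w = b & forall x, x < size a -> nth false w (i + x) = nth false a x].
Proof.
move=> hi E; have Es : n - i = size a + size b by rewrite -size_drop E size_cat.
split; first by lia.
  by rewrite addnC -drop_drop E drop_size_cat.
by move=> x lt; rewrite -nth_drop E nth_cat lt.
Qed.

Lemma drop_inj i j : i <= n -> j <= n -> drop i w = drop j w -> i = j.
Proof. by move=> hi hj /(congr1 size); rewrite !size_drop; lia. Qed.

Lemma at_fun T (e : T -> seq bool) i x x' j j' : prefix_inj e ->
  at_ e i x j -> at_ e i x' j' -> x = x' /\ j = j'.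
Proof.
move=> He [h1 h2 E] [_ h4 E']; have [-> Ed] := He _ _ _ _ (etrans (esym E) E').
by split=> //; apply: drop_inj.
Qed.

Lemma at_end T (e : T -> seq bool) i x j : at_ e i x j -> j = i + size (e x).
Proof.
case=> h1 h2 E; have [h3 E2 _] := drop_split h1 E.
by apply: drop_inj.
Qed.

Lemma at_intro T (e : T -> seq bool) i x b : i <= n -> drop i w = e x ++ b ->
  at_ e i x (i + size (e x)) /\ drop (i + size (e x)) w = b.
Proof. by move=> hi E; have [h E2 _] := drop_split hi E; split=> //; split=> //; rewrite E2. Qed.

Variable p : par.
Hypothesis pnE : pn p = n.
Hypothesis pWE : pW p = num w.
Hypothesis pME : pM p = M.

Lemma bwE i : bw p i = nth false w i.
Proof. by rewrite /bw pWE bit_num. Qed.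

Lemma bw_lt i : bw p i -> i < n.
Proof. by rewrite bwE; case: ltnP => // h; rewrite nth_default. Qed.

Lemma dropS i : i < n -> drop i w = bw p i :: drop i.+1 w.
Proof. by move=> h; rewrite bwE (drop_nth false). Qed.

Lemma pos_to l k : k + l + l < n -> (forall x, x < l -> bw p (k + x + x)) -> ~ bw p (k + l + l) ->
  exists q, drop k w = enc_pos q ++ drop (k + l + l).+1 w.
Proof.
elim: l k => [|l IH] k lt H1 H2.
  rewrite !addn0 in lt H2 *; exists BinNums.xH.
  by rewrite dropS //; case: (bw p k) H2 => // -[].
have h0 : bw p k by have := H1 0 isT; rewrite !addn0.
have [||| q Eq] := IH k.+2; first by lia.
- by move=> x xl; rewrite (_ : k.+2 + x + x = k + x.+1 + x.+1); [apply: H1|lia].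
- by rewrite (_ : k.+2 + l + l = k + l.+1 + l.+1); [|lia].
exists (if bw p k.+1 then BinNums.xI q else BinNums.xO q).
rewrite dropS; last by lia.
rewrite h0 dropS; last by lia.
rewrite Eq (_ : k.+2 + l + l = k + l.+1 + l.+1); last by lia.
by case: (bw p k.+1).
Qed.

Lemma pos_of q k j : k <= n -> j <= n -> drop k w = enc_pos q ++ drop j w ->
  exists l, [/\ j = (k + l + l).+1, forall x, x < l -> bw p (k + x + x) & ~ bw p (k + l + l)].
Proof.
elim: q k => [q IH|q IH|] k hk hj.
- move=> /[dup] /(drop_split (a := [:: true; true]) hk) /= [h1 h2 h3] _.
  rewrite addn2 in h1 h2; have [l [-> H1 H2]] := IH _ h1 hj h2; exists l.+1; split; first by lia.
    case=> [|x] xl; first by rewrite !addn0 bwE -[k]addn0 h3.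
    by rewrite (_ : k + x.+1 + x.+1 = k.+2 + x + x); [apply: H1|lia].
  by rewrite (_ : k + l.+1 + l.+1 = k.+2 + l + l); [|lia].
- move=> /[dup] /(drop_split (a := [:: true; false]) hk) /= [h1 h2 h3] _.
  rewrite addn2 in h1 h2; have [l [-> H1 H2]] := IH _ h1 hj h2; exists l.+1; split; first by lia.
    case=> [|x] xl; first by rewrite !addn0 bwE -[k]addn0 h3.
    by rewrite (_ : k + x.+1 + x.+1 = k.+2 + x + x); [apply: H1|lia].
  by rewrite (_ : k + l.+1 + l.+1 = k.+2 + l + l); [|lia].
- move=> /[dup] /(drop_split (a := [:: false]) hk) /= [h1 h2 h3] _.
  rewrite addn1 in h1 h2; exists 0; rewrite !addn0; split=> //.
    by apply/esym; apply: drop_inj.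
  by rewrite bwE -[k]addn0 h3.
Qed.

Lemma inatP i j : inat N p i j <-> exists x, at_ enc_nat i x j.
Proof.
rewrite /inat pnE; split.
  case=> [[h1 [h2 ->]]|[h1 [l [_ [-> [h3 [h4 h5]]]]]]].
    exists 0; split=> //; first exact: ltnW.
    by rewrite dropS //; case: (bw p i) h2 => // -[].
  have lt := bw_lt h1.
  have [||| q Eq] := @pos_to l i.+1; first by lia.
  - by move=> x xl; apply: (h4 x) => //; have := n_lt_N; lia.
  - by [].
  exists (nat_of_bin (BinNums.Npos q)); split=> //; first exact: ltnW.
  by rewrite /enc_nat nat_of_binK dropS // h1 Eq.
move=> [x [hi hj]]; rewrite /enc_nat; case: (bin_of_nat x) => [|q] E.
  have [/= h1 h2 h3] := drop_split (a := [:: false]) hi E; left.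
  rewrite addn1 in h1 h2; split=> //; split; first by rewrite bwE -[i]addn0 h3.
  by apply/esym; apply: drop_inj.
have [/= h1 h2 h3] := drop_split (a := [:: true]) hi E; right.
rewrite addn1 in h1 h2; split; first by rewrite bwE -[i]addn0 h3.
have [l [Ej H1 H2]] := pos_of h1 hj h2; subst j; exists l; split; first by have := n_lt_N; lia.
by split=> //; split; [lia|split=> // y _; apply: H1].
Qed.

Lemma nth_take_drop i a b x : i <= n -> drop i w = a ++ b -> x < size a ->
  nth false a x = bw p (i + x).
Proof. by move=> hi E lt; rewrite bwE; have [_ _ ->] := drop_split hi E. Qed.

Lemma eqnameP i i' : eqname N p i i' <->
  exists x j j', at_ enc_nat i x j /\ at_ enc_nat i' x j'.
Proof.
split.
  move=> [j [_ [j' [_ [l [_ [/inatP [x Hx] [/inatP [x' Hx'] [Ej [Ej' H]]]]]]]]]].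
  exists x, j, j'; split=> //; suff -> : x = x' by [].
  have [h1 h2 E] := Hx; have [h1' h2' E'] := Hx'.
  have s1 : size (enc_nat x) = l by have := at_end Hx; lia.
  have s2 : size (enc_nat x') = l by have := at_end Hx'; lia.
  suff Ee : enc_nat x = enc_nat x' by have [] := enc_nat_inj (congr1 (cat^~ [::]) Ee).
  apply: (@eq_from_nth _ false) => [|y]; rewrite s1 ?s2 // => yl.
  rewrite (nth_take_drop h1 E) ?s1 // (nth_take_drop h1' E') ?s2 //.
  by apply/idP/idP => /(H y); apply=> //; have := n_lt_N; lia.
move=> [x [j [j' [Hx Hx']]]]; have lt := n_lt_N.
have [h1 h2 E] := Hx; have [h1' h2' E'] := Hx'.
exists j; split; first by lia.
exists j'; split; first by lia.
exists (size (enc_nat x)); split; first by have := at_end Hx; lia.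
split; first by apply/inatP; exists x.
split; first by apply/inatP; exists x.
split; first exact: at_end Hx.
split; first exact: at_end Hx'.
by move=> y _ yl; rewrite -(nth_take_drop h1 E) // -(nth_take_drop h1' E').
Qed.

Lemma tag3 i : i.+3 <= n -> drop i w = bw p i :: bw p i.+1 :: bw p i.+2 :: drop i.+3 w.
Proof.
move=> h; rewrite (@dropS i) 1?ltnW 1?ltnW //; congr (_ :: _).
rewrite (@dropS i.+1) 1?ltnW //; congr (_ :: _).
exact: dropS.
Qed.

Lemma concept_inv i C j : at_ enc_concept i C j -> i.+3 <= n /\
  match C with
  | Top => [/\ ~ bw p i, ~ bw p i.+1, ~ bw p i.+2 & j = i.+3]
  | Bot => [/\ ~ bw p i, ~ bw p i.+1, bw p i.+2 & j = i.+3]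
  | Atomic A => [/\ ~ bw p i, bw p i.+1, ~ bw p i.+2 & at_ enc_nat i.+3 A j]
  | Neg C => [/\ ~ bw p i, bw p i.+1, bw p i.+2 & at_ enc_concept i.+3 C j]
  | And C D => [/\ bw p i, ~ bw p i.+1, ~ bw p i.+2 &
      exists k, at_ enc_concept i.+3 C k /\ at_ enc_concept k D j]
  | Or C D => [/\ bw p i, ~ bw p i.+1, bw p i.+2 &
      exists k, at_ enc_concept i.+3 C k /\ at_ enc_concept k D j]
  | Ex R C => [/\ bw p i, bw p i.+1, ~ bw p i.+2 &
      exists k, at_ enc_nat i.+3 R k /\ at_ enc_concept k C j]
  | All R C => [/\ bw p i, bw p i.+1, bw p i.+2 &
      exists k, at_ enc_nat i.+3 R k /\ at_ enc_concept k C j]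
  end.
Proof.
case=> hi hj E.
have E3 : exists b1 b2 b3 v, enc_concept C = [:: b1, b2, b3 & v] by case: (C) => *; do 4 eexists.
have h3 : i.+3 <= n.
  have [b1 [b2 [b3 [v Ev]]]] := E3; rewrite Ev in E.
  by move/(congr1 size): E; rewrite size_drop /= ; lia.
split=> //; move: E; rewrite (tag3 h3).
have two (T U : Type) (e : T -> seq bool) (f : U -> seq bool) x y :
  drop i.+3 w = (e x ++ f y) ++ drop j w -> exists k, at_ e i.+3 x k /\ at_ f k y j.
  move=> E; rewrite -catA in E; have [H1 H2] := at_intro h3 E; exists (i.+3 + size (e x)); split=> //.
  by split=> //; case: H1.
by case: C E3 => [||A|C|C D|C D|R C|R C] _ /=; case=> -> -> -> E; split=> //;
  try (by apply: drop_inj); try exact: two E.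
Qed.

Lemma concept_intro i C j :
  match C with
  | Top => [/\ ~ bw p i, ~ bw p i.+1, ~ bw p i.+2, i.+3 <= n & j = i.+3]
  | Bot => [/\ ~ bw p i, ~ bw p i.+1, bw p i.+2, i.+3 <= n & j = i.+3]
  | Atomic A => [/\ ~ bw p i, bw p i.+1, ~ bw p i.+2 & at_ enc_nat i.+3 A j]
  | Neg C => [/\ ~ bw p i, bw p i.+1, bw p i.+2 & at_ enc_concept i.+3 C j]
  | And C D => [/\ bw p i, ~ bw p i.+1, ~ bw p i.+2 &
      exists k, at_ enc_concept i.+3 C k /\ at_ enc_concept k D j]
  | Or C D => [/\ bw p i, ~ bw p i.+1, bw p i.+2 &
      exists k, at_ enc_concept i.+3 C k /\ at_ enc_concept k D j]
  | Ex R C => [/\ bw p i, bw p i.+1, ~ bw p i.+2 &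
      exists k, at_ enc_nat i.+3 R k /\ at_ enc_concept k C j]
  | All R C => [/\ bw p i, bw p i.+1, bw p i.+2 &
      exists k, at_ enc_nat i.+3 R k /\ at_ enc_concept k C j]
  end -> at_ enc_concept i C j.
Proof.
have F (b : bool) : ~ b -> b = false by case: b => // -[].
have two (T U : Type) (e : T -> seq bool) (f : U -> seq bool) x y k : i.+3 <= n ->
  at_ e i.+3 x k -> at_ f k y j -> i.+3 <= n /\ drop i.+3 w = (e x ++ f y) ++ drop j w.
  by move=> h [_ _ E1] [_ _ E2]; rewrite E1 E2 catA.
case: C => [||A|C|C D|C D|R C|R C] /= .
- by case=> /F a /F b /F c h ->; split=> //; [lia|rewrite tag3 // a b c].
- by case=> /F a /F b c h ->; split=> //; [lia|rewrite tag3 // a b c].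
- by case=> /F a b /F c [h hj E]; split=> //; [lia|rewrite tag3 // a b c E].
- by case=> /F a b c [h hj E]; split=> //; [lia|rewrite tag3 // a b c E].
- case=> a /F b /F c [k [H1 H2]]; have [h _ _] := H1; have [_ hj _] := H2.
  by split=> //; [lia|rewrite tag3 // a b c /=; have [_ ->] := two _ _ _ _ _ _ _ h H1 H2].
- case=> a /F b c [k [H1 H2]]; have [h _ _] := H1; have [_ hj _] := H2.
  by split=> //; [lia|rewrite tag3 // a b c /=; have [_ ->] := two _ _ _ _ _ _ _ h H1 H2].
- case=> a b /F c [k [H1 H2]]; have [h _ _] := H1; have [_ hj _] := H2.
  by split=> //; [lia|rewrite tag3 // a b c /=; have [_ ->] := two _ _ _ _ _ _ _ h H1 H2].
- case=> a b c [k [H1 H2]]; have [h _ _] := H1; have [_ hj _] := H2.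
  by split=> //; [lia|rewrite tag3 // a b c /=; have [_ ->] := two _ _ _ _ _ _ _ h H1 H2].
Qed.

Lemma bitPairC i j Y : bit (i * pM p + j) Y = bit (i * M + j) Y.
Proof. by rewrite pME. Qed.

(** From left to right, [Y] is instantiated by the true parse relation, which is closed under
    [cstep] and has a code below [N]. From right to left, by induction on the concept, it is
    contained in every closed [Y]. *)
Lemma iconcP i j : iconc N p i j <-> exists C, at_ enc_concept i C j.
Proof.
have lt := n_lt_N; have ltM := n_lt_M; split.
  rewrite /iconc pnE => -[hi [hj H]]; have [Y [YN HY]] := rel_ex (fun i j => exists C, at_ enc_concept i C j).
  have HY' k l : k <= n -> l <= n -> bit (k * M + l) Y <-> exists C, at_ enc_concept k C l.
    move=> hk hl; apply: HY; last by lia.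
    by apply: (@leq_trans M); [lia|rewrite leq_pmulr ?M_gt0].
  apply/(HY' i j) => //; rewrite -bitPairC; apply: H => // i' i'N j' j'N [h1 [h2 h3]].
  rewrite pnE in h1 h2; have hi' : i' <= n by lia.
  rewrite bitPairC; apply/HY' => //.
  case: h3 => [[a [b ->]]|[[a [b [k [_ [-> H1]]]]]|[a [k [_ [l [_ [-> [hl [H1 H2]]]]]]]]]].
  - by case c : (bw p i'.+2); [exists Bot|exists Top]; apply: concept_intro; rewrite c.
  - case: H1 => [[c /inatP [A HA]]|[c]].
      by exists (Atomic A); apply: concept_intro.
    by rewrite bitPairC => /(HY' _ _ h1 h2) [C HC]; exists (Neg C); apply: concept_intro.
  rewrite pnE in hl; move: H2; rewrite bitPairC => /(HY' _ _ hl h2) [D HD].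
  case: H1 => [[b]|[b /inatP [R HR]]].
    rewrite bitPairC => /(HY' _ _ h1 hl) [C HC].
    by case c : (bw p i'.+2); [exists (Or C D)|exists (And C D)]; apply: concept_intro; rewrite c; split=> //; exists l.
  by case c : (bw p i'.+2); [exists (All R D)|exists (Ex R D)]; apply: concept_intro; rewrite c; split=> //; exists l.
move=> [C HC]; have [hi hj _] := HC; rewrite /iconc pnE; do 2 split=> //.
move=> Y YN HY; move: hi hj HC.
have step i' j' : i' <= n -> j' <= n -> cstep N p Y i' j' -> bit (i' * pM p + j') Y.
  by move=> h1 h2; apply: HY; lia.
elim: C i j => [||A|C IH|C IHC D IHD|C IHC D IHD|R C IH|R C IH] i j hi hj /concept_inv [h3] /=;
  rewrite /cstep ?pnE.
- by case=> a b c ->; apply: step => //; split; rewrite pnE //; split=> //; left.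
- by case=> a b c ->; apply: step => //; split; rewrite pnE //; split=> //; left.
- case=> a b c HA; apply: step => //; split; rewrite pnE //; split=> //; right; left; split=> //; split=> //.
  by exists i.+3; split; [lia|split=> //; left; split=> //; apply/inatP; exists A].
- case=> a b c HC; apply: step => //; split; rewrite pnE //; split=> //; right; left; split=> //; split=> //.
  by exists i.+3; split; [lia|split=> //; right; split=> //; apply: IH].
- case=> a b c [k [H1 H2]]; have [_ hk _] := H1; apply: step => //; split; rewrite pnE //; split=> //.
  right; right; split=> //; exists i.+3; split; first by lia.
  exists k; split; first by lia.
  by rewrite ?pnE; split=> //; split=> //; split; [left; split=> //; apply: IHC|apply: IHD].
- case=> a b c [k [H1 H2]]; have [_ hk _] := H1; apply: step => //; split; rewrite pnE //; split=> //.
  right; right; split=> //; exists i.+3; split; first by lia.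
  exists k; split; first by lia.
  by rewrite ?pnE; split=> //; split=> //; split; [left; split=> //; apply: IHC|apply: IHD].
- case=> a b c [k [H1 H2]]; have [_ hk _] := H1; apply: step => //; split; rewrite pnE //; split=> //.
  right; right; split=> //; exists i.+3; split; first by lia.
  exists k; split; first by lia.
  by rewrite ?pnE; split=> //; split=> //; split; [right; split=> //; apply/inatP; exists R|apply: IH].
- case=> a b c [k [H1 H2]]; have [_ hk _] := H1; apply: step => //; split; rewrite pnE //; split=> //.
  right; right; split=> //; exists i.+3; split; first by lia.
  exists k; split; first by lia.
  by rewrite ?pnE; split=> //; split=> //; split; [right; split=> //; apply/inatP; exists R|apply: IH].
Qed.

End Word.

(** * Correctness of the parsing of lists and of whole inputs *)

Section Lists.

Variable w : seq bool.
Local Notation n := (size w).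
Local Notation N := (usize n).
Local Notation M := (2 ^ (n + n)).

Variable p : par.
Hypothesis pnE : pn p = n.
Hypothesis pWE : pW p = num w.
Hypothesis pME : pM p = M.

Local Notation at_ := (at_ w).

Lemma at_cat T U (e : T -> seq bool) (f : U -> seq bool) i x y j :
  (exists k, at_ e i x k /\ at_ f k y j) <-> [/\ i <= n, j <= n & drop i w = e x ++ f y ++ drop j w].
Proof.
split=> [[k [[h1 h2 E1] [h3 h4 E2]]]|[h1 h2 E]]; first by split=> //; rewrite E1 E2.
have [H1 H2] := at_intro h1 E; exists (i + size (e x)); split=> //.
by case: H1.
Qed.

Section Elements.

Variables (T : Type) (e : T -> seq bool) (el : nat -> par -> nat -> nat -> Prop).
Hypothesis e_inj : prefix_inj e.
Hypothesis elP : forall i j, bw p i -> (el N p i j <-> exists x, at_ e i.+1 x j).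

Lemma at_nil i j : at_ (enc_seq e) i [::] j <-> [/\ i < n, ~ bw p i & j = i.+1].
Proof.
split=> [[h1 h2 E]|[h1 h2 ->]].
  have lt : i < n by move/(congr1 size): E; rewrite size_drop /=; lia.
  move: E; rewrite (dropS pWE) //= => -[-> E]; split=> //.
  by apply/esym; apply: drop_inj E.
split=> //; first exact: ltnW.
by rewrite (dropS pWE) //; case: (bw p i) h2 => // -[].
Qed.

Lemma at_cons i x l j : at_ (enc_seq e) i (x :: l) j <->
  bw p i /\ exists k, at_ e i.+1 x k /\ at_ (enc_seq e) k l j.
Proof.
rewrite at_cat; split=> [[h1 h2 E]|[b [h1 h2 E]]].
  have lt : i < n by move/(congr1 size): E; rewrite size_drop /=; lia.
  by move: E; rewrite (dropS pWE) //= -catA => -[-> E].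
split=> //; first exact: ltnW.
by rewrite (dropS pWE) ?(bw_lt pWE) // b E /= catA.
Qed.

Lemma reachP s l s' q : at_ (enc_seq e) s l s' ->
  reach el N p s q <-> exists l1 l2, l = l1 ++ l2 /\ at_ (enc_seq e) q l2 s'.
Proof.
move=> Hl; have lt := n_lt_N w; have ltM := n_lt_M w; split.
  have [Y [YN HY]] := sub_ex w (fun q => exists l1 l2, l = l1 ++ l2 /\ at_ (enc_seq e) q l2 s').
  move=> /(_ Y YN) H; suff /HY [] : bit q Y by [].
  apply: H; first by apply/HY; split; [case: Hl; lia|exists [::], l].
  move=> i iN j jN /HY [_ [l1 [l2 [E Hi]]]] bi /(elP _ bi) [x Hx].
  have [_ jn _] := Hx; apply/HY; split; first by lia.
  case: l2 Hi E => [|x' l2] Hi E; first by case/at_nil: Hi.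
  move/at_cons: Hi => [_ [k [H1 H2]]]; have [_ Ek] := at_fun e_inj Hx H1.
  by exists (rcons l1 x'), l2; rewrite cat_rcons Ek.
move=> [l1 [l2 [E Hq]]] Y YN sY HY; elim: l1 l s E Hl sY => [|x l1 IH] l s E Hl sY.
  suff -> : q = s by [].
  by move: (at_end Hl) (at_end Hq); rewrite E /=; lia.
rewrite E /= in Hl; move/at_cons: Hl => [bs [k [H1 H2]]]; apply: (IH _ k (erefl _) H2).
have [_ hk _] := H1.
apply: HY (bs) _; rewrite ?elP //; try by [lia|exists x].
by have := bw_lt pWE bs; lia.
Qed.

Lemma at_tail s l1 l2 s' : at_ (enc_seq e) s (l1 ++ l2) s' -> exists q, at_ (enc_seq e) q l2 s'.
Proof.
elim: l1 s => [|x l1 IH] s; first by exists s.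
by move=> /at_cons [_ [k [_ /IH]]].
Qed.

(** No list is given in advance for the direction from left to right. The set used there consists of
    the [q] from which every coded list can be extended backwards to a coded list at [s]. *)
Lemma endsP s s' : s <= n -> ends el N p s s' <-> exists l, at_ (enc_seq e) s l s'.
Proof.
move=> hs; have lt := n_lt_N w; have ltM := n_lt_M w; split.
  rewrite /ends pnE => -[q [qN [H [qn [b ->]]]]].
  have [Y [YN HY]] := sub_ex w (fun q => q <= n /\ exists l1, forall l2 j,
    at_ (enc_seq e) q l2 j -> at_ (enc_seq e) s (l1 ++ l2) j).
  suff /HY [_ [_ [l1 H1]]] : bit q Y by exists (l1 ++ [::]); apply/H1/at_nil.
  apply: H => //; first by apply/HY; split; [lia|split=> //; exists [::]].
  move=> i iN j jN /HY [_ [hi [l1 H]]] bi /(elP _ bi) [x Hx].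
  have [_ jn _] := Hx; apply/HY; split; first by lia.
  split=> //; exists (rcons l1 x) => l2 k Hk; rewrite cat_rcons; apply: H.
  by apply/at_cons; split=> //; exists j.
move=> [l Hl]; have [q Hq] : exists q, at_ (enc_seq e) q [::] s'.
  by apply: (@at_tail s l); rewrite cats0.
have R : reach el N p s q by apply/(reachP _ Hl); exists l, [::]; rewrite cats0.
by have /at_nil [h1 h2 h3] := Hq; exists q; rewrite pnE; do !split=> //; lia.
Qed.

Lemma reach_elt s l s' q : at_ (enc_seq e) s l s' -> reach el N p s q -> bw p q ->
  exists x k, [/\ List.In x l, at_ e q.+1 x k & k <= n].
Proof.
move=> Hl /(reachP _ Hl) [l1 [l2 [E H]]] b; case: l2 H E => [|x l2] H E.
  by case/at_nil: H.
move/at_cons: H => [_ [k [H1 H2]]]; exists x, k; split=> //; last by case: H1.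
by rewrite E; apply/In_cat; right; left.
Qed.

Lemma elt_reach s l s' x : at_ (enc_seq e) s l s' -> List.In x l ->
  exists q k, [/\ reach el N p s q, bw p q, at_ e q.+1 x k & q < n].
Proof.
move=> Hl Hx; have [l1 [l2 E]] := List.in_split _ _ Hx.
have E' : l = l1 ++ x :: l2 by [].
rewrite E' in Hl; have [q Hq] := at_tail Hl.
have R : reach el N p s q by apply/(reachP _ Hl); exists l1, (x :: l2).
by move/at_cons: Hq => [b [k [H1 _]]]; exists q, k; split=> //; apply: (bw_lt pWE).
Qed.

End Elements.

Lemma elCIP i j : bw p i -> elCI N p i j <-> exists x, at_ enc_ci i.+1 x j.
Proof.
move=> b; have lt := n_lt_N w; split.
  move=> [i1 [_ [k [_ [-> [/(iconcP pnE pWE pME) [C HC] /(iconcP pnE pWE pME) [D HD]]]]]]].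
  exists (C, D); have /at_cat [h1 h2 E] : exists k, at_ enc_concept i.+1 C k /\ at_ enc_concept k D j by exists k.
  by split=> //; rewrite E /enc_ci catA.
move=> [[C D] [h1 h2 E]]; rewrite /enc_ci -catA /= in E.
have /at_cat [k [H1 H2]] : [/\ i.+1 <= n, j <= n & drop i.+1 w = enc_concept C ++ enc_concept D ++ drop j w] by [].
have [_ hk _] := H1; exists i.+1; split; first by lia.
exists k; split; first by lia.
by split=> //; split; apply/(iconcP pnE pWE pME); [exists C|exists D].
Qed.

Lemma elNP i j : bw p i -> elN N p i j <-> exists x, at_ enc_nat i.+1 x j.
Proof.
move=> b; have lt := n_lt_N w; have := bw_lt pWE b => hi; split.
  by move=> [i1 [_ [-> H]]]; apply/(inatP pnE pWE pME).
by move=> H; exists i.+1; split; [lia|split=> //; apply/(inatP pnE pWE pME)].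
Qed.

Lemma at_assert i s j : at_ enc_assertion i s j <-> i < n /\
  match s with
  | CAssert A a => ~ bw p i /\ exists k, at_ enc_nat i.+1 A k /\ at_ enc_nat k a j
  | RAssert R a b => bw p i /\ exists k l, [/\ at_ enc_nat i.+1 R k, at_ enc_nat k a l & at_ enc_nat l b j]
  end.
Proof.
have F (b : bool) : ~ b -> b = false by case: b => // -[].
split=> [[h1 h2 E]|[lt]].
  have lt : i < n by move/(congr1 size): E; rewrite size_drop; case: s => [A a|R a b] /=; lia.
  split=> //; move: E; rewrite (dropS pWE) //; case: s => [A a|R a b] /= [-> E]; split=> //.
    by apply/at_cat; rewrite catA.
  have E' : drop i.+1 w = enc_nat R ++ (enc_nat a ++ enc_nat b ++ drop j w) by rewrite E -!catA.
  have [H1 H2] := at_intro lt E'; have [_ hk _] := H1.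
  have /at_cat [l [H3 H4]] : [/\ i.+1 + size (enc_nat R) <= n, j <= n & drop (i.+1 + size (enc_nat R)) w = enc_nat a ++ enc_nat b ++ drop j w] by [].
  by exists (i.+1 + size (enc_nat R)), l.
case: s => [A a|R a b] [b1].
  move=> /at_cat [h1 h2 E]; split=> //; first exact: ltnW.
  by rewrite (dropS pWE) // E (F _ b1) /= -catA.
move=> [k [l [[h1 h2 E1] [h3 h4 E2] [h5 h6 E3]]]]; split=> //; first exact: ltnW.
by rewrite (dropS pWE) // b1 E1 E2 E3 /= -!catA.
Qed.

Lemma elAsP i j : bw p i -> elAs N p i j <-> exists x, at_ enc_assertion i.+1 x j.
Proof.
have iP := inatP pnE pWE pME; move=> b; have lt := n_lt_N w; split.
  move=> [i2 [_ [k [_ [l [_ [-> [/iP [x Hx] [/iP [y Hy] H]]]]]]]]].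
  have [lt1 _ _] := Hx; case: H => [[b1 ->]|[b1 /iP [z Hz]]].
    by exists (CAssert x y); apply/at_assert; split=> //; split=> //; exists k.
  by exists (RAssert x y z); apply/at_assert; split=> //; split=> //; exists k, l.
move=> [[A a|R a a'] /at_assert [lt1 [b1 H]]].
  have {H} [k [H1 H2]] := H; have [_ hk _] := H1; have [_ hl _] := H2.
  exists i.+2; split; first by lia.
  exists k; split; first by lia.
  exists j; split; first by lia.
  by split=> //; split; [apply/iP; exists A|split; [apply/iP; exists a|left]].
have {H} [k [l [H1 H2 H3]]] := H; have [_ hk _] := H1; have [_ hl _] := H2.
exists i.+2; split; first by lia.
exists k; split; first by lia.
exists l; split; first by lia.
split=> //; split; first by apply/iP; exists R.
by split; [apply/iP; exists a|right; split=> //; apply/iP; exists a'].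
Qed.

Record facts (K1 K2 : kb) (S : signature) : Prop := Facts {
  ft1 : at_ (enc_seq enc_ci) (pt1 p) (tbox K1) (pa1 p);
  fa1 : at_ (enc_seq enc_assertion) (pa1 p) (abox K1) (pt2 p);
  ft2 : at_ (enc_seq enc_ci) (pt2 p) (tbox K2) (pa2 p);
  fa2 : at_ (enc_seq enc_assertion) (pa2 p) (abox K2) (psc p);
  fsc : at_ (enc_seq enc_nat) (psc p) (sig_c S) (psr p);
  fsr : at_ (enc_seq enc_nat) (psr p) (sig_r S) n }.

Lemma wf_facts : wf N p <-> pt1 p = 0 /\ exists K1 K2 S, facts K1 K2 S.
Proof.
have lt := n_lt_N w; have ltM : n + n < M by apply: ltn_expl.
(* The only bit of [2 ^ (n + n)] is bit [n + n]; this is how formulas without exponentiation pin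
   down [pM]. *)
have pMP : forall x, x < N -> (bit x (pM p) <-> x = pn p + pn p).
  move=> x _; rewrite pME pnE /bit; split=> [|->]; last by rewrite divnn expn_gt0.
  case: (ltngtP x (n + n)) => // h.
    rewrite -[n + n in X in odd X](subnK (ltnW h)) expnD mulnK ?expn_gt0 //.
    by rewrite -(subnSK h) expnS oddM.
  by rewrite divn_small // ltn_exp2l.
split.
  move=> [_ [t0 [/endsP H1 [/endsP H2 [/endsP H3 [/endsP H4 [/endsP H5 [k [_ [/endsP H6 kn]]]]]]]]]].
  have [T1 H1'] := H1 _ _ enc_ci_inj elCIP (leq_trans (eq_leq t0) (leq0n _)); have [_ h1 _] := H1'.
  have [A1 H2'] := H2 _ _ enc_assertion_inj elAsP h1; have [_ h2 _] := H2'.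
  have [T2 H3'] := H3 _ _ enc_ci_inj elCIP h2; have [_ h3 _] := H3'.
  have [A2 H4'] := H4 _ _ enc_assertion_inj elAsP h3; have [_ h4 _] := H4'.
  have [sc H5'] := H5 _ _ enc_nat_inj elNP h4; have [_ h5 _] := H5'.
  have [sr H6'] := H6 _ _ enc_nat_inj elNP h5; rewrite kn pnE in H6'.
  by split=> //; exists (KB T1 A1), (KB T2 A2), (Signature sc sr).
move=> [t0 [K1 [K2 [S [F1 F2 F3 F4 F5 F6]]]]].
have [h0 h1 _] := F1; have [_ h2 _] := F2; have [_ h3 _] := F3; have [_ h4 _] := F4; have [_ h5 _] := F5.
split=> //; split=> //.
split; first by apply/(endsP enc_ci_inj elCIP) => //; eexists; eauto.
split; first by apply/(endsP enc_assertion_inj elAsP) => //; eexists; eauto.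
split; first by apply/(endsP enc_ci_inj elCIP) => //; eexists; eauto.
split; first by apply/(endsP enc_assertion_inj elAsP) => //; eexists; eauto.
split; first by apply/(endsP enc_nat_inj elNP) => //; eexists; eauto.
exists n; split; first by lia.
by split; [apply/(endsP enc_nat_inj elNP) => //; eexists; eauto|].
Qed.

Lemma facts_word K1 K2 S : pt1 p = 0 -> facts K1 K2 S -> w = enc_input (K1, K2, S).
Proof.
move=> t0 [[_ _ F1] [_ _ F2] [_ _ F3] [_ _ F4] [_ _ F5] [_ _ F6]].
rewrite t0 drop0 in F1; rewrite F1 F2 F3 F4 F5 F6 drop_size cats0.
by rewrite /enc_input /enc_kb /enc_signature -!catA.
Qed.

End Lists.

Lemma word_facts K1 K2 S : let w := enc_input (K1, K2, S) in exists a1 t2 a2 sc sr,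
  let p := Par (size w) (num w) (2 ^ (size w + size w)) 0 a1 t2 a2 sc sr in
  [/\ facts w p K1 K2 S, a1 <= size w, t2 <= size w, a2 <= size w & sc <= size w /\ sr <= size w].
Proof.
move=> w; have Ew : w = enc_seq enc_ci (tbox K1) ++ enc_seq enc_assertion (abox K1) ++
  enc_seq enc_ci (tbox K2) ++ enc_seq enc_assertion (abox K2) ++ enc_seq enc_nat (sig_c S) ++
  enc_seq enc_nat (sig_r S) ++ [::].
  by rewrite cats0 /w /enc_input /enc_kb /enc_signature -!catA.
have E0 := etrans (drop0 w) Ew.
have [H1 D1] := at_intro (leq0n _) E0; have [_ h1 _] := H1.
have [H2 D2] := at_intro h1 D1; have [_ h2 _] := H2.
have [H3 D3] := at_intro h2 D2; have [_ h3 _] := H3.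
have [H4 D4] := at_intro h3 D3; have [_ h4 _] := H4.
have [H5 D5] := at_intro h4 D4; have [_ h5 _] := H5.
have [H6 D6] := at_intro h5 D5; have [_ h6 _] := H6.
have E6 j : j <= size w -> drop j w = [::] -> j = size w.
  by move=> h /(congr1 size); rewrite size_drop /=; lia.
rewrite (E6 _ h6 D6) in H6.
do 5 eexists; split; [|exact: h1|exact: h2|exact: h3|split; [exact: h4|exact: h5]].
by split.
Qed.

(** * Types of elements *)

Section Semantics.

Variable w : seq bool.
Local Notation n := (size w).
Local Notation N := (usize n).
Local Notation M := (2 ^ (n + n)).

Variable p : par.
Hypothesis pnE : pn p = n.
Hypothesis pWE : pW p = num w.
Hypothesis pME : pM p = M.

Definition NA i x := exists j, at_ w enc_nat i x j.
Definition CA i C := exists j, at_ w enc_concept i C j.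

Lemma NA_fun i x x' : NA i x -> NA i x' -> x = x'.
Proof. by move=> [j H] [j' H']; have [] := at_fun enc_nat_inj H H'. Qed.

Lemma CA_fun i C C' : CA i C -> CA i C' -> C = C'.
Proof. by move=> [j H] [j' H']; have [] := at_fun enc_concept_inj H H'. Qed.

Lemma NA_lt i x : NA i x -> i < n.
Proof.
move=> [j [h1 h2 E]]; move/(congr1 size): E; rewrite size_drop size_cat /enc_nat.
by case: bin_of_nat => [|q] /=; lia.
Qed.

Lemma CA_lt i C : CA i C -> i < n.
Proof. by move=> [j /(concept_inv pnE pWE pME) [h _]]; lia. Qed.

Let ltnN : n + n < N := n_lt_N w.
Let ltMN : M < N := M_lt_N w.
Let ltnM : n < M := n_lt_M w.

Lemma eqnameE i i' : eqname N p i i' <-> exists x, NA i x /\ NA i' x.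
Proof.
rewrite (eqnameP pnE pWE pME); split=> [[x [j [j' [H H']]]]|[x [[j H] [j' H']]]].
  by exists x; split; [exists j|exists j'].
by exists x, j, j'.
Qed.

Lemma eqnameEr i i' x : NA i x -> eqname N p i i' <-> NA i' x.
Proof.
move=> H; rewrite eqnameE; split=> [[y [H1 H2]]|H']; last by exists x.
by rewrite (NA_fun H H1).
Qed.

Lemma eqnameEl i i' x : NA i' x -> eqname N p i i' <-> NA i x.
Proof.
move=> H; rewrite eqnameE; split=> [[y [H1 H2]]|H']; last by exists x.
by rewrite (NA_fun H H2).
Qed.

Definition quant (b : bool) R C := if b then All R C else Ex R C.

Let inatE := inatP pnE pWE pME.
Let iconcE := iconcP pnE pWE pME.
Let concept_invE := concept_inv pnE pWE pME.

Definition MA i c R C := [/\ at_ w enc_nat i.+3 R c, CA c C & CA i (quant (bw p i.+2) R C)].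

Lemma modalE i c : modal N p i c <-> exists R C, MA i c R C.
Proof.
split.
  move=> [b0 [b1 [[k [_ [-> /inatE [R HR]]]] [j [_ /iconcE [C HC]]]]]].
  have [h3] := concept_invE HC.
  case: C HC => [||A|C|C D|C D|R' C|R' C] HC [] // _ _ b2 [k' [HR' HC']];
    have [? ?] := at_fun enc_nat_inj HR HR'; subst R' k'; exists R, C; split=> //;
    by [exists j|case: (bw p i.+2) b2 => // _; exists j|rewrite b2; exists j].
move=> [R [C [HR _ [j HC]]]].
have [hi hc _] := HR.
suff [b0 b1] : bw p i /\ bw p i.+1.
  split=> //; split=> //; split; first by exists i.+3; split; [lia|split=> //; apply/inatE; exists R].
  by exists j; split; [case: HC; lia|apply/iconcE; eexists; exact: HC].
by move: HC; rewrite /quant; case: (bw p i.+2) => /concept_invE [_ []].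
Qed.

Lemma MA_ex i R C b : CA i (quant b R C) -> exists c, MA i c R C /\ bw p i.+2 = b.
Proof.
move=> [j HC]; suff [Eb [k [H1 H2]]] : bw p i.+2 = b /\ exists k, at_ w enc_nat i.+3 R k /\ at_ w enc_concept k C j.
  by exists k; split=> //; split=> //; [exists j|rewrite Eb; exists j].
by case: b HC => /concept_invE [_ [_ _]]; [|move=> /negP/negbTE]; move=> -> [k H]; split=> //; exists k.
Qed.

Lemma MA_fun i c c' R C R' C' : MA i c R C -> MA i c' R' C' -> [/\ c = c', R = R' & C = C'].
Proof.
move=> [H1 H2 _] [H1' H2' _]; have [-> E] := at_fun enc_nat_inj H1 H1'; rewrite E in H2 *.
by split=> //; apply: CA_fun H2 H2'.
Qed.

Lemma MA_NA i c R C : MA i c R C -> NA i.+3 R. Proof. by case=> H _ _; exists c. Qed.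

Lemma MA_lt i c R C : MA i c R C -> i < N /\ c < N.
Proof. by case=> _ /CA_lt h1 /CA_lt h2; lia. Qed.

Lemma samerE i i' c c' R C R' C' : MA i c R C -> MA i' c' R' C' -> samer N p i i' <-> R = R'.
Proof.
move=> /MA_NA H /MA_NA H'; have h := NA_lt H; have h' := NA_lt H'; split.
  by move=> [k [_ [k' [_ [-> [-> /(eqnameEr _ H) HR]]]]]]; apply: NA_fun HR H'.
move=> ER; rewrite ER in H; exists i.+3; split; first by lia.
exists i'.+3; split; first by lia.
by do 2 split=> //; apply/(eqnameEr _ H).
Qed.

Lemma compatmE i t t' c R C : MA i c R C -> compatm N p i t t' <-> compat N p i.+3 t t'.
Proof.
move=> /MA_NA/NA_lt h; split=> [[k [_ [-> H]]] //|H].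
by exists i.+3; split=> //; lia.
Qed.

Lemma compat_role r r' R t t' : NA r R -> NA r' R -> compat N p r t t' -> compat N p r' t t'.
Proof.
move=> Hr Hr' H i iN c cN Hm [k [kN [Ek He]]]; apply: H => //; exists k; split=> //; split=> //.
by apply/(eqnameEr _ Hr); move/(eqnameEr _ Hr'): He.
Qed.

Definition tpP I (d : dom I) x :=
  (x < n /\ exists C, CA x C /\ ext C d) \/ (n <= x /\ exists A, NA (x - n) A /\ cint A d).

Definition tp I (d : dom I) : nat :=
  proj1_sig (constructive_indefinite_description _ (set_ex (n + n) (tpP d))).

Lemma tpE I (d : dom I) : tp d < M /\ forall x, bit x (tp d) <-> x < n + n /\ tpP d x.
Proof. exact: (proj2_sig (constructive_indefinite_description _ (set_ex (n + n) (tpP d)))). Qed.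

Lemma tp_lt I (d : dom I) : tp d < M. Proof. by case: (tpE d). Qed.

Lemma tp_CA I (d : dom I) i C : CA i C -> bit i (tp d) <-> ext C d.
Proof.
move=> H; have h := CA_lt H; have [_ ->] := tpE d; split=> [[_ [[_ [C' [/(CA_fun H) ->]]] //|[]]]|Hd].
  by lia.
by split; [lia|left; split=> //; exists C].
Qed.

Lemma tp_NA I (d : dom I) i A : NA i A -> bit (n + i) (tp d) <-> cint A d.
Proof.
move=> H; have h := NA_lt H; have [_ ->] := tpE d; split=> [[_ [[]|[_ [A' []]]]]|Hd].
- by lia.
- by rewrite addKn => /(NA_fun H) ->.
by split; [lia|right; split; [lia|exists A; rewrite addKn]].
Qed.

Lemma tp_okc I (d : dom I) i c R C : MA i c R C ->
  okc p i c (tp d) <-> (if bw p i.+2 then ~ ext C d else ext C d).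
Proof.
move=> [_ HC _]; rewrite /okc (tp_CA _ HC).
case: (bw p i.+2); split=> [[h1 h2]|h].
- by move=> h; apply: (h1 h).
- by split=> // h' _; apply: h.
- by apply: h2.
- by split=> // _.
Qed.

(** An element outside [All R C] needs an [R]-successor outside [C]. Treating universal restrictions
    as negated existential ones lets both kinds share [dem] and [okc]. *)
Lemma tp_dem I (d : dom I) i c R C : MA i c R C ->
  dem p i (tp d) <-> exists e, rint R d e /\ okc p i c (tp e).
Proof.
move=> HM; have [_ _ HQ] := HM; rewrite /dem (tp_CA _ HQ) /quant.
have E e := tp_okc e HM; case: (bw p i.+2) E => E; split.
- move=> [h1 h2]; apply: NNPP => none; suff: ext (All R C) d by move=> h; exact: (h1 h isT).
  move=> e He /=; apply: NNPP => Ne; apply: none; exists e; split=> //.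
  by apply/E.
- by move=> [e [He /E Ne]]; split=> // h; case: Ne; apply: h.
- by move=> [_ h2]; have [//|e [He Ce]] := h2; exists e; split=> //; apply/E.
- by move=> [e [He /E Ce]]; split=> // _; exists e.
Qed.

Lemma tp_compat I (d e : dom I) r R : NA r R -> rint R d e -> compat N p r (tp d) (tp e).
Proof.
move=> Hr He i iN c cN /modalE [R' [C HM]] [k [_ [-> /(eqnameEr _ Hr) Hk]]] Hok.
apply/(tp_dem _ HM); exists e; split=> //.
by rewrite -(NA_fun Hk (MA_NA HM)).
Qed.

Lemma tp_lcond I (d : dom I) i C j : at_ w enc_concept i C j -> lcond N p i (tp d).
Proof.
move=> HC; have HCA : CA i C by exists j.
have T := tp_CA d HCA; have [h3] := concept_invE HC; rewrite /lcond.
case: C HC {HCA} T => [||A|C|C D|C D|R' C|R' C] HC /= T [] b0 b1 b2 H; do !split=> //; try tauto.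
- by have HA : NA i.+3 A by [exists j]; rewrite T pnE (tp_NA d HA).
- have HA : NA i.+3 A by exists j.
  by rewrite T pnE (tp_NA d HA).
- by have HD : CA i.+3 C by [exists j]; rewrite T (tp_CA d HD).
- by have HD : CA i.+3 C by [exists j]; rewrite T (tp_CA d HD).
- move=> _ _; have [k [H1 H2]] := H; have HD : CA i.+3 C by exists k.
  have HE : CA k D by exists j.
  have [_ hk _] := H1; exists i.+3; split; first by lia.
  exists k; split; first by lia.
  split=> //; split; first by apply/iconcE; exists C.
  by rewrite T (tp_CA d HD) (tp_CA d HE); split; tauto.
move=> _ _; have [k [H1 H2]] := H; have HD : CA i.+3 C by exists k.
have HE : CA k D by exists j.
have [_ hk _] := H1; exists i.+3; split; first by lia.
exists k; split; first by lia.
split=> //; split; first by apply/iconcE; exists C.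
by rewrite T (tp_CA d HD) (tp_CA d HE); split; tauto.
Qed.

Let at_catE := at_cat.
Let at_assertE := at_assert pnE pWE pME.

Section KB.

Variables (K : kb) (tb te ab ae : nat).
Hypothesis Ht : at_ w (enc_seq enc_ci) tb (tbox K) te.
Hypothesis Ha : at_ w (enc_seq enc_assertion) ab (abox K) ae.

Let elC := elCIP pnE pWE pME.
Let elA := elAsP pnE pWE pME.

Lemma ci_of q : reach elCI N p tb q -> bw p q -> exists C D k,
  [/\ List.In (C, D) (tbox K), at_ w enc_concept q.+1 C k & CA k D].
Proof.
move=> H b; have [[C D] [j [HI [h1 h2 E] _]]] := reach_elt pnE pWE pME enc_ci_inj elC Ht H b.
have [k [H1 H2]] : exists k, at_ w enc_concept q.+1 C k /\ at_ w enc_concept k D j.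
  by apply/at_catE; split=> //; rewrite E /enc_ci catA.
by exists C, D, k; split=> //; exists j.
Qed.

Lemma ci_ex C D : List.In (C, D) (tbox K) -> exists q k,
  [/\ q < n, reach elCI N p tb q, bw p q, at_ w enc_concept q.+1 C k & CA k D].
Proof.
move=> HI; have [q [j [H b [h1 h2 E] h]]] := elt_reach pnE pWE pME enc_ci_inj elC Ht HI.
have [k [H1 H2]] : exists k, at_ w enc_concept q.+1 C k /\ at_ w enc_concept k D j.
  by apply/at_catE; split=> //; rewrite E /enc_ci catA.
by exists q, k; split=> //; exists j.
Qed.

Lemma cass_of A a : cass N p ab A a -> exists An an,
  [/\ NA A An, NA a an & List.In (CAssert An an) (abox K)].
Proof.
move=> [q [_ [H [b [b1 [-> /inatE [x Hx]]]]]]].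
have [s [j [HI /at_assertE [_ Hs] _]]] := reach_elt pnE pWE pME enc_assertion_inj elA Ha H b.
case: s HI Hs => [A' a'|R a' b'] HI [b2 Hs]; last by case: b1.
have [k [H1 H2]] := Hs; have [EA Ek] := at_fun enc_nat_inj Hx H1; subst k A'.
by exists x, a'; split=> //; [exists a|exists j].
Qed.

Lemma cass_ex An an : List.In (CAssert An an) (abox K) -> exists A a,
  [/\ cass N p ab A a, NA A An & NA a an].
Proof.
move=> HI; have [q [j [H b /at_assertE [_ [b1 [k [H1 H2]]]] h]]] := elt_reach pnE pWE pME enc_assertion_inj elA Ha HI.
exists q.+2, k; split; [|by exists k|by exists j].
exists q; split; first by lia.
by do 4 split=> //; apply/inatE; exists An.
Qed.

Lemma rass_of R a b : rass N p ab R a b -> exists Rn an bn,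
  [/\ NA R Rn, NA a an, NA b bn & List.In (RAssert Rn an bn) (abox K)].
Proof.
move=> [q [_ [H [b0 [b1 [-> [/inatE [x Hx] /inatE [y Hy]]]]]]]].
have [s [j [HI /at_assertE [_ Hs] _]]] := reach_elt pnE pWE pME enc_assertion_inj elA Ha H b0.
case: s HI Hs => [A' a'|R' a' b'] HI [b2 Hs]; first by case: b2.
have [k [l [H1 H2 H3]]] := Hs; have [EA Ek] := at_fun enc_nat_inj Hx H1; subst k R'.
have [EA Ek] := at_fun enc_nat_inj Hy H2; subst l a'.
by exists x, y, b'; split=> //; [exists a|exists b|exists j].
Qed.

Lemma rass_ex Rn an bn : List.In (RAssert Rn an bn) (abox K) -> exists R a b,
  [/\ rass N p ab R a b, NA R Rn, NA a an & NA b bn].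
Proof.
move=> HI; have [q [j [H b /at_assertE [_ [b1 [k [l [H1 H2 H3]]]]] h]]] := elt_reach pnE pWE pME enc_assertion_inj elA Ha HI.
exists q.+2, k, l; split; [|by exists k|by exists l|by exists j].
exists q; split; first by lia.
by do 4 split=> //; split; apply/inatE; [exists Rn|exists an].
Qed.

Lemma indE an : an \in ind K -> (exists An, List.In (CAssert An an) (abox K)) \/
  exists Rn bn, List.In (RAssert Rn an bn) (abox K) \/ List.In (RAssert Rn bn an) (abox K).
Proof.
move=> /InP /In_flatten [s /In_map [[A a|R a b] HI <-]] /=.
  by case=> // <-; left; exists A.
by case=> [<-|[<-|//]]; right; exists R; [exists b; left|exists a; right].
Qed.

Lemma indp_of a : indp N p ab a -> exists an, NA a an /\ an \in ind K.
Proof.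
have I s x : List.In s (abox K) -> List.In x (assertion_inds s) -> x \in ind K.
  by move=> h1 h2; apply/InP/In_flatten; exists (assertion_inds s) => //; apply/In_map; exists s.
case=> [[A [_ /cass_of [An [an [_ H /I HI]]]]]|[R [_ [b [_ [|] /rass_of [Rn [an [bn [_ H1 H2 /I HI]]]]]]]]].
- by exists an; split=> //; apply: HI; left.
- by exists an; split=> //; apply: HI; left.
- by exists bn; split=> //; apply: HI; right; left.
Qed.

Lemma ind0_ex an : an \in ind K -> exists a, ind0 N p ab a /\ NA a an.
Proof.
move=> HI; have H : exists a, indp N p ab a /\ NA a an.
  have [[An]|[Rn [bn [|]]]] := indE HI.
  - move=> /cass_ex [A [a [H H1 H2]]]; exists a; split=> //; left; exists A; split=> //.
    by have := NA_lt H1; lia.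
  - move=> /rass_ex [R [a [b [H H1 H2 H3]]]]; exists a; split=> //; right; exists R.
    split; first by have := NA_lt H1; lia.
    by exists b; split; [have := NA_lt H3; lia|left].
  - move=> /rass_ex [R [a [b [H H1 H2 H3]]]]; exists b; split=> //; right; exists R.
    split; first by have := NA_lt H1; lia.
    by exists a; split; [have := NA_lt H2; lia|right].
have [|a /pbP [Hp HN] min] := @ex_minnP (fun a => pb (indp N p ab a /\ NA a an)).
  by have [a Ha'] := H; exists a; apply/pbP.
exists a; split=> //; split=> // a' _ lt Hp' /eqnameE [x [H1 H2]].
have : pb (indp N p ab a' /\ NA a' an) by apply/pbP; rewrite (NA_fun HN H2).
by move/min; lia.
Qed.

Lemma ind0_of a : ind0 N p ab a -> exists an, NA a an /\ an \in ind K.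
Proof. by case=> /indp_of. Qed.

Lemma ind0_fun a a' x : ind0 N p ab a -> ind0 N p ab a' -> NA a x -> NA a' x -> a = a'.
Proof.
move=> [Hp H] [Hp' H'] Hx Hx'; have := NA_lt Hx; have := NA_lt Hx'.
case: (ltngtP a a') => // lt h1 h2.
  by case: (H' a) => //; [lia|apply/eqnameE; exists x].
by case: (H a') => //; [lia|apply/eqnameE; exists x].
Qed.

Lemma tp_ltype I (d : dom I) : model I K -> ltype N p tb (tp d).
Proof.
move=> [HT _]; split; first by rewrite pME; apply: tp_lt.
split; first by move=> i _ j _ /iconcE [C HC]; apply: tp_lcond HC.
split.
  move=> i _ i' _ /eqnameE [x [H H']].
  by rewrite pnE (tp_NA d H) (tp_NA d H').
move=> q qN k kN H b [q1 [_ [-> /iconcE [C0 HC0]]]].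
have [C [D [k' [HI HC HD]]]] := ci_of H b.
have [? ?] := at_fun enc_concept_inj HC0 HC; subst k' C0.
have HCA : CA q.+1 C by exists k.
by rewrite (tp_CA d HCA) (tp_CA d HD); apply: HT.
Qed.

Lemma tp_real I (d : dom I) : model I K -> real N p tb (tp d).
Proof.
move=> HM; have [Y [YN HY]] := sub_ex w (fun t => exists e : dom I, t = tp e).
exists Y; split=> //; split; first by apply/HY; split; [apply: tp_lt|exists d].
move=> t tN /HY [tM [e ->]]; split; first exact: tp_ltype.
move=> i iN c cN /modalE [R [C HMA]] /(tp_dem _ HMA) [e' [He Hok]].
exists (tp e'); split; first by have := tp_lt e'; lia.
split; first by apply/HY; split; [apply: tp_lt|exists e'].
by split=> //; apply/(compatmE _ _ HMA); apply: tp_compat He; apply: MA_NA HMA.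
Qed.

(* An interpretation whose elements are labelled with types, such that labels
   and extensions agree on names. *)
Record lab I (lam : dom I -> nat) : Prop := Lab {
  lab_real : forall d, real N p tb (lam d);
  lab_atom : forall d i A, NA i A -> bit (n + i) (lam d) <-> cint A d;
  lab_edge : forall d e R r, rint R d e -> NA r R -> compat N p r (lam d) (lam e);
  lab_wit : forall d i c R C, MA i c R C -> dem p i (lam d) ->
    exists e, rint R d e /\ okc p i c (lam e) }.

Lemma real_ltype t : real N p tb t -> ltype N p tb t.
Proof.
move=> [Y [YN [tY H]]]; have tN : t < N by case: (ltnP t N) => // h; rewrite (bit_big YN h) in tY.
by have [] := H t tN tY.
Qed.

Lemma real_lt t : real N p tb t -> t < M.
Proof. by move=> /real_ltype []; rewrite pME. Qed.

Lemma real_wit t i c R C : real N p tb t -> MA i c R C -> dem p i t ->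
  exists t', [/\ real N p tb t', compatm N p i t t' & okc p i c t'].
Proof.
move=> [Y [YN [tY H]]] HM Hd; have [hi hc] := MA_lt HM.
have tN : t < N by case: (ltnP t N) => // h; rewrite (bit_big YN h) in tY.
have [_ /(_ i hi c hc _ Hd)] := H _ tN tY.
case; first by apply/modalE; exists R, C.
by move=> t' [t'N [t'Y [h1 h2]]]; exists t'; split=> //; exists Y.
Qed.

(** Induction on the concept. For a restriction, [lab_wit] supplies a witness if the label demands
    one, and [lab_edge] excludes any witness if it does not, since compatibility would turn it into
    a demand. *)
Lemma lab_truth I (lam : dom I -> nat) : lab lam ->
  forall C i d, CA i C -> bit i (lam d) <-> ext C d.
Proof.
move=> HL; elim=> [||A|C IH|C IHC D IHD|C IHC D IHD|R C IH|R C IH] i d [j HC].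
all: have [hlt [/(_ i) Hl _]] := real_ltype (lab_real HL d).
all: have [h1 h2 _] := HC; have := Hl _ j _ _; rewrite /lcond pnE => {}Hl.
all: have {}Hl := Hl (ltac:(have := CA_lt (ex_intro _ _ HC : CA i _); lia)) (ltac:(lia)) (ltac:(by apply/iconcE; eexists; exact: HC)).
all: have [h3] := concept_invE HC.
- by case=> b0 b1 b2 _; have [Hl1 _] := Hl; have := Hl1 b0 b1; rewrite /=; tauto.
- by case=> b0 b1 b2 _; have [Hl1 _] := Hl; have := Hl1 b0 b1; rewrite /=; tauto.
- case=> b0 b1 b2 HA; have [_ [Hl1 _]] := Hl; rewrite (Hl1 b0 b1 b2).
  by apply: (lab_atom HL); exists j.
- case=> b0 b1 b2 HC'; have [_ [_ [Hl1 _]]] := Hl; rewrite (Hl1 b0 b1 b2).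
  by rewrite /= (IH _ d (ex_intro _ _ HC')).
- case=> b0 b1 b2 [k [H1 H2]]; have [_ [_ [_ Hl1]]] := Hl.
  have [k' [_ [l [_ [-> [/iconcE [C' HC'] ->]]]]]] := Hl1 b0 b1.
  have [? ?] := at_fun enc_concept_inj HC' H1; subst C' l.
  by rewrite /= (IHC _ d (ex_intro _ _ H1)) (IHD _ d (ex_intro _ _ H2)); tauto.
- case=> b0 b1 b2 [k [H1 H2]]; have [_ [_ [_ Hl1]]] := Hl.
  have [k' [_ [l [_ [-> [/iconcE [C' HC'] ->]]]]]] := Hl1 b0 b1.
  have [? ?] := at_fun enc_concept_inj HC' H1; subst C' l.
  by rewrite /= (IHC _ d (ex_intro _ _ H1)) (IHD _ d (ex_intro _ _ H2)); tauto.
- move=> _; have [c [HM b2]] := @MA_ex i R C false (ex_intro _ _ HC).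
  have [_ HCc _] := HM; have [hi hc] := MA_lt HM; split.
    move=> Hi; have [|e [He Ho]] := lab_wit HL HM (d := d); first by rewrite /dem b2; split.
    exists e; split=> //; apply/(IH c e HCc).
    by case: Ho => _; rewrite b2; apply.
  move=> [e [He /(IH c e HCc) Hc]].
  have := lab_edge HL He (MA_NA HM) hi hc; rewrite /dem /okc b2.
  move=> H; apply H; first by apply/modalE; exists R, C.
  - by have hr := NA_lt (MA_NA HM); exists i.+3; split; [lia|split=> //; apply/(eqnameEr _ (MA_NA HM))/(MA_NA HM)].
  - by split.
  by [].
- move=> _; have [c [HM b2]] := @MA_ex i R C true (ex_intro _ _ HC).
  have [_ HCc _] := HM; have [hi hc] := MA_lt HM; split.
    move=> Hi e He; apply/(IH c e HCc); apply: NNPP => Ne.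
    have := lab_edge HL He (MA_NA HM) hi hc; rewrite /dem /okc b2.
    case=> [||| H _]; [by apply/modalE; exists R, C| |by split|by case: (H Hi)].
    by have hr := NA_lt (MA_NA HM); exists i.+3; split; [lia|split=> //; apply/(eqnameEr _ (MA_NA HM))/(MA_NA HM)].
  move=> Hall; apply: NNPP => Ni.
  have [|e [He]] := lab_wit HL HM (d := d); first by rewrite /dem b2; split.
  by rewrite /okc b2 => -[H _]; have /(IH c e HCc) := Hall e He => /H; apply.
Qed.

Lemma lab_model I (lam : dom I -> nat) : lab lam ->
  (forall s, List.In s (abox K) -> sat_assertion I s) -> model I K.
Proof.
move=> HL HA; split=> // C D HI d.
have [q [k [qn H b HC HD]]] := ci_ex HI.
have [_ [_ [_ Hl]]] := real_ltype (lab_real HL d).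
rewrite -(lab_truth HL d HD) -(lab_truth HL d (ex_intro _ _ HC : CA _ C)).
have := CA_lt HD; have := CA_lt (ex_intro _ _ HC : CA _ C) => h1 h2.
apply: (Hl q _ k) => //; try by lia.
by exists q.+1; split; [lia|split=> //; apply/iconcE; exists C].
Qed.

End KB.

End Semantics.

(** * Models built from assignments of types to individuals *)

Section Assignments.

Variable w : seq bool.
Local Notation n := (size w).
Local Notation N := (usize n).
Local Notation M := (2 ^ (n + n)).

Variable p : par.
Hypothesis pnE : pn p = n.
Hypothesis pWE : pW p = num w.
Hypothesis pME : pM p = M.

Local Notation NA := (NA w).
Local Notation MA := (MA w p).
Let ltnN : n + n < N := n_lt_N w.
Let ltMN : M < N := M_lt_N w.
Let ltnM : n < M := n_lt_M w.

Variables (K : kb) (tb te ab ae : nat).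
Hypothesis Ht : at_ w (enc_seq enc_ci) tb (tbox K) te.
Hypothesis Ha : at_ w (enc_seq enc_assertion) ab (abox K) ae.

Lemma NA_ltN i x : NA i x -> i < N. Proof. by move/(NA_lt pnE pWE pME); lia. Qed.
Lemma NA_ltM2 i x : NA i x -> i < M * M.
Proof. by move/(NA_lt pnE pWE pME) => h; apply: (@leq_trans M); [lia|rewrite leq_pmulr ?M_gt0]. Qed.

Lemma pairM a t : a * pM p + t = a * M + t. Proof. by rewrite pME. Qed.

Lemma real_ltM t : real N p tb t -> t < M.
Proof. exact: real_lt. Qed.

Definition cintL A (lam : iname + A -> nat) C (d : iname + A) :=
  exists i, NA i C /\ bit (n + i) (lam d).

Lemma build (A : Type) (lam : iname + A -> nat) (E : rname -> iname + A -> iname + A -> Prop) :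
  (forall d, real N p tb (lam d)) ->
  (forall R d e r, E R d e -> NA r R -> compat N p r (lam d) (lam e)) ->
  (forall d i c R C, MA i c R C -> dem p i (lam d) -> exists e, E R d e /\ okc p i c (lam e)) ->
  (forall C x, List.In (CAssert C x) (abox K) -> exists i, NA i C /\ bit (n + i) (lam (inl x))) ->
  (forall R x y, List.In (RAssert R x y) (abox K) -> E R (inl x) (inl y)) ->
  model (Interp (cintL lam) E) K.
Proof.
move=> HR HE HW HC HA; apply: (lab_model pnE pWE pME Ht (I := Interp (cintL lam) E) (lam := lam)).
  split=> //.
  - move=> d i C Hi; split=> [Hb|[i' [Hi' Hb]]]; first by exists i.
    have [_ [_ [He _]]] := real_ltype (HR d).
    rewrite pnE in He; apply/(He i (NA_ltN Hi) i' (NA_ltN Hi')) => //.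
    by apply/(eqnameE pnE pWE pME); exists C.
  - by move=> d e R r; apply: HE.
move=> s; case: s => [C x|R x y] HI; [exact: (HC C x HI)|exact: (HA R x y HI)].
Qed.

(** Every individual name is an element of the domain, so names outside the ABox need a label too;
    they receive the realizable type [t0]. *)
Lemma asg_fun T t0 : real N p tb t0 -> asg N p tb ab T -> exists tau : iname -> nat,
  [/\ forall x, real N p tb (tau x),
      forall x, x \in ind K -> exists a, [/\ ind0 N p ab a, NA a x & bit (a * M + tau x) T],
      forall C x, List.In (CAssert C x) (abox K) -> exists i, NA i C /\ bit (n + i) (tau x) &
      forall R x y r, List.In (RAssert R x y) (abox K) -> NA r R -> compat N p r (tau x) (tau y)].
Proof.
move=> H0 [H1 [H2 [H3 H4]]].
have HX x : exists t, real N p tb t /\ (x \in ind K ->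
    exists a, [/\ ind0 N p ab a, NA a x & bit (a * M + t) T]).
  case: (boolP (x \in ind K)) => xK; last by exists t0.
  have [a [Ia Na]] := ind0_ex pnE pWE pME Ha xK.
  have [t [_ [Hr]]] := H1 a (NA_ltN Na) Ia; rewrite pairM => HT.
  by exists t; split=> // _; exists a.
pose tau x := proj1_sig (constructive_indefinite_description _ (HX x)).
have Htau x : real N p tb (tau x) /\ (x \in ind K ->
    exists a, [/\ ind0 N p ab a, NA a x & bit (a * M + tau x) T]).
  exact: (proj2_sig (constructive_indefinite_description _ (HX x))).
have lt x : tau x < M by apply: real_ltM; case: (Htau x).
exists tau; split; first by move=> x; case: (Htau x).
- by move=> x; case: (Htau x).
- move=> C x HI; have xK : x \in ind K.
    by apply/InP/In_flatten; exists [:: x]; [apply/In_map; exists (CAssert C x)|left].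
  have [_ /(_ xK) [a [Ia Na HT]]] := Htau x.
  have [A [a' [Hc NC Na']]] := cass_ex pnE pWE pME Ha HI.
  exists A; split=> //; rewrite -pnE; apply: (H3 A (NA_ltN NC) a (NA_ltN Na) (tau x)) => //.
  - by have := lt x; lia.
  - split=> //; exists a'; split; first exact: NA_ltN Na'.
    by split=> //; apply/(eqnameE pnE pWE pME); exists x.
  - by rewrite pME.
  by rewrite pairM.
move=> R x y r HI Hr; have [xK yK] : x \in ind K /\ y \in ind K.
  by split; apply/InP/In_flatten; exists [:: x; y];
    [apply/In_map; exists (RAssert R x y)|left|apply/In_map; exists (RAssert R x y)|right; left].
have [_ /(_ xK) [a [Ia Na HTa]]] := Htau x.
have [_ /(_ yK) [b [Ib Nb HTb]]] := Htau y.
have [R' [a' [b' [Hc NR Na' Nb']]]] := rass_ex pnE pWE pME Ha HI.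
apply: (compat_role pnE pWE pME NR Hr).
apply: (H4 R' (NA_ltN NR) a (NA_ltN Na) b (NA_ltN Nb) (tau x) _ (tau y)) => //; rewrite ?pME ?pairM //.
- by have := lt x; lia.
- by have := lt y; lia.
split=> //; split=> //; exists a'; split; first exact: NA_ltN Na'.
exists b'; split; first exact: NA_ltN Nb'.
by split; [apply/(eqnameE pnE pWE pME); exists x|split=> //; apply/(eqnameE pnE pWE pME); exists y].
Qed.

Lemma asg_tp I : model I K -> exists T, [/\ T < N, asg N p tb ab T &
  forall a x t, NA a x -> t < M -> bit (a * M + t) T <-> t = tp w (iint I x)].
Proof.
move=> HM; have [T [TN HT]] := rel_ex w (fun a t => exists x, NA a x /\ t = tp w (iint I x)).
have HT' a x t : NA a x -> t < M -> bit (a * M + t) T <-> t = tp w (iint I x).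
  move=> Na tM; rewrite HT //; last exact: NA_ltM2 Na.
  by split=> [[y [/(NA_fun Na) -> ->]] //|->]; exists x.
exists T; split=> //; split.
  move=> a aN /(ind0_of pnE pWE pME Ha) [x [Na _]]; exists (tp w (iint I x)).
  have lt := tp_lt w (iint I x); split; first by lia.
  by split; [exact: (tp_real pnE pWE pME Ht _ HM)|rewrite pairM; apply/(HT' _ x)].
split.
  move=> a aN t tN t' t'N /(ind0_of pnE pWE pME Ha) [x [Na _]]; rewrite pME => tM t'M.
  by move=> /(HT' _ _ _ Na tM) -> /(HT' _ _ _ Na t'M) ->.
split.
  move=> A AN a aN t tN [/(ind0_of pnE pWE pME Ha) [x [Na _]] [a' [_ [/(eqnameEl pnE pWE pME _ Na) Na' Hc]]]].
  rewrite pME => tM /(HT' _ _ _ Na tM) ->.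
  have [C [y [NC Ny HI]]] := cass_of pnE pWE pME Ha Hc.
  by rewrite pnE (tp_NA pnE pWE pME _ NC) (NA_fun Na' Ny); apply: HM.2 HI.
move=> R RN a aN b bN t tN t' t'N [/(ind0_of pnE pWE pME Ha) [x [Na _]] [/(ind0_of pnE pWE pME Ha) [y [Nb _]]]].
move=> [a' [_ [b' [_ [/(eqnameEl pnE pWE pME _ Na) Na' [/(eqnameEl pnE pWE pME _ Nb) Nb' Hc]]]]]].
rewrite pME => tM t'M /(HT' _ _ _ Na tM) -> /(HT' _ _ _ Nb t'M) ->.
have [R' [x' [y' [NR Nx Ny HI]]]] := rass_of pnE pWE pME Ha Hc.
rewrite (NA_fun Na' Nx) (NA_fun Nb' Ny); apply: (tp_compat pnE pWE pME NR); exact: HM.2 HI.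
Qed.

Lemma consE : cons N p tb ab <-> consistent K.
Proof.
split=> [[[t0 [_ H0]] [T [_ HT]]]|[I HM]]; last first.
  split; last by have [T [TN HT _]] := asg_tp HM; exists T.
  exists (tp w (iint I 0)); split; first by have := tp_lt w (iint I 0); lia.
  exact: (tp_real pnE pWE pME Ht _ HM).
have [tau [h1 h2 h3 h4]] := asg_fun H0 HT.
(* The anonymous elements are the realizable types themselves, with an edge into each of them from
   every element whose label is compatible with it. *)
pose A := {t | real N p tb t}.
pose lam (d : iname + A) := match d with inl x => tau x | inr s => proj1_sig s end.
pose E R (d e : iname + A) := (exists x y, [/\ d = inl x, e = inl y & List.In (RAssert R x y) (abox K)]) \/
  (exists s : A, e = inr s /\ forall r, NA r R -> compat N p r (lam d) (proj1_sig s)).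
exists (Interp (cintL lam) E).
have Hlam d : real N p tb (lam d) by case: d => [x|[t]] /=.
apply: build => //.
- by move=> R d e r [[x [y [-> -> HI]]]|[s [-> H]]] Hr; [apply: h4 HI Hr|apply: H].
- move=> d i c R C HM Hd; have [t' [Hr Hc Ho]] := real_wit pnE pWE pME (Hlam d) HM Hd.
  exists (inr (exist _ t' Hr)); split=> //; right; exists (exist _ t' Hr); split=> // r NR.
  move/(compatmE pnE pWE pME _ _ HM): Hc => Hc.
  exact: (compat_role pnE pWE pME (MA_NA HM) NR Hc).
by move=> R x y HI; left; exists x, y.
Qed.

End Assignments.

(** * Refutations in a model *)

Section Directions.

Variable w : seq bool.
Local Notation n := (size w).
Local Notation N := (usize n).
Local Notation M := (2 ^ (n + n)).

Variable p : par.
Hypothesis pnE : pn p = n.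
Hypothesis pWE : pW p = num w.
Hypothesis pME : pM p = M.

Variables (K1 K2 : kb) (S : signature).
Hypothesis F : facts w p K1 K2 S.

Local Notation NA := (NA w).
Local Notation MA := (MA w p).
Local Notation real1 := (real N p (pt1 p)).
Local Notation real2 := (real N p (pt2 p)).
Let ltnN : n + n < N := n_lt_N w.
Let ltMN : M < N := M_lt_N w.
Let ltnM : n < M := n_lt_M w.
Let NA_ltn := @NA_lt w p pnE pWE pME.
Let MA_ltN := @MA_lt w p pnE pWE pME.
Let NA_ltN' := @NA_ltN w p pnE pWE pME.
Let realM t tb : real N p tb t -> t < M := @real_ltM w p pME tb t.

Lemma sigC_of i : sigC N p i -> exists A, NA i A /\ A \in sig_c S.
Proof.
move=> [q [_ [-> [H b]]]].
have [A [k [HI HA _]]] := reach_elt pnE pWE pME enc_nat_inj (elNP pnE pWE pME) (fsc F) H b.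
by exists A; split; [exists k|apply/InP].
Qed.

Lemma sigC_ex A : A \in sig_c S -> exists i, sigC N p i /\ NA i A.
Proof.
move=> /InP HI.
have [q [k [H b HA hq]]] := elt_reach pnE pWE pME enc_nat_inj (elNP pnE pWE pME) (fsc F) HI.
by exists q.+1; split; [exists q; split; [lia|]|exists k].
Qed.

Lemma sigRE r R : NA r R -> sigR N p r <-> R \in sig_r S.
Proof.
move=> Hr; split.
  move=> [q [_ [H [b [k [_ [-> /(eqnameEr pnE pWE pME _ Hr) HR]]]]]]].
  have [A [k' [HI HA _]]] := reach_elt pnE pWE pME enc_nat_inj (elNP pnE pWE pME) (fsr F) H b.
  by rewrite (NA_fun HR (ex_intro _ _ HA)); apply/InP.
move=> /InP HI.
have [q [k [H b HA hq]]] := elt_reach pnE pWE pME enc_nat_inj (elNP pnE pWE pME) (fsr F) HI.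
exists q; split; first by lia.
have HN : NA q.+1 R by exists k.
do 2 split=> //; exists q.+1; split; first exact: NA_ltN' HN.
by split=> //; apply/(eqnameEr pnE pWE pME _ Hr).
Qed.

Lemma sigRmE i c R C : MA i c R C -> sigRm N p i <-> R \in sig_r S.
Proof.
move=> HM; have Hr := MA_NA HM; rewrite -(sigRE Hr); split=> [[r [_ [-> H]]] //|H].
by exists i.+3; split; [exact: NA_ltN' Hr|].
Qed.

Lemma wit_lt t i c t' : wit N p t i c t' -> t' < M.
Proof. by case=> /realM. Qed.

Section Sound.

Variable I1 : interp.
Hypothesis M1 : model I1 K1.
Local Notation tp := (tp w).

(* [Ref d U]: at the element [d] no type of the set [U] can be simulated.  The
   function [g] chooses, for each type, a demand that cannot be met. *)
Definition gap (U : nat -> Prop) (g h : nat -> nat) (rr : nat -> rname) (d : dom I1) R t' :=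
  exists t, [/\ U t, ~ mism N p (tp d) t, rr t = R & wit N p t (g t) (h t) t'].

Inductive Ref : dom I1 -> (nat -> Prop) -> Prop :=
| Ref_intro d U (g h : nat -> nat) (rr : nat -> rname) :
    (forall t, U t -> mism N p (tp d) t \/
       [/\ exists C, MA (g t) (h t) (rr t) C, dem p (g t) t & rr t \in sig_r S]) ->
    (forall R e t0, rint R d e -> gap U g h rr d R t0 -> Ref e (gap U g h rr d R)) ->
    Ref d U.

(** Refuting nothing requires no strategy. This is the purpose of [t0] in [Ref_intro], which
    restricts the premise to nonempty gaps: without it [Ref] would fail wherever an infinite path
    starts. *)
Lemma Ref_empty d U : (forall t, ~ U t) -> Ref d U.
Proof.
move=> H; apply: (@Ref_intro _ _ id id id) => [t /H //|R e t0 _ [t [/H]]] //.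
Qed.

Lemma Ref_sub d U U' : Ref d U -> (forall t, U' t -> U t) -> Ref d U'.
Proof.
move=> H; elim: H U' => {}d {}U g h rr H1 _ IH U' sub.
apply: (@Ref_intro _ _ g h rr) => [t /sub/H1 //|R e t0 He [t [/sub Ut H2 H3 H4]]].
have G : gap U g h rr d R t0 by exists t.
by apply: (IH _ _ _ He G) => t' [t1 [/sub Ut1 G2 G3 G4]]; exists t1.
Qed.

(** Inside one model strategies can be merged: a type follows the first strategy if it is in [U1]
    and the second one otherwise, and the gap of the merged strategy splits accordingly. *)
Lemma Ref_union d U1 U2 : Ref d U1 -> Ref d U2 -> Ref d (fun t => U1 t \/ U2 t).
Proof.
move=> H; elim: H U2 => {}d {}U1 g h rr H1 HC IH U2 H2.
case: H2 HC IH H1 => {}d {}U2 g' h' rr' G1 G2 HC IH H1.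
pose sel A (f f' : nat -> A) t := if pb (U1 t) then f t else f' t.
apply: (@Ref_intro _ _ (sel _ g g') (sel _ h h') (sel _ rr rr')).
  by move=> t; rewrite /sel; case: pbP => [Ut _|nU [//|Ut]]; [apply: H1|apply: G1].
move=> R e t0 He _.
have C2 : Ref e (gap U2 g' h' rr' d R).
  case: (classic (exists t, gap U2 g' h' rr' d R t)) => [[t Ht]|none]; first exact: G2 He Ht.
  by apply: Ref_empty => t Ht; apply: none; exists t.
have C12 : Ref e (fun t => gap U1 g h rr d R t \/ gap U2 g' h' rr' d R t).
  case: (classic (exists t, gap U1 g h rr d R t)) => [[t Ht]|none]; first exact: IH He Ht _ C2.
  by apply: Ref_sub C2 _ => t [Ht|//]; case: none; exists t.
apply: Ref_sub C12 _ => t' [t].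
by rewrite /sel; case: pbP => [Ut|nU] [[//|Ut'] h1 h2 h3]; [left|left|right]; exists t.
Qed.

(** In a given model it is therefore enough to refute single types. Sets matter in the table, where
    the successors are still to be chosen. *)
Lemma Ref_fin d U B : (forall t, U t -> t < B) -> (forall t, U t -> Ref d (eq t)) -> Ref d U.
Proof.
elim: B U => [|B IH] U lt H; first by apply: Ref_empty => t /lt.
have H1 : Ref d (fun t => U t /\ t < B) by apply: IH => [t []//|t [/H]].
case: (classic (U B)) => UB.
  apply: Ref_sub (Ref_union H1 (H _ UB)) _ => t Ut.
  by have := lt _ Ut; rewrite ltnS leq_eqVlt => /orP [/eqP ->|]; auto.
apply: Ref_sub H1 _ => t Ut; split=> //.
by have := lt _ Ut; rewrite ltnS leq_eqVlt => /orP [/eqP E|//]; rewrite E in Ut.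
Qed.

(** The complement of an inductive predicate is coinductive: an unrefuted type keeps its names and
    passes, for each demand over the signature, to an unrefuted type at a successor. Repeating this
    gives a simulation of unbounded depth. *)
Lemma unref_step d t : ~ Ref d (eq t) -> ~ mism N p (tp d) t /\
  forall i c R C, MA i c R C -> dem p i t -> R \in sig_r S ->
  exists e t', [/\ rint R d e, wit N p t i c t' & ~ Ref e (eq t')].
Proof.
move=> H; split=> [Hm|i c R C HM Hd RS].
  apply: H; apply: (@Ref_intro _ _ id id id) => [t' <-|R e t0 _ [t' [<- //]]]; by left.
apply: NNPP => none; apply: H.
apply: (@Ref_intro _ _ (fun _ => i) (fun _ => c) (fun _ => R)) => [t' <-|R' e t0 He _].
  by right; split=> //; exists C.
apply: (@Ref_fin _ _ M) => [t' [t1 [_ _ _ /wit_lt]] //|t' [t1 [<- _ ER Hw]]].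
by apply: NNPP => nR; apply: none; exists e, t'; rewrite ER.
Qed.

Variable X : seq bool.
Hypothesis Xclosed : forall s V, s < M -> V < 2 ^ M -> gstep N p X s V -> nth false X (V * M + s).

Lemma pairM' a t : a * pM p + t = a * M + t. Proof. by rewrite pME. Qed.

(** Refutations that occur in a model of [K1] are found by the fixed point. Induction on the
    refutation, with the types of the elements involved as the entries [s]. *)
Lemma Ref_table d U : Ref d U -> forall V, V < 2 ^ M -> (forall t, bit t V -> U t) ->
  nth false X (V * M + tp d).
Proof.
elim=> {}d {}U g h rr H1 _ IH V lt HV; apply: Xclosed => //; first exact: tp_lt.
split; first exact: (tp_real pnE pWE pME (ft1 F) d M1).
case: (classic (exists t, bit t V)) => [_|none]; last by left=> t _ Ht; apply: none; exists t.
(* [P i] is what a witness of demand [i] has to refute: the witness types of all chosen demands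
   whose role is that of [i]. *)
right; pose P i t' := exists t, [/\ bit t V, ~ mism N p (tp d) t, NA i.+3 (rr t) & wit N p t (g t) (h t) t'].
have [Q [QN HQ]] := rel_ex w P; exists Q; split=> //.
have iM i : i < N -> forall c, modal N p i c -> i < M * M.
  move=> _ c /(modalE pnE pWE pME) [R [C [_ _ /(CA_lt pnE pWE pME) h0]]].
  by apply: (@leq_trans M); [lia|rewrite leq_pmulr ?M_gt0].
split.
  move=> t tN Ht; case: (classic (mism N p (tp d) t)) => Hm; first by left.
  right; have [//|[[C HM] Hd RS]] := H1 t (HV _ Ht).
  have [gN hN] := MA_ltN HM.
  exists (g t); split=> //; exists (h t); split=> //.
  split; first by apply/(modalE pnE pWE pME); exists (rr t), C.
  split=> //; split; first by apply/(sigRmE HM).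
  move=> i' i'N c' c'N Hm' _ Hs t' t'N Hw; rewrite pairM'.
  apply/HQ; [exact: iM Hm'|exact: wit_lt Hw|exists t; split=> //].
  move/(modalE pnE pWE pME): Hm' => [R' [C' HM']].
  have /(samerE pnE pWE pME HM HM') -> := Hs; exact: MA_NA HM'.
move=> i iN c cN Hm Hd; have /(modalE pnE pWE pME) [R [C HM]] := Hm.
have /(tp_dem pnE pWE pME d HM) [e [He Ho]] := Hd.
have [V' [V'lt HV']] := set_ex M (fun t' => P i t').
have V'N : V' < N by apply: leq_trans V'lt (set2_lt_N w).
exists (tp e); split; first by have := tp_lt w e; lia.
exists V'; split=> //; rewrite pairM'.
split.
  case: (classic (exists t0, bit t0 V')) => [[t0 /HV' [_ [t [h1 h2 h3 h4]]]]|none].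
    apply: (IH R e t0 He) => //.
      by exists t; split=> //; [apply: HV|apply: NA_fun h3 (MA_NA HM)].
    move=> t' /HV' [_ [t1 [g1 g2 g3 g4]]]; exists t1; split=> //; first exact: HV.
    by apply: NA_fun g3 (MA_NA HM).
  apply: Xclosed => //; first exact: tp_lt.
  split; first exact: (tp_real pnE pWE pME (ft1 F) e M1).
  by left=> t _ Ht; apply: none; exists t.
split; first by rewrite pME; apply: tp_lt.
split; first by apply/(compatmE pnE pWE pME _ _ HM); apply: (tp_compat pnE pWE pME (MA_NA HM) He).
split=> // t' _ t'M; rewrite pairM' => /HQ Hp; rewrite pME in t'M; apply/HV'; split=> //.
by apply: Hp => //; apply: iM Hm.
Qed.

(** [T] is taken from the types of the individuals in [I1], and [Q] from the types actually refuted
    in [I1] at one chosen witness for each demand. The answer [T'] then consists of types unrefuted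
    at their individuals, and a model of [K2] is unravelled from pairs of a type and an element of
    [I1] at which it is unrefuted. *)
Lemma entl_sim : cons N p (pt2 p) (pa2 p) -> entl N p X ->
  exists (I2 : interp) (V : dom I2 -> Prop) (h : dom I2 -> dom I1), [/\ model I2 K2,
    forall a, a \in ind K2 -> V (iint I2 a) /\ h (iint I2 a) = iint I1 a,
    forall A d, A \in sig_c S -> V d -> cint A d -> cint A (h d) &
    forall R d e, R \in sig_r S -> rint R d e -> (V d <-> V e) /\ (V d -> rint R (h d) (h e))].
Proof.
move=> [[t0 [_ Ht0]] _] [HE1 HE].
have [T [TN HT ET]] := asg_tp pnE pWE pME (ft1 F) (fa1 F) M1.
have [ch Hch] : exists ch : iname -> nat -> dom I1, forall x i c R C, MA i c R C ->
    dem p i (tp (iint I1 x)) -> rint R (iint I1 x) (ch x i) /\ okc p i c (tp (ch x i)).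
  have D x i : exists e, forall c R C, MA i c R C -> dem p i (tp (iint I1 x)) ->
      rint R (iint I1 x) e /\ okc p i c (tp e).
    case: (classic (exists c R C, MA i c R C /\ dem p i (tp (iint I1 x)))) => [[c [R [C [HM Hd]]]]|none].
      have /(tp_dem pnE pWE pME _ HM) [e [He Ho]] := Hd; exists e => c' R' C' HM' _.
      by have [<- <- _] := MA_fun HM HM'.
    by exists (iint I1 x) => c R C HM Hd; case: none; exists c, R, C.
  exists (fun x i => proj1_sig (constructive_indefinite_description _ (D x i))) => x i.
  exact: (proj2_sig (constructive_indefinite_description _ (D x i))).
pose P a t' := exists x, [/\ NA (a %/ M) x, real2 t' & Ref (ch x (a %% M)) (eq t')].
have [Q [QN HQ]] := rel_ex w P.
have HQ' a i t' x : NA a x -> i < M -> t' < M ->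
    bit ((a * M + i) * M + t') Q <-> real2 t' /\ Ref (ch x i) (eq t').
  move=> Na iM t'M; have aM := NA_ltn Na; rewrite HQ //; last first.
    apply: (@leq_trans (a.+1 * M)); first by rewrite mulSnr ltn_add2l.
    by rewrite leq_mul2r; apply/orP; right; lia.
  rewrite /P divnMDl ?M_gt0 // modnMDl divn_small // modn_small // addn0.
  by split=> [[y [/(NA_fun Na) <-]] //|[h1 h2]]; exists x.
have iM i c R C : MA i c R C -> i < M by case=> _ _ /(CA_lt pnE pWE pME); lia.
have [|T' [T'N [Z [ZN [HT' [Hedge [Hsub Hsafe]]]]]]] := HE T TN Q QN HT.
  move=> a aN s sN /(ind0_of pnE pWE pME (fa1 F)) [x [Na _]] sM.
  rewrite pME in sM; rewrite pairM' => /(ET _ _ _ Na sM) -> i iN c cN Hm Hd.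
  have /(modalE pnE pWE pME) [R [C HM]] := Hm.
  have [He Ho] := Hch x i c R C HM Hd.
  have [V' [V'lt HV']] := set_ex M (fun t' => real2 t' /\ Ref (ch x i) (eq t')).
  exists (tp (ch x i)); split; first by have := tp_lt w (ch x i); lia.
  exists V'; split; first by apply: leq_trans V'lt (set2_lt_N w).
  rewrite !pairM'; split.
    have HR : Ref (ch x i) (fun t' => bit t' V').
      by apply: (@Ref_fin _ _ M) => t' /HV' [] // _ [].
    exact: Ref_table HR _ V'lt _.
  split; first by rewrite pME; apply: tp_lt.
  split; first by apply/(compatmE pnE pWE pME _ _ HM); apply: (tp_compat pnE pWE pME (MA_NA HM) He).
  split=> // t' _ t'M; rewrite pME in t'M; rewrite !pME => /(HQ' _ _ _ _ Na (iM _ _ _ _ HM) t'M) H.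
  by apply/HV'.
have [tau [k1 k2 k3 k4]] := asg_fun pnE pWE pME (fa2 F) Ht0 HT'.
(* Pairs in [Z] are never refuted, by induction on the refutation: the move granted by [safe] leads
   either to a chosen witness where the type is unrefuted by the choice of [Q], or to another pair
   in [Z]. *)
have HZ d U : Ref d U -> forall a x t, d = iint I1 x -> ind0 N p (pa1 p) a -> NA a x ->
    bit (a * M + t) Z -> t < M -> U t -> False.
  elim=> {}d {}U g h rr H1 HC IH a x t Ed Ia Na Hb tM Ut.
  have [Hm Hi] : ~ mism N p (tp d) t /\ forall i, i < N -> forall c, c < N -> modal N p i c -> dem p i t -> sigRm N p i ->
    exists t', t' < N /\ (wit N p t i c t' /\
    ((exists i', i' < N /\ exists c', c' < N /\ (modal N p i' c' /\ dem p i' (tp d) /\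
        samer N p i i' /\ ~ bit ((a * pM p + i') * pM p + t') Q)) \/
     (exists R, R < N /\ exists b, b < N /\ exists k, k < N /\ (rass0 N p (pa1 p) R a b /\
        k = i.+3 /\ eqname N p R k /\ bit (b * pM p + t') Z)))).
    apply: (Hsafe a (NA_ltN' Na) t _ (tp d) _ Ia); rewrite ?pME //; try by have := tp_lt w d; lia.
    by apply/(ET _ _ _ Na) => //; [apply: tp_lt|rewrite Ed].
  case: (H1 _ Ut) => [//|[[C HM] Hd RS]]; have [gN hN] := MA_ltN HM.
  case: (Hi _ gN _ hN _ Hd _) => [||t' [t'N [Hw Hcase]]].
  - by apply/(modalE pnE pWE pME); exists (rr t), C.
  - by apply/(sigRmE HM).
  have t'M := wit_lt Hw.
  have G : gap U g h rr d (rr t) t' by exists t.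
  case: Hcase => [[i' [_ [c' [_ [Hm' [Hd' [Hs]]]]]]]|[R [_ [b [_ [k [_ [Hr [-> [Hk]]]]]]]]]].
    have /(modalE pnE pWE pME) [R' [C' HM']] := Hm'.
    rewrite Ed in Hd'; have [He _] := Hch x i' c' R' C' HM' Hd'.
    rewrite !pME => nQ; case: nQ; apply/(HQ' _ _ _ _ Na (iM _ _ _ _ HM') t'M).
    split; first by case: Hw.
    have /(samerE pnE pWE pME HM HM') ER := Hs.
    rewrite -ER -Ed in He.
    by apply: (Ref_sub (HC (rr t) _ t' He G)) => t1 <-.
  rewrite pairM' => HbZ.
  have [[_ _] [Ib [a1 [_ [b1 [_ [Ea [Eb Hrr]]]]]]]] := Hr.
  have [y [Nb _]] := ind0_of pnE pWE pME (fa1 F) Ib.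
  have [R1 [x1 [y1 [NR Nx1 Ny1 HI]]]] := rass_of pnE pWE pME (fa1 F) Hrr.
  have Ex : x1 = x by move/(eqnameEr pnE pWE pME _ Nx1): Ea => /(NA_fun Na) ->.
  have Ey : y1 = y by move/(eqnameEr pnE pWE pME _ Ny1): Eb => /(NA_fun Nb) ->.
  have ER : R1 = rr t by move/(eqnameEr pnE pWE pME _ NR): Hk => /(NA_fun (MA_NA HM)) ->.
  have He : rint (rr t) d (iint I1 y) by rewrite Ed -ER -Ex -Ey; have := M1.2 _ HI.
  exact: (IH (rr t) _ t' He G b y t' erefl Ib Nb HbZ t'M G).
have inx2 x : x \in ind K2 -> x \in ind K1.
  move=> xK; have [a [[Ia _] Na]] := ind0_ex pnE pWE pME (fa2 F) xK.
  have [a' [_ [Ia' /(eqnameEr pnE pWE pME _ Na) Na']]] := HE1 a (NA_ltN' Na) Ia.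
  by have [y [Ny yK]] := indp_of pnE pWE pME (fa1 F) Ia'; rewrite (NA_fun Na' Ny).
have nRef x : x \in ind K2 -> ~ Ref (iint I1 x) (eq (tau x)).
  move=> xK HR; have tM := realM (k1 x).
  have [a [Ia Na Hb]] := k2 _ xK.
  have [a' [Ia' Na']] := ind0_ex pnE pWE pME (fa1 F) (inx2 _ xK).
  apply: (HZ _ _ HR a' x (tau x)) => //; rewrite -pairM'.
  apply: (Hsub a (NA_ltN' Na) a' (NA_ltN' Na') (tau x)) => //; rewrite ?pME //; first by lia.
  by apply/(eqnameEr pnE pWE pME _ Na).
(* Elements of [LT] lie over [I1] and take part in the homomorphism. Those of [GT] are free
   witnesses for roles outside the signature and for elements that rooted queries cannot reach. *)
pose LT := {td : nat * dom I1 | real2 td.1 /\ ~ Ref td.2 (eq td.1)}.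
pose GT := {t : nat | real2 t}.
pose lam (d : iname + (LT + GT)) := match d with
  | inl x => tau x | inr (inl l) => (proj1_sig l).1 | inr (inr g) => proj1_sig g end.
pose V (d : iname + (LT + GT)) := match d with
  | inl x => x \in ind K2 : Prop | inr (inl l) => True | inr (inr g) => False end.
pose h (d : iname + (LT + GT)) : dom I1 := match d with
  | inl x => iint I1 x | inr (inl l) => (proj1_sig l).2 | inr (inr g) => iint I1 0 end.
have lam_real d : real2 (lam d).
  by case: d => [x|[[td [H1 H2]]|[t H1]]]; [exact: k1|exact: H1|exact: H1].
have lam_un d : V d -> ~ Ref (h d) (eq (lam d)).
  by case: d => [x|[[td [H1 H2]]|[t H1]]] //= ; exact: nRef.
pose cmp R d e := forall r, NA r R -> compat N p r (lam d) (lam e).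
pose E R (d e : iname + (LT + GT)) := cmp R d e /\ match e with
  | inl y => exists2 x, d = inl x & List.In (RAssert R x y) (abox K2)
  | inr (inl l) => [/\ V d, R \in sig_r S & rint R (h d) (h e)]
  | inr (inr g) => ~ (V d /\ R \in sig_r S) end.
have inR R x y : List.In (RAssert R x y) (abox K2) -> x \in ind K2 /\ y \in ind K2.
  move=> HI; by split; apply/InP/In_flatten; exists [:: x; y];
    [apply/In_map; exists (RAssert R x y)|left|apply/In_map; exists (RAssert R x y)|right; left].
exists (Interp (cintL w lam) E), V, h; split.
- apply: (build pnE pWE pME (ft2 F)) => //.
  + by move=> R d e r [H _]; apply: H.
  + move=> d i c R C HM Hd.
    case: (classic (V d /\ R \in sig_r S)) => [[Vd RS]|nV].
      have [_ /(_ i c R C HM Hd RS) [e [t' [He Hw Hn]]]] := unref_step (lam_un d Vd).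
      have H : real2 (t', e).1 /\ ~ Ref (t', e).2 (eq (t', e).1) by split=> //; case: Hw.
      exists (inr (inl (exist _ (t', e) H))); split; last by case: Hw => _ [].
      split=> // r Nr; case: Hw => _ [/(compatmE pnE pWE pME _ _ HM) Hc _].
      exact: (compat_role pnE pWE pME (MA_NA HM) Nr).
    have [t' [H /(compatmE pnE pWE pME _ _ HM) Hc Ho]] := real_wit pnE pWE pME (lam_real d) HM Hd.
    exists (inr (inr (exist _ t' H))); split=> //; split=> // r Nr.
    exact: (compat_role pnE pWE pME (MA_NA HM) Nr).
  + by move=> R x y HI; split; [move=> r; exact: k4 HI|exists x].
- by [].
- move=> A d AS Vd [i [Ni Hb]].
  have [Hm _] := unref_step (lam_un d Vd).
  apply/(@tp_NA w p pnE pWE pME _ _ i) => //; apply: NNPP => nb; apply: Hm.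
  have [i' [Hs Ni']] := sigC_ex AS.
  exists i'; split; first exact: NA_ltN' Ni'.
  rewrite pnE; split=> //; split.
    have [_ [_ [Hq _]]] := real_ltype (lam_real d).
    rewrite pnE in Hq; apply/(Hq i (NA_ltN' Ni) i' (NA_ltN' Ni')) => //.
    by apply/(eqnameE pnE pWE pME); exists A.
  move/(tp_NA pnE pWE pME (h d) Ni') => H; apply: nb.
  exact/(tp_NA pnE pWE pME (h d) Ni).
move=> R d e RS [_].
case: e => [y [x -> HI]|[l|g]].
- have [xK yK] := inR _ _ _ HI; split=> // _ /=.
  have [Rp [a [b [Hr NR Nx Ny]]]] := rass_ex pnE pWE pME (fa2 F) HI.
  have [R' [_ [a' [_ [b' [_ [Hr' [ER [Ea Eb]]]]]]]]] :=
    Hedge Rp (NA_ltN' NR) a (NA_ltN' Nx) b (NA_ltN' Ny) Hr ((sigRE NR).2 RS).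
  have [R1 [x1 [y1 [NR1 Nx1 Ny1 HI1]]]] := rass_of pnE pWE pME (fa1 F) Hr'.
  move/(eqnameEr pnE pWE pME _ NR): ER => /(NA_fun NR1) E1.
  move/(eqnameEr pnE pWE pME _ Nx): Ea => /(NA_fun Nx1) E2.
  move/(eqnameEr pnE pWE pME _ Ny): Eb => /(NA_fun Ny1) E3.
  by have := M1.2 _ HI1; rewrite /= E1 E2 E3.
- by move=> [Vd _ Hr].
by move=> nV; split=> [|Vd]; [split=> // Vd; case: nV|case: nV].
Qed.
End Sound.
End Directions.

(** * Stages of refutation *)

Lemma bound_ex (P : nat -> nat -> Prop) B : (forall i k, P i k -> P i k.+1) ->
  exists K, forall i k, i < B -> P i k -> P i K.
Proof.
move=> mono; have mono' i k k' : k <= k' -> P i k -> P i k'.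
  by move=> /subnKC <-; elim: (k' - k) => [|m IH]; rewrite ?addn0 // addnS => /IH/mono.
elim: B => [|B [K HK]]; first by exists 0.
have [K' HK'] : exists K', forall k, P B k -> P B K'.
  case: (classic (exists k, P B k)) => [[k Hk]|none]; first by exists k.
  by exists 0 => k Hk; case: none; exists k.
exists (maxn K K') => i k; rewrite ltnS leq_eqVlt => /orP [/eqP ->|h] Hk.
  by apply: mono' (HK' _ Hk); exact: leq_maxr.
by apply: mono' (HK _ _ h Hk); exact: leq_maxl.
Qed.

Section Complete.

Variable w : seq bool.
Local Notation n := (size w).
Local Notation N := (usize n).
Local Notation M := (2 ^ (n + n)).

Variable p : par.
Hypothesis pnE : pn p = n.
Hypothesis pWE : pW p = num w.
Hypothesis pME : pM p = M.

Variables (K1 K2 : kb) (S : signature).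
Hypothesis F : facts w p K1 K2 S.

Local Notation NA := (NA w).
Local Notation MA := (MA w p).
Local Notation tp := (tp w).
Local Notation real1 := (real N p (pt1 p)).
Local Notation real2 := (real N p (pt2 p)).
Let ltnN : n + n < N := n_lt_N w.
Let ltMN : M < N := M_lt_N w.
Let ltnM : n < M := n_lt_M w.
Let NA_ltn := @NA_lt w p pnE pWE pME.
Let MA_ltN := @MA_lt w p pnE pWE pME.
Let NA_ltN' := @NA_ltN w p pnE pWE pME.
Let realM t tb : real N p tb t -> t < M := @real_ltM w p pME tb t.

Lemma entl_inds X : entl N p X -> forall x, x \in ind K2 -> x \in ind K1.
Proof.
move=> [HE1 _] x xK; have [a [[Ia _] Na]] := ind0_ex pnE pWE pME (fa2 F) xK.
have [a' [_ [Ia' /(eqnameEr pnE pWE pME _ Na) Na']]] := HE1 a (NA_ltN' Na) Ia.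
by have [y [Ny yK]] := indp_of pnE pWE pME (fa1 F) Ia'; rewrite (NA_fun Na' Ny).
Qed.

Lemma entl_entails X :
  (forall s V, s < M -> V < 2 ^ M -> gstep N p X s V -> nth false X (V * M + s)) ->
  cons N p (pt2 p) (pa2 p) -> entl N p X -> rucq_entails S K1 K2.
Proof.
move=> HX Hc HE q a Hq Hov _ sub Hent; have inds := entl_inds HE.
split=> [x /sub/inds //|I1 M1].
have [I2 [V [h [M2 Ha Hcn Hr]]]] := entl_sim pnE pWE pME F M1 HX Hc HE.
exact: (hom_transfer (V := V) (h := h) (fun x xa => Ha x (sub x xa)) Hcn Hr Hq Hov (Hent _ M2)).
Qed.

Section Stages.

Variable Xs : nat -> seq bool.
Hypothesis Xs_step : forall k s V, s < M -> nth false (Xs k) (V * M + s) ->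
  exists k', [/\ k = k'.+1, V < N & gstep N p (Xs k') s V].
Hypothesis Xs_close : forall k s V, s < M -> V < 2 ^ M -> gstep N p (Xs k) s V ->
  nth false (Xs k.+1) (V * M + s).

(* A node carries a type of the first knowledge base, the sets of refuted types
   promised for its witnesses, and the stage at which they are refuted. *)
Record node := Node { nt : nat; nQ : nat -> nat -> Prop; nl : nat }.

Definition valid (d : node) := real1 (nt d) /\
  forall i c R C, MA i c R C -> dem p i (nt d) -> exists s' V',
  [/\ nth false (Xs (nl d)) (V' * M + s'), s' < M, compatm N p i (nt d) s', okc p i c s' &
      forall t', t' < M -> nQ d i t' -> bit t' V'].

(** The stage drops by one from a set to the sets promised for the witnesses, so a refutation along
    anonymous elements ends within as many rounds as the stage tells. The empty set asks for no
    stage. *)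
Definition just k V (d : node) := (forall t, ~ bit t V) \/ (k = (nl d).+1 /\
  forall t, bit t V -> mism N p (nt d) t \/ exists i c R C,
  [/\ MA i c R C, dem p i t, R \in sig_r S & forall i' c' C', MA i' c' R C' -> dem p i' (nt d) ->
     forall t', wit N p t i c t' -> nQ d i' t']).

Lemma gempty k s : real1 s -> nth false (Xs k.+1) (0 * M + s).
Proof.
move=> Hs; apply: Xs_close; [exact: realM Hs|by rewrite expn_gt0|].
by split=> //; left=> t _; rewrite bit_small ?expn_gt0.
Qed.

Lemma valid_empty k s : real1 s -> valid (Node s (fun _ _ => False) k.+1).
Proof.
move=> Hs; split=> // i c R C HM Hd; have [s' [H1 H2 H3]] := real_wit pnE pWE pME Hs HM Hd.
by exists s', 0; split=> //; [exact: gempty|exact: realM H1].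
Qed.

Lemma just_ex k s V : s < M -> nth false (Xs k) (V * M + s) ->
  exists d, [/\ nt d = s, valid d & just k V d].
Proof.
move=> sM /(Xs_step sM) [k' [-> VN [Hr [HV|[Q [_ [H1 H2]]]]]]].
  exists (Node s (fun _ _ => False) 1); split=> //; first exact: valid_empty.
  left=> t; case: (ltnP t N) => tN; first exact: HV.
  by rewrite (bit_big VN tN).
exists (Node s (fun i t' => t' < M /\ bit (i * M + t') Q) k'); split=> //.
  split=> //= i c R C HM Hd; have [iN cN] := MA_ltN HM.
  have /(modalE pnE pWE pME) Hm : exists R C, MA i c R C by exists R, C.
  have [s' [_ [V' [_ [h1 [h2 [h3 [h4 h5]]]]]]]] := H2 i iN c cN Hm Hd.
  rewrite pME in h1 h2 h5; exists s', V'; split=> // t' t'M [_ Hb].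
  by apply: h5 => //; lia.
right; split=> // t Hb; have tN : t < N by case: ltnP => // h; rewrite (bit_big VN h) in Hb.
case: (H1 t tN Hb) => [|[i [iN [c [cN [Hm [Hd [Hs H]]]]]]]]; first by left.
have /(modalE pnE pWE pME) [R [C HM]] := Hm.
right; exists i, c, R, C; split=> //; first by apply/(sigRmE pnE pWE pME F HM).
move=> i' c' C' HM' Hd' t' Hw; have [i'N c'N] := MA_ltN HM'; have t'M := realM Hw.1.
split=> //; rewrite -pME; apply: (H i' i'N c' c'N _ Hd' _ t') => //.
- by apply/(modalE pnE pWE pME); exists R, C'.
- by apply/(samerE pnE pWE pME HM HM').
by lia.
Qed.

Variables (T Q t0 : nat).
Hypothesis Ht0 : real1 t0.
Hypothesis HT : asg N p (pt1 p) (pa1 p) T.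
Hypothesis HQ : childok N p (Xs N) T Q.
Variable tau : iname -> nat.
Hypothesis k1 : forall x, real1 (tau x).
Hypothesis k2 : forall x, x \in ind K1 -> exists a,
  [/\ ind0 N p (pa1 p) a, NA a x & bit (a * M + tau x) T].
Hypothesis k3 : forall C x, List.In (CAssert C x) (abox K1) -> exists i, NA i C /\ bit (n + i) (tau x).
Hypothesis k4 : forall R x y r, List.In (RAssert R x y) (abox K1) -> NA r R -> compat N p r (tau x) (tau y).

Definition el := (iname + {d : node | valid d})%type.

Definition nd (d : el) : node := match d with
  | inl x => Node (tau x) (fun i t' => exists a,
      [/\ ind0 N p (pa1 p) a, NA a x & bit ((a * M + i) * M + t') Q]) N
  | inr d => proj1_sig d end.

Lemma N_gt0 : exists k, N = k.+1.
Proof. by exists N.-1; rewrite prednK //; lia. Qed.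

Lemma nd_valid d : valid (nd d).
Proof.
case: d => [x|[d Hd]] //=; case: (boolP (x \in ind K1)) => xK; last first.
  split=> [|i c R C HM Hd]; first exact: k1.
  have [k Nk] := N_gt0; have [_ H] := valid_empty k (k1 x).
  have [s' [V' [h1 h2 h3 h4 h5]]] := H i c R C HM Hd.
  rewrite /= -Nk in h1; exists s', V'; split=> // t' t'M [a [Ia Na _]].
  by have [y [/(NA_fun Na) <- yK]] := ind0_of pnE pWE pME (fa1 F) Ia; rewrite yK in xK.
have [a [Ia Na Hb]] := k2 xK; split=> [|i c R C HM Hd] /=; first exact: k1.
have [iN cN] := MA_ltN HM; have tM := realM (k1 x).
have /(modalE pnE pWE pME) Hm : exists R C, MA i c R C by exists R, C.
have tN : tau x < N by lia.
have tM' : tau x < pM p by rewrite pME.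
rewrite -pME in Hb.
have [s' [_ [V [_ [h1 [h2 [h3 [h4 h5]]]]]]]] := HQ (NA_ltN' Na) tN Ia tM' Hb iN cN Hm Hd.
rewrite pME in h1 h2 h5; exists s', V; split=> // t' t'M [a' [Ia' Na' Hb']].
apply: h5 => //; first by lia.
by rewrite (ind0_fun pnE pWE pME Ia Ia' Na Na').
Qed.

(** The model realizes what [T] and [Q] promise. An edge to an anonymous node is drawn only if that
    node justifies the promised set at the stage of the source, and edges between individuals are
    only the asserted ones: any further edge could help [K2]. *)
Definition edge R (d e : el) : Prop := match e with
  | inl y => exists2 x, d = inl x & List.In (RAssert R x y) (abox K1)
  | inr _ => exists i c C V', [/\ MA i c R C, dem p i (nt (nd d)), compatm N p i (nt (nd d)) (nt (nd e)),
     okc p i c (nt (nd e)) & (forall t', t' < M -> nQ (nd d) i t' -> bit t' V') /\ just (nl (nd d)) V' (nd e)]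
  end.

Definition I1 := Interp (cintL w (fun d : el => nt (nd d))) edge.

Lemma I1_model : model I1 K1.
Proof.
apply: (build pnE pWE pME (ft1 F)) => //.
- by move=> d; case: (nd_valid d).
- move=> R d [y|e] r /=; first by move=> [x -> /k4]; apply.
  move=> [i [c [C [V' [HM Hd /(compatmE pnE pWE pME _ _ HM) Hc _ _]]]]] Nr.
  exact: (compat_role pnE pWE pME (MA_NA HM) Nr).
- move=> d i c R C HM Hd; have [_ H] := nd_valid d.
  have [s' [V' [h1 h2 h3 h4 h5]]] := H i c R C HM Hd.
  have [e [E He Hj]] := just_ex h2 h1; subst s'.
  exists (inr (exist _ e He)); split=> //=; exists i, c, C, V'; split=> //.
by move=> R x y HI; exists x.
Qed.

(* [RN k d t]: the type [t] is refuted at [d] within [k] rounds. *)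
Fixpoint RN k (d : el) t : Prop := if k is k'.+1 then mism N p (nt (nd d)) t \/
  exists i c R C, [/\ MA i c R C, dem p i t, R \in sig_r S &
    forall e t', edge R d e -> wit N p t i c t' -> RN k' e t'] else False.

Lemma RN_mono k d t : RN k d t -> RN k.+1 d t.
Proof.
elim: k d t => [|k IH] d t //= [|[i [c [R [C [h1 h2 h3 h4]]]]]]; first by left.
by right; exists i, c, R, C; split=> // e t' He Hw; apply: IH; apply: h4 He Hw.
Qed.

Lemma RN_le k k' d t : k <= k' -> RN k d t -> RN k' d t.
Proof.
by move=> /subnKC <-; elim: (k' - k) => [|m IH]; rewrite ?addn0 // addnS => /IH/RN_mono.
Qed.

(** Induction on the stage: all edges over the role of the chosen demand lead to nodes that justify
    sets containing the witness types in question, one stage earlier. *)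
Lemma just_RN k d V t : just k V (proj1_sig d) -> bit t V -> RN k (inr d) t.
Proof.
elim: k d V t => [|k IH] d V t [none|[E H]] Hb; try by case: (none _ Hb).
  by [].
case: E => E; case: (H _ Hb) => [|[i [c [R [C [h1 h2 h3 h4]]]]]]; first by left.
right; exists i, c, R, C; split=> // -[y|e] t' He Hw; first by case: He.
move: He => [i' [c' [C' [V' [HM' Hd' _ _ [h5 h6]]]]]].
rewrite /= -E in h6; exact: (IH e V' t' h6 (h5 _ (realM Hw.1) (h4 _ _ _ HM' Hd' _ Hw))).
Qed.

(** A bounded simulation answers each round of a refutation by an actual element of a model of [K2],
    whose type is one of the witness types that the refutation has to treat; after [k] rounds
    nothing is left. The list [exs] holds every restriction in existential form, a universal one as
    its negation. *)
Lemma psim_RN exs (I2 : interp) k (d2 : dom I2) (d1 : el) : model I2 K2 ->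
  (forall i c R C, MA i c R C -> List.In (R, if bw p i.+2 then Neg C else C) exs) ->
  psim (I2 := I2) (I1 := I1) S exs k d2 d1 -> ~ RN k d1 (tp d2).
Proof.
move=> M2 Hexs; elim: k d2 d1 => [|k IH] d2 d1; first by move=> _ [].
move=> /= [HA Hs].
rewrite /not => -[[i [iN [Hi Hb]]]|[i [c [R [C [HM Hd RS H]]]]]].
  have [A [NiA AS]] := sigC_of pnE pWE pME F Hi.
  rewrite pnE in Hb; case: Hb => [/(tp_NA pnE pWE pME d2 NiA) /(HA _ AS) [i' [Ni' Hb]] nb]; apply: nb.
  have [_ [_ [Hq _]]] := real_ltype (nd_valid d1).1.
  rewrite pnE in Hq; apply/(Hq i (NA_ltN' NiA) i' (NA_ltN' Ni')) => //.
  by apply/(eqnameE pnE pWE pME); exists A.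
have /(tp_dem pnE pWE pME d2 HM) [e [He Ho]] := Hd.
have Hx : ext (Ex R (if bw p i.+2 then Neg C else C)) d2.
  exists e; split=> //; have /(tp_okc pnE pWE pME e HM) := Ho; by case: (bw p i.+2).
have [e2 [e1 [h1 h2 h3 h4]]] := Hs _ _ (Hexs _ _ _ _ HM) RS Hx.
apply: IH h4 _; apply: H h3 _; split; first exact: (tp_real pnE pWE pME (ft2 F) e2 M2).
split; last by apply/(tp_okc pnE pWE pME e2 HM); move: h2; case: (bw p i.+2).
by apply/(compatmE pnE pWE pME _ _ HM); apply: (tp_compat pnE pWE pME (MA_NA HM) h1).
Qed.

Lemma exs_ex : exists exs, forall i c R C, MA i c R C -> List.In (R, if bw p i.+2 then Neg C else C) exs.
Proof.
suff [exs H] : exists exs, forall i c R C, i < n -> MA i c R C ->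
    List.In (R, if bw p i.+2 then Neg C else C) exs.
  by exists exs => i c R C HM; apply: H (HM); case: HM => _ _ /(CA_lt pnE pWE pME).
elim: n => [|B [exs IH]]; first by exists [::].
case: (classic (exists c R C, MA B c R C)) => [[c [R [C HM]]]|none].
  exists ((R, if bw p B.+2 then Neg C else C) :: exs) => i c' R' C'.
  rewrite ltnS leq_eqVlt => /orP [/eqP ->|lt] HM'; last by right; apply: IH HM'.
  by have [_ -> ->] := MA_fun HM HM'; left.
exists exs => i c R C; rewrite ltnS leq_eqVlt => /orP [/eqP ->|lt] HM; last exact: IH HM.
by case: none; exists c, R, C.
Qed.

Hypothesis ent : rucq_entails S K1 K2.

(** [entails_psim] is applied to the model built from [T] and [Q]. The simulated model of [K2]
    yields [T'], and [Z] is the set of all pairs that are refuted in no number of rounds. *)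
Lemma stages_sim : exists T', T' < N /\ exists Z, Z < N /\
    (asg N p (pt2 p) (pa2 p) T' /\
     (forall R, R < N -> forall a, a < N -> forall b, b < N -> rass N p (pa2 p) R a b -> sigR N p R ->
        exists R', R' < N /\ exists a', a' < N /\ exists b', b' < N /\
          (rass N p (pa1 p) R' a' b' /\ eqname N p R R' /\ eqname N p a a' /\ eqname N p b b')) /\
     (forall a, a < N -> forall a', a' < N -> forall t, t < N -> ind0 N p (pa2 p) a ->
        ind0 N p (pa1 p) a' -> eqname N p a a' -> t < pM p -> bit (a * pM p + t) T' ->
        bit (a' * pM p + t) Z) /\
     safe N p T Q Z).
Proof.
have [exs Hexs] := exs_ex.
(* Stages bound the refutations at anonymous elements only; those passing through the ABox may be
   longer. There are finitely many pairs of an individual and a type, so one [K] bounds them all. *)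
have [K HK] : exists K, forall x t k, x \in ind K1 -> t < M -> RN k (inl x) t -> RN K (inl x) t.
  have [K HK] := @bound_ex (fun j k => exists2 x, NA (j %/ M) x & RN k (inl x) (j %% M)) (n * M)
    (fun j k => ltac:(by move=> [x h1 h2]; exists x => //; apply: RN_mono)).
  exists K => x t k xK tM Hx; have [a [_ Na]] := ind0_ex pnE pWE pME (fa1 F) xK.
  have E1 : (a * M + t) %/ M = a by rewrite divnMDl ?M_gt0 // divn_small // addn0.
  have E2 : (a * M + t) %% M = t by rewrite modnMDl modn_small.
  have lt : a * M + t < n * M.
    by apply: (@leq_trans (a.+1 * M)); [rewrite mulSnr ltn_add2l|rewrite leq_mul2r (NA_ltn Na) orbT].
  have := HK _ k lt; rewrite E1 E2; case; first by exists x.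
  by move=> y /(NA_fun Na) <-.
have [I2 [M2 HR Hsim]] := entails_psim exs K ent I1_model.
have [T' [T'N HT' ET']] := asg_tp pnE pWE pME (ft2 F) (fa2 F) M2.
exists T'; split=> //.
have [Z [ZN HZ]] := rel_ex w (fun a t => exists2 x, NA a x & forall k, ~ RN k (inl x) t).
exists Z; split=> //; split=> //; split; last split.
- move=> R _ a _ b _ /(rass_of pnE pWE pME (fa2 F)) [Rn [x [y [NR Nx Ny HI]]]] /(sigRE pnE pWE pME F NR) RS.
  have /= [x1 [<-] HI1] := HR _ _ _ HI RS.
  have [R' [a' [b' [Hr NR' Nx' Ny']]]] := rass_ex pnE pWE pME (fa1 F) HI1.
  exists R'; split; first exact: NA_ltN' NR'.
  exists a'; split; first exact: NA_ltN' Nx'.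
  exists b'; split; first exact: NA_ltN' Ny'.
  by split=> //; do !split; apply/(eqnameE pnE pWE pME); [exists Rn|exists x|exists y].
- move=> a _ a' _ t _ Ia Ia' Ea; have [x [Nx xK]] := ind0_of pnE pWE pME (fa2 F) Ia.
  move/(eqnameEr pnE pWE pME _ Nx): Ea => Nx'; rewrite !pME => tM /(ET' _ _ _ Nx tM) Et.
  apply/HZ => //; first exact: (@NA_ltM2 w p pnE pWE pME _ _ Nx').
  have [y [/(NA_fun Nx') <- xK1]] := ind0_of pnE pWE pME (fa1 F) Ia'.
  exists x => // k /(HK _ _ _ xK1 tM); rewrite Et.
  exact: (psim_RN M2 Hexs (Hsim _ xK)).
move=> a aN t tN s sN Ia; rewrite !pME => tM sM HbZ HbT.
have [x [Na xK]] := ind0_of pnE pWE pME (fa1 F) Ia.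
have iMM i y : NA i y -> i < M * M := @NA_ltM2 w p pnE pWE pME i y.
have {HbZ} nRN k : ~ RN k (inl x) t.
  have [y Ny H] := (HZ a t (iMM _ _ Na) tM).1 HbZ.
  by rewrite (NA_fun Na Ny); apply: H.
have Es : s = tau x.
  have [a' [Ia' Na' HbT']] := k2 xK; rewrite -(ind0_fun pnE pWE pME Ia Ia' Na Na') in HbT'.
  have [_ [H _]] := HT; have := realM (k1 x) => tauM.
  by apply: (H a aN s sN (tau x)) => //; rewrite ?pME //; lia.
split=> [Hm|i iN c cN Hm Hd Hs]; first by apply: (nRN 1); left; rewrite /= -Es.
apply: NNPP => none; have /(modalE pnE pWE pME) [R [C HM]] := Hm.
have /(sigRmE pnE pWE pME F HM) RS := Hs.
(* One round for this demand, then at most [K] rounds at a named successor or [N] at an anonymous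
   one. *)
apply: (nRN (maxn K N).+1); right; exists i, c, R, C; split=> //.
move=> [y|e] t' He Hw; have t'M := realM Hw.1; have t'N : t' < N by lia.
  have [_ [<-] HI] := He.
  apply: (RN_le (leq_maxl _ _)); apply: NNPP => nK; apply: none; exists t'; split=> //; split=> //; right.
  have [R' [a' [b' [Hr NR' Nx' Ny']]]] := rass_ex pnE pWE pME (fa1 F) HI.
  have yK : y \in ind K1.
    by apply/InP/In_flatten; exists [:: x; y]; [apply/In_map; exists (RAssert R x y)|right; left].
  have [b [Ib Nb]] := ind0_ex pnE pWE pME (fa1 F) yK.
  exists R'; split; first exact: NA_ltN' NR'.
  exists b; split; first exact: NA_ltN' Nb.
  exists i.+3; split; first exact: NA_ltN' (MA_NA HM).
  split; last first.
    split=> //; split; first by apply/(eqnameE pnE pWE pME); exists R; split=> //; exact: MA_NA HM.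
    apply/HZ => //; first exact: iMM Nb.
    by exists y => // k /(HK _ _ _ yK t'M).
  split=> //; split=> //; exists a'; split; first exact: NA_ltN' Nx'.
  exists b'; split; first exact: NA_ltN' Ny'.
  by split; [apply/(eqnameE pnE pWE pME); exists x|split=> //; apply/(eqnameE pnE pWE pME); exists y].
have [i' [c' [C' [V' [HM' Hd' _ _ [h5 h6]]]]]] := He.
apply: (RN_le (leq_maxr _ _)); apply: just_RN h6 _; apply: h5 => //=.
exists a; split=> //; apply: NNPP => nb; apply: none; exists t'; split=> //; split=> //; left.
have [i'N c'N] := MA_ltN HM'.
exists i'; split=> //; exists c'; split=> //; split.
  by apply/(modalE pnE pWE pME); exists R, C'.
split; first by rewrite Es.
by split; [apply/(samerE pnE pWE pME HM HM')|].
Qed.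

End Stages.

Lemma entails_entl Xs :
  (forall k s V, s < M -> nth false (Xs k) (V * M + s) ->
     exists k', [/\ k = k'.+1, V < N & gstep N p (Xs k') s V]) ->
  (forall k s V, s < M -> V < 2 ^ M -> gstep N p (Xs k) s V -> nth false (Xs k.+1) (V * M + s)) ->
  cons N p (pt1 p) (pa1 p) -> rucq_entails S K1 K2 -> entl N p (Xs N).
Proof.
move=> H1 H2 [[t0 [_ Ht0]] _] ent; split.
  move=> a aN /(indp_of pnE pWE pME (fa2 F)) [x [Nx xK]].
  (* The empty disjunct is true of every tuple, so this query forces [x] to be an individual of
     [K1]. *)
  have [|||||/(_ x) xK1 _] := ent (UCQ [:: 0] [:: [::]]) [:: x] => //.
  - by split=> // q [<-|//].
  - by move=> y; rewrite inE => /eqP ->.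
  - by move=> I _; exists [::]; [left|exists (fun _ => iint I x)].
  have [a' [[Ia _] Na']] := ind0_ex pnE pWE pME (fa1 F) (xK1 (mem_head _ _)).
  exists a'; split; first exact: NA_ltN' Na'.
  by split=> //; apply/(eqnameE pnE pWE pME); exists x.
move=> T TN Q QN HT HQ.
have [tau [k1 k2 k3 k4]] := asg_fun pnE pWE pME (fa1 F) Ht0 HT.
exact: (stages_sim H1 H2 HT HQ k1 k2 k3 k4 ent).
Qed.

End Complete.

(** * The upper bound *)

(** As long as the sequence is not stable, each stage strictly enlarges a subset of an [N]-element
    set. *)
Lemma stabilizes N (X : nat -> nat -> bool) : (forall k x, X k x -> X k.+1 x) ->
  (forall k, (forall x, x < N -> X k.+1 x = X k x) -> forall x, x < N -> X k.+2 x = X k.+1 x) ->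
  forall x, x < N -> X N.+1 x = X N x.
Proof.
move=> mono stab; pose st k := forall x, x < N -> X k.+1 x = X k x.
pose A k := [set x : 'I_N | X k x].
have up k : ~ st k -> #|A k| < #|A k.+1|.
  move=> ns; apply: proper_card; rewrite properE; apply/andP; split.
    by apply/subsetP => x; rewrite !inE => /mono.
  apply/negP => /subsetP H; apply: ns => x xN; apply/idP/idP => [|/mono //].
  by have := H (Ordinal xN); rewrite !inE.
have H k : st k \/ k < #|A k.+1|.
  elim: k => [|k IH].
    case: (classic (st 0)) => [|/up h]; [by left|right]; exact: leq_ltn_trans h.
  case: (classic (st k.+1)) => [|ns]; [by left|right]; case: IH => [/stab //|h].
  exact: leq_ltn_trans h (up _ ns).
case: (H N) => // h; have := leq_trans h (max_card _); by rewrite card_ord ltnn.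
Qed.

Lemma bit_ext a b : (forall x, bit x a = bit x b) -> a = b.
Proof.
elim/ltn_ind: a b => a IH b H; have E x c : bit x c./2 = bit x.+1 c.
  by rewrite /bit -divn2 -divnMA -expnS.
have H0 : odd a = odd b by have := H 0; rewrite /bit expn0 !divn1.
case: (posnP a) => [a0|a0].
  apply/esym; elim/ltn_ind: b {IH} H H0 => b IHb H; rewrite a0 => b0.
  case: (posnP b) => [->//|bp]; rewrite -(odd_double_half b) -b0 add0n.
  rewrite (_ : b./2 = 0) ?double0 //; rewrite -a0; apply: IHb => [|x|]; first by lia.
    by rewrite E -H a0 /bit !div0n.
  by have := H 1; rewrite a0 /bit div0n expn1 !divn2 => <-.
rewrite -(odd_double_half a) -(odd_double_half b) H0 (IH a./2 _ b./2) //; first by lia.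
by move=> x; rewrite !E.
Qed.

Section Upper.

Variable w : seq bool.
Local Notation n := (size w).
Local Notation N := (usize n).
Local Notation M := (2 ^ (n + n)).

Lemma nN : n < N. Proof. by apply: leq_ltn_trans (leq_addr n n) (n_lt_N w). Qed.

(** [wf] speaks of the bits at positions below [N] only; all others vanish because both numbers are
    below [N]. *)
Lemma wf_pM p : pn p = n -> pM p < N -> wf N p -> pM p = M.
Proof.
move=> pnE lt [H _]; apply: bit_ext => x; case: (ltnP x N) => xN; last first.
  by rewrite (bit_big lt xN) (bit_big (M_lt_N w) xN).
apply/idP/idP => [/(H x xN)|].
  by rewrite pnE => ->; rewrite /bit divnn expn_gt0.
move=> Hb; apply/(H x xN); rewrite pnE; move: Hb; rewrite /bit.
case: (ltngtP x (n + n)) => // h.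
  rewrite -[n + n in X in odd X](subnK (ltnW h)) expnD mulnK ?expn_gt0 //.
  by rewrite -(subnSK h) expnS oddM.
by rewrite divn_small // ltn_exp2l.
Qed.

Lemma parsedE p (P : par -> Prop) : pn p = n -> pW p = num w -> pM p = M -> wf N p ->
  parsed N n (num w) P <-> P p.
Proof.
move=> pnE pWE pME Hwf; have [E1 [K1 [K2 [S F]]]] := (wf_facts pnE pWE pME).1 Hwf.
have lt i : i <= n -> i < N by move=> h; apply: leq_ltn_trans h nN.
have Ep : p = Par n (num w) M (pt1 p) (pa1 p) (pt2 p) (pa2 p) (psc p) (psr p).
  by move: pnE pWE pME; case: (p) => /= ? ? ? ? ? ? ? ? ? -> -> ->.
split=> [[M' [M'N [t1 [_ [a1 [_ [t2 [_ [a2 [_ [sc [_ [sr [_ [Hwf' HP]]]]]]]]]]]]]]]|HP].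
  have EM := @wf_pM (Par n (num w) M' t1 a1 t2 a2 sc sr) erefl M'N Hwf'; rewrite /= in EM; subst M'.
  have [/= E1' [K1' [K2' [S' F']]]] := (wf_facts (p := Par n (num w) M t1 a1 t2 a2 sc sr) erefl erefl erefl).1 Hwf'.
  case: F F' => h1 h2 h3 h4 h5 h6 [/= g1 g2 g3 g4 g5 g6]; rewrite E1' in g1; rewrite E1 in h1.
  have [_ Ea1] := at_fun (enc_seq_inj enc_ci_inj) h1 g1; rewrite -Ea1 in g2.
  have [_ Et2] := at_fun (enc_seq_inj enc_assertion_inj) h2 g2; rewrite -Et2 in g3.
  have [_ Ea2] := at_fun (enc_seq_inj enc_ci_inj) h3 g3; rewrite -Ea2 in g4.
  have [_ Esc] := at_fun (enc_seq_inj enc_assertion_inj) h4 g4; rewrite -Esc in g5.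
  have [_ Esr] := at_fun (enc_seq_inj enc_nat_inj) h5 g5.
  by rewrite Ep E1 Ea1 Et2 Ea2 Esc Esr; rewrite E1' in HP.
case: (F) => [[h1 h1' _] [h2 h2' _] [h3 h3' _] [h4 h4' _] [h5 h5' _] [h6 h6' _]].
exists M; split; first exact: M_lt_N.
exists (pt1 p); split; first exact: lt.
exists (pa1 p); split; first exact: lt.
exists (pt2 p); split; first exact: lt.
exists (pa2 p); split; first exact: lt.
exists (psc p); split; first exact: lt.
exists (psr p); split; first exact: lt.
by rewrite -Ep.
Qed.

Variables (phi psi : fm).
Hypothesis Hphi : forall X g, size X <= N -> all (fun x => x < N) (env (b := 3) g) ->
  (sem N X (env g) phi <-> phiP N X g.1.1.2 g.1.2 g.2).

Local Notation f := (tstage phi N n (num w)).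
Let W_lt : num w < N.
Proof. exact: ltn_trans (num_lt w) (leq_ltn_trans (leq_pexp2l (isT : 0 < 2) (leq_addr n n)) (M_lt_N w)). Qed.

Lemma nth_f X x : size X <= N -> nth false (f X) x <-> x < N /\ phiP N X n (num w) x.
Proof.
move=> hX; case: (ltnP x N) => xN; last first.
  by rewrite nth_default ?size_map ?size_iota //; split=> // -[].
rewrite /tstage (nth_map 0) ?size_iota // nth_iota // add0n.
have := Hphi (g := (((tt, n), num w), x)) hX; rewrite /= nN W_lt xN => /(_ isT) ->.
by split=> [|[]].
Qed.

Let Xs k := iter k f [::].
Lemma size_Xs k : size (Xs k) <= N.
Proof. by case: k => [|k] //=; rewrite /tstage size_map size_iota. Qed.

Lemma gstep_mono p (X Y : seq bool) s V : (forall x, nth false X x -> nth false Y x) ->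
  gstep N p X s V -> gstep N p Y s V.
Proof.
move=> sub [h [H|[Q [QN [h1 h2]]]]]; split=> //; [by left|right; exists Q; split=> //; split=> //].
move=> i iN c cN Hm Hd; have [s' [h3 [V' [h4 [h5 h6]]]]] := h2 i iN c cN Hm Hd.
by exists s'; split=> //; exists V'; split=> //; split=> //; apply: sub.
Qed.

Lemma phi_mono X Y x : (forall x, nth false X x -> nth false Y x) ->
  phiP N X n (num w) x -> phiP N Y n (num w) x.
Proof.
move=> sub [M' [l0 [t1 [l1 [a1 [l2 [t2 [l3 [a2 [l4 [sc [l5 [sr [l6 [Hwf [s [sN [V [VN [h1 [h2 h3]]]]]]]]]]]]]]]]]]]]].
exists M'; split=> //; exists t1; split=> //; exists a1; split=> //; exists t2; split=> //.
exists a2; split=> //; exists sc; split=> //; exists sr; split=> //; split=> //.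
by exists s; split=> //; exists V; do 3 split=> //; apply: gstep_mono sub h3.
Qed.

Lemma Xs_mono k x : nth false (Xs k) x -> nth false (Xs k.+1) x.
Proof.
elim: k x => [|k IH] x; first by rewrite /= nth_nil.
move=> /(nth_f _ (size_Xs k)) [xN H]; apply/(nth_f _ (size_Xs k.+1)); split=> //.
exact: phi_mono IH H.
Qed.

Lemma Xs_fix x : nth false (Xs N.+1) x -> nth false (Xs N) x.
Proof.
case: (ltnP x N) => xN; last by rewrite nth_default // (leq_trans (size_Xs _) xN).
suff -> : nth false (Xs N.+1) x = nth false (Xs N) x by [].
apply: (@stabilizes N (fun k x => nth false (Xs k) x)) => // [|k H y yN]; first exact: Xs_mono.
apply/idP/idP => [|/Xs_mono //].
move=> /(nth_f _ (size_Xs k.+1)) [_ H']; apply/(nth_f _ (size_Xs k)); split=> //.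
apply: phi_mono H' => z; case: (ltnP z N) => zN; first by rewrite H.
by rewrite nth_default // (leq_trans (size_Xs _) zN).
Qed.

Hypothesis Hpsi : forall X g, size X <= N -> all (fun x => x < N) (env (b := 2) g) ->
  (sem N X (env g) psi <-> psiP N X g.1.2 g.2).

Lemma upper : language rucq_entailment w <-> sem N (Xs N) [:: n; num w] psi.
Proof.
have := Hpsi (g := ((tt, n), num w)) (size_Xs N); rewrite /= nN W_lt => /(_ isT) ->.
have phiE p : pn p = n -> pW p = num w -> pM p = M -> wf N p -> forall X x, phiP N X n (num w) x <->
    exists s, s < N /\ exists V, V < N /\ (s < M /\ x = V * M + s /\ gstep N p X s V).
  by move=> h1 h2 h3 h4 X x; rewrite /phiP (parsedE _ h1 h2 h3 h4) h3.
have close p k s V : pn p = n -> pW p = num w -> pM p = M -> wf N p -> s < M -> V < 2 ^ M ->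
    gstep N p (Xs k) s V -> nth false (Xs k.+1) (V * M + s).
  move=> h1 h2 h3 h4 sM VM H; apply/(nth_f _ (size_Xs k)); split; first exact: pair_lt.
  apply/(phiE p) => //; exists s; split; first exact: ltn_trans sM (M_lt_N w).
  by exists V; split=> //; exact: leq_trans VM (set2_lt_N w).
have decode p k s V : pn p = n -> pW p = num w -> pM p = M -> wf N p -> s < M ->
    nth false (Xs k) (V * M + s) -> exists k', [/\ k = k'.+1, V < N & gstep N p (Xs k') s V].
  move=> h1 h2 h3 h4 sM; case: k => [|k]; first by rewrite nth_nil.
  move=> /(nth_f _ (size_Xs k)) [_ /(phiE p _ h2 h3 h4) [] // s' [_ [V' [VN [s'M [E H]]]]]].
  exists k; have /= E1 := congr1 (fun x => x %% M) E; have /= E2 := congr1 (fun x => x %/ M) E.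
  rewrite !modnMDl !modn_small // in E1; rewrite !divnMDl ?M_gt0 // !divn_small // !addn0 in E2.
  by rewrite E1 E2.
split=> [[[[K1 K2] S] [Ew [/= c1 c2] ent]]|].
  have [a1 [t2 [a2 [sc [sr [F _ _ _ _]]]]]] := word_facts K1 K2 S; rewrite -[enc_input _]Ew in F.
  set p := Par _ _ _ _ _ _ _ _ _ in F.
  have Hwf : wf N p by apply/(wf_facts (p := p) erefl erefl erefl); split=> //; exists K1, K2, S.
  have C1 := (consE (p := p) erefl erefl erefl (ft1 F) (fa1 F)).2 c1.
  have C2 := (consE (p := p) erefl erefl erefl (ft2 F) (fa2 F)).2 c2.
  apply: (proj2 (parsedE (p := p) _ erefl erefl erefl Hwf)).
  split; first exact: C1; split; first exact: C2.
  apply: (entails_entl (p := p) erefl erefl erefl F _ _ C1 ent).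
  - by move=> k s V; apply: (decode p).
  by move=> k s V; apply: (close p).
move=> Hps; have [M' [M'N [t1 [_ [a1 [_ [t2 [_ [a2 [_ [sc [_ [sr [_ [Hwf H]]]]]]]]]]]]]]] := Hps.
have EM := @wf_pM (Par n (num w) M' t1 a1 t2 a2 sc sr) erefl M'N Hwf; rewrite /= in EM; subst M'.
set p := Par _ _ _ _ _ _ _ _ _ in Hwf H.
have [E1 [K1 [K2 [S F]]]] := (wf_facts (p := p) erefl erefl erefl).1 Hwf.
have [c1 [c2 HE]] := H.
have C1 := (consE (p := p) erefl erefl erefl (ft1 F) (fa1 F)).1 c1.
have C2 := (consE (p := p) erefl erefl erefl (ft2 F) (fa2 F)).1 c2.
exists (K1, K2, S); split=> //; first exact: (facts_word E1 F).
apply: (entl_entails (p := p) erefl erefl erefl F _ c2 HE) => s V sM VM Hg.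
by apply: Xs_fix; apply: (close p).
Qed.

End Upper.

Lemma rucq_in_2exptime : in_2exptime (language rucq_entailment).
Proof.
have [phi Hphi] := D_phi; have [psi Hpsi] := D_psi.
apply: (fo_2exptime (phi := phi) (psi := psi)) => w n N.
exact: (upper (fun X g => Hphi _ X g) (fun X g => Hpsi _ X g)).
Qed.

(** * Printing programs *)

(* Templates of words: [Rep] prints an index in unary, where the index is that of
   the current iteration plus a constant, the parameter [m] or the length of the input. *)
Inductive ix := ICur of nat | IM | IN.
Inductive piece := Str of seq bool | Rep of ix.
Inductive block := Once of seq piece | LoopM of seq piece | LoopIn of seq piece & seq piece.

Definition ixv m n j i := match i with ICur d => j + d | IM => m | IN => n end.
(** [enc_pos] prints a digit [xI] as two letters [true], so a numeral whose lowest [k] digits are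
    [xI] begins with [k + k] such letters. *)
Definition dbl_true k := nseq (k + k) true.
Definition piece_word m n j p := match p with Str s => s | Rep i => dbl_true (ixv m n j i) end.
Definition line_word m n j l := flatten (map (piece_word m n j) l).
Definition block_word (w : seq bool) m b := match b with
  | Once l => line_word m (size w) 0 l
  | LoopM l => flatten [seq line_word m (size w) j l | j <- iota 0 m]
  | LoopIn l1 l0 => flatten [seq line_word m (size w) j (if nth false w j then l1 else l0) | j <- iota 0 (size w)]
  end.
Definition text_word w m bs := flatten (map (block_word w m) bs).

(* Register 1 holds the output, 2 the parameter [m], 4 the length of the input, 5 the
   current index, 6 the loop counter and 9 the input. *)
Definition pst (w : seq bool) m o j c : store := fun i =>
  nth [::] [:: [::]; o; nseq m true; [::]; nseq (size w) true; nseq j true; c; [::]; [::]; w] i.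

Ltac pst := let x := fresh "x" in apply functional_extensionality; intro x; rewrite /upd;
  do 10 (try (destruct x as [|x]; simpl; try done)); rewrite ?nth_nil ?nth_default //.

Fixpoint PrintStr (s : seq bool) := if s is b :: s then Seq (Push 1 b) (PrintStr s) else Skip.

Lemma exec_str w m o j c s : exec (PrintStr s) (pst w m o j c) (pst w m (rev s ++ o) j c) (size s).
Proof.
elim: s o => [|b s IH] o; first exact: exec_skip.
apply: (@exec_seq (pst w m (b :: o) j c) _ _ _ _ 1).
  by apply: (exec_eq (exec_push _ _ _)); pst.
by rewrite rev_cons cat_rcons; apply: IH.
Qed.

Definition PrintRep i := Seq (Copy i 8) (For 8 (Seq (Push 1 true) (Push 1 true))).

Lemma exec_rep w m o j c i k : i != 3 -> i != 8 -> pst w m o j c i = nseq k true ->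
  exec (PrintRep i) (pst w m o j c) (pst w m (dbl_true k ++ o) j c) (8 * k + 3).
Proof.
move=> n3 n8 Ei; apply: (exec_le (B := (5 * k + 2) + (k * 3).+1)); last by lia.
apply: (exec_seq (s' := upd (pst w m o j c) 8 (nseq k true))).
  by apply: (exec_copyE (x := k)) => //; rewrite cats0.
apply: (@exec_for_eq 8 _ (fun l => pst w m (dbl_true l ++ o) j c) k 2) => //; first by pst.
move=> l lk; apply: (exec_seq (B := 1) (B' := 1) (exec_push _ _ _)).
by apply: (exec_eq (exec_push _ _ _)); pst; rewrite /dbl_true addnS.
Qed.

Definition PrintPiece p := match p with
  | Str s => PrintStr s
  | Rep (ICur d) => Seq (PrintRep 5) (PrintStr (dbl_true d))
  | Rep IM => PrintRep 2
  | Rep IN => PrintRep 4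
  end.

Lemma rev_dbl k : rev (dbl_true k) = dbl_true k. Proof. exact: rev_nseq. Qed.

Lemma exec_piece p : exists C, forall w m o j c, j <= m -> size w <= m ->
  exec (PrintPiece p) (pst w m o j c) (pst w m (rev (piece_word m (size w) j p) ++ o) j c) (C * m.+1).
Proof.
case: p => [s|[d| |]].
- exists (size s) => w m o j c _ _; apply: (exec_le (exec_str _ _ _ _ _ _)); by rewrite leq_pmulr.
- exists (11 + (d + d)) => w m o j c jm _ /=.
  apply: (exec_le (exec_eq (exec_seq (@exec_rep w m o j c 5 j isT isT erefl) (exec_str _ _ _ _ _ _)) _)).
    by rewrite !rev_dbl catA /dbl_true -nseqD; congr (pst _ _ (nseq _ _ ++ _) _ _); lia.
  by rewrite size_nseq; nia.
- exists 11 => w m o j c _ _ /=; rewrite rev_dbl.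
  by apply: (exec_le (@exec_rep w m o j c 2 m isT isT erefl)); lia.
exists 11 => w m o j c _ nm /=; rewrite rev_dbl.
by apply: (exec_le (@exec_rep w m o j c 4 (size w) isT isT erefl)); lia.
Qed.

Fixpoint PrintLine l := if l is p :: l then Seq (PrintPiece p) (PrintLine l) else Skip.

Lemma exec_line l : exists C, forall w m o j c, j <= m -> size w <= m ->
  exec (PrintLine l) (pst w m o j c) (pst w m (rev (line_word m (size w) j l) ++ o) j c) (C * m.+1).
Proof.
elim: l => [|p l [C' H']]; first by exists 0 => *; apply: exec_skip.
have [C H] := exec_piece p; exists (C + C') => w m o j c jm nm.
rewrite mulnDl; apply: (exec_seq (H w m o j c jm nm)).
by rewrite /line_word /= rev_cat -catA; apply: H'.
Qed.

Definition LoopBody l := Seq (PrintLine l) (Push 5 true).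

Lemma exec_body l : exists C, forall w m o j c, j <= m -> size w <= m ->
  exec (LoopBody l) (pst w m o j c) (pst w m (rev (line_word m (size w) j l) ++ o) j.+1 c) (C * m.+1).
Proof.
have [C H] := exec_line l; exists C.+1 => w m o j c jm nm.
apply: (exec_le (exec_seq (H w m o j c jm nm) (exec_eq (exec_push _ _ _) _))); first by pst.
by rewrite mulSn; lia.
Qed.

(** Looping over the input consumes a stack, so the input is first reversed into register 7 and then
    poured into both the loop counter 6 and its home 9. *)
Definition PrintBlock b := match b with
  | Once l => PrintLine l
  | LoopM l => Seq (Copy 2 6) (Seq (For 6 (LoopBody l)) (Loop 5 Skip Skip))
  | LoopIn l1 l0 => Seq (Move 9 7) (Seq
      (Loop 7 (Seq (Push 6 false) (Push 9 false)) (Seq (Push 6 true) (Push 9 true)))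
      (Seq (Loop 6 (LoopBody l0) (LoopBody l1)) (Loop 5 Skip Skip)))
  end.

Lemma exec_dup s u v : s 7 = rev v -> s 6 = u -> s 9 = u ->
  exec (Loop 7 (Seq (Push 6 false) (Push 9 false)) (Seq (Push 6 true) (Push 9 true))) s
    (upd (upd (upd s 7 [::]) 6 (v ++ u)) 9 (v ++ u)) (3 * size v).+1.
Proof.
elim/last_ind: v s u => [|v b IH] s u E7 E6 E9.
  apply: (exec_eq (exec_loop_nil E7)); seq_store.
rewrite rev_rcons in E7.
have H : exec (if b then Seq (Push 6 true) (Push 9 true) else Seq (Push 6 false) (Push 9 false))
    (upd s 7 (rev v)) (upd (upd (upd s 7 (rev v)) 6 (b :: u)) 9 (b :: u)) 2.
  rewrite -{2}E6 -E9; case: (b); apply: (exec_seq (B := 1) (B' := 1) (exec_push _ _ _));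
    by apply: (exec_eq (exec_push _ _ _)); seq_store.
rewrite cat_rcons size_rcons.
apply: (exec_le (exec_loop_cons E7 H (exec_eq (IH _ (b :: u) _ _ _) _))); try by reg.
  by seq_store.
Qed.

Lemma exec_clear5 w m o j c : exec (Loop 5 Skip Skip) (pst w m o j c) (pst w m o 0 c) j.+1.
Proof.
have := @exec_clear 5 (pst w m o j c) (nseq j true) erefl; rewrite size_nseq => H.
by apply: (exec_eq H); pst.
Qed.

Lemma exec_block b : exists C, forall w m o, size w <= m ->
  exec (PrintBlock b) (pst w m o 0 [::]) (pst w m (rev (block_word w m b) ++ o) 0 [::]) (C * m.+1 * m.+1).
Proof.
case: b => [l|l|l1 l0].
- have [C H] := exec_line l; exists C => w m o nm.
  by apply: (exec_le (H w m o 0 [::] isT nm)); rewrite leq_pmulr.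
- have [C H] := exec_body l; exists (C + 20) => w m o nm.
  apply: (exec_le (B := (5 * m + 2) + ((m * (C * m.+1).+1).+1 + m.+1))); last by nia.
  apply: (exec_seq (s' := pst w m o 0 (nseq m true))).
    by apply: exec_copyE => //; pst; rewrite cats0.
  apply: (exec_seq (s' := pst w m (rev (block_word w m (LoopM l)) ++ o) m [::])); last exact: exec_clear5.
  apply: (@exec_for_eq 6 _ (fun k => pst w m (rev (flatten [seq line_word m (size w) j l | j <- iota 0 k]) ++ o) k [::]) m (C * m.+1)).
  - by pst.
  - by pst.
  move=> k km; have := H w m (rev (flatten [seq line_word m (size w) j l | j <- iota 0 k]) ++ o) k (nseq (m - k.+1) true) (ltnW km) nm.
  rewrite catA -rev_cat => H1.
  have -> : upd (pst w m (rev (flatten [seq line_word m (size w) j l | j <- iota 0 k]) ++ o) k [::]) 6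
    (nseq (m - k.+1) true) = pst w m (rev (flatten [seq line_word m (size w) j l | j <- iota 0 k]) ++ o) k (nseq (m - k.+1) true) by pst.
  apply: (exec_eq H1); rewrite -addn1 iotaD map_cat flatten_cat /= add0n cats0 addn1.
  by pst.
have [C1 H1] := exec_body l1; have [C0 H0] := exec_body l0.
exists (C1 + C0 + 20) => w m o nm; set n := size w in nm.
apply: (exec_le (B := (2 * n).+1 + ((3 * n).+1 + ((n * ((C1 + C0) * m.+1).+1).+1 + n.+1)))); last by nia.
have Er : size (rev w) = n by rewrite size_rev.
apply: (exec_seq (s' := upd (upd (pst w m o 0 [::]) 9 [::]) 7 (rev w))).
  by have := @exec_move 9 7 (pst w m o 0 [::]) w isT erefl; rewrite cats0.
apply: (exec_seq (s' := pst w m o 0 w)).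
  apply: (exec_eq (@exec_dup (upd (upd (pst w m o 0 [::]) 9 [::]) 7 (rev w)) [::] w _ _ _)) => //.
  by pst; rewrite cats0.
apply: (exec_seq (s' := pst w m (rev (block_word w m (LoopIn l1 l0)) ++ o) n [::])); last exact: exec_clear5.
pose tx a b := flatten [seq line_word m n j (if nth false w j then l1 else l0) | j <- iota a b].
suff G : forall d k o, k + d = n -> exec (Loop 6 (LoopBody l0) (LoopBody l1)) (pst w m o k (drop k w))
    (pst w m (rev (tx k d) ++ o) n [::]) (d * ((C1 + C0) * m.+1).+1).+1.
  by have := G n 0 o (add0n _); rewrite drop0.
elim=> [|d IH] k {}o kd.
  rewrite addn0 in kd; rewrite kd drop_size mul0n.
  exact: exec_loop_nil.
have kn : k < size w by rewrite -/n; lia.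
rewrite (drop_nth false kn) /tx /= rev_cat -catA mulSn.
have H : exec (if nth false w k then LoopBody l1 else LoopBody l0) (pst w m o k (drop k.+1 w))
   (pst w m (rev (line_word m n k (if nth false w k then l1 else l0)) ++ o) k.+1 (drop k.+1 w)) ((C1 + C0) * m.+1).
  have km : k <= m by apply: leq_trans (ltnW kn) nm.
  case: ifP => _; [apply: (exec_le (H1 w m o k _ km nm))|apply: (exec_le (H0 w m o k _ km nm))];
    by rewrite leq_mul2r; apply/orP; right; lia.
apply: (exec_le (exec_loop_cons (i := 6) (s := pst w m o k (nth false w k :: drop k.+1 w)) (b := nth false w k) (v := drop k.+1 w) erefl _ (IH k.+1 _ _))).
- rewrite (_ : upd _ 6 _ = pst w m o k (drop k.+1 w)); [exact: H|by pst].
- by lia.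
by lia.
Qed.

Fixpoint PrintText bs := if bs is b :: bs then Seq (PrintBlock b) (PrintText bs) else Skip.

Lemma exec_text bs : exists C, forall w m o, size w <= m ->
  exec (PrintText bs) (pst w m o 0 [::]) (pst w m (rev (text_word w m bs) ++ o) 0 [::]) (C * m.+1 * m.+1).
Proof.
elim: bs => [|b bs [C' H']]; first by exists 0 => *; apply: exec_skip.
have [C H] := exec_block b; exists (C + C') => w m o nm.
rewrite !mulnDl; apply: (exec_seq (H w m o nm)).
by rewrite /text_word /= rev_cat -catA; apply: H'.
Qed.

(** A push adds one bit and costs one step. Thus the time spent on printing bounds the length of the
    output, and with it the cost of the final moves. *)
Lemma run_size c s s' t i : run c s s' t -> size (s' i) <= size (s i) + t.
Proof.
elim=> {c s s' t} [s|k b s|c d s s' s'' t t' _ IH _ IH'|k cn cf ct s s' t E _ IH|k cn cf ct s s' t b v E _ IH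
  |k cf ct s _|k cf ct s s' s'' t t' b v E _ IH _ IH'] //.
- by rewrite addn0.
- by rewrite /upd; case: eqP => [->|_] /=; lia.
- by lia.
- by lia.
- by move: IH; rewrite /upd; case: eqP => [->|_]; rewrite ?E /=; lia.
- by lia.
by move: IH IH'; rewrite /upd; case: eqP => [->|_]; rewrite ?E /=; lia.
Qed.

Definition ReadIn := Loop 0 (Seq (Push 9 false) (Push 4 true)) (Seq (Push 9 true) (Push 4 true)).

Lemma exec_readin s w u : s 0 = rev w -> s 9 = u -> s 4 = nseq (size u) true ->
  exec ReadIn s (upd (upd (upd s 0 [::]) 9 (w ++ u)) 4 (nseq (size (w ++ u)) true)) (3 * size w).+1.
Proof.
elim/last_ind: w s u => [|w b IH] s u E0 E9 E4.
  apply: (exec_eq (exec_loop_nil E0)); seq_store.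
rewrite rev_rcons in E0.
have H : exec (if b then Seq (Push 9 true) (Push 4 true) else Seq (Push 9 false) (Push 4 true))
    (upd s 0 (rev w)) (upd (upd (upd s 0 (rev w)) 9 (b :: u)) 4 (nseq (size (b :: u)) true)) 2.
  rewrite [nseq _ _](_ : _ = true :: s 4) ?E4 // -[in b :: u]E9 -E4; case: (b); apply: (exec_seq (B := 1) (B' := 1) (exec_push _ _ _));
    by apply: (exec_eq (exec_push _ _ _)); seq_store.
rewrite cat_rcons size_rcons.
apply: (exec_le (exec_loop_cons E0 H (exec_eq (IH _ (b :: u) _ _ _) _))); try by reg.
  by seq_store.
Qed.

Definition MulLen := Seq (Copy 4 6) (Seq (For 6 (Copy 2 7)) (Seq (Loop 2 Skip Skip) (Move 7 2))).

Lemma exec_mullen w x : exec MulLen (pst w x [::] 0 [::]) (pst w (size w * x) [::] 0 [::])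
  (20 * (size w).+1 * x.+1).
Proof.
set n := size w.
apply: (exec_le (B := (5 * n + 2) + ((n * (5 * x + 2).+1).+1 + (x.+1 + (2 * (n * x)).+1)))); last by nia.
apply: (exec_seq (s' := pst w x [::] 0 (nseq n true))).
  by apply: exec_copyE => //; pst; rewrite cats0.
apply: (exec_seq (s' := upd (pst w x [::] 0 [::]) 7 (nseq (n * x) true))).
  apply: (@exec_for_eq 6 _ (fun k => upd (pst w x [::] 0 [::]) 7 (nseq (k * x) true)) n (5 * x + 2)) => //.
  - by pst.
  - by pst.
  move=> k kn; apply: exec_copyE => //; rewrite upd_neq // upd_same -nseqD mulSn.
  by pst.
apply: (exec_seq (s' := upd (pst w 0 [::] 0 [::]) 7 (nseq (n * x) true))).
  apply: (exec_eq (B := x.+1) (s1 := upd (upd (pst w x [::] 0 [::]) 7 (nseq (n * x) true)) 2 [::])); last by pst.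
  have := @exec_clear 2 (upd (pst w x [::] 0 [::]) 7 (nseq (n * x) true)) (nseq x true) erefl.
  by rewrite size_nseq.
have := @exec_move 7 2 (upd (pst w 0 [::] 0 [::]) 7 (nseq (n * x) true)) (nseq (n * x) true) isT erefl.
by rewrite size_nseq rev_nseq => H; apply: (exec_eq H); pst; rewrite cats0.
Qed.

Fixpoint PowLen k := if k is k.+1 then Seq (PowLen k) MulLen else Push 2 true.

Lemma exec_powlen k w : exec (PowLen k) (pst w 0 [::] 0 [::]) (pst w (size w ^ k) [::] 0 [::])
  (1 + k * (40 * (size w).+2 ^ k.+1)).
Proof.
set n := size w; elim: k => [|k IH].
  by apply: (exec_eq (exec_push _ _ _)); pst.
apply: (exec_le (exec_seq IH (exec_eq (exec_mullen w (n ^ k)) _))); first by rewrite -expnS.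
rewrite -/n; have h1 : n ^ k <= n.+2 ^ k by rewrite leq_exp2r' // || (case: (k) => // j; rewrite leq_exp2r //; lia).
have h2 : 0 < n.+2 ^ k by rewrite expn_gt0.
have h3 : 20 * n.+1 * (n ^ k).+1 <= 40 * n.+2 ^ k.+2 by rewrite !expnS; nia.
have h4 : n.+2 ^ k.+1 <= n.+2 ^ k.+2 by rewrite leq_exp2l.
by nia.
Qed.

(** The part [n ^ k + k] comes from the time bound of the machine; [n + 3] makes [2 ^ (2 ^ m)]
    exceed twice the time plus the input, see [param_bound]. That [m] is at least [n] serves the
    cost estimate of the printing. *)
Definition param k n := n ^ k + k + n + 3.

Definition Writer k bs :=
  Seq ReadIn (Seq (PowLen k) (Seq (Pushes (k + 3) 2) (Seq (Copy 4 2) (Seq (PrintText bs)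
    (Seq (Loop 2 Skip Skip) (Seq (Loop 4 Skip Skip) (Seq (Loop 9 Skip Skip) (Seq (Move 1 7) (Move 7 0))))))))).

Lemma exec_writer k bs : exists e, forall w,
  exec (Writer k bs) (reg0 (rev w)) (reg0 (rev (text_word w (param k (size w)) bs))) ((size w).+2 ^ e).
Proof.
have [C HC] := exec_text bs; exists ((k + 3) * 2 + (C + (k + 100))) => w.
set n := size w; set m := param k n; set T := text_word w m bs.
have nm : n <= m by rewrite /m /param; lia.
have mb : m.+1 <= n.+2 ^ (k + 3).
  have h1 : n ^ k <= n.+2 ^ k by case: (k) => // j; rewrite leq_exp2r //; lia.
  have h2 : k < 2 ^ k by apply: ltn_expl.
  have h3 : 2 ^ k <= n.+2 ^ k by case: (k) => // j; rewrite leq_exp2r.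
  by rewrite /m /param expnD; move: (n.+2 ^ k) h1 h3 => Y h1 h3; rewrite !expnS expn0; nia.
have [t tC Hr] := HC w m [::] nm; rewrite cats0 -/T in Hr.
have sT : size T <= C * m.+1 * m.+1.
  by have := run_size 1 Hr; rewrite /= size_rev => h; lia.
pose B := C * m.+1 * m.+1.
apply: (exec_le (B := (3 * n).+1 + ((1 + k * (40 * n.+2 ^ k.+1)) + ((k + 3) + ((5 * n + 2) + (B +
  (m.+1 + (n.+1 + (n.+1 + ((2 * B).+1 + (2 * B).+1)))))))))).
  apply: (exec_seq (s' := pst w 0 [::] 0 [::])).
    have := @exec_readin (reg0 (rev w)) w [::] erefl erefl erefl; rewrite cats0 => H.
    by apply: (exec_eq H); pst; rewrite /pst /reg0 /= nth_nil.
  apply: (exec_seq (exec_powlen k w)).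
  apply: (exec_seq (s' := pst w (n ^ k + k + 3) [::] 0 [::])).
    apply: (exec_eq (exec_pushes _ _ _)); rewrite /= -nseqD.
    by pst; congr nseq; rewrite -/n addnC addnA.
  apply: (exec_seq (s' := pst w m [::] 0 [::])).
    apply: exec_copyE => //; rewrite /= -nseqD.
    by pst; congr nseq; rewrite /m /param -/n; lia.
  apply: (exec_seq (s' := pst w m (rev T) 0 [::])); first by exists t.
  apply: (exec_seq (s' := pst w 0 (rev T) 0 [::])).
    have := @exec_clear 2 (pst w m (rev T) 0 [::]) (nseq m true) erefl; rewrite size_nseq => H.
    by apply: (exec_eq H); pst.
  apply: (exec_seq (s' := upd (pst w 0 (rev T) 0 [::]) 4 [::])).
    by have := @exec_clear 4 (pst w 0 (rev T) 0 [::]) (nseq n true) erefl; rewrite size_nseq.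
  apply: (exec_seq (s' := upd (upd (pst w 0 (rev T) 0 [::]) 4 [::]) 9 [::])).
    exact: (@exec_clear 9 (upd (pst w 0 (rev T) 0 [::]) 4 [::]) w erefl).
  have H1 := @exec_move 1 7 (upd (upd (pst w 0 (rev T) 0 [::]) 4 [::]) 9 [::]) (rev T) isT erefl.
  apply: (exec_le (exec_seq H1 (exec_eq (@exec_move 7 0 _ (rev (rev T) ++ [::]) isT _) _))).
  - by rewrite upd_same.
  - by rewrite !cats0; pst; rewrite /pst /reg0 /= ?nth_nil ?revK.
  by rewrite cats0 !size_rev /B; lia.
rewrite /B; set Y := n.+2 in mb *.
have Y2 : 2 <= Y by [].
have cY a : a <= Y ^ a by apply: leq_trans (ltnW (ltn_expl a (isT : 1 < 2))) _; case: (a) => // j; rewrite leq_exp2r.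
have h1 : C * m.+1 * m.+1 <= Y ^ C * (Y ^ (k + 3) * Y ^ (k + 3)) by rewrite -mulnA; apply: leq_mul; [apply: cY|apply: leq_mul].
have h2 : k * (40 * Y ^ k.+1) <= Y ^ k * (40 * Y ^ k.+1) by rewrite leq_mul2r cY orbT.
pose Z := Y ^ ((k + 3) * 2 + (C + k)).
have e1 : Y ^ C * (Y ^ (k + 3) * Y ^ (k + 3)) <= Z.
  by rewrite /Z muln2 -addnn -!expnD leq_exp2l //; lia.
have e2 : Y ^ k * Y ^ k.+1 <= Z by rewrite /Z -expnD leq_exp2l //; lia.
have e3 : Y <= Z by rewrite /Z -{1}[Y]expn1 leq_exp2l //; lia.
have e4 : m.+1 <= Z by apply: leq_trans mb _; rewrite /Z leq_exp2l //; lia.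
have e5 : k <= Z by apply: leq_trans (cY k) _; rewrite /Z leq_exp2l //; lia.
have -> : (k + 3) * 2 + (C + (k + 100)) = (k + 3) * 2 + (C + k) + 100 by lia.
rewrite expnD -/Z.
have e6 : 2 ^ 7 <= Y ^ 100 by apply: (@leq_trans (2 ^ 100)); [rewrite leq_exp2l|rewrite leq_exp2r].
have e7 : 128 * Z <= Z * Y ^ 100 by rewrite mulnC leq_mul2l -[128]/(2 ^ 7) e6 orbT.
apply: leq_trans e7; have e8 : n < Z by apply: leq_trans e3; rewrite /Y.
have e9 : k * (40 * Y ^ k.+1) <= 40 * Z by apply: leq_trans h2 _; rewrite mulnCA leq_mul2l e2 orbT.
have e10 := leq_trans h1 e1.
by move: (C * m.+1 * m.+1) (k * (40 * Y ^ k.+1)) e9 e10 => a b e9 e10; lia.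
Qed.

Lemma poly_absorb n e : n.+2 ^ e <= n ^ (3 ^ e + 2 * e) + (3 ^ e + 2 * e).
Proof.
case: n => [|[|n]].
- have h : 2 ^ e <= 3 ^ e by case: e => // e; rewrite leq_exp2r.
  by lia.
- by lia.
apply: leq_trans (leq_addr _ _); apply: (@leq_trans (n.+2 ^ (2 * e))).
  by rewrite expnM; case: e => // e; rewrite leq_exp2r // expnS expn1; lia.
by rewrite leq_exp2l //; lia.
Qed.

Lemma writer_polytime k bs : polytime (fun w => text_word w (param k (size w)) bs).
Proof.
have [e He] := exec_writer k bs; pose d := 2 * e + 7.
exists (tm_of (Writer k bs)), (3 ^ d + 2 * d) => w.
have [t te r] := He w; have [T [cf [nb [h1 h2 h3 _]]]] := tm_of_sound r.
exists T, cf, nb; split=> //; apply: leq_trans h1 (leq_trans _ (poly_absorb _ _)).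
set Y := (size w).+2 ^ e in te; have Y1 : 0 < Y by rewrite expn_gt0.
have -> : (size w).+2 ^ d = Y * Y * (size w).+2 ^ 7.
  by rewrite /d mul2n -addnn !expnD.
apply: (@leq_trans (Y * Y * (64 * (size w).+2))).
  by move: (size w) te => n te; apply: (@leq_trans ((2 * Y) * (2 * (n + 1 + Y) + 8))); [apply: leq_mul; lia|nia].
rewrite leq_mul2l; apply/orP; right; rewrite expnSr leq_mul2r; apply/orP; right.
by rewrite -[64]/(2 ^ 6) leq_exp2r.
Qed.

(** * The knowledge bases of the reduction *)

(** A name is a numeral whose digits, from the lowest on, spell [j], [x] and [i] in unary with [xO]
    as separator. The variable part [j] comes first, so a template prints it by [Rep] followed by a
    fixed word. *)
Definition nm_base i x := BinNums.xO (iter x BinNums.xI (BinNums.xO (iter i BinNums.xI (BinNums.xO BinNums.xH)))).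

(* Opaque, so that these numbers are never computed in unary. *)
Lemma nm_ex i x j : {N : nat | bin_of_nat N = BinNums.Npos (iter j BinNums.xI (nm_base i x))}.
Proof. by exists (nat_of_bin (BinNums.Npos (iter j BinNums.xI (nm_base i x)))); rewrite nat_of_binK. Qed.

Definition nm i x j : nat := proj1_sig (nm_ex i x j).

Lemma bin_nm i x j : bin_of_nat (nm i x j) = BinNums.Npos (iter j BinNums.xI (nm_base i x)).
Proof. exact: (proj2_sig (nm_ex i x j)). Qed.

Lemma iter_xI_inj a b p q : iter a BinNums.xI (BinNums.xO p) = iter b BinNums.xI (BinNums.xO q) -> a = b /\ p = q.
Proof. by elim: a b => [|a IH] [|b] //= []; [move=> ->|move/IH=> [-> ->]]. Qed.

Lemma nm_inj i x j i' x' j' : nm i x j = nm i' x' j' -> [/\ i = i', x = x' & j = j'].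
Proof.
move=> /(congr1 bin_of_nat); rewrite !bin_nm /nm_base => -[] /iter_xI_inj [->].
by move=> /iter_xI_inj [->] /iter_xI_inj [->].
Qed.

Lemma enc_nm i x j : enc_nat (nm i x j) = true :: dbl_true j ++ enc_pos (nm_base i x).
Proof.
rewrite /enc_nat bin_nm; congr (_ :: _); elim: j => //= j IH.
by rewrite IH /dbl_true addnS.
Qed.

Definition tname := (nat * nat * option ix)%type.
Definition name_of m n j (t : tname) := nm t.1.1 t.1.2 (if t.2 is Some i then ixv m n j i else 0).
Definition name_line (t : tname) : seq piece :=
  Str [:: true] :: (if t.2 is Some i then [:: Rep i] else [::]) ++ [:: Str (enc_pos (nm_base t.1.1 t.1.2))].

Lemma line_cat m n j l l' : line_word m n j (l ++ l') = line_word m n j l ++ line_word m n j l'.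
Proof. by rewrite /line_word map_cat flatten_cat. Qed.

Lemma line_str m n j s l : line_word m n j (Str s :: l) = s ++ line_word m n j l.
Proof. by []. Qed.

Lemma name_lineE m n j t : line_word m n j (name_line t) = enc_nat (name_of m n j t).
Proof.
by case: t => [[i x] [k|]]; rewrite /name_of enc_nm /name_line /line_word /= ?cats0.
Qed.

Inductive tc := TA of tname | TTop | TBot | TNeg of tc | TAnd of tc & tc | TOr of tc & tc | TEx of tc | TAll of tc.

Section Instances.

Variables m n j : nat.

Fixpoint tinst (t : tc) : concept := match t with
  | TA a => Atomic (name_of m n j a)
  | TTop => Top
  | TBot => Bot
  | TNeg t => Neg (tinst t)
  | TAnd t u => And (tinst t) (tinst u)
  | TOr t u => Or (tinst t) (tinst u)
  | TEx t => Ex 0 (tinst t)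
  | TAll t => All 0 (tinst t)
  end.

Definition tinst2 (c : tc * tc) := (tinst c.1, tinst c.2).

End Instances.

Fixpoint tc_line (t : tc) : seq piece := match t with
  | TA a => Str [:: false; true; false] :: name_line a
  | TTop => [:: Str [:: false; false; false]]
  | TBot => [:: Str [:: false; false; true]]
  | TNeg t => Str [:: false; true; true] :: tc_line t
  | TAnd t u => Str [:: true; false; false] :: tc_line t ++ tc_line u
  | TOr t u => Str [:: true; false; true] :: tc_line t ++ tc_line u
  | TEx t => Str [:: true; true; false; false] :: tc_line t
  | TAll t => Str [:: true; true; true; false] :: tc_line t
  end.

Lemma tc_lineE m n j t : line_word m n j (tc_line t) = enc_concept (tinst m n j t).
Proof.
elim: t => [a|||t IH|t IH u IH'|t IH u IH'|t IH|t IH] //=;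
  by rewrite line_str ?line_cat ?name_lineE ?IH ?IH' //=.
Qed.

Definition ci_line (c : tc * tc) := tc_line c.1 ++ tc_line c.2.
Lemma ci_lineE m n j c : line_word m n j (ci_line c) = enc_ci (tinst2 m n j c).
Proof. by rewrite line_cat !tc_lineE. Qed.

Inductive group A := Fixed of seq A | PerM of seq A | PerIn of seq A & seq A.

Section Groups.

Variables (A B : Type) (f : nat -> nat -> nat -> A -> B) (line : A -> seq piece) (e : B -> seq bool).
Hypothesis lineE : forall m n j a, line_word m n j (line a) = e (f m n j a).

Definition group_inst (w : seq bool) m (g : group A) := match g with
  | Fixed s => map (f m (size w) 0) s
  | PerM s => flatten [seq map (f m (size w) j) s | j <- iota 0 m]
  | PerIn s1 s0 => flatten [seq map (f m (size w) j) (if nth false w j then s1 else s0) | j <- iota 0 (size w)]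
  end.

Definition groups_inst w m gs := flatten (map (group_inst w m) gs).

Definition items_line (s : seq A) := flatten [seq Str [:: true] :: line a | a <- s].
Definition group_block g := match g with
  | Fixed s => Once (items_line s)
  | PerM s => LoopM (items_line s)
  | PerIn s1 s0 => LoopIn (items_line s1) (items_line s0)
  end.
Definition groups_text gs := rcons (map group_block gs) (Once [:: Str [:: false]]).

Definition items_word (s : seq B) := flatten [seq true :: e b | b <- s].

Lemma items_lineE m n j s : line_word m n j (items_line s) = items_word (map (f m n j) s).
Proof.
elim: s => //= a s IH; rewrite /items_line /= -cat_cons line_cat -/(items_line s) IH.
by rewrite line_str lineE.
Qed.

Lemma items_cat s s' : items_word (s ++ s') = items_word s ++ items_word s'.
Proof. by rewrite /items_word map_cat flatten_cat. Qed.

Lemma items_flatten ss : items_word (flatten ss) = flatten (map items_word ss).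
Proof. by elim: ss => //= s ss IH; rewrite items_cat IH. Qed.

Lemma group_blockE w m g : block_word w m (group_block g) = items_word (group_inst w m g).
Proof.
case: g => [s|s|s1 s0] /=; rewrite ?items_lineE // items_flatten -map_comp; congr flatten; apply: eq_map => j /=.
  exact: items_lineE.
by case: (nth _ _ _); rewrite items_lineE.
Qed.

Lemma enc_seq_items s : enc_seq e s = items_word s ++ [:: false].
Proof. by elim: s => //= b s ->; rewrite -catA. Qed.

Lemma groups_textE w m gs : text_word w m (groups_text gs) = enc_seq e (groups_inst w m gs).
Proof.
rewrite /text_word /groups_text map_rcons flatten_rcons /= enc_seq_items items_flatten.
by congr (flatten _ ++ _); rewrite -!map_comp; apply: eq_map => g /=; rewrite group_blockE.
Qed.

End Groups.

(** * The two TBoxes and the signature *)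

Section Kbs.

Variable M : tm.

Definition Sym : finType := option (bool + aux M).
Definition rk (T : finType) (x : T) : nat := enum_rank x.
Lemma rk_inj (T : finType) : injective (@rk T).
Proof. by move=> x y /ord_inj /enum_rank_inj. Qed.

Definition L i := TA (i, 0, None).
Definition Lx i x := TA (i, x, None).
Definition Lj d i := TA (i, 0, Some (ICur d)).
Definition Lm i := TA (i, 0, Some IM).
Definition Ln i := TA (i, 0, Some IN).
Definition st (q : state M) := Lx 18 (rk q).
Definition sy (s : Sym) := Lx 19 (rk s).

Fixpoint ands (s : seq tc) := if s is t :: s then TAnd t (ands s) else TTop.
Fixpoint ors (s : seq tc) := if s is t :: s then TOr t (ors s) else TBot.
(** [Lm 2] is the carry out of all [m] counter bits, that is, the mark of the last node of a block.
    Nothing is transported across the end of a block. *)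
Definition nlast t := TOr (Lm 2) (TAll t).
Definition xor t u := TOr (TAnd t (TNeg u)) (TAnd (TNeg t) u).
Definition xnor t u := TOr (TAnd t u) (TAnd (TNeg t) (TNeg u)).
Definition mvc (d : move) := match d with MoveL => 0 | Stay => 1 | MoveR => 2 end.
Definition keeps (t : tc) := (t, nlast t).

(* Kinds of concept names: 0, 1, 2 the bits of the counter, their negations and
   the carries; 3, 4 the first node of a block and its negation; 5, 6 the bits of time
   and position; 7, 8, 9 all lower bits of time are 0, of position 0, of position 1;
   10 node; 11 root; 12 escape; 13, 14 position 0, position not 0; 15 the position is
   that of the parent moved by [x]; 16, 17 expected and actual bits; 18, 19, 20 states,
   symbols and states of the input phase; 21-27 names of the second knowledge base. *)
Definition base1 : seq (tc * tc) :=
  [:: (TTop, L 2); (Lm 2, TAll (L 3)); (TTop, nlast (L 4));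
      (L 3, ands [:: L 10; L 7; L 8; L 9]); (L 10, TOr (Lm 2) (TEx (L 10)));
      (TAnd (L 7) (TNeg (L 5)), nlast (L 7)); (L 5, nlast (TNeg (L 7))); (TNeg (L 7), nlast (TNeg (L 7)));
      (TAnd (L 8) (TNeg (L 6)), nlast (L 8)); (L 6, nlast (TNeg (L 8))); (TNeg (L 8), nlast (TNeg (L 8)));
      (TAnd (L 9) (L 6), nlast (L 9)); (TNeg (L 6), nlast (TNeg (L 9))); (TNeg (L 9), nlast (TNeg (L 9)));
      (L 13, TNeg (L 6)); (ands [:: L 14; Lm 2; L 8], L 6)].

Definition marks1 : seq (tc * tc) :=
  [:: (xnor (L 5) (L 7), Lx 16 0); (xor (L 5) (L 7), Lx 16 1);
      (xnor (L 6) (L 8), Lx 16 2); (xor (L 6) (L 8), Lx 16 3);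
      (TNeg (L 6), Lx 16 4); (L 6, Lx 16 5);
      (xnor (L 6) (L 9), Lx 16 6); (xor (L 6) (L 9), Lx 16 7);
      (TNeg (L 5), Lx 17 0); (L 5, Lx 17 1);
      (TAnd (Lx 15 0) (TNeg (L 6)), Lx 17 2); (TAnd (Lx 15 0) (L 6), Lx 17 3);
      (TAnd (Lx 15 1) (TNeg (L 6)), Lx 17 4); (TAnd (Lx 15 1) (L 6), Lx 17 5);
      (TAnd (Lx 15 2) (TNeg (L 6)), Lx 17 6); (TAnd (Lx 15 2) (L 6), Lx 17 7)].

Definition labels1 : seq tc := [:: L 13; L 14; Lx 15 0; Lx 15 1; Lx 15 2; Ln 20] ++
  [seq st q | q <- enum (state M)] ++ [seq sy s | s <- enum Sym].

Definition rule (src : tc) (a x : Sym) (d : move) (s : Sym) : tc :=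
  TOr (if s == x then TEx (ands [:: L 3; src; sy a; L 13; Lx 15 (mvc d)]) else TBot)
      (TAnd (TEx (ands [:: L 3; src; sy a; L 13])) (TEx (ands [:: L 3; src; sy s; L 14; Lx 15 (mvc d)]))).

Definition zero := TAnd (L 7) (TNeg (L 5)).

Definition into (q : state M) (s : Sym) : seq tc :=
  (if q == start M then [:: rule (L 20) None None MoveR s] else [::]) ++
  flatten [seq match trans qa.1 qa.2 with
               | Some (q', x, d) => if q' == q then [:: rule (st qa.1) qa.2 x d s] else [::]
               | None => [::] end | qa <- enum {: state M * Sym}].

Definition steps1 : seq (tc * tc) :=
  [seq (ands [:: Lm 2; st qs.1; sy qs.2; TNeg zero], ors (into qs.1 qs.2)) | qs <- enum {: state M * Sym}].

Definition rejecting : seq (state M * Sym) :=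
  [seq qa <- enum {: state M * Sym} | (if trans qa.1 qa.2 is Some _ then false else true) && ~~ accepting qa.1].

(** Claims of time 0 may only be about the blank tape in the first state of the input phase, and
    that state occurs at no other time. A root that does not escape starts with a claim of a
    rejecting halting configuration. *)
Definition ends1 : seq (tc * tc) :=
  [seq (ands [:: Lm 2; zero; st q], TBot) | q <- enum (state M)] ++
  [seq (ands [:: Lm 2; zero; sy s], TBot) | s <- enum Sym & s != None] ++
  [:: (ands [:: Lm 2; Ln 20; TNeg zero], TBot);
      (L 11, TOr (L 12) (ands [:: L 3; L 13; ors [seq TAnd (st qa.1) (sy qa.2) | qa <- rejecting]]))].

Definition counter1 : seq (tc * tc) :=
  [:: (TTop, TOr (Lj 0 0) (Lj 0 1)); (TAnd (Lj 0 0) (Lj 0 1), TBot);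
      (TAnd (Lj 0 2) (Lj 0 0), TAnd (Lj 1 2) (TAll (Lj 0 1))); (Lj 1 2, TAnd (Lj 0 2) (Lj 0 0));
      (TAnd (Lj 0 2) (Lj 0 1), TAll (Lj 0 0)); (Lj 0 0, TOr (Lj 0 2) (TAll (Lj 0 0)));
      (Lj 0 1, TOr (Lj 0 2) (TAll (Lj 0 1))); (L 3, Lj 0 1)].

(** State [inl j] is entered from [inl j.+1] by writing the letter [j] of the input, which is
    [b]. *)
Definition phase1 (b : bool) : seq (tc * tc) :=
  [:: keeps (Lj 0 20); (ands [:: Lm 2; zero; Lj 0 20], TBot)] ++
  [seq (ands [:: Lm 2; Lj 0 20; sy s; TNeg zero], rule (Lj 1 20) None (Some (inl b)) MoveL s) | s <- enum Sym].

Definition tbox1 : seq (group (tc * tc)) :=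
  [:: Fixed base1; Fixed marks1; Fixed (map keeps labels1); Fixed steps1; Fixed ends1; PerM counter1;
      PerIn (phase1 true) (phase1 false)].

Definition neg_code e := if odd e then e.-1 else e.+1.

(** Name 22 guesses the node of the parent, 23 walks to the start of the next block, and 24 walks
    inside that block to a node with the opposite digit, so the two blocks are successive. Name 25
    at both ends compares the counter with the value memorized by 26 and 27. *)
Definition error2 e : seq (tc * tc) :=
  [:: (Lx 22 e, ands [:: L 25; Lx 16 e; TEx (Lx 23 e)]);
      (Lx 23 e, TOr (TAnd (L 4) (TEx (Lx 23 e))) (TAnd (L 3) (Lx 24 e)));
      (Lx 24 e, TOr (TEx (TAnd (L 4) (Lx 24 e))) (TAnd (L 25) (Lx 17 (neg_code e))))].

Definition match2 : seq (tc * tc) :=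
  [:: (L 25, TOr (TAnd (Lj 0 0) (Lj 0 26)) (TAnd (Lj 0 1) (Lj 0 27)));
      (Lj 0 26, TAll (Lj 0 26)); (Lj 0 27, TAll (Lj 0 27)); (TAnd (Lj 0 26) (Lj 0 27), TBot)].

Definition tbox2 : seq (group (tc * tc)) :=
  [:: Fixed [:: (L 21, TOr (TEx (L 21)) (TOr (L 12) (ors [seq Lx 22 e | e <- iota 0 8])))];
      Fixed (flatten [seq error2 e | e <- iota 0 8]); PerM match2].

Definition sigma : seq (group tname) :=
  [:: Fixed ([:: (3, 0, None); (4, 0, None); (12, 0, None)] ++
      [seq (16, e, None) | e <- iota 0 8] ++ [seq (17, e, None) | e <- iota 0 8]);
      PerM [:: (0, 0, Some (ICur 0)); (1, 0, Some (ICur 0))]].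

Variables (w : seq bool) (m : nat).

Definition K1 := KB (groups_inst tinst2 w m tbox1) [:: CAssert (nm 11 0 0) 0].
Definition K2 := KB (groups_inst tinst2 w m tbox2) [:: CAssert (nm 21 0 0) 0].
Definition Sg := Signature (groups_inst name_of w m sigma) [:: 0].

End Kbs.

Definition input_text M : seq block :=
  groups_text ci_line (tbox1 M) ++ [:: Once [:: Str (enc_seq enc_assertion [:: CAssert (nm 11 0 0) 0])]] ++
  groups_text ci_line tbox2 ++ [:: Once [:: Str (enc_seq enc_assertion [:: CAssert (nm 21 0 0) 0])]] ++
  groups_text name_line sigma ++ [:: Once [:: Str (enc_seq enc_nat [:: 0])]].

Lemma input_textE M w m : text_word w m (input_text M) = enc_input (K1 M w m, K2 w m, Sg w m).
Proof.
have tcat s s' : text_word w m (s ++ s') = text_word w m s ++ text_word w m s'.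
  by rewrite /text_word map_cat flatten_cat.
have tstr s : text_word w m [:: Once [:: Str s]] = s by rewrite /text_word /= /line_word /= !cats0.
rewrite /input_text !tcat !tstr.
rewrite !(groups_textE (e := enc_ci) ci_lineE) (groups_textE (e := enc_nat) name_lineE).
rewrite /enc_input /enc_kb /enc_signature; cbn [fst snd tbox abox sig_c sig_r K1 K2 Sg].
by rewrite -!catA.
Qed.

(** * Runs on a circular tape *)

Section Circular.

Variables (M : tm) (w : seq bool) (S : nat).
Local Notation n := (size w).
Local Notation Sym := (Sym M).

Definition mst := (nat + state M)%type.

(* Before [M] starts, the states [inl n], .., [inl 0] write the input from right to left. *)
Definition mtrans (q : mst) (a : Sym) : option (mst * Sym * move) := match q with
  | inl k => if a is None then Some (if k is k.+1 then (inl k, Some (inl (nth false w k)), MoveL)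
                                     else (inr (start M), None, MoveR)) else None
  | inr q => if trans q a is Some (q', x, d) then Some (inr q', x, d) else None
  end.

(** Cells are numbered from the head, so a move renumbers them: cell [p] after the move was cell
    [sh d p] before it. *)
Definition sh d p := match d with MoveL => (p + S.-1) %% S | Stay => p | MoveR => p.+1 %% S end.

(* Configurations on a circular tape with [S] cells, numbered from the head. *)
Definition cconf := (mst * (nat -> Sym))%type.
Definition circ_step (c : cconf) : option cconf := if mtrans c.1 (c.2 0) is Some (q, x, d)
  then Some (q, fun p => if sh d p == 0 then x else c.2 (sh d p)) else None.
Definition crun t : option cconf := iter t (obind circ_step) (Some (inl n, fun _ => None)).

Definition Claim t p q s := p < S /\ exists c, [/\ crun t = Some c, c.1 = q & c.2 p = s].

Hypothesis S_gt1 : 1 < S.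

Lemma sh_lt d p : p < S -> sh d p < S.
Proof. by case: d => //= _; apply: ltn_pmod; lia. Qed.

Lemma Claim_step t p q s q' a x d : mtrans q' a = Some (q, x, d) -> Claim t 0 q' a -> p < S ->
  (sh d p = 0 /\ s = x) \/ (sh d p <> 0 /\ Claim t (sh d p) q' s) -> Claim t.+1 p q s.
Proof.
move=> E [_ [c [Hc E1 E2]]] pS H; split=> //.
exists (q, fun p => if sh d p == 0 then x else c.2 (sh d p)).
rewrite /crun iterS -/(crun t) Hc /= /circ_step E1 E2 E; split=> //=.
case: H => [[-> ->]//|[/eqP/negbTE -> [_ [c' [Hc' _ <-]]]]].
by move: Hc'; rewrite Hc => -[->].
Qed.

Lemma Claim_inv t p q s : Claim t.+1 p q s -> exists q' a x d,
  [/\ mtrans q' a = Some (q, x, d), Claim t 0 q' a &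
      (sh d p = 0 /\ s = x) \/ (sh d p <> 0 /\ Claim t (sh d p) q' s)].
Proof.
move=> [pS [c [Hc E1 E2]]]; move: Hc; rewrite /crun iterS -/(crun t).
case Ec : (crun t) => [c'|] //= Hs; move: (Hs); rewrite /circ_step.
case Et : (mtrans c'.1 (c'.2 0)) => [[[q1 x] d]|] // -[Ecc].
exists c'.1, (c'.2 0), x, d; rewrite -E1 -Ecc /=; split=> //.
  by split; [lia|exists c'].
rewrite -E2 -Ecc /=; case: eqP => h; [by left|right]; split=> //.
by split; [exact: sh_lt|exists c'].
Qed.

(** The circular tape agrees with the two-way one up to distance [B] from the head. Each step uses
    up one unit of [B], and [S] is so large that the two sides do not meet. *)
Definition sim B (l : seq Sym) x r (c : nat -> Sym) :=
  (forall p, p <= B -> nth None (x :: r) p = c p) /\ (forall p, p < B -> nth None l p = c (S - p.+1)).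

Lemma sim_step B l a r c q x d (C : config M) : 2 * B.+1 < S -> sim B.+1 l a r c ->
  C = shift q l x r d -> sim B (cleft C) (chead C) (cright C)
    (fun p => if sh d p == 0 then x else c (sh d p)).
Proof.
move=> BS [H1 H2] ->; case: d => /=.
- split=> p pB.
    case: p pB => [|[|p]] pB.
    + rewrite add0n modn_small; last by lia.
      rewrite ifF; last by lia.
      by have := H2 0 isT; rewrite subn1 nth0.
    + by rewrite (_ : 1 + S.-1 = S) ?modnn //; lia.
    rewrite (_ : p.+2 + S.-1 = p.+1 + S); last by lia.
    by rewrite modnDr modn_small ?ifF -?H1 //=; lia.
  rewrite (_ : S - p.+1 + S.-1 = S - p.+2 + S); last by lia.
  by rewrite modnDr modn_small ?ifF -?H2 ?nth_behead //; lia.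
- split=> p pB.
    rewrite modn_small ?ifF -?H1 //=; try lia.
    by case: p {pB} => [|p] /=; rewrite ?nth0 ?nth_behead.
  case: p pB => [|p] pB; first by rewrite (_ : (S - 1).+1 = S) ?modnn //; lia.
  rewrite (_ : (S - p.+2).+1 = S - p.+1) ?modn_small ?ifF -?H2 //=; lia.
split=> p pB.
  by case: p pB => [|p] pB //=; rewrite -H1 //=; lia.
by rewrite ifF -?H2 //; lia.
Qed.

Lemma sim_run t B C0 C c0 k : 2 * (B + t) < S -> iter t (obind (@step M)) (Some C0) = Some C ->
  crun k = Some (inr (cstate C0), c0) -> sim (B + t) (cleft C0) (chead C0) (cright C0) c0 ->
  exists c, crun (k + t) = Some (inr (cstate C), c) /\ sim B (cleft C) (chead C) (cright C) c.
Proof.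
elim: t B C => [|t IH] B C BS /=; first by rewrite !addn0 => -[<-] Hk Hs; exists c0.
rewrite -addSnnS in BS *; case Et : (iter _ _ _) => [C1|] //= Hst Hk Hs.
have [c1 [Hc1 Hs1]] := IH _ _ BS Et Hk Hs.
move: Hst; rewrite /step; case Er : (trans _ _) => [[[q x] d]|] // -[EC].
exists (fun p => if sh d p == 0 then x else c1 (sh d p)); split.
  rewrite addnS /crun iterS -/(crun _) Hc1 /= /circ_step /=.
  by rewrite -(Hs1.1 0 isT) /= Er -EC; case: (d).
by apply: (sim_step _ Hs1 (esym EC)); lia.
Qed.

Definition word_tape (o j : nat) p : Sym :=
  if (0 < p + o) && (p + o <= j) then Some (inl (nth false w (n - j + p + o).-1)) else None.

Lemma phase_run j : j <= n -> n + 2 < S -> exists c, crun j = Some (inl (n - j), c) /\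
  forall p, p < S -> c p = word_tape 0 j p.
Proof.
move=> jn nS; elim: j jn => [|j IH] jn.
  exists (fun _ => None); rewrite subn0; split=> // p _; rewrite /word_tape ifF //.
  by rewrite addn0; case: p.
have [c [Hc E]] := IH (ltnW jn).
rewrite /crun iterS -/(crun j) Hc /= /circ_step /= E ?addn0 /word_tape /=; last by lia.
rewrite -(subnSK jn); eexists; split; first by [].
move=> p; rewrite /sh; case: p => [|[|p]] pS.
- rewrite add0n modn_small ?ifF ?E /word_tape; try lia.
  by rewrite !addn0 ifF //; lia.
- by rewrite (_ : 1 + S.-1 = S) ?modnn /= ?addn0 ?addn1; [|lia].
rewrite (_ : p.+2 + S.-1 = p.+1 + S); last by lia.
rewrite modnDr modn_small; last by lia.
rewrite /= E; last by lia.
rewrite /word_tape !addn0 !ltnS leq0n /=; case: ifP => // h; congr (Some (inl (nth _ _ _))); lia.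
Qed.

Lemma start_run B : n + 2 < S -> 2 * B < S -> n + B < S -> exists c, crun n.+1 = Some (inr (start M), c) /\
  sim B [::] (chead (init M w)) (cright (init M w)) c.
Proof.
move=> nS BS nB; have [c [Hc E]] := phase_run (leqnn n) nS; rewrite subnn in Hc.
rewrite /crun iterS -/(crun n) Hc /= /circ_step /= E /word_tape /=; last by lia.
eexists; split; first by [].
have init_nth p : nth None (head None (map (insym M) w) :: behead (map (insym M) w)) p =
    if p < n then Some (inl (nth false w p)) else None.
  have -> : nth None (head None (map (insym M) w) :: behead (map (insym M) w)) p = nth None (map (insym M) w) p.
    by case: (w) p => [|b v] [|p] //=; rewrite nth_nil.
  case: ltnP => h; first by rewrite (nth_map false).
  by rewrite nth_default ?size_map.
split=> p pB.
  rewrite init_nth modn_small; last by lia.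
  by rewrite /= E ?/word_tape ?addn0 ?subnn ?add0n //=; lia.
rewrite nth_nil; case: p pB => [|p] pB; first by rewrite (_ : (S - 1).+1 = S) ?modnn //; lia.
rewrite (_ : (S - p.+2).+1 = S - p.+1) ?modn_small; try lia.
case: eqP => // _; rewrite E /word_tape ?addn0; last by lia.
by rewrite ifF //; lia.
Qed.

Lemma crun_None t k : crun t = None -> crun (t + k) = None.
Proof. by move=> H; elim: k => [|k IH]; rewrite ?addn0 // addnS /crun iterS -/(crun _) IH. Qed.

Variables (L : seq bool -> Prop) (T : nat -> nat).
Hypothesis HL : decides_in M L T.
Hypothesis TS : 2 * (T n + n + 3) < S.

Lemma halting : exists t C c, [/\ t < S, crun t = Some (inr (cstate C), c), c 0 = chead C,
  trans (cstate C) (chead C) = None & accepting (cstate C) <-> L w].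
Proof.
have [t [C [tT [Hr Hh] Ha]]] := HL w.
have [c0 [H0 Hs]] : exists c, crun n.+1 = Some (inr (start M), c) /\
  sim t [::] (chead (init M w)) (cright (init M w)) c by apply: start_run; lia.
have [|c [Hc Hs1]] := @sim_run t 0 (init M w) C c0 n.+1 _ Hr H0 Hs; first by lia.
exists (n.+1 + t), C, c; split=> //; first by lia.
- by rewrite -(Hs1.1 0 isT).
by move: Hh; rewrite /step; case: trans => [[[]]|].
Qed.

(** The run is deterministic and stops at its halting configuration, so a claim of a rejecting
    halting state can only be about that configuration. *)
Lemma reject_not t q a : Claim t 0 (inr q) a -> (q, a) \in rejecting M -> ~ L w.
Proof.
move=> [_ [c [Hc Eq Ea]]]; rewrite mem_filter /= => /andP [/andP [Ht Hna] _].
have [t' [C [c' [_ Hc' Ea' Ht' HA]]]] := halting.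
have stop k c1 q1 : crun k = Some c1 -> c1.1 = inr q1 -> trans q1 (c1.2 0) = None -> crun k.+1 = None.
  by move=> H1 H2 H3; rewrite /crun iterS -/(crun k) H1 /= /circ_step H2 /= H3.
have S1 := stop _ _ _ Hc Eq; rewrite Ea in S1.
have {}S1 : crun t.+1 = None by apply: S1; move: Ht; case: trans.
have S2 : crun t'.+1 = None by apply: (stop _ _ _ Hc' erefl); rewrite /= Ea'.
case: (ltngtP t t') => h.
- by have := crun_None (t' - t.+1) S1; rewrite subnKC // Hc'.
- by have := crun_None (t - t'.+1) S2; rewrite subnKC // Hc.
move: Hc; rewrite h Hc' => -[Ec]; move: Eq; rewrite -Ec /= => -[Eq].
by rewrite -HA Eq; apply/negP.
Qed.

Lemma not_reject : ~ L w -> exists t q a, [/\ t < S, Claim t 0 (inr q) a & (q, a) \in rejecting M].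
Proof.
move=> nL; have [t [C [c [tS Hc Ea Ht HA]]]] := halting.
exists t, (cstate C), (chead C); split=> //.
  by split; [lia|exists (inr (cstate C), c)].
rewrite mem_filter mem_enum /= Ht andbT; apply/negP => /HA //.
Qed.

End Circular.

(** * Binary arithmetic and satisfaction of templates *)

(** The carry reaches bit [i] iff all lower bits of [x] are 1, that is, iff [2 ^ i] divides
    [x.+1]. *)
Lemma bit_succ i x : bit i x.+1 = bit i x (+) (2 ^ i %| x.+1).
Proof. by rewrite /bit divnS ?expn_gt0 // oddD addbC; case: dvdn. Qed.

Lemma bit_mod i x B : i < B -> bit i (x %% 2 ^ B) = bit i x.
Proof.
move=> iB; rewrite /bit [x in RHS](divn_eq x (2 ^ B)) -(subnK (ltnW iB)) expnD mulnA divnMDl ?expn_gt0 //.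
by rewrite oddD oddM (_ : odd (2 ^ (B - i)) = false) ?andbF // -(subnSK iB) oddX.
Qed.

Lemma dvd_bit i x : (2 ^ i.+1 %| x) = (2 ^ i %| x) && ~~ bit i x.
Proof.
rewrite /bit expnSr; apply/idP/andP => [h|[/dvdnP [k ->]]].
  have h1 : 2 ^ i %| x by apply: dvdn_trans h; apply: dvdn_mulr.
  move/dvdnP: h => [k ->]; split; first by rewrite mulnCA; apply: dvdn_mulr.
  by rewrite mulnCA mulKn ?expn_gt0 // oddM andbF.
by rewrite mulnK ?expn_gt0 // -dvdn2 mulnC => h; apply: dvdn_mul.
Qed.

Lemma dvd_bit1 i x : (2 ^ i.+1 %| x.+1) = (2 ^ i %| x.+1) && bit i x.
Proof. by rewrite dvd_bit bit_succ; case: dvdn => //=; case: bit. Qed.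

Lemma bit_pred i p B : i < B -> p < 2 ^ B -> bit i ((p + (2 ^ B).-1) %% 2 ^ B) = bit i p (+) (2 ^ i %| p).
Proof.
move=> iB pB; set y := _ %% _; case: p @y pB => [|p] y pB.
  rewrite dvdn0 /y add0n modn_small ?prednK ?expn_gt0 // [bit i 0]bit_small ?expn_gt0 //.
  have := bit_succ i (2 ^ B).-1; rewrite prednK ?expn_gt0 //.
  rewrite (_ : 2 ^ i %| 2 ^ B); last by rewrite dvdn_Pexp2l // ltnW.
  rewrite {1}/bit -{1}(subnK (ltnW iB)) expnD mulnK ?expn_gt0 // -(subnSK iB) oddX /=.
  by case: bit.
rewrite /y addSnnS prednK ?expn_gt0 // modnDr modn_small; last by lia.
by rewrite bit_succ -addbA addbb addbF.
Qed.

Lemma bit_next i p B : i < B -> bit i (p.+1 %% 2 ^ B) = bit i p (+) (2 ^ i %| p.+1).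
Proof. by move=> iB; rewrite bit_mod // bit_succ. Qed.

Lemma bit_ext_lt B x y : x < 2 ^ B -> y < 2 ^ B -> (forall i, i < B -> bit i x = bit i y) -> x = y.
Proof.
move=> hx hy H; apply: bit_ext => i; case: (ltnP i B) => h; first exact: H.
by rewrite !bit_small // ?(leq_trans hx) ?(leq_trans hy) // leq_exp2l.
Qed.

Definition nat_of_bits B (f : nat -> Prop) := num (mkseq (fun i => pb (f i)) B).

Lemma nat_of_bits_lt B f : nat_of_bits B f < 2 ^ B.
Proof. by have := num_lt (mkseq (fun i => pb (f i)) B); rewrite size_mkseq. Qed.

Lemma bit_of_bits B f i : i < B -> bit i (nat_of_bits B f) = pb (f i).
Proof. by move=> h; rewrite /nat_of_bits bit_num nth_mkseq. Qed.

Section Sat.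

Variables (I : interp) (w : seq bool) (m : nat).

Definition satT j (s : seq (tc * tc)) := forall c, List.In c s -> forall d : dom I,
  ext (tinst m (size w) j c.1) d -> ext (tinst m (size w) j c.2) d.

Definition satG (g : group (tc * tc)) := match g with
  | Fixed s => satT 0 s
  | PerM s => forall j, j < m -> satT j s
  | PerIn s1 s0 => forall j, j < size w -> satT j (if nth false w j then s1 else s0)
  end.

Lemma satG_P gs : (forall C D, List.In (C, D) (groups_inst tinst2 w m gs) -> forall d : dom I, ext C d -> ext D d) <->
  forall g, List.In g gs -> satG g.
Proof.
have aux j s : (forall C D, List.In (C, D) (map (tinst2 m (size w) j) s) -> forall d : dom I, ext C d -> ext D d) <-> satT j s.
  split=> [H c Hc|H C D /In_map [c Hc]]; first by apply: H; apply/In_map; exists c.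
  by rewrite /tinst2 => -[<- <-]; apply: H.
have iot a k : List.In a (iota 0 k) <-> a < k by rewrite (rwP (InP _ _)) mem_iota add0n.
split=> [H g Hg|H C D].
  have {}H C D : List.In (C, D) (group_inst tinst2 w m g) -> forall d : dom I, ext C d -> ext D d.
    by move=> HI; apply: H; apply/In_flatten; exists (group_inst tinst2 w m g) => //; apply/In_map; exists g.
  case: g Hg H => [s|s|s1 s0] _ /= H; first exact/aux.
    by move=> j jm; apply/aux => C D HI; apply: H; apply/In_flatten; eexists; [apply/In_map; exists j; [exact/iot|by []]|exact: HI].
  by move=> j jm; apply/aux => C D HI; apply: H; apply/In_flatten; eexists; [apply/In_map; exists j; [exact/iot|by []]|exact: HI].
move=> /In_flatten [l /In_map [g Hg <-]] HI; have := H g Hg.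
case: g Hg HI => [s|s|s1 s0] _ /=; first by move=> HI /aux; apply.
  by move=> /In_flatten [l' /In_map [j /iot jm <-]] HI /(_ _ jm) /aux; apply.
by move=> /In_flatten [l' /In_map [j /iot jm <-]] HI /(_ _ jm) /aux; apply.
Qed.

Lemma satT_nth j s k : satT j s -> k < size s -> forall d : dom I,
  ext (tinst m (size w) j (nth (TTop, TTop) s k).1) d -> ext (tinst m (size w) j (nth (TTop, TTop) s k).2) d.
Proof.
move=> H hk; apply: H; elim: s k hk => [|a s IH] [|k] //= hk; [by left|by right; apply: IH].
Qed.

Lemma ext_ors j s (d : dom I) : ext (tinst m (size w) j (ors s)) d <-> exists2 t, List.In t s & ext (tinst m (size w) j t) d.
Proof.
elim: s => [|t s IH] /=; first by split=> // -[].
rewrite IH; split=> [[h|[u hu h]]|[u [<-|hu] h]]; [by exists t; [left|]|by exists u; [right|]|by left|by right; exists u].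
Qed.

Lemma satT_cat j s1 s2 : satT j (s1 ++ s2) <-> satT j s1 /\ satT j s2.
Proof.
split=> [H|[H1 H2] c /In_cat [/H1|/H2] //].
by split=> c Hc; apply: H; apply/In_cat; auto.
Qed.

Lemma satT_map j (T : eqType) (f : T -> tc * tc) l : satT j (map f l) <->
  forall x, x \in l -> forall d : dom I, ext (tinst m (size w) j (f x).1) d -> ext (tinst m (size w) j (f x).2) d.
Proof.
split=> [H x /InP xl|H c /In_map [x /InP xl <-]]; last exact: H.
by apply: H; apply/In_map; exists x.
Qed.

End Sat.

(** * Claims in models of the first knowledge base *)

Section Soundness.

Variables (M : tm) (w : seq bool) (m : nat).
Local Notation n := (size w).
Local Notation B := (2 ^ m).
Local Notation S := (2 ^ (2 ^ m)).
Local Notation Sym := (Sym M).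

Variable I1 : interp.
Hypothesis M1 : model I1 (K1 M w m).

Local Notation D := (dom I1).
Definition lb i x j (d : D) := cint (nm i x j) d.
Local Notation l1 i d := (lb i 0 0 d).
Local Notation r := (rint (i := I1) 0).

Lemma sat1 g : List.In g (tbox1 M) -> satG I1 w m g.
Proof. exact: (satG_P I1 w m (tbox1 M)).1 M1.1 g. Qed.

Lemma base k : k < size base1 -> forall d : D, ext (tinst m n 0 (nth (TTop, TTop) base1 k).1) d ->
  ext (tinst m n 0 (nth (TTop, TTop) base1 k).2) d.
Proof. by apply: satT_nth; apply: (sat1 (g := Fixed base1)); left. Qed.
Arguments base {k} _ d _.

Lemma marks k : k < size marks1 -> forall d : D, ext (tinst m n 0 (nth (TTop, TTop) marks1 k).1) d ->
  ext (tinst m n 0 (nth (TTop, TTop) marks1 k).2) d.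
Proof. by apply: satT_nth; apply: (sat1 (g := Fixed marks1)); right; left. Qed.
Arguments marks {k} _ d _.

Lemma counter k j : k < size counter1 -> j < m -> forall d : D,
  ext (tinst m n j (nth (TTop, TTop) counter1 k).1) d -> ext (tinst m n j (nth (TTop, TTop) counter1 k).2) d.
Proof.
move=> hk jm; apply: satT_nth hk; apply: (sat1 (g := PerM counter1)) jm.
by do 5 right; left.
Qed.
Arguments counter {k j} _ _ d _.

Local Notation X j d := (lb 0 0 j d).
Local Notation Cr j d := (lb 2 0 j d).
Local Notation Tb d := (l1 5 d).
Local Notation Pb d := (l1 6 d).
Local Notation last d := (lb 2 0 m d).

Definition val d := nat_of_bits m (fun j => X j d).

Lemma Xbar j d : j < m -> ~ X j d -> lb 1 0 j d.
Proof. by move=> jm; have /= := counter (k := 0) isT jm d I; rewrite /lb /name_of /= !addn0; case. Qed.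

Lemma Xdisj j d : j < m -> X j d -> lb 1 0 j d -> False.
Proof. by move=> jm h1 h2; have /= := counter (k := 1) isT jm d; rewrite /lb /name_of /= !addn0; apply. Qed.

Lemma carry j d : j <= m -> Cr j d <-> 2 ^ j %| (val d).+1.
Proof.
elim: j => [|j IH] jm.
  by rewrite expn0 dvd1n; split=> // _; have /= := base (k := 0) isT d I.
have := counter (k := 2) isT jm d; have := counter (k := 3) isT jm d.
rewrite /= /name_of /= !addn0 !addn1 -!/(lb _ _ _ _) => h3 h2.
rewrite dvd_bit1 (bit_of_bits _ jm); split=> [/h3 [/(IH (ltnW jm)) -> /(rwP (pbP _)) ->]//|/andP [/(IH (ltnW jm)) h /pbP h']].
by have [] := h2 (conj h h').
Qed.

Lemma lastE d : last d <-> val d = B.-1.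
Proof.
rewrite carry //; have lt := nat_of_bits_lt m (fun j => X j d); rewrite -/(val d) in lt *.
split=> [h|->]; last by rewrite prednK ?expn_gt0.
by have := dvdn_leq (ltn0Sn _) h; lia.
Qed.

Lemma val_next d e : r d e -> val e = (val d).+1 %% B.
Proof.
move=> He; apply: (@bit_ext_lt m); rewrite ?nat_of_bits_lt ?ltn_pmod ?expn_gt0 // => j jm.
rewrite bit_next // !bit_of_bits //.
have := counter (k := 2) isT jm d; have := counter (k := 4) isT jm d.
have := counter (k := 5) isT jm d; have := counter (k := 6) isT jm d.
rewrite /= /name_of /= !addn0 !addn1 -!/(lb _ _ _ _) => h6 h5 h4 h2.
have hc := carry d (ltnW jm); have xb := Xbar (d := d) jm.
apply/idP/idP => [/pbP Xe|].
  case: (pbP (X j d)) => Xd; case: (boolP (2 ^ j %| (val d).+1)) => // c.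
    by have [_ /(_ e He) /(Xdisj jm Xe)] := h2 (conj (hc.2 c) Xd).
  case: (h6 (xb Xd)) => [/hc|/(_ e He) /(Xdisj jm Xe) //]; by rewrite (negbTE c).
case: (pbP (X j d)) => Xd; case: (boolP (2 ^ j %| (val d).+1)) => // c _; apply/pbP.
  by case: (h5 Xd) => [/hc|/(_ e He) //]; rewrite (negbTE c).
exact: (h4 (conj (hc.2 c) (xb Xd)) e He).
Qed.

Lemma val_first d : l1 3 d -> val d = 0.
Proof.
move=> Fd; apply: (@bit_ext_lt m); rewrite ?nat_of_bits_lt ?expn_gt0 // => j jm.
rewrite bit_of_bits // [bit j 0]bit_small ?expn_gt0 //; apply/pbP => Xd.
have /= := counter (k := 7) isT jm d; rewrite /name_of /= !addn0 => /(_ Fd).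
exact: Xdisj.
Qed.

Lemma next_cases d e : r d e -> (last d /\ l1 3 e) \/ (~ last d /\ l1 4 e).
Proof.
move=> He; case: (classic (last d)) => h; [left|right]; split=> //.
  exact: (base (k := 1) isT d h e He).
by have /= := base (k := 2) isT d I; case=> // /(_ e He).
Qed.

Definition kept (l : D -> Prop) := forall d e, ~ last d -> r d e -> l d -> l e.

Lemma kept_keeps j t : (forall d : D, ext (tinst m n j t) d -> ext (tinst m n j (nlast t)) d) ->
  kept (fun d => ext (tinst m n j t) d).
Proof. by move=> H d e nl He /H /= [//|]; apply. Qed.

Lemma low_next i b d e : i \in [:: 7; 8; 9] -> b = (if i == 7 then 5 else 6) -> ~ last d -> r d e ->
  l1 i e <-> l1 i d /\ (if i == 9 then l1 b d else ~ l1 b d).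
Proof.
rewrite !inE => /or3P [] /eqP -> -> nl He; rewrite /lb /=.
- have := base (k := 5) isT d; have := base (k := 6) isT d; have := base (k := 7) isT d.
  rewrite /= /name_of /= -!/(lb _ _ _ _) => h3 h2 h1; split=> [he|h]; last by case: (h1 h) => // /(_ e He).
  split=> [|t]; last by case: (h2 t) => // /(_ e He).
  by apply: NNPP => nb; case: (h3 nb) => // /(_ e He).
- have := base (k := 8) isT d; have := base (k := 9) isT d; have := base (k := 10) isT d.
  rewrite /= /name_of /= -!/(lb _ _ _ _) => h3 h2 h1; split=> [he|h]; last by case: (h1 h) => // /(_ e He).
  split=> [|t]; last by case: (h2 t) => // /(_ e He).
  by apply: NNPP => nb; case: (h3 nb) => // /(_ e He).
have := base (k := 11) isT d; have := base (k := 12) isT d; have := base (k := 13) isT d.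
rewrite /= /name_of /= -!/(lb _ _ _ _) => h3 h2 h1; split=> [he|h]; last by case: (h1 h) => // /(_ e He).
by split; apply: NNPP => nb; [case: (h3 nb)|case: (h2 nb)] => // /(_ e He).
Qed.

Lemma next_ex d : exists e, l1 10 d -> ~ last d -> r d e /\ l1 10 e.
Proof.
case: (classic (l1 10 d /\ ~ last d)) => [[h nl]|h]; last by exists d => h1 h2; case: h.
have /= := base (k := 4) isT d h; case=> // -[e [He Ne]]; by exists e.
Qed.

(** Nodes of a model may have many successors; one is fixed, so that a block becomes a function of
    its first node. *)
Definition nxt d := proj1_sig (constructive_indefinite_description _ (next_ex d)).
Lemma nxtP d : l1 10 d -> ~ last d -> r d (nxt d) /\ l1 10 (nxt d).
Proof. exact: (proj2_sig (constructive_indefinite_description _ (next_ex d))). Qed.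

Definition blk d i := iter i nxt d.
Definition time d := nat_of_bits B (fun i => Tb (blk d i)).
Definition pos d := nat_of_bits B (fun i => Pb (blk d i)).

Lemma B_gt0 : 0 < B. Proof. by rewrite expn_gt0. Qed.

Lemma blk_val d i : l1 3 d -> i < B -> l1 10 (blk d i) /\ val (blk d i) = i.
Proof.
move=> Fd; elim: i => [|i IH] iB.
  by split; [have [] := base (k := 3) isT d Fd|exact: val_first].
have [N v] := IH (ltnW iB).
have nl : ~ last (blk d i) by rewrite lastE v; lia.
have [He Ne] := nxtP N nl; split=> //; rewrite /blk iterS -/(blk d i).
by rewrite (val_next He) v modn_small.
Qed.

Lemma blk_last d i : l1 3 d -> i < B -> last (blk d i) <-> i.+1 = B.
Proof. by move=> Fd iB; rewrite lastE (blk_val Fd iB).2; have := B_gt0; lia. Qed.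

Lemma blk_next d i : l1 3 d -> i.+1 < B -> r (blk d i) (blk d i.+1) /\ ~ last (blk d i).
Proof.
move=> Fd iB; have nl : ~ last (blk d i) by rewrite (blk_last Fd (ltnW iB)); lia.
by split=> //; apply: (nxtP (blk_val Fd (ltnW iB)).1 nl).1.
Qed.

Lemma blk_kept l d i : kept l -> l1 3 d -> l d -> i < B -> l (blk d i).
Proof.
move=> Hl Fd ld; elim: i => [//|i IH] iB; have [He nl] := blk_next Fd iB.
exact: Hl nl He (IH (ltnW iB)).
Qed.

Lemma blk_low d i : l1 3 d -> i < B -> [/\ l1 7 (blk d i) <-> 2 ^ i %| time d,
  l1 8 (blk d i) <-> 2 ^ i %| pos d & l1 9 (blk d i) <-> 2 ^ i %| (pos d).+1].
Proof.
move=> Fd; elim: i => [|i IH] iB.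
  by rewrite expn0 !dvd1n; have /= [_ [? [? [? _]]]] := base (k := 3) isT d Fd; split; split.
have [h7 h8 h9] := IH (ltnW iB); have [He nl] := blk_next Fd iB.
have E7 := low_next (i := 7) isT erefl nl He; have E8 := low_next (i := 8) isT erefl nl He.
have E9 := low_next (i := 9) isT erefl nl He; rewrite /= in E7 E8 E9.
have a1 (l l' t : Prop) b : (l' <-> l /\ ~ t) -> (l <-> is_true b) -> (l' <-> b && ~~ pb t).
  move=> -> ->; split=> [[-> nt]|/andP [-> nt]]; first by apply/negP => /pbP.
  by split=> // /pbP ht; rewrite ht in nt.
have a2 (l l' t : Prop) b : (l' <-> l /\ t) -> (l <-> is_true b) -> (l' <-> b && pb t).
  by move=> -> ->; split=> [[-> /pbP]|/andP [-> /pbP]].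
rewrite dvd_bit (dvd_bit i (pos d)) dvd_bit1 !bit_of_bits ?(ltnW iB) //.
by split; [apply: a1 E7 h7|apply: a1 E8 h8|apply: a2 E9 h9].
Qed.

Definition Rch d := exists k (e : nat -> D), [/\ e 0 = iint I1 0, e k = d & forall i, i < k -> r (e i) (e i.+1)].

(** All that a path must offer to carry a model of [K2]: nodes [k] and [k + l] with contradictory
    marks and equal counters, and exactly one block start, [k + f], after the first and not after
    the second. *)
Definition errpath := exists k l f (e : nat -> D) x, [/\ x < 8, e 0 = iint I1 0, 0 < f <= l,
  (forall i, i < k + l -> r (e i) (e i.+1)) &
  [/\ l1 3 (e (k + f)), (forall i, 0 < i <= l -> i != f -> l1 4 (e (k + i))),
      lb 16 x 0 (e k), lb 17 (neg_code x) 0 (e (k + l)) &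
      forall j, j < m -> X j (e k) <-> X j (e (k + l))]].

Hypothesis noerr : ~ errpath.

Definition lastn d := blk d B.-1.

Lemma lastnP d : l1 3 d -> last (lastn d).
Proof. by move=> Fd; rewrite blk_last ?prednK ?B_gt0. Qed.

Lemma Rch_path d k (e : nat -> D) : Rch d -> e 0 = d -> (forall i, i < k -> r (e i) (e i.+1)) ->
  exists k0 (g : nat -> D), [/\ g 0 = iint I1 0, forall i, i < k0 + k -> r (g i) (g i.+1) & forall i, g (k0 + i) = e i].
Proof.
move=> [k0 [g [g0 gk Hg]]] e0 He; exists k0, (fun i => if i < k0 then g i else e (i - k0)).
split.
- by case: (posnP k0) => h //; rewrite sub0n e0 -gk h.
- move=> i ik; case: (ltnP i k0) => h; case: (ltnP i.+1 k0) => h'; try lia.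
  + exact: Hg.
  + have E : i.+1 = k0 by lia.
    by rewrite -E subnn e0 -gk -E; apply: Hg.
  by rewrite subSn //; apply: He; lia.
move=> i; rewrite ifF ?addKn //; lia.
Qed.

Definition two d d' s := if s < B then blk d s else blk d' (s - B).

Lemma two_next d d' i : l1 3 d -> l1 3 d' -> r (lastn d) d' -> i.+1 < B + B -> r (two d d' i) (two d d' i.+1).
Proof.
move=> Fd Fd' He iB; rewrite /two; have := B_gt0 => B0.
case: (ltnP i B) => h; case: (ltnP i.+1 B) => h'; try lia.
- by case: (blk_next Fd h').
- have E : i.+1 = B by lia.
  by rewrite E subnn (_ : i = B.-1) //; lia.
rewrite subSn //; apply: (proj1 (blk_next Fd' _)); lia.
Qed.

Lemma Rch_next d d' : l1 3 d -> Rch d -> r (lastn d) d' -> Rch d'.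
Proof.
move=> Fd HR He; have Fd' : l1 3 d' by case: (next_cases He) => [[]|[/(_ (lastnP Fd))]].
have B0 := B_gt0.
have [||k0 [g [g0 Hg E]]] := @Rch_path d B (two d d') HR; first by rewrite /two B0.
  by move=> i iB; apply: two_next => //; lia.
by exists (k0 + B), g; split=> //; rewrite E /two ltnn subnn.
Qed.

(** Nodes with the same offset [i] in successive blocks are [B] apart, and the block start between
    them comes [B - i] steps after the first; contradictory marks there would form an error path. *)
Lemma no_error d d' i x : l1 3 d -> Rch d -> r (lastn d) d' -> i < B -> x < 8 ->
  lb 16 x 0 (blk d i) -> lb 17 (neg_code x) 0 (blk d' i) -> False.
Proof.
move=> Fd HR He iB x8 h1 h2; apply: noerr; have B0 := B_gt0.
have Fd' : l1 3 d' by case: (next_cases He) => [[]|[/(_ (lastnP Fd))]].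
have [||k0 [g [g0 Hg E]]] := @Rch_path d (B + B).-1 (two d d') HR; first by rewrite /two B0.
  by move=> k kB; apply: two_next => //; lia.
have E1 : g (k0 + i) = blk d i by rewrite E /two iB.
have E2 : g (k0 + i + B) = blk d' i by rewrite -addnA E /two ifF ?addnK //; lia.
exists (k0 + i), B, (B - i), g, x; split=> //; first by lia.
  by move=> k kB; apply: Hg; lia.
split.
- by rewrite -addnA subnKC ?(ltnW iB) // E /two ltnn subnn.
- move=> k kB kf; have := next_cases (Hg (k0 + i + k.-1) _).
  rewrite -addnS prednK; last by lia.
  case; [by lia| |by case].
  case=> hl _; move: hl; rewrite -addnA E /two; case: ltnP => h.
    by rewrite blk_last //; lia.
  by rewrite blk_last //; lia.
- by rewrite E1.
- by rewrite E2.
move=> j jm; rewrite E1 E2.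
have v1 := (blk_val Fd iB).2; have v2 := (blk_val Fd' iB).2.
have := bit_of_bits (fun j => X j (blk d i)) jm; have := bit_of_bits (fun j => X j (blk d' i)) jm.
by rewrite -!/(val _) v1 v2 => -> H; split=> /pbP h; apply/pbP; [rewrite H|rewrite -H].
Qed.

Lemma xor_pb (A C V : Prop) (a b : bool) : (A <-> a) -> (C <-> b) ->
  ((A /\ C) \/ (~ A /\ ~ C) -> ~ V) -> ((A /\ ~ C) \/ (~ A /\ C) -> V) -> pb V = a (+) b.
Proof.
move=> hA hC H1 H2; case: pbP => hV; move: H1 H2; rewrite hA hC; case: (a); case: (b) => H1 H2 //=;
  exfalso; first [apply: (H1 _ hV)|apply: hV; apply: H2]; by [left|right].
Qed.

(** Bit by bit: without errors of codes 0 and 1 the child can only carry the digits of the time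
    minus one. *)
Lemma time_next d d' : l1 3 d -> Rch d -> r (lastn d) d' -> 0 < time d -> time d = (time d').+1.
Proof.
move=> Fd HR He t0; suff -> : time d' = (time d).-1 by rewrite prednK.
apply: (@bit_ext_lt B); rewrite ?nat_of_bits_lt //.
  by apply: leq_ltn_trans (leq_pred _) (nat_of_bits_lt _ _).
move=> i iB; rewrite bit_of_bits //.
have -> : bit i (time d).-1 = bit i (time d) (+) (2 ^ i %| time d).
  by have := bit_succ i (time d).-1; rewrite prednK // => ->; rewrite -addbA addbb addbF.
have err x := no_error Fd HR He (i := i) (x := x) iB.
have [h7 _ _] := blk_low Fd iB.
have hT : Tb (blk d i) <-> bit i (time d) by rewrite bit_of_bits //; split=> /pbP.
apply: (xor_pb hT h7) => h; [move=> hV|apply: NNPP => hV].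
  exact: (err 0 isT (marks (k := 0) isT _ h) (marks (k := 9) isT _ hV)).
exact: (err 1 isT (marks (k := 1) isT _ h) (marks (k := 8) isT _ hV)).
Qed.

Lemma kept_label t : List.In t (labels1 M) -> kept (fun d => ext (tinst m n 0 t) d).
Proof.
move=> Ht; apply: kept_keeps.
have H : satT I1 w m 0 (map keeps (labels1 M)).
  by apply: (sat1 (g := Fixed (map keeps (labels1 M)))); do 2 right; left.
by apply: (H (keeps t)); apply/In_map; exists t.
Qed.

Lemma kept_l1 k : k < 6 -> kept (fun d => ext (tinst m n 0 (nth TTop (labels1 M) k)) d).
Proof. by move=> hk; apply: kept_label; do 6 (case: k hk => [|k] hk; first by simpl; tauto). Qed.

Lemma pos_next d d' dr : l1 3 d -> Rch d -> r (lastn d) d' -> lb 15 (mvc dr) 0 d' ->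
  pos d' = sh S dr (pos d).
Proof.
move=> Fd HR He hc; have S1 : 1 < S by rewrite -{1}(expn0 2) ltn_exp2l // expn_gt0.
have Fd' : l1 3 d' by case: (next_cases He) => [[]|[/(_ (lastnP Fd))]].
apply: (@bit_ext_lt B); rewrite ?sh_lt ?nat_of_bits_lt // => i iB; rewrite bit_of_bits //.
have err x := no_error Fd HR He (i := i) (x := x) iB.
have [_ h8 h9] := blk_low Fd iB.
have hP : Pb (blk d i) <-> bit i (pos d) by rewrite bit_of_bits //; split=> /pbP.
have hcmp k : k < 3 -> lb 15 k 0 d' -> lb 15 k 0 (blk d' i).
  move=> k3 h; apply: (blk_kept (l := lb 15 k 0)) => //.
  by case: k k3 {h} => [|[|[|k]]] // _; [apply: (kept_l1 (k := 2))|apply: (kept_l1 (k := 3))|apply: (kept_l1 (k := 4))].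
have {}hcmp : lb 15 (mvc dr) 0 (blk d' i) by apply: hcmp => //; case: (dr).
case: dr hcmp {hc} => /= hc.
- rewrite bit_pred ?nat_of_bits_lt //; apply: (xor_pb hP h8) => h; [move=> hV|apply: NNPP => hV].
    exact: (err 2 isT (marks (k := 2) isT _ h) (marks (k := 11) isT _ (conj hc hV))).
  exact: (err 3 isT (marks (k := 3) isT _ h) (marks (k := 10) isT _ (conj hc hV))).
- rewrite bit_next //; apply: (xor_pb hP h9) => h; [move=> hV|apply: NNPP => hV].
    exact: (err 6 isT (marks (k := 6) isT _ h) (marks (k := 15) isT _ (conj hc hV))).
  exact: (err 7 isT (marks (k := 7) isT _ h) (marks (k := 14) isT _ (conj hc hV))).
apply/pbP/idP => [hV|/hP h].
  by apply/hP; apply: NNPP => h; exact: (err 4 isT (marks (k := 4) isT _ h) (marks (k := 13) isT _ (conj hc hV))).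
apply: NNPP => hV; exact: (err 5 isT (marks (k := 5) isT _ h) (marks (k := 12) isT _ (conj hc hV))).
Qed.

Lemma Zpos d : l1 3 d -> l1 13 d -> pos d = 0.
Proof.
move=> Fd hZ; apply: (@bit_ext_lt B); rewrite ?nat_of_bits_lt ?expn_gt0 // => i iB.
rewrite bit_of_bits // [bit i 0]bit_small ?expn_gt0 //; apply/pbP => hP.
have hZ' : l1 13 (blk d i) by apply: (blk_kept (kept_l1 (k := 0) isT) Fd hZ iB).
exact: (base (k := 14) isT _ hZ' hP).
Qed.

Lemma NZpos d : l1 3 d -> l1 14 d -> pos d <> 0.
Proof.
move=> Fd hZ E; have iB : B.-1 < B by rewrite prednK ?B_gt0.
have hZ' : l1 14 (lastn d) by apply: (blk_kept (kept_l1 (k := 1) isT) Fd hZ iB).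
have [_ h8 _] := blk_low Fd iB.
have hP : Pb (lastn d).
  by apply: (base (k := 15) isT); split=> //; split; [exact: lastnP|split=> //; apply/h8; rewrite E dvdn0].
by have := bit_of_bits (fun i => Pb (blk d i)) iB; rewrite -/(pos d) E bit_small ?expn_gt0 //; case: pbP.
Qed.

Definition qlab (q : mst M) d := match q with inl k => k <= n /\ lb 20 0 k d | inr q => lb 18 (rk q) 0 d end.

Lemma satph j : j < n -> satT I1 w m j (phase1 M (nth false w j)).
Proof.
move=> jn; have := sat1 (g := PerIn (phase1 M true) (phase1 M false)); rewrite /= => H.
by have := H ltac:(tauto) j jn; case: nth.
Qed.

Lemma kept_q q : kept (qlab q).
Proof.
case: q => [k|q] d e nl He /=; last first.
  apply: (kept_label (t := st q)) nl He; apply/In_cat; right; apply/In_cat; left.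
  by apply/In_map; exists q => //; apply/InP; rewrite mem_enum.
move=> [kn h]; split=> //; rewrite leq_eqVlt in kn; case/orP: kn => [/eqP E|kn].
  by rewrite E in h *; exact: (kept_l1 (k := 5) isT nl He h).
have := @satT_nth _ _ _ _ _ 0 (satph kn) isT d; rewrite /= /name_of /= addn0 => /(_ h) [//|].
exact.
Qed.

Lemma kept_s (s : Sym) : kept (lb 19 (rk s) 0).
Proof.
apply: (kept_label (t := sy s)); apply/In_cat; right; apply/In_cat; right.
by apply/In_map; exists s => //; apply/InP; rewrite mem_enum.
Qed.

Lemma zeroE d : l1 3 d -> ext (tinst m n 0 (zero)) (lastn d) <-> time d = 0.
Proof.
move=> Fd; have iB : B.-1 < B by rewrite prednK ?B_gt0.
have [h7 _ _] := blk_low Fd iB; have hT := bit_of_bits (fun i => Tb (blk d i)) iB; rewrite -/(time d) in hT.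
have -> : ext (tinst m n 0 zero) (lastn d) = (l1 7 (blk d B.-1) /\ ~ l1 5 (blk d B.-1)) by [].
have E2 := dvd_bit B.-1 (time d); rewrite prednK ?B_gt0 // in E2.
split=> [[/h7 h1 h2]|E]; last first.
  rewrite h7 E dvdn0; split=> // h; move: hT; rewrite E bit_small ?expn_gt0 //; by case: pbP.
have h : 2 ^ B %| time d by rewrite E2 h1 hT; apply/negP => /pbP.
by apply/eqP; case: posnP => // t0; have := dvdn_leq t0 h; rewrite leqNgt nat_of_bits_lt.
Qed.

Local Notation Claim := (@Claim M w S).

Lemma rule_claim t d (q q' : mst M) (a x s : Sym) dr src j :
  (forall d', l1 3 d' -> Rch d' -> time d' = t ->
     forall q s, qlab q d' -> lb 19 (rk s) 0 d' -> Claim t (pos d') q s) ->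
  l1 3 d -> Rch d -> time d = t.+1 -> mtrans w q' a = Some (q, x, dr) ->
  (forall d', ext (tinst m n j src) d' -> qlab q' d') ->
  ext (tinst m n j (rule src a x dr s)) (lastn d) -> Claim t.+1 (pos d) q s.
Proof.
move=> IH Fd HR Ht Hm Hsrc; have pS := nat_of_bits_lt B (fun i => Pb (blk d i)).
have S1 : 1 < S by rewrite -{1}(expn0 2) ltn_exp2l // expn_gt0.
have nx d' : r (lastn d) d' -> Rch d' /\ time d' = t.
  move=> He; split; first exact: Rch_next He.
  by have := time_next Fd HR He; rewrite Ht => /(_ isT) [].
rewrite /rule; case=> [|[[d1 [He1 H1]] [d2 [He2 H2]]]].
  case: eqP => // -> [d' [He [F' [hs [ha [hZ [hc _]]]]]]]; have [R' t'] := nx _ He.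
  have E := pos_next Fd HR He hc; have E0 := Zpos F' hZ.
  apply: (Claim_step Hm) => //; first by have := IH _ F' R' t' _ _ (Hsrc _ hs) ha; rewrite E0.
  by left; rewrite -E.
case: H1 => [F1 [hs1 [ha1 [hZ1 _]]]]; have [R1 t1] := nx _ He1.
case: H2 => [F2 [hs2 [ha2 [hZ2 [hc2 _]]]]]; have [R2 t2] := nx _ He2.
apply: (Claim_step Hm) => //; first by have := IH _ F1 R1 t1 _ _ (Hsrc _ hs1) ha1; rewrite (Zpos F1 hZ1).
right; rewrite -(pos_next Fd HR He2 hc2); split; first exact: NZpos.
exact: (IH _ F2 R2 t2 _ _ (Hsrc _ hs2) ha2).
Qed.

(** Induction on the time. A block may carry several states and symbols; each pair of them is shown
    to be a true claim, which replaces any axiom of uniqueness. *)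
Lemma claims t d : l1 3 d -> Rch d -> time d = t ->
  forall q s, qlab q d -> lb 19 (rk s) 0 d -> Claim t (pos d) q s.
Proof.
elim: t d => [|t IH] d Fd HR Ht q s hq hs.
all: have iB : B.-1 < B by rewrite prednK ?B_gt0.
all: have hq' := blk_kept (kept_q (q := q)) Fd hq iB.
all: have hs' := blk_kept (kept_s (s := s)) Fd hs iB.
all: have hl := lastnP Fd.
all: have E1 := sat1 (g := Fixed (ends1 M)) ltac:(simpl; tauto).
  have hz := (zeroE Fd).2 Ht.
  move/satT_cat: E1 => [Eq /satT_cat [Es Er]].
  have Es' := (satT_map I1 w m 0 (fun s : Sym => (ands [:: Lm 2; zero; sy s], TBot)) _).1 Es.
  have Eq' := (satT_map I1 w m 0 (fun q : state M => (ands [:: Lm 2; zero; st q], TBot)) _).1 Eq.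
  have -> : s = None.
    apply/eqP; apply/negPn/negP => sN.
    have H : s \in [seq s <- enum Sym | s != None] by rewrite mem_filter sN mem_enum.
    exact: (Es' s H (lastn d) (conj hl (conj hz (conj hs' I)))).
  have -> : q = inl n.
    case: q hq hq' => [k|q] hq hq'.
      case: hq' => kn h; rewrite leq_eqVlt in kn; case/orP: kn => [/eqP -> //|kn].
      have H := @satT_nth _ _ _ _ _ 1 (satph kn) isT (lastn d).
      case: (H (conj hl (conj hz (conj _ I)))).
      by rewrite /= /name_of /= addn0.
    have H : q \in enum (state M) by rewrite mem_enum.
    by case: (Eq' q H (lastn d) (conj hl (conj hz (conj hq' I)))).
  by split; [exact: nat_of_bits_lt|exists (inl n, fun _ => None)].
have nz : ~ ext (tinst m n 0 zero) (lastn d) by move/(zeroE Fd); rewrite Ht.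
case: q hq hq' => [k|q] hq hq'.
  case: hq' => kn h; rewrite leq_eqVlt in kn; case/orP: kn => [/eqP Ek|kn].
    move/satT_cat: E1 => [_ /satT_cat [_ Er]].
    have H := satT_nth (k := 0) Er isT (d := lastn d); rewrite Ek in h.
    by case: (H (conj hl (conj h (conj nz I)))).
  have Hp := satph kn; case/satT_cat: Hp => _ /satT_map /(_ s).
  rewrite mem_enum => /(_ isT (lastn d)) H.
  apply: (rule_claim IH Fd HR Ht (q' := inl k.+1) (a := None) (dr := MoveL) _ _ (H _)) => //.
  - by move=> d' /=; rewrite /name_of /= addn1.
  by split=> //; split; [rewrite /= /name_of /= addn0|split=> //; split].
have H := (satT_map I1 w m 0 _ _).1 (sat1 (g := Fixed (steps1 M)) ltac:(simpl; tauto)) (q, s).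
rewrite mem_enum in H; have {}H := H isT (lastn d).
have /ext_ors [u Hu Hx] := H (conj hl (conj hq' (conj hs' (conj nz I)))).
move/In_cat: Hu => [|/In_flatten [l /In_map [[q' a] _ <-]]].
  case: eqP => //= E [Eu|//]; rewrite -Eu in Hx.
  by apply: (rule_claim IH Fd HR Ht (q' := inl 0) _ _ Hx) => //=; rewrite E.
case Et : (trans q' a) => [[[q1 x] dr]|] //=; case: eqP => //= E [Eu|//]; rewrite -Eu in Hx.
by apply: (rule_claim IH Fd HR Ht (q' := inr q') _ _ Hx) => //=; rewrite Et E.
Qed.

Lemma root_claim : l1 11 (iint I1 0) -> ~ l1 12 (iint I1 0) ->
  exists t q a, Claim t 0 (inr q) a /\ (q, a) \in rejecting M.
Proof.
move=> hr he; have E1 := sat1 (g := Fixed (ends1 M)) ltac:(simpl; tauto).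
move/satT_cat: E1 => [_ /satT_cat [_ Er]].
have := satT_nth (k := 1) Er isT (d := iint I1 0) hr; case=> // -[Fd [hZ [/ext_ors [u /In_map [[q a] /InP Hqa <-] [hq ha]] _]]].
exists (time (iint I1 0)), q, a; split=> //.
have HR : Rch (iint I1 0) by exists 0, (fun _ => iint I1 0).
by have := claims Fd HR erefl (q := inr q) hq ha; rewrite (Zpos Fd hZ).
Qed.

End Soundness.

(** * Models of the second knowledge base from counting errors *)

Section Signature.

Variables (w : seq bool) (m : nat).
Local Notation Sg := (Sg w m).

Lemma sigP A : A \in sig_c Sg <-> exists i x j, A = nm i x j /\
  ([/\ i \in [:: 3; 4; 12], x = 0 & j = 0] \/ [/\ i \in [:: 16; 17], x < 8 & j = 0] \/ [/\ i \in [:: 0; 1], x = 0 & j < m]).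
Proof.
have iot a k : List.In a (iota 0 k) <-> a < k by rewrite (rwP (InP _ _)) mem_iota add0n.
split=> [/InP /In_flatten [l /In_map [g Hg <-]]|[i [x [j [-> H]]]]].
  case: Hg => [<-|[<-|//]]; rewrite /group_inst.
    move=> /In_map [t Ht <-]; case/In_cat: Ht => [|/In_cat []].
    - case=> [<-|]; first by exists 3, 0, 0; split; [|left].
      case=> [<-|]; first by exists 4, 0, 0; split; [|left].
      by case=> [<-|//]; exists 12, 0, 0; split; [|left].
    - by move=> /In_map [e /iot he <-]; exists 16, e, 0; split; [|right; left].
    by move=> /In_map [e /iot he <-]; exists 17, e, 0; split; [|right; left].
  move=> /In_flatten [l1 /In_map [j /iot jm <-]] /=; rewrite /name_of /= addn0.
  by case=> [<-|[<-|//]]; [exists 0, 0, j|exists 1, 0, j]; split=> //; right; right.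
apply/InP/In_flatten; case: H => [[Hi -> ->]|[[Hi hx ->]|[Hi -> jm]]].
- eexists; first by left.
  rewrite /group_inst; apply/In_map; exists (i, 0, None) => //; apply/In_cat; left.
  by rewrite !inE in Hi; case/or3P: Hi => /eqP ->; [left|right; left|do 2 right; left].
- eexists; first by left.
  rewrite /group_inst; apply/In_map; exists (i, x, None) => //; apply/In_cat; right; apply/In_cat.
  by rewrite !inE in Hi; case/orP: Hi => /eqP ->; [left|right]; apply/In_map; exists x => //; apply/iot.
eexists; first by right; left.
apply/In_flatten; eexists; first by apply/In_map; exists j; [apply/iot|by []].
by rewrite !inE in Hi; case/orP: Hi => /eqP ->; [left|right; left]; rewrite /name_of /= addn0.
Qed.

Lemma sig_lt i x j : nm i x j \in sig_c Sg -> i < 20.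
Proof.
move=> /sigP [i' [x' [j' [/nm_inj [-> _ _]]]]].
by case=> [[]|[[]|[]]]; rewrite !inE => h _ _; lia.
Qed.

End Signature.

(** * Models of the second knowledge base along a single path *)

Section Paths.

Variables (w : seq bool) (m : nat).
Local Notation n := (size w).
Local Notation Sg := (Sg w m).

Section Path.

Variables (I1 : interp) (e : nat -> dom I1) (len : nat) (aux : nat -> nat -> nat -> nat -> Prop).
Hypothesis e0 : e 0 = iint I1 0.
Hypothesis estep : forall s, s < len -> rint 0 (e s) (e s.+1).

Definition pos2 (s : nat) : nat + nat := if s is s.+1 then inr s else inl 0.

(** A path of [I1] is cut out with its names in the signature, and [aux] interprets the names of
    [K2] of kind above 20. The start is the individual 0; all elements off the path are bare. *)
Definition I2 := @Interp nat
  (fun A d => exists s, [/\ d = pos2 s, s <= len &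
     (A \in sig_c Sg /\ cint A (e s)) \/ exists i x j, [/\ A = nm i x j, 20 < i & aux i x j s]])
  (fun R d d' => R = 0 /\ exists s, [/\ s < len, d = pos2 s & d' = pos2 s.+1]).

Lemma pos2_inj s s' : pos2 s = pos2 s' -> s = s'.
Proof. by case: s s' => [|s] [|s'] //= [->]. Qed.

Lemma auxE i x j d : 20 < i -> cint (i := I2) (nm i x j) d <-> exists s, [/\ d = pos2 s, s <= len & aux i x j s].
Proof.
move=> hi; split=> [[s [-> h [[/sig_lt]|[i' [x' [j' [/nm_inj [-> -> ->] _ ha]]]]]]]|[s [-> h ha]]].
- by lia.
- by exists s.
by exists s; split=> //; right; exists i, x, j.
Qed.

Lemma sigE A s : A \in sig_c Sg -> s <= len -> cint A (e s) -> cint (i := I2) A (pos2 s).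
Proof. by move=> h1 h2 h3; exists s; split=> //; left. Qed.

Lemma edgeE s : s < len -> rint (i := I2) 0 (pos2 s) (pos2 s.+1).
Proof. by move=> h; split=> //; exists s. Qed.

Lemma path_transfer q a : is_rucq q -> ucq_over Sg q -> {subset a <= [:: 0]} -> sat_ucq I2 q a -> sat_ucq I1 q a.
Proof.
move=> Hq Hov sub; pose V (d : dom I2) := exists2 s, s <= len & d = pos2 s.
pose h (d : dom I2) : dom I1 := match d with inl _ => e 0 | inr s => e s.+1 end.
have hp s : h (pos2 s) = e s by case: s.
apply: (hom_transfer (S := Sg) (V := V) (h := h)) => //.
- by move=> b /sub; rewrite inE => /eqP ->; split; [exists 0|rewrite /= e0].
- move=> A d AS _ [s [-> hs [[_ hc]|[i [x [j [EA hi _]]]]]]]; first by rewrite hp.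
  by move: AS; rewrite EA => /sig_lt; lia.
move=> R d d' _ [-> [s [hs -> ->]]]; split; last by rewrite !hp => _; apply: estep.
by split=> _; [exists s.+1|exists s => //; apply: ltnW].
Qed.

End Path.

Variables (M : tm) (I1 : interp).
Hypothesis M1 : model I1 (K1 M w m).

Lemma tbox2_sat I : (satT I w m 0 [:: (L 21, TOr (TEx (L 21)) (TOr (L 12) (ors [seq Lx 22 e | e <- iota 0 8])))]) ->
  (forall e, e < 8 -> satT I w m 0 (error2 e)) -> (forall j, j < m -> satT I w m j match2) ->
  cint (nm 21 0 0) (iint I 0) -> model I (K2 w m).
Proof.
move=> H1 H2 H3 H4; split; last by move=> s [<-|//].
suff H : forall g, List.In g tbox2 -> satG I w m g by exact: (proj2 (satG_P I w m tbox2) H).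
move=> g; case=> [<-|]; first exact: H1.
case=> [<-|[<-|//]]; last exact: H3.
move=> c /In_flatten [l /In_map [e he <-]].
by apply: H2; move/InP: he; rewrite mem_iota.
Qed.

Lemma esc_path : lb 12 0 0 (iint I1 0) -> exists e len aux, [/\ e 0 = iint I1 0,
  forall s, s < len -> rint (i := I1) 0 (e s) (e s.+1) & model (I2 e len aux) (K2 w m)].
Proof.
move=> hE; exists (fun _ => iint I1 0), 0, (fun i _ _ _ => i = 21); split=> //.
have no i x j d : cint (i := I2 (fun _ => iint I1 0) 0 (fun i _ _ _ => i = 21)) (nm i x j) d -> 21 < i -> False.
  by move=> h hi; move/auxE: h => [|s [_ _ E]]; [lia|rewrite E in hi].
apply: tbox2_sat.
- move=> c [<-|//] d /= /auxE [//|s [-> hs _]]; right; left; apply: sigE => //.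
  by apply/sigP; exists 12, 0, 0; split=> //; left.
- by move=> e he c; do 3 (case=> [<-|]; first by move=> d /= /no /(_ isT)).
- move=> j jm c; do 3 (case=> [<-|]; first by move=> d /= /no /(_ isT)).
  by case=> [<-|//] d /= [/no /(_ isT)].
by apply/auxE => //; exists 0.
Qed.

Lemma err_path : errpath m I1 -> exists e len aux, [/\ e 0 = iint I1 0,
  forall s, s < len -> rint (i := I1) 0 (e s) (e s.+1) & model (I2 e len aux) (K2 w m)].
Proof.
move=> [k [l [f [e [x [x8 e0 fl estep [hF hFb hE hG hX]]]]]]].
(* The intended reading of [error2] along the path: 21 up to node [k], 22 there, 23 up to the block
   start [k + f], 24 from there on, 25 at both ends, and 26, 27 recording the counter of node [k]
   from [k] on. *)
pose aux i y j s := match i with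
  | 21 => s <= k | 22 => y = x /\ s = k | 23 => y = x /\ k < s <= k + f | 24 => y = x /\ k + f <= s
  | 25 => s = k \/ s = k + l | 26 => k <= s /\ lb 0 0 j (e k) | 27 => k <= s /\ ~ lb 0 0 j (e k) | _ => False end.
exists e, (k + l), aux; split=> //.
pose J := I2 e (k + l) aux.
have sg i y j : [\/ [/\ i \in [:: 3; 4; 12], y = 0 & j = 0], [/\ i \in [:: 16; 17], y < 8 & j = 0] | [/\ i \in [:: 0; 1], y = 0 & j < m]] ->
    nm i y j \in sig_c Sg by move=> h; apply/sigP; exists i, y, j; split=> //; case: h; auto.
have hlb i y j s : [\/ [/\ i \in [:: 3; 4; 12], y = 0 & j = 0], [/\ i \in [:: 16; 17], y < 8 & j = 0] | [/\ i \in [:: 0; 1], y = 0 & j < m]] ->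
    s <= k + l -> lb i y j (e s) -> cint (i := J) (nm i y j) (pos2 s) by move=> /sg; apply: sigE.
have hed s : s < k + l -> rint (i := J) 0 (pos2 s) (pos2 s.+1) by apply: edgeE.
have hau i y j s : 20 < i -> s <= k + l -> aux i y j s -> cint (i := J) (nm i y j) (pos2 s).
  by move=> h1 h2 h3; apply/auxE => //; exists s.
apply: tbox2_sat.
- move=> c [<-|//] d /= /auxE [//|s [-> _ hs]].
  have {}hs : s <= k := hs.
  rewrite leq_eqVlt in hs; case/orP: hs => [/eqP ->|hs]; last first.
    left; exists (pos2 s.+1); split; first by apply: hed; lia.
    by apply: hau => //; rewrite /aux; lia.
  right; right; apply/(ext_ors (I := J) w m 0 [seq Lx 22 e | e <- iota 0 8]).
  by exists (Lx 22 x); [apply/In_map; exists x => //; apply/InP; rewrite mem_iota|apply: hau => //; lia].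
- move=> y y8 c; case=> [<-|].
    move=> d /= /auxE [//|s [-> _ [hy hk]]]; rewrite [s]hk [y](hy : y = x); split; first by apply: hau; [|lia|left].
    split; first by apply: hlb; [constructor 2|lia|].
    split=> //; exists (pos2 k.+1); split; first by apply: hed; lia.
    by apply: hau => //; [lia|split=> //; lia].
  case=> [<-|].
    move=> d /= /auxE [//|s [-> hs [hy hk]]]; rewrite [y](hy : y = x) {hy}; have {}hk : k < s <= k + f := hk; case: (ltnP s (k + f)) => h.
      left; split.
        apply: hlb => //; first by constructor 1.
        by have := hFb (s - k); rewrite subnKC; [apply; lia|lia].
      exists (pos2 s.+1); split; first by apply: hed; lia.
      by apply: hau; [|lia|split=> //; lia].
    have -> : s = k + f by lia.
    by right; split; [apply: hlb; [constructor 1|lia|]|apply: hau; [|lia|]].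
  case=> [<-|//] d /= /auxE [//|s [-> hs [hy hk]]]; rewrite [y](hy : y = x) {hy}; have {}hk : k + f <= s := hk.
  rewrite leq_eqVlt in hs; case/orP: hs => [/eqP ->|hs].
    right; split; first by apply: hau; [|lia|right].
    apply: hlb => //; constructor 2; split=> //; move: (x) x8; by do 8 (case=> //).
  left; exists (pos2 s.+1); split; first exact: hed.
  split; last by apply: hau; [|lia|split=> //; lia].
  apply: hlb; [by constructor 1|lia|].
  have := hFb (s.+1 - k); rewrite subnKC; last by lia.
  by apply; lia.
- move=> j jm c; case=> [<-|].
    move=> d /= /auxE [//|s [-> hs hy]]; rewrite /name_of /= !addn0.
    case: (classic (lb 0 0 j (e k))) => hX0; [left|right].
      split; last by apply: hau => //; case: hy => ->; split=> //; lia.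
      by apply: hlb => //; [constructor 3|case: hy => -> //; apply/hX].
    split; last by apply: hau => //; case: hy => ->; split=> //; lia.
    apply: hlb => //; first by constructor 3.
    by apply: (Xbar M1 jm); case: hy => -> //; rewrite -hX.
  case=> [<-|].
    move=> d; rewrite /= /name_of /= addn0 => /auxE [//|s [-> hs [hk hX0]]] d' [_ [s' [hs' /pos2_inj E ->]]].
    by rewrite -E in hs' *; exact: (hau 26 0 j s.+1 isT hs' (conj (leq_trans hk (leqnSn s)) hX0)).
  case=> [<-|].
    move=> d; rewrite /= /name_of /= addn0 => /auxE [//|s [-> hs [hk hX0]]] d' [_ [s' [hs' /pos2_inj E ->]]].
    by rewrite -E in hs' *; exact: (hau 27 0 j s.+1 isT hs' (conj (leq_trans hk (leqnSn s)) hX0)).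
  case=> [<-|//] d; rewrite /= /name_of /= addn0.
  by move=> [/auxE [//|s [-> hs [hk hX0]]] /auxE [//|s' [_ _ [_ /(_ hX0)]]]].
by apply: (hau 21 0 0 0).
Qed.

End Paths.

(** A model of [K1] with neither escape nor error path would make the rejecting claim at its root
    true. Otherwise the path found carries a model of [K2] that maps back into the model of [K1]. *)
Lemma entails_of_L (M : tm) L T w m : decides_in M L T -> 2 * (T (size w) + size w + 3) < 2 ^ (2 ^ m) ->
  L w -> rucq_entails (Sg w m) (K1 M w m) (K2 w m).
Proof.
move=> HL HT Lw q a Hq Hov _ sub Hent; split=> // I1 M1.
have hr : lb 11 0 0 (iint I1 0) by apply: (M1.2 (CAssert (nm 11 0 0) 0)); left.
have [e [len [aux [e0 es M2]]]] : exists e len aux, [/\ e 0 = iint I1 0,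
    forall s, s < len -> rint (i := I1) 0 (e s) (e s.+1) & model (I2 w m e len aux) (K2 w m)].
  case: (classic (lb 12 0 0 (iint I1 0))) => hE; first exact: esc_path.
  apply: (err_path M1); apply: NNPP => ne.
  have [t [q' [b [Hc Hr]]]] := root_claim M1 ne hr hE.
  by apply: (reject_not _ HL HT Hc Hr) => //; apply: leq_trans HT; lia.
exact: (path_transfer e0 es Hq Hov sub (Hent _ M2)).
Qed.

(** * The model of all true claims *)

Section Dag.

Variables (M : tm) (w : seq bool) (m : nat).
Local Notation n := (size w).
Local Notation B := (2 ^ m).
Local Notation S := (2 ^ (2 ^ m)).
Local Notation Sym := (Sym M).
Local Notation Claim := (@Claim M w S).

Lemma phase_time t p k s : Claim t p (inl k) s -> k + t = n.
Proof.
move=> [_ [c [Hc E _]]]; elim: t c k Hc E => [|t IH] c k; first by move=> [<-] /= [->]; rewrite addn0.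
rewrite /crun iterS -/(crun M w S t); case Ec : (crun M w S t) => [c'|] //=; rewrite /circ_step.
case Et : (mtrans w c'.1 (c'.2 0)) => [[[q x] d]|] // -[<-] /= Eq.
move: Et; rewrite Eq; case E1 : (c'.1) => [k'|q'] /=; last by case: trans => [[[]]|].
by case: (c'.2 0) => // ; case: k' E1 => [|k'] // E1 [<- _ _]; have := IH _ _ Ec E1; lia.
Qed.

(* [bc] is the direction in which the position is compared with that of the parent, 3 for none. *)
Record blck := Blck { bt : nat; bp : nat; bq : mst M; bs : Sym; bc : nat }.

Definition bvalid b := bt b < S /\ Claim (bt b) (bp b) (bq b) (bs b).
Definition child b b' := bt b = (bt b').+1 /\ forall d, bc b' = mvc d -> bp b' = sh S d (bp b).

Definition rej b := bp b = 0 /\ exists q, bq b = inr q /\ (q, bs b) \in rejecting M.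

Variable root : option blck.
Hypothesis root_ok : forall b, root = Some b -> bvalid b /\ rej b.

Definition bnode := {y : blck * nat | bvalid y.1 /\ y.2 < B}.

Definition dnode (d : iname + bnode) : option (blck * nat) := match d with
  | inl 0 => omap (fun b => (b, 0)) root
  | inl _ => None
  | inr y => Some (proj1_sig y) end.

Definition expb k (y : blck * nat) : bool := match k with
  | 0 => bit y.2 (bt y.1) (+) (2 ^ y.2 %| bt y.1)
  | 1 => bit y.2 (bp y.1) (+) (2 ^ y.2 %| bp y.1)
  | 2 => bit y.2 (bp y.1)
  | _ => bit y.2 (bp y.1) (+) (2 ^ y.2 %| (bp y.1).+1) end.

Definition gotb k (y : blck * nat) (v : bool) : Prop := match k with
  | 0 => bit y.2 (bt y.1) = v
  | k.+1 => bc y.1 = k /\ bit y.2 (bp y.1) = v end.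

(** [None] concerns individuals that start no block. No edge leaves them, so a few names satisfy all
    axioms: counter value 0, the carry into bit 0, all marks, and root with escape. With
    [root = None] this gives the consistency of [K1]. *)
Definition holds k x j (o : option (blck * nat)) : Prop := match o with
  | None => match k with 1 => True | 2 => j = 0 | 11 => True | 12 => True | 16 => True | 17 => True | _ => False end
  | Some y => match k with
    | 0 => bit j y.2 | 1 => ~ bit j y.2 | 2 => 2 ^ j %| y.2.+1 | 3 => y.2 = 0 | 4 => y.2 <> 0
    | 5 => bit y.2 (bt y.1) | 6 => bit y.2 (bp y.1)
    | 7 => 2 ^ y.2 %| bt y.1 | 8 => 2 ^ y.2 %| bp y.1 | 9 => 2 ^ y.2 %| (bp y.1).+1
    | 10 => True | 11 => y.2 = 0 /\ rej y.1 | 13 => bp y.1 = 0 | 14 => bp y.1 <> 0 | 15 => bc y.1 = x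
    | 16 => expb x./2 y = odd x | 17 => gotb x./2 y (odd x)
    | 18 => exists2 q, bq y.1 = inr q & x = rk q | 19 => x = rk (bs y.1) | 20 => bq y.1 = inl j
    | _ => False end
  end.

Definition bedge (y y' : blck * nat) := (y'.1 = y.1 /\ y'.2 = y.2.+1) \/ (y.2.+1 = B /\ y'.2 = 0 /\ child y.1 y'.1).

(** Proof trees are folded: there is one block for each true claim within the time range and each
    order of comparison, and all parents share it. Paths still end, since the time drops along
    [child]. *)
Definition Dag := @Interp bnode
  (fun A d => exists k x j, A = nm k x j /\ holds k x j (dnode d))
  (fun R d e => R = 0 /\ exists y y', [/\ dnode d = Some y, e = inr y' & bedge y (proj1_sig y')]).

Lemma cE k x j d : cint (i := Dag) (nm k x j) d <-> holds k x j (dnode d).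
Proof. by split=> [[k' [x' [j' [/nm_inj [-> -> ->]]]]]|h] //; exists k, x, j. Qed.

Lemma ncE k x j d : ~ cint (i := Dag) (nm k x j) d <-> ~ holds k x j (dnode d).
Proof. by split=> h h'; apply: h; apply/cE. Qed.

Lemma jE k j d : ext (I := Dag) (tinst m n j (Lj 0 k)) d <-> holds k 0 j (dnode d).
Proof. by rewrite -cE; change (ext _ _) with (cint (i := Dag) (nm k 0 (j + 0)) d); rewrite addn0. Qed.

Lemma j1E k j d : ext (I := Dag) (tinst m n j (Lj 1 k)) d <-> holds k 0 j.+1 (dnode d).
Proof. by rewrite -cE; change (ext _ _) with (cint (i := Dag) (nm k 0 (j + 1)) d); rewrite addn1. Qed.

Lemma dnode_valid d y : dnode d = Some y -> bvalid y.1 /\ y.2 < B.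
Proof.
case: d => [[|a]|[y' Hy]] //=; last by case=> <-.
by case E : root => [b|] //= [<-]; have [H _] := root_ok E; rewrite expn_gt0.
Qed.

Lemma lastB i : i < B -> 2 ^ m %| i.+1 <-> i.+1 = B.
Proof. by move=> h; split=> [/(dvdn_leq (ltn0Sn _))|->]; [lia|exact: dvdnn]. Qed.

Lemma edge_inv d e y : dnode d = Some y -> rint (i := Dag) 0 d e -> exists y', dnode e = Some y' /\ bedge y y' /\ y'.2 < B.
Proof.
move=> E [_ [y1 [y' [E1 -> He]]]]; exists (proj1_sig y'); split=> //.
by move: E1; rewrite E => -[->]; split=> //; case: y' {He} => y' [].
Qed.

Lemma edge_ex d y y' : dnode d = Some y -> bedge y y' -> bvalid y'.1 -> y'.2 < B ->
  exists e, rint (i := Dag) 0 d e /\ dnode e = Some y'.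
Proof.
move=> E He h1 h2; exists (inr (exist _ y' (conj h1 h2))); split=> //; split=> //.
by exists y, (exist _ y' (conj h1 h2)).
Qed.

Lemma dead d e : dnode d = None -> ~ rint (i := Dag) 0 d e.
Proof. by move=> E [_ [y [y' [E1]]]]; rewrite E in E1. Qed.

Lemma keep_next j (t : tc) d : (forall y, dnode d = Some y -> 2 ^ m %| y.2.+1 \/
    forall e, dnode e = Some (y.1, y.2.+1) -> ext (I := Dag) (tinst m n j t) e) ->
  ext (I := Dag) (tinst m n j (nlast t)) d.
Proof.
move=> H; case E : (dnode d) => [y|]; last by right=> e /dead; rewrite E => /(_ erefl).
have [_ yB] := dnode_valid E.
case: (H _ E) => [h|h]; first by left; apply/cE; rewrite E.
case: (boolP (2 ^ m %| y.2.+1)) => hl; first by left; apply/cE; rewrite E.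
right=> e /(edge_inv E) [y' [E' [[[h1 h2]|[h1 _]] _]]]; last by move: hl; rewrite h1 dvdnn.
by apply: h; rewrite E' -h1 -h2; case: (y').
Qed.

Lemma dag_base : 0 < m -> satT Dag w m 0 base1.
Proof.
move=> m0 c.
have lastE d y : dnode d = Some y -> ~ 2 ^ m %| y.2.+1 -> y.2.+1 < B.
  move=> /dnode_valid [_ h1] h2; rewrite ltn_neqAle h1 andbT; apply/eqP => E; apply: h2; rewrite E; exact: dvdnn.
case=> [<-|].
  by move=> d _; apply/cE; case: (dnode d) => //= y; rewrite dvd1n.
case=> [<-|].
  move=> d /cE; case E : (dnode d) => [y|]; last by move=> /= h; rewrite h in m0.
  move=> /= hl e He; have [y' [E' [[[h1 h2]|[h1 [h2 _]]] h3]]] := edge_inv E He; apply/cE; rewrite E' //=.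
  by have [_ h4] := dnode_valid E; move/(lastB h4): hl; lia.
case=> [<-|].
  move=> d _; apply: keep_next => y E; right=> e E'; apply/cE; by rewrite E'.
case=> [<-|].
  move=> d /cE; case E : (dnode d) => [y|] //= h.
  by do !split=> //; apply/cE; rewrite E //= h dvd1n.
case=> [<-|].
  move=> d /cE; case E : (dnode d) => [y|] //= _; have [hv hB] := dnode_valid E.
  case: (classic (2 ^ m %| y.2.+1)) => hl; first by left; apply/cE; rewrite E.
  have [e [He Ee]] := edge_ex E (y' := (y.1, y.2.+1)) (or_introl (conj erefl erefl)) hv (lastE _ _ E hl).
  by right; exists e; split=> //; apply/cE; rewrite Ee.
case=> [<-|].
  move=> d [/cE h1 /ncE h2]; apply: keep_next => y E; right=> e E'; apply/cE.
  by move: h1 h2; rewrite E E' /= dvd_bit => -> /negP.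
case=> [<-|].
  move=> d /cE h1; apply: keep_next => y E; right=> e E' /cE.
  by move: h1; rewrite E E' /= dvd_bit => -> /andP [].
case=> [<-|].
  move=> d /ncE h1; apply: keep_next => y E; right=> e E' /cE.
  by move: h1; rewrite E E' /= dvd_bit => h /andP [].
case=> [<-|].
  move=> d [/cE h1 /ncE h2]; apply: keep_next => y E; right=> e E'; apply/cE.
  by move: h1 h2; rewrite E E' /= dvd_bit => -> /negP.
case=> [<-|].
  move=> d /cE h1; apply: keep_next => y E; right=> e E' /cE.
  by move: h1; rewrite E E' /= dvd_bit => -> /andP [].
case=> [<-|].
  move=> d /ncE h1; apply: keep_next => y E; right=> e E' /cE.
  by move: h1; rewrite E E' /= dvd_bit => h /andP [].
case=> [<-|].
  move=> d [/cE h1 /cE h2]; apply: keep_next => y E; right=> e E'; apply/cE.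
  by move: h1 h2; rewrite E E' /= dvd_bit1 => -> ->.
case=> [<-|].
  move=> d /ncE h1; apply: keep_next => y E; right=> e E' /cE.
  by move: h1; rewrite E E' /= dvd_bit1 => h /andP [].
case=> [<-|].
  move=> d /ncE h1; apply: keep_next => y E; right=> e E' /cE.
  by move: h1; rewrite E E' /= dvd_bit1 => h /andP [].
case=> [<-|].
  move=> d /cE h /cE; case E : (dnode d) h => [y|] //= ->; by rewrite bit_small ?expn_gt0.
case=> [<-|//] d [/cE h1 [/cE h2 [/cE h3 _]]]; apply/cE; move: h1 h2 h3.
case E : (dnode d) => [y|] //=; have [[hv hc] hB] := dnode_valid E => h1 /(lastB hB) h2 h3.
apply/negPn/negP => nb; have := dvd_bit y.2 (bp y.1); rewrite h3 nb /= h2 => h4.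
have h5 : 2 ^ B %| bp y.1 by rewrite h4.
by case: (posnP (bp y.1)) => // p0; have := dvdn_leq p0 h5; rewrite leqNgt hc.1.
Qed.

Lemma dag_marks : satT Dag w m 0 marks1.
Proof.
have ex x d : (forall y, dnode d = Some y -> expb x./2 y = odd x) -> cint (i := Dag) (nm 16 x 0) d.
  by move=> H; apply/cE; case E : (dnode d) => [y|] //=; apply: H.
have go x d : (forall y, dnode d = Some y -> gotb x./2 y (odd x)) -> cint (i := Dag) (nm 17 x 0) d.
  by move=> H; apply/cE; case E : (dnode d) => [y|] //=; apply: H.
have xo (k l x : nat) (v : blck * nat -> bool) (u : blck * nat -> bool) d (b : bool) :
    (forall y, holds k 0 0 (Some y) <-> v y) -> (forall y, holds l 0 0 (Some y) <-> u y) ->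
    (if b then ext (I := Dag) (tinst m n 0 (xor (L k) (L l))) d else ext (I := Dag) (tinst m n 0 (xnor (L k) (L l))) d) ->
    forall y, dnode d = Some y -> v y (+) u y = b.
  move=> hv hu H y E.
  have h1 : cint (i := Dag) (nm k 0 0) d <-> v y by rewrite cE E.
  have h2 : cint (i := Dag) (nm l 0 0) d <-> u y by rewrite cE E.
  case: b H => -[[a1 a2]|[a1 a2]].
  - by move/h1: a1 => ->; case: (u y) h2 => // h2; case: a2; apply/h2.
  - by move/h2: a2 => ->; case: (v y) h1 => // h1; case: a1; apply/h1.
  - by move/h1: a1 => ->; move/h2: a2 => ->.
  by case: (v y) h1 => h1; [case: a1; apply/h1|case: (u y) h2 => // h2; case: a2; apply/h2].
move=> c.
case=> [<-|]; first by move=> d h; apply: ex; apply: (xo 5 7 0 _ _ d false) h.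
case=> [<-|]; first by move=> d h; apply: ex; apply: (xo 5 7 1 _ _ d true) h.
case=> [<-|]; first by move=> d h; apply: ex; apply: (xo 6 8 2 _ _ d false) h.
case=> [<-|]; first by move=> d h; apply: ex; apply: (xo 6 8 3 _ _ d true) h.
case=> [<-|]; first by move=> d /ncE h; apply: ex => y E; move: h; rewrite E /= => /negP/negbTE.
case=> [<-|]; first by move=> d /cE h; apply: ex => y E; move: h; rewrite E.
case=> [<-|]; first by move=> d h; apply: ex; apply: (xo 6 9 6 _ _ d false) h.
case=> [<-|]; first by move=> d h; apply: ex; apply: (xo 6 9 7 _ _ d true) h.
case=> [<-|]; first by move=> d /ncE h; apply: go => y E; move: h; rewrite E /= => /negP/negbTE.
case=> [<-|]; first by move=> d /cE h; apply: go => y E; move: h; rewrite E.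
case=> [<-|]; first by move=> d [/cE h1 /ncE h2]; apply: go => y E; move: h1 h2; rewrite E /= => -> /negP/negbTE.
case=> [<-|]; first by move=> d [/cE h1 /cE h2]; apply: go => y E; move: h1 h2; rewrite E.
case=> [<-|]; first by move=> d [/cE h1 /ncE h2]; apply: go => y E; move: h1 h2; rewrite E /= => -> /negP/negbTE.
case=> [<-|]; first by move=> d [/cE h1 /cE h2]; apply: go => y E; move: h1 h2; rewrite E.
case=> [<-|]; first by move=> d [/cE h1 /ncE h2]; apply: go => y E; move: h1 h2; rewrite E /= => -> /negP/negbTE.
by case=> [<-|//] d [/cE h1 /cE h2]; apply: go => y E; move: h1 h2; rewrite E.
Qed.

Lemma dag_counter j : 0 < m -> j < m -> satT Dag w m j counter1.
Proof.
move=> m0 jm c.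
have nxt d e y : dnode d = Some y -> rint (i := Dag) 0 d e -> exists y', [/\ dnode e = Some y',
    y'.2 < B & (y'.2 = y.2.+1) \/ (y.2.+1 = B /\ y'.2 = 0)].
  by move=> E /(edge_inv E) [y' [E' [[[_ h]|[h1 [h2 _]]] h3]]]; exists y'; split; auto.
have bB : bit j B = false by rewrite /bit -[in X in X %/ _](subnK (ltnW jm)) expnD mulnK ?expn_gt0 // -(subnSK jm) oddX.
have dB : 2 ^ j %| B by rewrite dvdn_Pexp2l // ltnW.
have b0 : bit j 0 = false by rewrite bit_small ?expn_gt0.
have nb d e y : dnode d = Some y -> rint (i := Dag) 0 d e -> exists2 y', dnode e = Some y' & bit j y'.2 = bit j y.2 (+) (2 ^ j %| y.2.+1).
  move=> E /(nxt _ _ _ E) [y' [E' _ [h|[h1 h2]]]]; exists y' => //; rewrite -bit_succ ?h // h1 h2.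
  by rewrite bB b0.
case=> [<-|].
  move=> d _; case E : (dnode d) => [y|]; last by right; apply/jE; rewrite E.
  by case: (boolP (bit j y.2)) => h; [left; apply/jE; rewrite E|right; apply/jE; rewrite E; apply/negP].
case=> [<-|].
  by move=> d [/jE h1 /jE h2]; move: h1 h2; case: (dnode d).
case=> [<-|].
  move=> d [/jE h1 /jE h2]; move: h1 h2.
  case E : (dnode d) => [y|] //= h1 h2; split; first by apply/j1E; rewrite E /= dvd_bit1 h1.
  by move=> e /(nb _ _ _ E) [y' E' hb]; apply/jE; rewrite E' /= hb h1 h2.
case=> [<-|].
  move=> d /j1E; case E : (dnode d) => [y|] //=; rewrite dvd_bit1 => /andP [h1 h2].
  by split; apply/jE; rewrite E.
case=> [<-|].
  move=> d [/jE h1 /jE h2] e He; move: h1 h2.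
  case E : (dnode d) => [y|]; last by case: (dead E He).
  by have [y' E' hb] := nb _ _ _ E He; move=> /= h1 h2; apply/jE; rewrite E' /= hb h1; case: bit h2.
case=> [<-|].
  move=> d /jE h1; case: (classic (ext (I := Dag) (tinst m n j (Lj 0 2)) d)) => [|/jE h2]; first by left.
  right=> e He; move: h1 h2; case E : (dnode d) => [y|]; last by case: (dead E He).
  by have [y' E' hb] := nb _ _ _ E He; move=> /= h1 /negP h2; apply/jE; rewrite E' /= hb h1; case: dvdn h2.
case=> [<-|].
  move=> d /jE h1; case: (classic (ext (I := Dag) (tinst m n j (Lj 0 2)) d)) => [|/jE h2]; first by left.
  right=> e He; move: h1 h2; case E : (dnode d) => [y|]; last by case: (dead E He).
  by have [y' E' hb] := nb _ _ _ E He; move=> /= h1 /negP h2; apply/jE; rewrite E' /= hb; case: bit h1 => //; case: dvdn h2.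
by case=> [<-|//] d /cE h; apply/jE; move: h; case: (dnode d) => [y|] //= ->; rewrite b0.
Qed.

Lemma keeps_ok k x j t : (k \in [:: 13; 14; 15; 18; 19; 20]) -> tinst m n j t = Atomic (nm k x (if k == 20 then j else 0)) \/ tinst m n j t = Atomic (nm k x (if k == 20 then n else 0)) ->
  forall d, ext (I := Dag) (tinst m n j t) d -> ext (I := Dag) (tinst m n j (nlast t)) d.
Proof.
move=> hk ht d h; apply: keep_next => y E; right=> e E'; case: ht h => -> /cE h; apply/cE;
  move: h; rewrite E E' /= !inE in hk *; by case/or3P: hk => [||/or4P []] /eqP ->.
Qed.

Lemma stE j (q : state M) d : ext (I := Dag) (tinst m n j (st q)) d <-> holds 18 (rk q) 0 (dnode d).
Proof. exact: cE. Qed.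

Lemma syE j (s : Sym) d : ext (I := Dag) (tinst m n j (sy s)) d <-> holds 19 (rk s) 0 (dnode d).
Proof. exact: cE. Qed.

Lemma dag_labels : satT Dag w m 0 (map keeps (labels1 M)).
Proof.
move=> c /In_map [t Ht <-]; case/In_cat: Ht => [|/In_cat [] /In_map [x _ <-]].
- case=> [<-|]; first by apply: (keeps_ok (k := 13) (x := 0)) => //; left.
  case=> [<-|]; first by apply: (keeps_ok (k := 14) (x := 0)) => //; left.
  case=> [<-|]; first by apply: (keeps_ok (k := 15) (x := 0)) => //; left.
  case=> [<-|]; first by apply: (keeps_ok (k := 15) (x := 1)) => //; left.
  case=> [<-|]; first by apply: (keeps_ok (k := 15) (x := 2)) => //; left.
  by case=> [<-|//]; apply: (keeps_ok (k := 20) (x := 0)) => //; right.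
- by apply: (keeps_ok (k := 18) (x := rk x)) => //; left.
by apply: (keeps_ok (k := 19) (x := rk x)) => //; left.
Qed.

Lemma nzeroE j d y : dnode d = Some y -> y.2.+1 = B -> ext (I := Dag) (tinst m n j zero) d <-> bt y.1 = 0.
Proof.
move=> E yB; have [[tS _] _] := dnode_valid E.
have D := dvd_bit y.2 (bt y.1); rewrite yB in D.
split=> [[/cE h1 /ncE h2]|h].
  move: h1 h2; rewrite E /= => h1 /negP h2; rewrite h1 h2 in D.
  by case: (posnP (bt y.1)) => // t0; have := dvdn_leq t0 D; rewrite leqNgt tS.
by split; [apply/cE|apply/ncE]; rewrite E /= h ?dvdn0 // bit_small ?expn_gt0.
Qed.

(** A true claim rests on true claims one step earlier, and all of these are blocks of the model, so
    the required successors exist. Direction 3 is used for the head claim whose position is not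
    compared. *)
Lemma rule_ok j d y t q' (a x : Sym) dr src : 0 < m -> dnode d = Some y -> y.2.+1 = B -> bt y.1 = t.+1 ->
  Claim t 0 q' a -> (sh S dr (bp y.1) = 0 /\ bs y.1 = x) \/
    (sh S dr (bp y.1) <> 0 /\ Claim t (sh S dr (bp y.1)) q' (bs y.1)) ->
  (forall e b, dnode e = Some (b, 0) -> bq b = q' -> ext (I := Dag) (tinst m n j src) e) ->
  ext (I := Dag) (tinst m n j (rule src a x dr (bs y.1))) d.
Proof.
move=> m0 E yB Et Hc H Hsrc; have B0 : 0 < B by rewrite expn_gt0.
have [[tS _] _] := dnode_valid E; rewrite Et in tS.
have mk b : bvalid b -> bt b = t -> (forall d', bc b = mvc d' -> bp b = sh S d' (bp y.1)) ->
    exists e, rint (i := Dag) 0 d e /\ dnode e = Some (b, 0).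
  move=> hv hb hc; apply: (edge_ex (y' := (b, 0)) E) => //; right; split=> //; split=> //.
  by split; [rewrite Et hb|].
have tS' : t < S by lia.
have mvi d1 d2 : mvc d1 = mvc d2 -> d1 = d2 by case: d1; case: d2.
case: H => [[h1 h2]|[h1 h2]].
  left; rewrite h2 eqxx.
  have [|e [He Ee]] := mk (Blck t 0 q' a (mvc dr)) (conj tS' Hc) erefl; first by move=> d' /mvi <-.
  exists e; split=> //; split; first by apply/cE; rewrite Ee.
  split; first exact: Hsrc Ee erefl.
  split; first by apply/syE; rewrite Ee.
  by split; [apply/cE; rewrite Ee|split=> //; apply/cE; rewrite Ee].
right; split.
  have [|e [He Ee]] := mk (Blck t 0 q' a 3) (conj tS' Hc) erefl; first by case.
  exists e; split=> //; split; first by apply/cE; rewrite Ee.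
  split; first exact: Hsrc Ee erefl.
  split; first by apply/syE; rewrite Ee.
  by split=> //; apply/cE; rewrite Ee.
have [|e [He Ee]] := mk (Blck t (sh S dr (bp y.1)) q' (bs y.1) (mvc dr)) (conj tS' h2) erefl; first by move=> d' /mvi <-.
exists e; split=> //; split; first by apply/cE; rewrite Ee.
split; first exact: Hsrc Ee erefl.
split; first by apply/syE; rewrite Ee.
by split; [apply/cE; rewrite Ee|split=> //; apply/cE; rewrite Ee].
Qed.

Let S_gt1 : 1 < S. Proof. by rewrite -{1}(expn0 2) ltn_exp2l // expn_gt0. Qed.

Lemma dag_steps : 0 < m -> satT Dag w m 0 (steps1 M).
Proof.
move=> m0; apply/satT_map => -[q s] _ d [/cE h1 [/stE h2 [/syE h3 [h4 _]]]].
move: h1 h2 h3; case E : (dnode d) => [y|] /=; last by move=> h; rewrite h in m0.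
have [[tS Hc] yB] := dnode_valid E => /(lastB yB) yl [q1 Eq /rk_inj Eq1] /rk_inj Es; subst q1 s.
have t0 : 0 < bt y.1 by rewrite lt0n; apply/eqP => t0; apply: h4; apply/(nzeroE 0 E yl).
move: Hc; rewrite -(prednK t0) => /(Claim_inv S_gt1) [q' [a [x [dr [Hm Hc H]]]]].
apply/ext_ors; case: q' Hm Hc H => [k|q'] /=; last first.
  case Et : (trans q' a) => [[[q1 x1] dr1]|] //; rewrite Eq => -[<- <- <-] Hc H.
  exists (rule (st q') a x1 dr1 (bs y.1)).
    apply/In_cat; right; apply/In_flatten; exists [:: rule (st q') a x1 dr1 (bs y.1)]; last by left.
    by apply/In_map; exists (q', a); rewrite /= ?Et ?eqxx //; apply/InP; rewrite mem_enum.
  apply: (rule_ok m0 E yl _ Hc H); first by rewrite prednK.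
  by move=> e b Ee Eb; apply/stE; rewrite Ee /= Eb; exists q'.
case: a => // Hm Hc H; case: k Hm Hc H => [|k]; rewrite Eq // => -[<- <- <-] Hc H.
exists (rule (L 20) None None MoveR (bs y.1)).
  by apply/In_cat; left; rewrite eqxx; left.
apply: (rule_ok m0 E yl _ Hc H); first by rewrite prednK.
by move=> e b Ee Eb; apply/cE; rewrite Ee.
Qed.

Lemma dag_ends : 0 < m -> satT Dag w m 0 (ends1 M).
Proof.
move=> m0; have leaf d : ext (I := Dag) (tinst m n 0 (Lm 2)) d -> ext (I := Dag) (tinst m n 0 zero) d ->
    exists y, [/\ dnode d = Some y, bq y.1 = inl n & bs y.1 = None].
  move=> /cE h1 h2; move: h1; case E : (dnode d) => [y|] /=; last by move=> h; rewrite h in m0.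
  have [[tS Hc] yB] := dnode_valid E => /(lastB yB) yl; exists y; split=> //.
    by move: Hc; move/(nzeroE 0 E yl): h2 => -> [_ [c [[<-] <- _]]].
  by move: Hc; move/(nzeroE 0 E yl): h2 => -> [_ [c [[<-] _ <-]]].
apply/satT_cat; split.
  apply/satT_map => q _ d [h1 [h2 [/stE h3 _]]]; have [y [E Eq _]] := leaf _ h1 h2.
  by move: h3; rewrite E /= Eq => -[].
apply/satT_cat; split.
  apply/satT_map => s; rewrite mem_filter => /andP [sN _] d [h1 [h2 [/syE h3 _]]]; have [y [E _ Es]] := leaf _ h1 h2.
  by move: h3 sN; rewrite E /= Es => /rk_inj ->.
move=> c; case=> [<-|].
  move=> d [/cE h1 [/cE h2 [h3 _]]]; move: h1 h2; case E : (dnode d) => [y|] //=.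
  have [[tS Hc] yB] := dnode_valid E => /(lastB yB) yl Eq; apply: h3; apply/(nzeroE 0 E yl).
  by move: Hc; rewrite Eq => /phase_time; lia.
case=> [<-|//] d /cE; case E : (dnode d) => [y|]; last by left; apply/cE; rewrite E.
move=> [y0 [hp [q [Eq Hr]]]]; right; split; first by apply/cE; rewrite E.
split; first by apply/cE; rewrite E.
split=> //; apply/ext_ors; exists (TAnd (st q) (sy (bs y.1))).
  by apply/In_map; exists (q, bs y.1) => //; apply/InP.
by split; [apply/stE; rewrite E; exists q|apply/syE; rewrite E].
Qed.

Lemma dag_phase j : 0 < m -> j < n -> satT Dag w m j (phase1 M (nth false w j)).
Proof.
move=> m0 jn; apply/satT_cat; split.
  move=> c; case=> [<-|].
    by apply: (keeps_ok (k := 20) (x := 0)) => //; left; rewrite /= /name_of /= addn0.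
  case=> [<-|//] d [/cE h1 [h2 [/jE h3 _]]]; move: h1 h3; case E : (dnode d) => [y|] //=.
  have [[tS Hc] yB] := dnode_valid E => /(lastB yB) yl Eq; move/(nzeroE j E yl): h2 => t0.
  by move: Hc; rewrite Eq => /phase_time; lia.
apply/satT_map => s _ d [/cE h1 [/jE h2 [/syE h3 [h4 _]]]]; move: h1 h2 h3.
case E : (dnode d) => [y|] //=; have [[tS Hc] yB] := dnode_valid E => /(lastB yB) yl Eq /rk_inj ->.
have t0 : 0 < bt y.1 by rewrite lt0n; apply/eqP => t0; apply: h4; apply/(nzeroE j E yl).
move: Hc; rewrite -(prednK t0) Eq => /(Claim_inv S_gt1) [q' [a [x [dr [Hm Hc H]]]]].
case: q' Hm Hc H => [k|q'] /=; last by case: trans => [[[]]|].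
case: a => //; case: k => [|k] // [<- <- <-] Hc H.
apply: (rule_ok m0 E yl _ Hc H); first by rewrite prednK.
by move=> e b Ee Eb; apply/j1E; rewrite Ee.
Qed.

Lemma dag_model : 0 < m -> model Dag (K1 M w m).
Proof.
move=> m0; split; last first.
  move=> s [<-|//]; apply/cE; case E : (dnode _) => [y|] //=.
  by move: E => /=; case Er : root => [b|] //= [<-]; have [_] := root_ok Er.
suff H : forall g, List.In g (tbox1 M) -> satG Dag w m g by exact: (proj2 (satG_P Dag w m (tbox1 M)) H).
move=> g; case=> [<-|]; first exact: dag_base.
case=> [<-|]; first exact: dag_marks.
case=> [<-|]; first exact: dag_labels.
case=> [<-|]; first exact: dag_steps.
case=> [<-|]; first exact: dag_ends.
case=> [<-|]; first by move=> j; apply: dag_counter.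
case=> [<-|//] j jn; have := dag_phase m0 jn; by case: nth.
Qed.

(** * No bounded simulation into the model of true claims *)

Section Walk.

Variable I2 : interp.
Hypothesis M2 : model I2 (K2 w m).
Local Notation c2 := (@cint I2).
Local Notation r2 := (@rint I2 0).

Definition walk_exs : seq (rname * concept) := (0, Atomic (nm 21 0 0)) ::
  flatten [seq [:: (0, Atomic (nm 23 x 0)); (0, And (Atomic (nm 4 0 0)) (Atomic (nm 24 x 0)))] | x <- iota 0 8].
Local Notation ps k d2 d1 := (@psim (Sg w m) walk_exs I2 Dag k d2 d1).

Lemma sat2 g : List.In g tbox2 -> satG I2 w m g.
Proof. exact: (satG_P I2 w m tbox2).1 M2.1 g. Qed.

Lemma in_iota8 x : x < 8 -> List.In x (iota 0 8). Proof. by move=> h; apply/InP; rewrite mem_iota. Qed.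

Lemma exs_ok x k : x < 8 -> k \in [:: 0; 1; 2] ->
  List.In (nth (0, Top) [:: (0, Atomic (nm 21 0 0)); (0, Atomic (nm 23 x 0)); (0, And (Atomic (nm 4 0 0)) (Atomic (nm 24 x 0)))] k) walk_exs.
Proof.
move=> hx; rewrite !inE => /or3P [] /eqP ->; [by left|right|right]; apply/In_flatten;
  (eexists; [by apply/In_map; exists x; [exact: in_iota8|by []]|]); [by left|by right; left].
Qed.

Lemma S_ax d : c2 (nm 21 0 0) d -> (exists e, r2 d e /\ c2 (nm 21 0 0) e) \/ c2 (nm 12 0 0) d \/
  exists2 x, x < 8 & c2 (nm 22 x 0) d.
Proof.
move=> h; have := sat2 (or_introl erefl) _ (or_introl erefl) _ h => /= -[|[|]]; auto => H.
right; right; have := H; move/(ext_ors w m 0 [seq Lx 22 e | e <- iota 0 8]) => [t /In_map [x hx <-] hc].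
by exists x => //; move/InP: hx; rewrite mem_iota.
Qed.

Lemma err_ax x k d : x < 8 -> k < 3 -> c2 (nm (22 + k) x 0) d -> match k with
  | 0 => [/\ c2 (nm 25 0 0) d, c2 (nm 16 x 0) d & exists e, r2 d e /\ c2 (nm 23 x 0) e]
  | 1 => (c2 (nm 4 0 0) d /\ exists e, r2 d e /\ c2 (nm 23 x 0) e) \/ (c2 (nm 3 0 0) d /\ c2 (nm 24 x 0) d)
  | _ => (exists e, r2 d e /\ (c2 (nm 4 0 0) e /\ c2 (nm 24 x 0) e)) \/
         (c2 (nm 25 0 0) d /\ c2 (nm 17 (neg_code x) 0) d) end.
Proof.
move=> hx hk h; have H : satT I2 w m 0 (error2 x).
  move=> c Hc; apply: (sat2 (g := Fixed (flatten [seq error2 e | e <- iota 0 8]))); first by right; left.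
  by apply/In_flatten; exists (error2 x) => //; apply/In_map; exists x => //; apply: in_iota8.
case: k hk h => [|[|[|//]]] _ h.
- by have [h1 [h2 [h3 _]]] := H _ (or_introl erefl) _ h.
- exact: (H _ (or_intror (or_introl erefl)) _ h).
exact: (H _ (or_intror (or_intror (or_introl erefl))) _ h).
Qed.

Lemma match_ax j k d : j < m -> ext (I := I2) (tinst m n j (nth (TTop, TTop) match2 k).1) d -> k < 4 ->
  ext (I := I2) (tinst m n j (nth (TTop, TTop) match2 k).2) d.
Proof.
move=> jm h hk; have H : satT I2 w m j match2 by apply: (sat2 (g := PerM match2)) jm; do 2 right; left.
exact: (satT_nth H hk h).
Qed.

Definition mem_bits i (d : dom I2) := forall j, j < m -> c2 (nm (if bit j i then 26 else 27) 0 j) d.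

Lemma mem_next i d e : mem_bits i d -> r2 d e -> mem_bits i e.
Proof.
move=> H He j jm; have := H j jm; case: (bit j i) => h.
  have := match_ax (k := 1) jm (d := d); rewrite /= /name_of /= addn0 => /(_ h isT); exact.
have := match_ax (k := 2) jm (d := d); rewrite /= /name_of /= addn0 => /(_ h isT); exact.
Qed.

(** The rest of the current block plus one block for each remaining unit of time: a bound on the
    length of paths from [y], hence a depth of simulation that never runs out during the walk. *)
Definition mu (y : blck * nat) := bt y.1 * B + (B - y.2).

Lemma mu_edge y y' : bedge y y' -> y'.2 < B -> mu y' < mu y.
Proof.
rewrite /mu; case=> [[-> ->] h|[h1 [-> [-> _]]] _]; first by lia.
by rewrite mulSn -h1; nia.
Qed.

Lemma ps_cint k d2 d1 A : ps k d2 d1 -> A \in sig_c (Sg w m) -> c2 A d2 -> cint (i := Dag) A d1.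
Proof. by case: k => [|k] [H _]; apply: H. Qed.

Lemma ps_next k d2 d1 y C : ps k d2 d1 -> dnode d1 = Some y -> mu y < k -> List.In (0, C) walk_exs ->
  (exists e, r2 d2 e /\ ext (I := I2) C e) -> exists e2 e1 y' k', [/\ r2 d2 e2, ext (I := I2) C e2, ps k' e2 e1, dnode e1 = Some y' & [/\ bedge y y', mu y' < k' & mu y' < mu y]].
Proof.
case: k => [|k] // [_ H] E hm hC he; have [e2 [e1 [h1 h2 h3 h4]]] := H 0 C hC (mem_head _ _) he.
have [y' [E' [hb hB]]] := edge_inv E h3; exists e2, e1, y', k; split=> //; have hm' := mu_edge hb hB.
by split=> //; lia.
Qed.

Definition found x b i := exists d2 d1 k b' i', [/\ child b b', dnode d1 = Some (b', i'), mem_bits i d2,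
  c2 (nm 25 0 0) d2 & c2 (nm 17 (neg_code x) 0) d2 /\ ps k d2 d1].

Lemma sig_in k x j : [\/ [/\ k \in [:: 3; 4; 12], x = 0 & j = 0], [/\ k \in [:: 16; 17], x < 8 & j = 0] | [/\ k \in [:: 0; 1], x = 0 & j < m]] ->
  nm k x j \in sig_c (Sg w m).
Proof. by move=> H; apply/sigP; exists k, x, j; split=> //; case: H; auto. Qed.

Lemma walk2 x i b b' q k d2 d1 i' : x < 8 -> child b b' -> mu (b', i') < q -> ps k d2 d1 ->
  dnode d1 = Some (b', i') -> mu (b', i') < k -> mem_bits i d2 -> c2 (nm 24 x 0) d2 -> found x b i.
Proof.
move=> hx hb; elim: q k d2 d1 i' => // q IH k d2 d1 i' hq hp E hm hM h.
case: (err_ax (k := 2) hx isT h) => [he|[h1 h2]]; last by exists d2, d1, k, b', i'.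
have [e2 [e1 [y' [k' [h1 [h2 h3] h4 h5 [h6 h7 h8]]]]]] := ps_next hp E hm (exs_ok (k := 2) hx isT) he.
have h9 : cint (i := Dag) (nm 4 0 0) e1 by apply: ps_cint h4 _ h2; apply: sig_in; constructor 1.
move/cE: h9; rewrite h5 /= => h9.
case: h6 => [[Ey Ei]|[_ [//]]]; rewrite /= in Ey Ei.
have Ey' : y' = (b', y'.2) by rewrite -Ey; case: (y').
rewrite Ey' in h5 h7 h8.
by apply: (IH k' e2 e1 y'.2) => //; [lia|exact: mem_next hM h1].
Qed.

Lemma walk1 x i b q k d2 d1 y : x < 8 -> mu y < q -> ps k d2 d1 ->
  dnode d1 = Some y -> mu y < k -> (y.1 = b /\ 0 < y.2) \/ (child b y.1 /\ y.2 = 0) ->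
  mem_bits i d2 -> c2 (nm 23 x 0) d2 -> found x b i.
Proof.
move=> hx; elim: q k d2 d1 y => // q IH k d2 d1 y hq hp E hm hy hM h.
have sig k' : k' \in [:: 3; 4; 12] -> nm k' 0 0 \in sig_c (Sg w m) by move=> hk; apply: sig_in; constructor 1.
case: (err_ax (k := 1) hx isT h) => [[hF he]|[hF h2]].
  have [e2 [e1 [y' [k' [h1 h2 h4 h5 [h6 h7 h8]]]]]] := ps_next hp E hm (exs_ok (k := 1) hx isT) he.
  have /cE := ps_cint hp (sig 4 isT) hF; rewrite E /= => y0.
  apply: (IH k' e2 e1 y') => //; first by lia.
    case: hy => [[Ey _]|[_ //]]; rewrite -Ey.
    by case: h6 => [[-> ->]|[_ [-> hc]]]; [left|right].
  exact: mem_next hM h1.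
have /cE := ps_cint hp (sig 3 isT) hF; rewrite E /= => y0.
case: hy => [[_]|[hc _]]; first by rewrite y0.
have Ey : y = (y.1, 0) by rewrite -{1}y0; case: (y).
by rewrite Ey in E hm; apply: (walk2 hx hc (leqnn _) hp E hm hM h2).
Qed.

Lemma neg_codeE x : x < 8 -> [/\ (neg_code x)./2 = x./2, odd (neg_code x) = ~~ odd x & neg_code x < 8].
Proof. by do 8 (case: x => [|x] //). Qed.

(** Why true claims contain no error: time and position of the child are obtained from the parent by
    the very flips that define the expected digits. *)
Lemma exp_got b b' i x : i < B -> bp b < S -> child b b' -> x < 8 -> expb x./2 (b, i) = odd x -> gotb (neg_code x)./2 (b', i) (odd (neg_code x)) -> False.
Proof.
move=> iB pS [Et Hc] x8.
have H k v : k < 4 -> expb k (b, i) = v -> gotb k (b', i) (~~ v) -> False.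
  case: k => [|[|[|[|//]]]] _ /=.
  - by rewrite Et bit_succ -addbA addbb addbF => -> ; case: v.
  - move=> <- [/(Hc MoveL) -> /=]; rewrite bit_pred //; by case: (_ (+) _).
  - move=> <- [/(Hc Stay) -> /=]; by case: bit.
  move=> <- [/(Hc MoveR) -> /=]; rewrite bit_next //; by case: (_ (+) _).
have [E1 E2 _] := neg_codeE x8.
by rewrite E1 E2; apply: H; lia.
Qed.

(** The name 21 cannot be passed on for ever, as [mu] drops, and escape is absent from all blocks.
    So an error would have to start somewhere; followed by [walk1], it leads to a child block, at
    the same offset because of the memorized counter, and contradicts [exp_got]. *)
Lemma walk0 q k d2 d1 y : mu y < q -> ps k d2 d1 -> dnode d1 = Some y -> mu y < k -> c2 (nm 21 0 0) d2 -> False.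
Proof.
elim: q k d2 d1 y => // q IH k d2 d1 y hq hp E hm h.
case: (S_ax h) => [he|[hE|[x hx hQ]]].
- have [e2 [e1 [y' [k' [h1 h2 h4 h5 [h6 h7 h8]]]]]] := ps_next hp E hm (exs_ok (k := 0) (x := 0) isT isT) he.
  by apply: (IH k' e2 e1 y') => //; lia.
- have s12 : nm 12 0 0 \in sig_c (Sg w m) by apply: sig_in; constructor 1.
  by have /cE := ps_cint hp s12 hE; rewrite E.
have [hY hX he] := err_ax (k := 0) hx isT hQ.
have [[_ hc] yB] := dnode_valid E; have pS := hc.1.
have sX k' j : k' \in [:: 0; 1] -> j < m -> nm k' 0 j \in sig_c (Sg w m) by move=> h1 h2; apply: sig_in; constructor 3.
have sE k' : k' \in [:: 16; 17] -> forall x, x < 8 -> nm k' x 0 \in sig_c (Sg w m) by move=> h1 x' h2; apply: sig_in; constructor 2.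
have Yb d e y' k' j : j < m -> ps k' d e -> dnode e = Some y' -> c2 (nm 25 0 0) d ->
    c2 (nm (if bit j y'.2 then 26 else 27) 0 j) d.
  move=> jm hp' E' hY'; have := match_ax (k := 0) jm hY' isT; rewrite /= /name_of /= addn0.
  case=> [[h1 h2]|[h1 h2]]; [have /cE := ps_cint hp' (sX 0 j isT jm) h1|have /cE := ps_cint hp' (sX 1 j isT jm) h1]; rewrite E' /=; first by move=> ->.
  by move/negP/negbTE => ->.
have hM : mem_bits y.2 d2 by move=> j jm; apply: Yb jm hp E hY.
have [e2 [e1 [y' [k' [h1 h2 h4 h5 [h6 h7 h8]]]]]] := ps_next hp E hm (exs_ok (k := 1) hx isT) he.
have [||f2 [f1 [k1 [b' [i' [g1 g2 g3 g4 [g5 g6]]]]]]] := @walk1 x y.2 y.1 (mu y').+1 k' e2 e1 y' hx (leqnn _) h4 h5 h7 _ _ h2.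
- by case: h6 => [[-> ->]|[_ [-> hc']]]; [left|right].
- exact: mem_next hM h1.
have iB : i' < B by have [] := dnode_valid g2.
have Ei : i' = y.2.
  apply: (@bit_ext_lt m) => // j jm; have a1 := g3 j jm; have a2 := Yb _ _ _ _ _ jm g6 g2 g4; rewrite /= in a2.
  have dis : c2 (nm 26 0 j) f2 -> c2 (nm 27 0 j) f2 -> False.
    move=> a3 a4; have := match_ax (k := 3) jm (d := f2); rewrite /= /name_of /= addn0.
    by move=> /(_ (conj a3 a4) isT).
  by move: a1 a2; case: (bit j i'); case: (bit j y.2) => // a1 a2; case: dis.
have [_ _ n8] := neg_codeE hx.
have /cE := ps_cint hp (sE 16 isT x hx) hX; rewrite E /= => ex.
have /cE := ps_cint g6 (sE 17 isT _ n8) g5; rewrite g2 /= Ei => gx.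
apply: (exp_got yB pS g1 hx _ gx); by rewrite -ex; case: (y).
Qed.

End Walk.

Lemma dag_not_entails b : 0 < m -> root = Some b -> ~ rucq_entails (Sg w m) (K1 M w m) (K2 w m).
Proof.
move=> m0 Er ent; have [I2 [M2 _ Hs]] := entails_psim walk_exs (mu (b, 0)).+1 ent (dag_model m0).
have hS : cint (i := I2) (nm 21 0 0) (iint I2 0) by apply: (M2.2 (CAssert (nm 21 0 0) 0)); left.
have E : dnode (iint Dag 0) = Some (b, 0) by rewrite /= Er.
exact: (walk0 M2 (leqnn _) (Hs 0 (mem_head _ _)) E (leqnn _) hS).
Qed.

End Dag.

(** If the machine does not accept, its rejecting halting claim is true and can serve as the root of
    the model of true claims, which then refutes the entailment. *)
Lemma L_of_entails (M : tm) L T w m : 0 < m -> decides_in M L T -> 2 * (T (size w) + size w + 3) < 2 ^ (2 ^ m) ->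
  rucq_entails (Sg w m) (K1 M w m) (K2 w m) -> L w.
Proof.
move=> m0 HL HT ent; apply: NNPP => nL.
have S1 : 1 < 2 ^ (2 ^ m) by rewrite -{1}(expn0 2) ltn_exp2l // expn_gt0.
have [t [q [a [tS Hc Hr]]]] := not_reject S1 HL HT nL.
have H b : Some (Blck t 0 (inr q) a 3) = Some b -> bvalid w m b /\ rej b.
  by move=> [<-]; split; [|split=> //; exists q].
exact: (dag_not_entails H m0 erefl ent).
Qed.

Lemma K1_consistent M w m : 0 < m -> consistent (K1 M w m).
Proof.
move=> m0; have H : forall b : blck M, None = Some b -> bvalid w m b /\ rej b by [].
by exists (@Dag M w m None); apply: dag_model.
Qed.

Lemma K2_consistent w m : consistent (K2 w m).
Proof.
pose I := @Interp False (fun A _ => A = nm 21 0 0 \/ A = nm 12 0 0) (fun _ _ _ => False).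
have no i x j d : cint (i := I) (nm i x j) d -> i = 21 \/ i = 12 by case=> /nm_inj [-> _ _]; auto.
exists I; apply: tbox2_sat.
- by move=> c [<-|//] d _; right; left; right.
- by move=> e he c; do 3 (case=> [<-|]; first by move=> d /no []).
- move=> j jm c; do 3 (case=> [<-|]; first by move=> d /no []).
  by case=> [<-|//] d [/no []].
by left.
Qed.

(** * Completeness *)

(** With [a = 2 ^ (n ^ k + k)] the right side is [2 ^ (a * 2 ^ (n + 3))], and the exponent is at
    least [a + (n + 5)]. *)
Lemma param_bound k n : 2 * (2 ^ (2 ^ (n ^ k + k)) + n + 3) < 2 ^ (2 ^ param k n).
Proof.
have -> : 2 ^ param k n = 2 ^ (n ^ k + k) * 2 ^ (n + 3) by rewrite -expnD /param addnA.
have : 0 < 2 ^ (n ^ k + k) by rewrite expn_gt0.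
move: (2 ^ (n ^ k + k)) => a a0.
have hn : n < 2 ^ n by apply: ltn_expl.
apply: (@leq_trans (2 ^ (a + (n + 5)))); last first.
  by rewrite leq_exp2l // [2 ^ (n + 3)]expnD -[2 ^ 3]/8; nia.
have h2 : 2 <= 2 ^ a by rewrite -{1}(expn1 2) leq_exp2l.
rewrite expnD [2 ^ (n + 5)]expnD -[2 ^ 5]/32.
by move: (2 ^ a) (2 ^ n) h2 hn => b c h2 hn; nia.
Qed.

Lemma rucq_hard (L : seq bool -> Prop) : in_2exptime L -> reduces_to L rucq_entailment.
Proof.
move=> [M [k HL]]; exists (fun w => text_word w (param k (size w)) (input_text M)).
split=> [|w]; first exact: writer_polytime.
set m := param k (size w); have m0 : 0 < m by rewrite /m /param; lia.
exists (K1 M w m, K2 w m, Sg w m); split; first exact: input_textE.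
  by split; [exact: K1_consistent|exact: K2_consistent].
have HB := param_bound k (size w).
by split; [exact: (entails_of_L HL HB)|exact: (L_of_entails m0 HL HB)].
Qed.

Theorem theorem9 : complete_2exptime rucq_entailment.
Proof. split; [exact: rucq_in_2exptime|exact: rucq_hard]. Qed.
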